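(* (I) Let $A$ be a subhomogeneous $C^*$-algebra (not necessarily unital). Then $(\mathfrak Z(A),\theta_A)$ is a proper pointed m-tower of finite height and $J_A\colon A\to C^*(\mathfrak Z(A),\theta_A)$, $(J_A(a))(\pi)=\pi(a)$, is a $*$-isomorphism. (II) Conversely, let $(S,\kappa)$ be an arbitrary proper pointed m-tower of finite height. Then $C^*(S,\kappa)$ is subhomogeneous, and for every finite-dimensional representation $\pi$ of $C^*(S,\kappa)$ there is a unique point $s\in S$ such that $\pi=\pi_s$, where $\pi_s\colon C^*(S,\kappa)\ni u\mapsto u(s)\in M_{d(s)}$. Moreover, the assignment $s\mapsto\pi_s$ correctly defines an isomorphism between the pointed towers $(S,\kappa)$ and $(\mathfrak Z(C^*(S,\kappa)),\theta_{C^*(S,\kappa)})$.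
   Context: Conventions. All topological spaces are Hausdorff; $\mathbb N=\{1,2,\ldots\}$. $M_n$ is the $C^*$-algebra of complex $n\times n$ matrices, $\mathcal U_n$ its unitary group, $I_n$ its unit. For $U\in\mathcal U_n$, $X\in M_n$: $U.X=UXU^{-1}$. For $X\in M_n$, $Y\in M_k$, $X\oplus Y\in M_{n+k}$ is the block-diagonal matrix. An $n$-dimensional representation of a $C^*$-algebra $A$ is a (possibly zero, possibly degenerate) $*$-homomorphism $A\to M_n$. A $C^*$-algebra is subhomogeneous if the dimensions of its irreducible representations are bounded by some finite $n$. Towers. A tower is a topological space $T$ with a continuous function $d\colon T\to\mathbb N$, an operation $\oplus\colon T\times T\to T$ and functions $\mathcal U_n\times T_n\ni(U,x)\mapsto U.x\in T$ (where $T_n=d^{-1}(\{n\})$), such that: (T1) $\oplus$ is associative and continuous, and for each $n$ the map $T_n\times T\ni(x,y)\mapsto x\oplus y\in T$ is a closed embedding; (T2) $d(x\oplus y)=d(x)+d(y)$ and $d(U.x)=d(x)$; (T3) each $\mathcal U_n\times T_n\to T_n$ is a continuous group action; (T4) $U.x=x$ if $U\in\mathcal U_{d(x)}$ is a scalar multiple of the unit matrix; (T5) $(U\oplus V).(x\oplus y)=(U.x)\oplus(V.y)$ for $x\in T_n$, $y\in T_k$, $U\in\mathcal U_n$, $V\in\mathcal U_k$; (T6) $U_{d(x),d(y)}.(x\oplus y)=y\oplus x$, where $U_{p,q}\in\mathcal U_{p+q}$ is given by $(w_1,\ldots,w_q,z_1,\ldots,z_p)\cdot U_{p,q}=(z_1,\ldots,z_p,w_1,\ldots,w_q)$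 (row vectors). The tower is proper if $d$ is a proper map, i.e. each $T_n$ is compact. Let $T$ be a tower. An element $x$ is reducible if $V.x=a\oplus b$ for some $a,b\in T$, $V\in\mathcal U_{d(x)}$; otherwise it is irreducible. $\operatorname{stab}(x)=\{U\in\mathcal U_{d(x)}: U.x=x\}$. $x\equiv y$ means $U.x=y$ for some $U\in\mathcal U_{d(x)}$; $x\preccurlyeq y$ means that $x\equiv y$ or there are $a,b\in T$ with $x\equiv a$, $y\equiv a\oplus b$; $x\perp y$ ($x,y$ disjoint) means there is no $a\in T$ with $a\preccurlyeq x$ and $a\preccurlyeq y$. $\operatorname{core}(T)$ is the set of irreducible elements, and $\operatorname{ht}(T)=\sup\{d(x): x\in\operatorname{core}(T)\}$ ($\sup\varnothing=0$) is the height. A topological space $X$ has property $(\sigma)$ if there are sets $K_1\subset K_2\subset\cdots$ with union $X$, each compact Hausdorff in the subspace topology, such that $B\subset X$ is closed iff $B\cap K_n$ is closed for each $n$. An m-tower is a tower $T$ that has property $(\sigma)$ and satisfies for all $x,y,z\in T$: (mT1) if $z\perp x$ and $z\perp y$, then $z\perp x\oplus y$; (mT2) if $z\oplus x\equiv z\oplus y$, then $x\equiv y$; (mT3) if $x\perp y$, then $\operatorname{stab}(x\oplus y)=\{U\oplus V: U\in\operatorname{stab}(x),\ V\in\operatorname{stab}(y)\}$; (mT4) if $x$ is irreducible and $p=d(x)$, then for each $n>0$ the stabilizer of the $n$-fold sum $x\oplus\cdots\oplus x$ is $\{I_p\otimes U: U\in\mathcal U_n\}$, where $I_p\otimes[u_{jk}]$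 is the block matrix $[u_{jk}I_p]$. A pointed (m-)tower is a pair $(T,\theta)$ with $T$ an (m-)tower and $\theta\in T$, $d(\theta)=1$; it is proper (of finite height) if $T$ is. An isomorphism of pointed towers $(T,\theta)\to(T',\theta')$ is a homeomorphism $v\colon T\to T'$ with $d(v(x))=d(x)$, $v(U.x)=U.v(x)$, $v(x\oplus y)=v(x)\oplus v(y)$ and $v(\theta)=\theta'$. $C^*(T)$ is the unital $C^*$-algebra (pointwise operations, supremum norm) of all functions $f$ on $T$ with $f(x)\in M_{d(x)}$, $f|_{T_n}\colon T_n\to M_n$ continuous for all $n$, $f(U.x)=U.f(x)$ for $U\in\mathcal U_{d(x)}$, $f(x\oplus y)=f(x)\oplus f(y)$, and $\|f\|=\sup_{x\in T}\|f(x)\|<\infty$. For a pointed tower, $C^*(T,\theta)=\{f\in C^*(T): f(\theta)=0\}$. Concrete pointed tower. For a $C^*$-algebra $A$, $\mathfrak Z(A)$ is the topological disjoint union over $n\ge1$ of the spaces $\mathfrak Z_n(A)$ of all (possibly zero) $n$-dimensional representations of $A$ with the pointwise convergence topology; $d(\pi)=n$ for $\pi\in\mathfrak Z_n(A)$, $(\pi_1\oplus\pi_2)(a)=\pi_1(a)\oplus\pi_2(a)$, $(U.\pi)(a)=U.\pi(a)$; $\theta_A$ is the zero one-dimensional representation of $A$. *)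

(* Defs.v *)
From HB Require Import structures.
From mathcomp Require Import all_boot all_order all_algebra.
From mathcomp Require Import complex mxtens.
From mathcomp Require Import all_classical all_reals all_analysis.
From mathcomp Require Import ring.

Set Implicit Arguments.
Unset Strict Implicit.
Unset Printing Implicit Defensive.

Import Order.TTheory GRing.Theory Num.Theory.
Import numFieldNormedType.Exports.

Local Open Scope classical_set_scope.
Local Open Scope ring_scope.
Local Open Scope complex_scope.
Local Open Scope sesquilinear_scope.

Set Warnings "-redundant-canonical-projection".

(* The complex numbers are R[i] for an arbitrary realType R; here R[i] gets its
   structure of Banach space over itself. *)
HB.instance Definition _ (R : realType) := NormedModule.copy R[i] R[i]^o.

Notation normc := ComplexField.Normc.normc.

Section ComplexComplete.
Variable R : realType.
Implicit Types z w : R[i].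

Lemma normcE z : `|z| = (normc z)%:C. Proof. by []. Qed.

Lemma normc_ge0 z : 0 <= normc z.
Proof. by rewrite -lecR -normcE normr_ge0. Qed.

Lemma ler_Re_normc z : `|complex.Re z| <= normc z.
Proof.
case: z => a b /=; rewrite -sqrtr_sqr; apply: ler_wsqrtr.
by rewrite lerDl sqr_ge0.
Qed.

Lemma ler_Im_normc z : `|complex.Im z| <= normc z.
Proof.
case: z => a b /=; rewrite -sqrtr_sqr; apply: ler_wsqrtr.
by rewrite lerDr sqr_ge0.
Qed.

Lemma normcD z w : normc (z + w) <= normc z + normc w.
Proof. by rewrite -lecR rmorphD -!normcE ler_normD. Qed.

Lemma normcN z : normc (- z) = normc z.
Proof. by apply: (@complexI R); rewrite -!normcE normrN. Qed.

Lemma normc_real (x : R) : normc x%:C = `|x|.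
Proof. by rewrite /= expr0n /= addr0 sqrtr_sqr. Qed.

Lemma normc_ReIm z : normc z <= `|complex.Re z| + `|complex.Im z|.
Proof.
rewrite {1}[z]complexE (le_trans (normcD _ _))// normc_real lerD2l.
rewrite ComplexField.Normc.normcM normc_real.
by rewrite [normc 'i](_ : _ = 1) ?mul1r//= expr0n expr1n add0r sqrtr1.
Qed.

Lemma gt0_complexP (e : R[i]) : 0 < e -> exists2 r : R, 0 < r & e = r%:C.
Proof.
case: e => a b; rewrite ltcE /= => /andP[/eqP -> a0].
by exists a.
Qed.

Lemma complex_complete (F : set_system R[i]) :
  ProperFilter F -> cauchy F -> cvg F.
Proof.
move=> FF /cauchyP Fc.
have cp (p : R[i] -> R) : (forall z w, p (z - w) = p z - p w) ->
    (forall z, `|p z| <= normc z) -> cvg (p @ F).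
  move=> pB ple; apply: cauchy_cvg; apply: cauchy_exP => e e0.
  have e0c : 0 < e%:C :> R[i] by rewrite ltcR.
  have [x Fx] := Fc _ e0c.
  exists (p x); suff : \forall y \near F, ball (p x) e (p y) by [].
  near=> y; rewrite -ball_normE /= -pB (le_lt_trans (ple _))// -ltcR.
  suff : ball x e%:C y by rewrite -ball_normE.
  by near: y.
have /cvg_ex[/= a Fa] : cvg (@complex.Re R @ F).
  by apply: cp => [[? ?] [? ?]//|]; exact: ler_Re_normc.
have /cvg_ex[/= b Fb] : cvg (@complex.Im R @ F).
  by apply: cp => [[? ?] [? ?]//|]; exact: ler_Im_normc.
apply/cvg_ex; exists (a +i* b); apply/cvgrPdist_le => e e0.
have [r r0 ->] := gt0_complexP e0.
have r20 : 0 < r / 2 by rewrite divr_gt0.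
move/cvgrPdist_le : Fa => /(_ _ r20) Fa.
move/cvgrPdist_le : Fb => /(_ _ r20) Fb.
near=> z.
rewrite normcE lecR (le_trans (normc_ReIm _))// (splitr r) lerD//.
- by rewrite raddfB; near: z.
- by rewrite raddfB; near: z.
Unshelve. all: by end_near. Qed.

HB.instance Definition _ := Uniform_isComplete.Build R[i] complex_complete.
End ComplexComplete.
Section OperatorNorm.
Variables (R : realType).
Local Notation C := R[i].

(* Euclidean norm. *)
Definition vnorm n (v : 'cV[C]_n) : R := Num.sqrt (\sum_i normc (v i 0) ^+ 2).

(* The C*-norm of M_n; the library norm on matrices is the largest modulus of an
   entry, which induces the same topology. *)
Definition opnorm n (X : 'M[C]_n) : R :=
  sup [set vnorm (X *m v) | v in [set v | vnorm v <= 1]].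

Lemma vnorm_ge0 n (v : 'cV[C]_n) : 0 <= vnorm v.
Proof. exact: sqrtr_ge0. Qed.

Lemma vnorm_sqr n (v : 'cV[C]_n) : vnorm v ^+ 2 = \sum_i normc (v i 0) ^+ 2.
Proof. by rewrite sqr_sqrtr// sumr_ge0// => i _; rewrite exprn_ge0// normc_ge0. Qed.

Lemma vnorm_dot n (v : 'cV[C]_n) : (vnorm v ^+ 2)%:C = dotmx v^T v^T.
Proof.
rewrite vnorm_sqr dotmxE !mxE rmorph_sum; apply: eq_bigr => i _.
by rewrite !mxE -normCK rmorphXn.
Qed.

Lemma vnorm_sqrtC n (v : 'cV[C]_n) : (vnorm v)%:C = sqrtC (dotmx v^T v^T).
Proof.
by rewrite -vnorm_dot rmorphXn /= sqrCK// ler0c vnorm_ge0.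
Qed.

Lemma vnorm0 n : vnorm (0 : 'cV[C]_n) = 0.
Proof.
by rewrite /vnorm big1 ?sqrtr0// => i _; rewrite mxE ComplexField.Normc.normc0 expr0n.
Qed.

Lemma vnorm_entry n (v : 'cV[C]_n) i : normc (v i 0) <= vnorm v.
Proof.
rewrite -(ger0_norm (normc_ge0 _)) -sqrtr_sqr ler_wsqrtr// (bigD1 i)//= lerDl.
by rewrite sumr_ge0// => j _; rewrite exprn_ge0// normc_ge0.
Qed.

Lemma vnorm_eq0 n (v : 'cV[C]_n) : vnorm v = 0 -> v = 0.
Proof.
move=> v0; apply/colP => i; rewrite mxE; apply: ComplexField.Normc.eq0_normc.
by apply/eqP; rewrite eq_le normc_ge0 andbT -v0 vnorm_entry.
Qed.

Lemma vnormZ n k (v : 'cV[C]_n) : vnorm (k *: v) = normc k * vnorm v.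
Proof.
rewrite /vnorm -[normc k]ger0_norm ?normc_ge0// -sqrtr_sqr -sqrtrM ?sqr_ge0//.
congr Num.sqrt; rewrite mulr_sumr; apply: eq_bigr => i _.
by rewrite mxE ComplexField.Normc.normcM exprMn.
Qed.

Lemma vnormD n (v w : 'cV[C]_n) : vnorm (v + w) <= vnorm v + vnorm w.
Proof.
rewrite -lecR rmorphD /= !vnorm_sqrtC linearD /=.
exact: (triangle_lerif (@dotmx C n) v^T w^T).1.
Qed.

Lemma vnorm_CS n (v w : 'cV[C]_n) : normc (dotmx v^T w^T) <= vnorm v * vnorm w.
Proof.
rewrite -lecR rmorphM /= !vnorm_sqrtC -normcE.
exact: (CauchySchwarz_sqrt (@dotmx C n) v^T w^T).1.
Qed.

Lemma vnorm_sum n (I : Type) (r : seq I) (v : I -> 'cV[C]_n) :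
  vnorm (\sum_(i <- r) v i) <= \sum_(i <- r) vnorm (v i).
Proof.
elim/big_ind2 : _ => [|x1 x2 y1 y2 h1 h2|//]; first by rewrite vnorm0.
by rewrite (le_trans (vnormD _ _))// lerD.
Qed.

Lemma mulmx_col_sum n (X : 'M[C]_n) (v : 'cV[C]_n) :
  X *m v = \sum_j v j 0 *: col j X.
Proof.
apply/colP => i; rewrite mxE summxE; apply: eq_bigr => j _.
by rewrite !mxE mulrC.
Qed.

Lemma vnorm_mulmx n (X : 'M[C]_n) (v : 'cV[C]_n) :
  vnorm (X *m v) <= (\sum_j vnorm (col j X)) * vnorm v.
Proof.
rewrite mulmx_col_sum (le_trans (vnorm_sum _ _))// mulr_suml ler_sum// => j _.
by rewrite vnormZ mulrC ler_wpM2l ?vnorm_ge0 ?vnorm_entry.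
Qed.

Lemma opnorm_has_sup n (X : 'M[C]_n) :
  has_sup [set vnorm (X *m v) | v in [set v | vnorm v <= 1]].
Proof.
split; first by exists (vnorm (X *m 0)), 0 => //=; rewrite vnorm0.
exists (\sum_j vnorm (col j X)) => _ [v /= v1 <-].
rewrite (le_trans (vnorm_mulmx _ _))// ler_piMr// sumr_ge0// => j _.
exact: vnorm_ge0.
Qed.

Lemma opnorm_ge0 n (X : 'M[C]_n) : 0 <= opnorm X.
Proof.
rewrite -(vnorm0 n); apply: (sup_upper_bound (opnorm_has_sup X)).
by exists 0; rewrite /= ?vnorm0// mulmx0 vnorm0.
Qed.

Lemma opnormP n (X : 'M[C]_n) v : vnorm (X *m v) <= opnorm X * vnorm v.
Proof.
have [v0|v0] := eqVneq (vnorm v) 0.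
  by rewrite (vnorm_eq0 v0) mulmx0 vnorm0 mulr0.
have vgt0 : 0 < vnorm v by rewrite lt_neqAle eq_sym v0 vnorm_ge0.
have nk : normc (vnorm v)^-1%:C = (vnorm v)^-1.
  by rewrite normc_real ger0_norm// invr_ge0 vnorm_ge0.
rewrite -ler_pdivrMr// mulrC -[X in X * _]nk -vnormZ.
apply: (sup_upper_bound (opnorm_has_sup X)).
exists ((vnorm v)^-1%:C *: v); rewrite /= ?scalemxAr//.
by rewrite vnormZ nk mulVf.
Qed.

Lemma opnorm_le n (X : 'M[C]_n) M : 0 <= M ->
  (forall v, vnorm (X *m v) <= M * vnorm v) -> opnorm X <= M.
Proof.
move=> M0 XM; apply: ge_sup; first by case: (opnorm_has_sup X).
by move=> _ [v /= v1 <-]; rewrite (le_trans (XM v))// ler_piMr.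
Qed.

Lemma opnormD n (X Y : 'M[C]_n) : opnorm (X + Y) <= opnorm X + opnorm Y.
Proof.
apply: opnorm_le => [|v]; first by rewrite addr_ge0 ?opnorm_ge0.
by rewrite mulmxDl mulrDl (le_trans (vnormD _ _))// lerD// opnormP.
Qed.

Lemma opnorm_mul n (X Y : 'M[C]_n) : opnorm (X *m Y) <= opnorm X * opnorm Y.
Proof.
apply: opnorm_le => [|v]; first by rewrite mulr_ge0 ?opnorm_ge0.
rewrite -mulmxA -mulrA (le_trans (opnormP _ _))//.
by rewrite ler_wpM2l ?opnorm_ge0 ?opnormP.
Qed.

Lemma opnorm0 n : opnorm (0 : 'M[C]_n) = 0.
Proof.
apply/eqP; rewrite eq_le opnorm_ge0 andbT.
by apply: opnorm_le => // v; rewrite mul0mx vnorm0 mul0r.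
Qed.

Lemma opnormZ_le n k (X : 'M[C]_n) : opnorm (k *: X) <= normc k * opnorm X.
Proof.
apply: opnorm_le => [|v]; first by rewrite mulr_ge0 ?opnorm_ge0 ?normc_ge0.
by rewrite -scalemxAl vnormZ -mulrA ler_wpM2l ?normc_ge0 ?opnormP.
Qed.

Lemma opnormZ n k (X : 'M[C]_n) : opnorm (k *: X) = normc k * opnorm X.
Proof.
have [->|k0] := eqVneq k 0.
  by rewrite scale0r opnorm0 ComplexField.Normc.normc0 mul0r.
apply/eqP; rewrite eq_le opnormZ_le /=.
have nk0 : 0 < normc k.
  rewrite lt_neqAle normc_ge0 andbT eq_sym; apply: contra k0.
  by move=> /eqP /ComplexField.Normc.eq0_normc ->.
rewrite -ler_pdivlMl// -ComplexField.Normc.normcV.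
by rewrite -{1}[X](scalerK k0) opnormZ_le.
Qed.

Lemma opnormN n (X : 'M[C]_n) : opnorm (- X) = opnorm X.
Proof. by rewrite -scaleN1r opnormZ normcN ComplexField.Normc.normc1 mul1r. Qed.

Lemma opnorm_entry n (X : 'M[C]_n) i j : normc (X i j) <= opnorm X.
Proof.
have e1 : vnorm (delta_mx j 0 : 'cV[C]_n) = 1.
  rewrite /vnorm (bigD1 j)//= mxE !eqxx ComplexField.Normc.normc1 expr1n.
  rewrite big1 ?addr0 ?sqrtr1// => k kj.
  by rewrite mxE (negPf kj) ComplexField.Normc.normc0 expr0n.
have := opnormP X (delta_mx j 0); rewrite e1 mulr1 -colE; apply: le_trans.
by have := vnorm_entry (col j X) i; rewrite mxE.
Qed.

Lemma opnorm_eq0 n (X : 'M[C]_n) : opnorm X = 0 -> X = 0.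
Proof.
move=> X0; apply/matrixP => i j; rewrite mxE; apply: ComplexField.Normc.eq0_normc.
by apply/eqP; rewrite eq_le normc_ge0 andbT -X0 opnorm_entry.
Qed.

Lemma opnorm_entries n (X : 'M[C]_n) M : (forall i j, normc (X i j) <= M) ->
  opnorm X <= n%:R * n%:R * M.
Proof.
case: n X => [|n] X XM.
  rewrite mul0r mul0r; apply: opnorm_le => // v; rewrite mul0r.
  by rewrite /vnorm big1 ?sqrtr0// => -[].
have M0 : 0 <= M by apply: le_trans (normc_ge0 _) (XM ord0 ord0).
apply: opnorm_le => [|v]; first by rewrite !mulr_ge0.
rewrite (le_trans (vnorm_mulmx _ _))// ler_wpM2r ?vnorm_ge0//.
have -> : n.+1%:R * n.+1%:R * M = \sum_(j < n.+1) (\sum_(i < n.+1) M).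
  by rewrite !sumr_const card_ord -mulrnA -natrM mulr_natl.
rewrite ler_sum// => j _; rewrite /vnorm.
have s0 : 0 <= \sum_(i < n.+1) M by rewrite sumr_ge0.
rewrite -[leRHS]ger0_norm// -sqrtr_sqr ler_wsqrtr//.
rewrite [leRHS]expr2 mulr_suml ler_sum// => i _.
rewrite expr2 ler_pM ?normc_ge0 ?mxE//.
by rewrite (le_trans (XM i j))// (bigD1 i)//= lerDl sumr_ge0.
Qed.

Lemma adj_dot n (X : 'M[C]_n) (v w : 'cV[C]_n) :
  dotmx (X *m v)^T w^T = dotmx v^T (X ^t* *m w)^T.
Proof.
rewrite !dotmxE; congr (_ _ 0 0).
by rewrite !trmxK map_mxM map_mxCK trmx_mul mulmxA.
Qed.

Lemma opnorm_star_sqr_le n (X : 'M[C]_n) : opnorm X ^+ 2 <= opnorm (X ^t* *m X).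
Proof.
rewrite -[leRHS]sqr_sqrtr ?opnorm_ge0// lerXn2r ?nnegrE ?opnorm_ge0 ?sqrtr_ge0//.
apply: opnorm_le => [|v]; first exact: sqrtr_ge0.
rewrite -[leRHS]ger0_norm ?mulr_ge0 ?sqrtr_ge0// -sqrtr_sqr.
rewrite -[leLHS]ger0_norm ?vnorm_ge0// -sqrtr_sqr ler_wsqrtr//.
rewrite exprMn [X in _ <= X * _]sqr_sqrtr ?opnorm_ge0//.
rewrite -lecR. rewrite vnorm_dot adj_dot mulmxA.
have dge0 : 0 <= dotmx v^T (X ^t* *m X *m v)^T.
  by rewrite -mulmxA -adj_dot -vnorm_dot ler0c sqr_ge0.
rewrite -(ger0_norm dge0) normcE lecR (le_trans (vnorm_CS _ _))//.
by rewrite mulrC expr2 mulrA ler_wpM2r ?vnorm_ge0 ?opnormP.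
Qed.

Lemma opnorm_star_le n (X : 'M[C]_n) : opnorm X <= opnorm (X ^t*).
Proof.
have [->|X0] := eqVneq (opnorm X) 0; first exact: opnorm_ge0.
have Xgt0 : 0 < opnorm X by rewrite lt_neqAle eq_sym X0 opnorm_ge0.
rewrite -(ler_pM2r Xgt0) -expr2 (le_trans (opnorm_star_sqr_le _))//.
exact: opnorm_mul.
Qed.

Lemma opnorm_star n (X : 'M[C]_n) : opnorm (X ^t*) = opnorm X.
Proof.
apply/eqP; rewrite eq_le opnorm_star_le andbT.
by rewrite -{2}[X]trmxCK opnorm_star_le.
Qed.

Lemma opnorm_star_sqr n (X : 'M[C]_n) : opnorm (X ^t* *m X) = opnorm X ^+ 2.
Proof.
apply/eqP; rewrite eq_le opnorm_star_sqr_le andbT.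
by rewrite (le_trans (opnorm_mul _ _))// opnorm_star expr2.
Qed.

Lemma mx_norm_opnorm n (X : 'M[C]_n) : `|X| <= (opnorm X)%:C.
Proof.
rewrite -[leLHS]/(mx_norm X); have [->|X0] := eqVneq (mx_norm X) 0.
  by rewrite ler0c opnorm_ge0.
have [[i j] -> /=] := mx_norm_neq0 X0.
by rewrite normcE lecR opnorm_entry.
Qed.

Lemma cvg_opnormP (T : Type) (F : set_system T) (FF : Filter F) n
    (f : T -> 'M[C]_n) (X : 'M[C]_n) :
  f @ F --> X <-> forall e : R, 0 < e -> \forall x \near F, opnorm (X - f x) <= e.
Proof.
split=> [fX e e0|fX].
  pose d : R := (n%:R * n%:R + 1)^-1 * e.
  have d0 : 0 < d by rewrite mulr_gt0// invr_gt0 ltr_wpDl// mulr_ge0.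
  have d0C : 0 < d%:C :> C by rewrite ltcR.
  move/cvg_ballP : fX => /(_ _ d0C).
  apply: filterS => x [_ Xd].
  have hd i j : normc ((X - f x) i j) <= d.
    have := Xd i j; rewrite -ball_normE /= => /ltW.
    by rewrite normcE lecR !mxE.
  rewrite (le_trans (opnorm_entries hd))// /d mulrA ler_piMl// ?(ltW e0)//.
  by rewrite ler_pdivrMr ?ltr_wpDl// ?mulr_ge0// mul1r lerDl.
apply/cvgrPdist_le => e e0; have [r r0 ->] := gt0_complexP e0.
apply: filterS (fX _ r0) => x h; rewrite (le_trans (mx_norm_opnorm _))//.
by rewrite lecR.
Qed.

End OperatorNorm.

(* A possibly non-unital C*-algebra: neither a unit nor commutativity of the
   product is assumed, so the ring structures of the library do not apply. *)
HB.mixin Record Banach_isCStarAlgebra (R : realType) A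
    of CompleteNormedModule R[i] A := {
  cmul : A -> A -> A;
  cstar : A -> A;
  cmulA : associative cmul;
  cmulDl : left_distributive cmul +%R;
  cmulDr : right_distributive cmul +%R;
  cmulZl : forall (k : R[i]) a b, cmul (k *: a) b = k *: cmul a b;
  cmulZr : forall (k : R[i]) a b, cmul a (k *: b) = k *: cmul a b;
  cnormM : forall a b, `|cmul a b| <= `|a| * `|b|;
  cstarK : involutive cstar;
  cstarD : {morph cstar : a b / a + b};
  cstarZ : forall (k : R[i]) a, cstar (k *: a) = k^*%R *: cstar a;
  cstarM : forall a b, cstar (cmul a b) = cmul (cstar b) (cstar a);
  cnorm_star : forall a, `|cmul (cstar a) a| = `|a| ^+ 2
}.

#[short(type="cStarAlgType")]
HB.structure Definition CStarAlgebra (R : realType) :=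
  {A of CompleteNormedModule R[i] A & Banach_isCStarAlgebra R A}.

Record hilbertType (R : realType) := HilbertType {
  hcar :> completeNormedModType R[i];
  hdot : {dot hcar for Num.Def.conjC};
  hdotE : forall x, `|x| ^+ 2 = hdot x x
}.

Section Representations.
Variables (R : realType) (A : cStarAlgType R).
Local Notation C := R[i].

Record is_hrep (H : hilbertType R) (pi : A -> H -> H) : Prop := IsHrep {
  hrep_linear : forall a, linear (pi a);
  hrep_bounded : forall a, continuous (pi a);
  hrep_lin : forall (k : C) a b x, pi (k *: a + b) x = k *: pi a x + pi b x;
  hrep_mul : forall a b x, pi (cmul a b) x = pi a (pi b x);
  hrep_star : forall a x y, hdot H (pi a x) y = hdot H x (pi (cstar a) y)
}.

Definition hirreducible (H : hilbertType R) (pi : A -> H -> H) : Prop :=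
  (exists a x, pi a x != 0) /\
  forall M : set H, closed M -> M 0 ->
    (forall (k : C) x y, M x -> M y -> M (k *: x + y)) ->
    (forall a x, M x -> M (pi a x)) ->
    M = [set 0] \/ M = [set: H].

Definition hdim_le (H : hilbertType R) (n : nat) : Prop :=
  exists v : 'I_n -> H, forall x, exists c : 'I_n -> C,
    x = \sum_(i < n) c i *: v i.

(* Irreducible representations are taken on arbitrary Hilbert spaces, so that
   boundedness of their dimensions also excludes infinite-dimensional ones. *)
Definition subhomogeneous : Prop :=
  exists n : nat, forall (H : hilbertType R) (pi : A -> H -> H),
    is_hrep pi -> hirreducible pi -> hdim_le H n.

(* n-dimensional representations, possibly zero or degenerate. *)
Record is_rep n (pi : A -> 'M[C]_n) : Prop := IsRep {
  rep_lin : linear pi;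
  rep_mul : forall a b, pi (cmul a b) = pi a *m pi b;
  rep_star : forall a, pi (cstar a) = (pi a) ^t*
}.

End Representations.

Record is_star_iso (R : realType) (A B : cStarAlgType R) (J : A -> B) : Prop :=
  IsStarIso {
    iso_bij : bijective J;
    iso_lin : linear J;
    iso_mul : forall a b, J (cmul a b) = cmul (J a) (J b);
    iso_star : forall a, J (cstar a) = cstar (J a)
  }.

Definition dsum (R : realType) n k (X : 'M[R[i]]_n) (Y : 'M[R[i]]_k) :
  'M[R[i]]_(n + k) := block_mx X 0 0 Y.

(* The matrix U_{p,q}, characterised by swap_mxP below. *)
Definition swap_mx (R : realType) p q : 'M[R[i]]_(p + q) :=
  castmx (addnC q p, erefl) (block_mx 0 1%:M 1%:M 0 : 'M[R[i]]_(q + p, p + q)).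

Lemma swap_mxP (R : realType) p q (w : 'rV[R[i]]_q) (z : 'rV[R[i]]_p) :
  castmx (erefl, addnC q p) (row_mx w z) *m swap_mx R p q = row_mx z w.
Proof.
have cast m (e : (q + p = m)%N) k (X : 'M[R[i]]_(q + p, k)) (v : 'rV_(q + p)) :
    castmx (erefl, e) v *m castmx (e, erefl) X = v *m X.
  by case: m / e; rewrite !castmx_id.
by rewrite /swap_mx cast mul_row_block !mulmx0 !mulmx1 add0r addr0.
Qed.

(* The data of a tower.  [tact U x] is U.x; it is defined for all square
   matrices U and all x, but its value is only meaningful, and only ever used,
   when U is unitary and its size is [tdeg x].  Not indexing the action by the
   degree avoids casts along equalities between degrees. *)
Record towerData (R : realType) := TowerData {
  tcar :> topologicalType;
  tdeg : tcar -> nat;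
  tplus : tcar -> tcar -> tcar;
  tact : forall n, 'M[R[i]]_n -> tcar -> tcar
}.

Notation "x ⊕ y" := (tplus x y) (at level 50, left associativity).
Notation "U ∙ x" := (tact U x) (at level 40, no associativity).

Definition tfib R (T : towerData R) (n : nat) : set T := [set x | tdeg x = n].
Arguments tfib {R} T n.

Definition closed_embedding (X Y : topologicalType) (f : X -> Y) : Prop :=
  [/\ continuous f, injective f & forall F, closed F -> closed (f @` F)].

Record is_tower R (T : towerData R) : Prop := IsTower {
  tower_hausdorff : hausdorff_space T;
  tdeg_gt0 : forall x : T, (0 < tdeg x)%N;
  tdeg_continuous : continuous (@tdeg R T);
  tplusA : associative (@tplus R T);
  tplus_continuous : continuous (fun p : T * T => p.1 ⊕ p.2);
  tplus_closed_embedding : forall n,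
    closed_embedding (fun p : tfib T n * T => \val p.1 ⊕ p.2);
  tdeg_plus : forall x y : T, tdeg (x ⊕ y) = (tdeg x + tdeg y)%N;
  tdeg_act : forall (x : T) (U : 'M[R[i]]_(tdeg x)), U \is unitarymx ->
    tdeg (U ∙ x) = tdeg x;
  tact_continuous : forall n,
    {within [set p : 'M[R[i]]_n * T | p.1 \is unitarymx /\ tdeg p.2 = n],
       continuous (fun p => p.1 ∙ p.2)};
  tact1 : forall x : T, (1%:M : 'M[R[i]]_(tdeg x)) ∙ x = x;
  tactM : forall (x : T) (U V : 'M[R[i]]_(tdeg x)),
    U \is unitarymx -> V \is unitarymx -> (U *m V) ∙ x = U ∙ (V ∙ x);
  tact_scalar : forall (x : T) (k : R[i]),
    (k%:M : 'M[R[i]]_(tdeg x)) \is unitarymx -> (k%:M : 'M[R[i]]_(tdeg x)) ∙ x = x;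
  tact_plus : forall (x y : T) (U : 'M[R[i]]_(tdeg x)) (V : 'M[R[i]]_(tdeg y)),
    U \is unitarymx -> V \is unitarymx ->
    dsum U V ∙ (x ⊕ y) = (U ∙ x) ⊕ (V ∙ y);
  tact_swap : forall x y : T, swap_mx R (tdeg x) (tdeg y) ∙ (x ⊕ y) = y ⊕ x
}.

Section TowerNotions.
Variables (R : realType) (T : towerData R).
Implicit Types x y z : T.

Definition proper_tower : Prop := forall n, compact (tfib T n).

Definition reducible x : Prop :=
  exists (a b : T) (V : 'M[R[i]]_(tdeg x)), V \is unitarymx /\ V ∙ x = a ⊕ b.

Definition core : set T := [set x | ~ reducible x].

(* Only used with n the degree of x. *)
Definition stab n x : set 'M[R[i]]_n :=
  [set U | U \is unitarymx /\ U ∙ x = x].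

Definition tequiv x y : Prop :=
  exists U : 'M[R[i]]_(tdeg x), U \is unitarymx /\ U ∙ x = y.

Definition tsub x y : Prop :=
  tequiv x y \/ exists a b : T, tequiv x a /\ tequiv y (a ⊕ b).

Definition tdisj x y : Prop := ~ exists a : T, tsub a x /\ tsub a y.

(* 0 is added because the supremum of the empty set is 0 by convention. *)
Definition height : \bar R :=
  ereal_sup ([set 0%E] `|` [set ((tdeg x)%:R)%:E | x in core]).

(* The n-fold sum of x, for n > 0. *)
Definition nfold n x : T := iter n.-1 (tplus x) x.

End TowerNotions.
Arguments stab {R T} n x.

Definition property_sigma (X : topologicalType) : Prop :=
  exists K : nat -> set X,
    [/\ forall n, K n `<=` K n.+1,
        \bigcup_n K n = [set: X],
        forall n, compact (K n) /\ hausdorff_space (K n) &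
        forall B : set X, closed B <-> forall n, closed (B `&` K n)].

Record is_mtower R (T : towerData R) : Prop := IsMtower {
  mtower_tower : is_tower T;
  mtower_sigma : property_sigma T;
  mtower_disj : forall x y z : T,
    tdisj z x -> tdisj z y -> tdisj z (x ⊕ y);
  mtower_cancel : forall x y z : T, tequiv (z ⊕ x) (z ⊕ y) -> tequiv x y;
  mtower_stab_plus : forall x y : T, tdisj x y ->
    stab (tdeg x + tdeg y) (x ⊕ y) =
      [set dsum U V | U in stab (tdeg x) x & V in stab (tdeg y) y];
  (* [U *t 1%:M] is the block matrix of the u_jk I_p. *)
  mtower_stab_nfold : forall (x : T) n, ~ reducible x -> (0 < n)%N ->
    stab (n * tdeg x) (nfold n x) =
      [set U *t (1%:M : 'M[R[i]]_(tdeg x)) |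
         U in [set U : 'M[R[i]]_n | U \is unitarymx]]
}.

Record is_proper_pointed_mtower_fh R (T : towerData R) (theta : T) : Prop :=
  IsProperPointedMtowerFh {
    ppm_mtower : is_mtower T;
    ppm_proper : proper_tower T;
    ppm_height : (height T < +oo)%E;
    ppm_point : tdeg theta = 1%N
  }.

Definition homeomorphism (X Y : topologicalType) (v : X -> Y) : Prop :=
  exists w : Y -> X, [/\ cancel v w, cancel w v, continuous v & continuous w].

Record is_tower_iso R (T T' : towerData R) (theta : T) (theta' : T')
    (v : T -> T') : Prop := IsTowerIso {
  tiso_homeo : homeomorphism v;
  tiso_deg : forall x, tdeg (v x) = tdeg x;
  tiso_act : forall x (U : 'M[R[i]]_(tdeg x)), U \is unitarymx -> v (U ∙ x) = U ∙ v x;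
  tiso_plus : forall x y, v (x ⊕ y) = v x ⊕ v y;
  tiso_point : v theta = theta'
}.

Definition mxfun R (T : towerData R) := forall x : T, 'M[R[i]]_(tdeg x).

(* Membership in C*(T).  [conform_mx 0] only transports matrices along equalities
   between degrees, for instance tdeg (U ∙ x) = tdeg x. *)
Record in_cstar R (T : towerData R) (f : mxfun T) : Prop := InCstar {
  cstar_cont : forall n,
    {within tfib T n, continuous (fun x => conform_mx (0 : 'M[R[i]]_n) (f x))};
  cstar_act : forall x (U : 'M[R[i]]_(tdeg x)), U \is unitarymx ->
    conform_mx 0 (f (U ∙ x)) = U *m f x *m invmx U;
  cstar_plus : forall x y,
    conform_mx 0 (f (x ⊕ y)) = dsum (f x) (f y);
  cstar_bounded : exists M : R, forall x, opnorm (f x) <= M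
}.

(* C*(T, theta), made below into a C*-algebra for the pointwise operations and the
   supremum norm. *)
Record ptCstar R (T : towerData R) (theta : T) := PtCstar {
  ptval :> forall x : T, 'M[R[i]]_(tdeg x);
  ptval_in : in_cstar ptval;
  ptval0 : ptval theta = 0
}.

HB.instance Definition _ R (T : towerData R) theta :=
  gen_eqMixin (@ptCstar R T theta).
HB.instance Definition _ R (T : towerData R) theta :=
  gen_choiceMixin (@ptCstar R T theta).

Section Conform.
Variables (R : realType) (m n : nat).
Implicit Types X Y : 'M[R[i]]_m.
Local Notation cf := (conform_mx (0 : 'M[R[i]]_n)).

Lemma conform_lin k X Y : cf (k *: X + Y) = k *: cf X + cf Y.
Proof.
have [e|e] := eqVneq m n; first by case: n / e; rewrite !conform_mx_id.
by rewrite !nonconform_mx ?e// scaler0 addr0.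
Qed.

Lemma conform_mul X Y : cf (X *m Y) = cf X *m cf Y.
Proof.
have [e|e] := eqVneq m n; first by case: n / e; rewrite !conform_mx_id.
by rewrite !nonconform_mx ?e// mul0mx.
Qed.

Lemma conform_star X : cf (X ^t*) = (cf X) ^t*.
Proof.
have [e|e] := eqVneq m n; first by case: n / e; rewrite !conform_mx_id.
by rewrite !nonconform_mx ?e// trmx0 map_mx0.
Qed.

Lemma conform_sub X Y : cf (X - Y) = cf X - cf Y.
Proof. by rewrite addrC -scaleN1r conform_lin scaleN1r addrC. Qed.

Lemma conform0 : cf (0 : 'M[R[i]]_m) = 0.
Proof.
have [e|e] := eqVneq m n; first by case: n / e; rewrite conform_mx_id.
by rewrite nonconform_mx ?e.
Qed.

Lemma conform_opnorm X : opnorm (cf X) <= opnorm X.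
Proof.
have [e|e] := eqVneq m n; first by case: n / e; rewrite !conform_mx_id.
by rewrite !nonconform_mx ?e// opnorm0 opnorm_ge0.
Qed.

End Conform.

Section DSum.
Variables (R : realType) (m n : nat).
Implicit Types (X : 'M[R[i]]_m) (Y : 'M[R[i]]_n).

Lemma dsum_lin k X X' Y Y' :
  dsum (k *: X + X') (k *: Y + Y') = k *: dsum X Y + dsum X' Y'.
Proof. by rewrite /dsum scale_block_mx add_block_mx !scaler0 !addr0. Qed.

Lemma dsum_sub X X' Y Y' : dsum (X - X') (Y - Y') = dsum X Y - dsum X' Y'.
Proof. by rewrite addrC -scaleN1r [Y - _]addrC -[- Y']scaleN1r dsum_lin scaleN1r addrC. Qed.

Lemma dsum_mul X X' Y Y' : dsum (X *m X') (Y *m Y') = dsum X Y *m dsum X' Y'.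
Proof. by rewrite /dsum mulmx_block !mul0mx !mulmx0 !addr0 !add0r. Qed.

Lemma dsum_star X Y : dsum (X ^t*) (Y ^t*) = (dsum X Y) ^t*.
Proof. by rewrite /dsum tr_block_mx map_block_mx !trmx0 !map_mx0. Qed.

Lemma dsum0 : dsum (0 : 'M[R[i]]_m) (0 : 'M[R[i]]_n) = 0.
Proof. by rewrite /dsum block_mx0. Qed.

Lemma dsum_unitary X Y : X \is unitarymx -> Y \is unitarymx ->
  dsum X Y \is unitarymx.
Proof.
move=> /unitarymxP XX /unitarymxP YY; apply/unitarymxP.
by rewrite -dsum_star -dsum_mul XX YY /dsum -scalar_mx_block.
Qed.

Lemma dsum_entry X Y e : (forall i j, normc (X i j) <= e) ->
  (forall i j, normc (Y i j) <= e) -> 0 <= e ->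
  forall i j, normc (dsum X Y i j) <= e.
Proof.
move=> Xe Ye e0 i j; rewrite /dsum !mxE.
by case: splitP => i' _; rewrite !mxE; case: splitP => j' _ //;
  rewrite mxE ComplexField.Normc.normc0.
Qed.

End DSum.

Section InCstar.
Variables (R : realType) (T : towerData R).
Local Notation C := R[i].
Implicit Types f g : mxfun T.

Lemma unitary_invmx n (U : 'M[C]_n) : U \is unitarymx -> invmx U *m U = 1%:M.
Proof. by move=> /unitarymx_unit; exact: mulVmx. Qed.

Lemma in_cstar0 : in_cstar (fun x : T => 0 : 'M[C]_(tdeg x)).
Proof.
split=> [n x|x U _|x y|].
- by under eq_fun do rewrite conform0; exact: cvg_cst.
- by rewrite conform0 mulmx0 mul0mx.
- by rewrite conform0 dsum0.
- by exists 0 => x; rewrite opnorm0.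
Qed.

Lemma in_cstar_lin k f g : in_cstar f -> in_cstar g ->
  in_cstar (fun x => k *: f x + g x).
Proof.
move=> [fc fa fp [M fM]] [gc ga gp [N gN]]; split=> [n x|x U uU|x y|].
- under eq_fun do rewrite conform_lin.
  by apply: cvgD; [apply: cvgZl_tmp; exact: fc|exact: gc].
- by rewrite conform_lin fa// ga// mulmxDr mulmxDl -scalemxAr -scalemxAl.
- by rewrite conform_lin fp gp dsum_lin.
- exists (normc k * M + N) => x; rewrite (le_trans (opnormD _ _))//.
  by rewrite lerD// opnormZ ler_wpM2l// normc_ge0.
Qed.

Lemma opnorm_mulB n (X X' Y Y' : 'M[C]_n) :
  opnorm (X *m Y - X' *m Y') <=
  opnorm (X - X') * opnorm Y + opnorm X' * opnorm (Y - Y').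
Proof.
have -> : X *m Y - X' *m Y' = (X - X') *m Y + X' *m (Y - Y').
  by rewrite mulmxBl mulmxBr addrA subrK.
apply: le_trans (opnormD _ _) _; apply: lerD; exact: opnorm_mul.
Qed.

Lemma in_cstar_mul f g : in_cstar f -> in_cstar g ->
  in_cstar (fun x => f x *m g x).
Proof.
move=> [fc fa fp [M fM]] [gc ga gp [N gN]]; split=> [n x|x U uU|x y|].
- under eq_fun do rewrite conform_mul.
  have M1 : 0 < `|M| + `|N| + 1 by rewrite ltr_wpDl// addr_ge0.
  apply/cvg_opnormP => e e0; pose d := e / 2 / (`|M| + `|N| + 1).
  have d0 : 0 < d by rewrite !divr_gt0.
  have /cvg_opnormP/(_ _ d0) fx := fc n x.
  have /cvg_opnormP/(_ _ d0) gx := gc n x.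
  apply: filterS2 fx gx => y; rewrite /from_subspace => fxy gxy.
  apply: le_trans (opnorm_mulB _ _ _ _) _.
  have hM : opnorm (conform_mx (0 : 'M[C]_n) (f y)) <= `|M| + `|N| + 1.
    apply: le_trans (conform_opnorm _ _) _; apply: le_trans (fM _) _.
    by apply: le_trans (ler_norm M) _; rewrite -addrA lerDl addr_ge0.
  have hN : opnorm (conform_mx (0 : 'M[C]_n) (g x)) <= `|M| + `|N| + 1.
    apply: le_trans (conform_opnorm _ _) _; apply: le_trans (gN _) _.
    by apply: le_trans (ler_norm N) _; rewrite -addrA addrCA lerDl addr_ge0.
  have -> : e = d * (`|M| + `|N| + 1) + (`|M| + `|N| + 1) * d.
    by rewrite [X in _ + X]mulrC /d divfK ?gt_eqF// -splitr.
  apply: lerD.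
    exact: (ler_pM (opnorm_ge0 _) (opnorm_ge0 _) fxy hN).
  exact: (ler_pM (opnorm_ge0 _) (opnorm_ge0 _) hM gxy).
- rewrite conform_mul fa// ga// -!mulmxA; congr (_ *m (_ *m _)).
  by rewrite [invmx U *m _]mulmxA unitary_invmx// mul1mx.
- by rewrite conform_mul fp gp dsum_mul.
- exists (`|M| * `|N|) => x; rewrite (le_trans (opnorm_mul _ _))//.
  by rewrite ler_pM ?opnorm_ge0// (le_trans _ (ler_norm _)).
Qed.

Lemma in_cstar_star f : in_cstar f -> in_cstar (fun x => (f x) ^t*).
Proof.
move=> [fc fa fp [M fM]]; split=> [n x|x U uU|x y|].
- under eq_fun do rewrite conform_star.
  apply/cvg_opnormP => e e0; have /cvg_opnormP/(_ _ e0) := fc n x.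
  by apply: filterS => y; rewrite -map_mxB -linearB opnorm_star.
- rewrite conform_star fa// invmx_unitary// !trmx_mul !map_mxM.
  by rewrite trmxCK mulmxA.
- by rewrite conform_star fp dsum_star.
- by exists M => x; rewrite opnorm_star.
Qed.

Lemma eq_opnorm n (X Y : 'M[C]_n) :
  (forall e, 0 < e -> opnorm (X - Y) <= e) -> X = Y.
Proof.
move=> h; apply/eqP; rewrite -subr_eq0; apply/eqP/opnorm_eq0/eqP.
by rewrite eq_le opnorm_ge0 andbT; apply/ler_addgt0Pl => e /h; rewrite addr0.
Qed.

Lemma opnorm_dist3 n (X X' Y Y' : 'M[C]_n) :
  opnorm (X - Y) <= opnorm (X' - X) + opnorm (X' - Y') + opnorm (Y' - Y).
Proof.
rewrite -[opnorm (X' - X)]opnormN opprB -[X - Y](subrKA Y') -[X - Y'](subrKA X').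
by apply: le_trans (opnormD _ _) _; rewrite lerD2r opnormD.
Qed.

Lemma in_cstar_lim (g : mxfun T) :
  (forall e, 0 < e -> exists2 f, in_cstar f &
     forall x, opnorm (f x - g x) <= e) -> in_cstar g.
Proof.
move=> gf; split=> [n x|x U uU|x y|].
- apply/cvg_opnormP => e e0.
  have e3 : 0 < e / 3 by rewrite divr_gt0.
  have [f [fc _ _ _] fg] := gf _ e3.
  have /cvg_opnormP/(_ _ e3) := fc n x; apply: filterS => y; rewrite /from_subspace => fxy.
  have gf1 z : opnorm (conform_mx (0 : 'M[C]_n) (f z) - conform_mx 0 (g z)) <= e / 3.
    by rewrite -conform_sub; exact: le_trans (conform_opnorm _ _) (fg z).
  have -> : e = e / 3 + e / 3 + e / 3 by field.
  apply: le_trans (opnorm_dist3 _ _ _ _) _.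
  by apply: lerD (gf1 y); apply: lerD fxy; exact: gf1.
- apply: eq_opnorm => e e0.
  have K0 : 0 < opnorm U * opnorm (invmx U) + 1.
    by rewrite ltr_wpDl// mulr_ge0 ?opnorm_ge0.
  pose d := e / (opnorm U * opnorm (invmx U) + 1).
  have d0 : 0 < d by rewrite divr_gt0.
  have [f [_ fa _ _] fg] := gf _ d0.
  have -> : conform_mx 0 (g (tact U x)) - U *m g x *m invmx U =
    U *m (f x - g x) *m invmx U - conform_mx 0 (f (tact U x) - g (tact U x)).
    rewrite conform_sub fa// mulmxBr mulmxBl.
    by rewrite opprB [RHS]addrC subrKA.
  rewrite (le_trans (opnormD _ _))// opnormN.
  have -> : e = opnorm U * opnorm (invmx U) * d + d.
    by rewrite -[X in _ + X]mul1r -mulrDl /d mulrC divfK ?gt_eqF.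
  rewrite lerD// ?(le_trans (conform_opnorm _ _))//.
  rewrite (le_trans (opnorm_mul _ _))// mulrAC ler_wpM2r ?opnorm_ge0//.
  by rewrite (le_trans (opnorm_mul _ _))// ler_wpM2l ?opnorm_ge0.
- apply/matrixP => i j; apply/eqP; rewrite -subr_eq0; apply/eqP.
  apply: ComplexField.Normc.eq0_normc; apply/eqP.
  rewrite eq_le normc_ge0 andbT; apply/ler_addgt0Pl => e e0; rewrite addr0.
  have e2 : 0 < e / 2 by rewrite divr_gt0.
  have [f [_ _ fp _] fg] := gf _ e2.
  have -> : conform_mx 0 (g (tplus x y)) i j - dsum (g x) (g y) i j =
    dsum (f x - g x) (f y - g y) i j
      - conform_mx 0 (f (tplus x y) - g (tplus x y)) i j.
    rewrite conform_sub fp dsum_sub.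
    move: (dsum (f x) _) (dsum (g x) _) (conform_mx _ _) => P B A.
    by rewrite !mxE opprB [RHS]addrC subrKA.
  rewrite (le_trans (normcD _ _))// normcN (splitr e) lerD//.
    by apply: dsum_entry => [? ?|? ?|]; rewrite ?(ltW e2)//;
      exact: le_trans (opnorm_entry _ _ _) (fg _).
  rewrite (le_trans (opnorm_entry _ _ _))//.
  exact: le_trans (conform_opnorm _ _) (fg _).
- have [f [_ _ _ [M fM]] fg] := gf _ ltr01.
  exists (1 + M) => x; rewrite -[g x](subKr (f x)) opprB addrC.
  by rewrite (le_trans (opnormD _ _))// lerD// -opnormN opprB.
Qed.

End InCstar.

Section PtCstar.
Variables (R : realType) (T : towerData R) (theta : T).
Local Notation C := R[i].
Local Notation W := (ptCstar theta).
Implicit Types f g h : W.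

Lemma ptCstar_eq f g : (forall x, f x = g x) -> f = g.
Proof.
case: f g => [f f1 f2] [g g1 g2] /= fg.
have e : f = g by apply: functional_extensionality_dep.
by case: g / e g1 g2 {fg} => g1 g2; congr PtCstar; exact: Prop_irrelevance.
Qed.

Definition pt_zero : W := PtCstar (in_cstar0 T) erefl.

Lemma pt_lin_subproof k f g : k *: f theta + g theta = 0.
Proof. by rewrite !ptval0 scaler0 addr0. Qed.

Definition pt_lin k f g : W :=
  PtCstar (in_cstar_lin k (ptval_in f) (ptval_in g)) (pt_lin_subproof k f g).

Lemma pt_mul_subproof f g : f theta *m g theta = 0.
Proof. by rewrite !ptval0 mul0mx. Qed.

Definition pt_mul f g : W :=
  PtCstar (in_cstar_mul (ptval_in f) (ptval_in g)) (pt_mul_subproof f g).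

Lemma pt_star_subproof f : (f theta) ^t* = 0.
Proof. by rewrite ptval0 trmx0 map_mx0. Qed.

Definition pt_star f : W :=
  PtCstar (in_cstar_star (ptval_in f)) (pt_star_subproof f).

Definition pt_add f g := pt_lin 1 f g.
Definition pt_opp f := pt_lin (-1) f pt_zero.
Definition pt_scale k f := pt_lin k f pt_zero.

Lemma pt_addA : associative pt_add.
Proof. by move=> f g h; apply: ptCstar_eq => x; rewrite /= !scale1r addrA. Qed.
Lemma pt_addC : commutative pt_add.
Proof. by move=> f g; apply: ptCstar_eq => x; rewrite /= !scale1r addrC. Qed.
Lemma pt_add0 : left_id pt_zero pt_add.
Proof. by move=> f; apply: ptCstar_eq => x; rewrite /= scale1r add0r. Qed.
Lemma pt_addN : left_inverse pt_zero pt_opp pt_add.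
Proof.
by move=> f; apply: ptCstar_eq => x; rewrite /= scale1r scaleN1r addr0 addNr.
Qed.

HB.instance Definition _ :=
  GRing.isZmodule.Build W pt_addA pt_addC pt_add0 pt_addN.

Lemma pt_addE f g x : (f + g) x = f x + g x.
Proof. by rewrite /= scale1r. Qed.

Lemma pt_scaleA k l f : pt_scale k (pt_scale l f) = pt_scale (k * l) f.
Proof. by apply: ptCstar_eq => x; rewrite /= !addr0 scalerA. Qed.
Lemma pt_scale1 : left_id 1 pt_scale.
Proof. by move=> f; apply: ptCstar_eq => x; rewrite /= addr0 scale1r. Qed.
Lemma pt_scaleDr : right_distributive pt_scale +%R.
Proof.
by move=> k f g; apply: ptCstar_eq => x; rewrite /= !addr0 !scale1r scalerDr.
Qed.
Lemma pt_scaleDl f : {morph pt_scale^~ f : k l / k + l}.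
Proof.
by move=> k l; apply: ptCstar_eq => x; rewrite /= !addr0 !scale1r scalerDl.
Qed.

HB.instance Definition _ :=
  GRing.Zmodule_isLmodule.Build C W pt_scaleA pt_scale1 pt_scaleDr pt_scaleDl.

Lemma pt_scaleE k f x : (k *: f) x = k *: f x.
Proof. by rewrite /= addr0. Qed.

Lemma pt_subE f g x : (f - g) x = f x - g x.
Proof. by rewrite /= scale1r addr0 scaleN1r. Qed.

Definition supnorm f : R := sup [set opnorm (f x) | x in [set: T]].

Lemma supnorm_has_sup f : has_sup [set opnorm (f x) | x in [set: T]].
Proof.
split; first by exists (opnorm (f theta)), theta.
by have [_ _ _ [M fM]] := ptval_in f; exists M => _ [x _ <-].
Qed.

Lemma opnorm_supnorm f x : opnorm (f x) <= supnorm f.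
Proof. by apply: (sup_upper_bound (supnorm_has_sup f)); exists x. Qed.

Lemma supnorm_le f M : (forall x, opnorm (f x) <= M) -> supnorm f <= M.
Proof.
move=> fM; apply: ge_sup; first by case: (supnorm_has_sup f).
by move=> _ [x _ <-].
Qed.

Lemma supnorm_ge0 f : 0 <= supnorm f.
Proof. exact: le_trans (opnorm_ge0 _) (opnorm_supnorm f theta). Qed.

Lemma supnorm_eq0 f : supnorm f = 0 -> f = 0.
Proof.
move=> f0; apply: ptCstar_eq => x; apply: opnorm_eq0; apply/eqP.
by rewrite eq_le opnorm_ge0 andbT -f0 opnorm_supnorm.
Qed.

Lemma supnormD f g : supnorm (f + g) <= supnorm f + supnorm g.
Proof.
apply: supnorm_le => x; rewrite pt_addE (le_trans (opnormD _ _))//.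
by rewrite lerD ?opnorm_supnorm.
Qed.

Lemma supnormZ_le k f : supnorm (k *: f) <= normc k * supnorm f.
Proof.
apply: supnorm_le => x.
by rewrite pt_scaleE opnormZ ler_wpM2l ?normc_ge0 ?opnorm_supnorm.
Qed.

Lemma supnormZ k f : supnorm (k *: f) = normc k * supnorm f.
Proof.
apply/eqP; rewrite eq_le supnormZ_le /=.
have [->|k0] := eqVneq k 0.
  by rewrite ComplexField.Normc.normc0 mul0r supnorm_ge0.
have nk0 : 0 < normc k.
  rewrite lt_neqAle normc_ge0 andbT eq_sym; apply: contra k0.
  by move=> /eqP /ComplexField.Normc.eq0_normc ->.
rewrite -ler_pdivlMl// -ComplexField.Normc.normcV.
by rewrite -{1}[f](scalerK k0) supnormZ_le.
Qed.

Lemma pt_normD f g : (supnorm (f + g))%:C <= (supnorm f)%:C + (supnorm g)%:C :> C.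
Proof. by rewrite -rmorphD lecR supnormD. Qed.

Lemma pt_normZ (k : C) f : (supnorm (k *: f))%:C = `|k| * (supnorm f)%:C.
Proof. by rewrite supnormZ rmorphM. Qed.

Lemma pt_norm_eq0 f : (supnorm f)%:C = 0 :> C -> f = 0.
Proof. by move=> /complexI /supnorm_eq0. Qed.

HB.instance Definition _ :=
  Lmodule_isNormed.Build C W pt_normD pt_normZ pt_norm_eq0.

Lemma pt_normE f : `|f| = (supnorm f)%:C :> C. Proof. by []. Qed.

Lemma pt_complete (F : set_system W) : ProperFilter F -> cauchy F -> cvg F.
Proof.
move=> FF /cauchyP Fc.
have ptc x : cvg ((fun f : W => f x) @ F).
  apply: cauchy_cvg; apply: cauchy_exP => e e0.
  have [f0 Ff0] := Fc _ e0; exists (f0 x).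
  suff : \forall f \near F, ball ((f0 : W) x) e ((f : W) x) by [].
  apply: filterS Ff0 => f; rewrite -!ball_normE /=.
  apply: le_lt_trans; rewrite -pt_subE (le_trans (mx_norm_opnorm _))//.
  by rewrite pt_normE lecR opnorm_supnorm.
pose g : mxfun T := fun x => lim ((fun f : W => f x) @ F).
have ptc' x e : 0 < e -> \forall h \near F, opnorm (g x - (h : W) x) <= e.
  move: e; suff : (fun f : W => f x) @ F --> g x by move/cvg_opnormP.
  exact: ptc.
have Fg e : 0 < e -> \forall f \near F, forall x, opnorm ((f : W) x - g x) <= e.
  move=> e0; have e3 : 0 < e / 3 by rewrite divr_gt0.
  have e3C : 0 < (e / 3)%:C :> C by rewrite ltcR.
  have [f0 /= Ff0] := Fc _ e3C.
  have fb (f : W) : ball f0 (e / 3)%:C f -> forall x, opnorm (f0 x - f x) <= e / 3.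
    rewrite -ball_normE /= pt_normE ltcR => /ltW h x; apply: le_trans h.
    by rewrite -pt_subE opnorm_supnorm.
  have near_f0 : \forall f \near F, forall x, opnorm (f0 x - (f : W) x) <= e / 3.
    exact: filterS Ff0.
  apply: (filterS _ near_f0) => f f0f x.
  have [h [f0h gh]] := filter_ex (filterI near_f0 (ptc' x _ e3)).
  apply: le_trans (opnorm_dist3 _ (f0 x) _ (h x)) _.
  have -> : e = e / 3 + e / 3 + e / 3 by field.
  apply: lerD; first exact: lerD (f0f x) (f0h x).
  by rewrite -opnormN opprB.
have gin : in_cstar g.
  apply: in_cstar_lim => e e0; have [f fg] := filter_ex (Fg _ e0).
  by exists f; [exact: ptval_in|].
have g0 : g theta = 0.
  apply: eq_opnorm => e e0; have [f fg] := filter_ex (Fg _ e0).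
  by rewrite subr0 -opnormN -[- _]add0r -(ptval0 f).
apply/cvg_ex; exists (PtCstar gin g0); apply/cvgrPdist_le => e e0.
have [r r0 ->] := gt0_complexP e0.
apply: filterS (Fg _ r0) => f fg; rewrite pt_normE lecR.
by apply: supnorm_le => x; rewrite pt_subE -opnormN opprB.
Unshelve. all: by end_near. Qed.

HB.instance Definition _ := Uniform_isComplete.Build W pt_complete.

Lemma pt_mulA : associative pt_mul.
Proof. by move=> f g h; apply: ptCstar_eq => x /=; rewrite mulmxA. Qed.
Lemma pt_mulDl : left_distributive pt_mul +%R.
Proof. by move=> f g h; apply: ptCstar_eq => x /=; rewrite !scale1r mulmxDl. Qed.
Lemma pt_mulDr : right_distributive pt_mul +%R.
Proof. by move=> f g h; apply: ptCstar_eq => x /=; rewrite !scale1r mulmxDr. Qed.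
Lemma pt_mulZl (k : C) f g : pt_mul (k *: f) g = k *: pt_mul f g.
Proof. by apply: ptCstar_eq => x /=; rewrite !addr0 scalemxAl. Qed.
Lemma pt_mulZr (k : C) f g : pt_mul f (k *: g) = k *: pt_mul f g.
Proof. by apply: ptCstar_eq => x /=; rewrite !addr0 scalemxAr. Qed.
Lemma pt_normM f g : `|pt_mul f g| <= `|f| * `|g|.
Proof.
rewrite !pt_normE -rmorphM lecR; apply: supnorm_le => x /=.
by rewrite (le_trans (opnorm_mul _ _))// ler_pM ?opnorm_ge0 ?opnorm_supnorm.
Qed.
Lemma pt_starK : involutive pt_star.
Proof. by move=> f; apply: ptCstar_eq => x /=; rewrite trmxCK. Qed.
Lemma pt_starD : {morph pt_star : f g / f + g}.
Proof.
by move=> f g; apply: ptCstar_eq => x /=; rewrite !scale1r linearD /= map_mxD.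
Qed.
Lemma pt_starZ (k : C) f : pt_star (k *: f) = k^*%R *: pt_star f.
Proof. by apply: ptCstar_eq => x /=; rewrite !addr0 linearZ /= map_mxZ. Qed.
Lemma pt_starM f g : pt_star (pt_mul f g) = pt_mul (pt_star g) (pt_star f).
Proof. by apply: ptCstar_eq => x /=; rewrite trmx_mul map_mxM. Qed.
Lemma pt_norm_star f : `|pt_mul (pt_star f) f| = `|f| ^+ 2.
Proof.
rewrite !pt_normE -rmorphXn; congr _%:C; apply/eqP; rewrite eq_le.
apply/andP; split.
  apply: supnorm_le => x /=; rewrite opnorm_star_sqr.
  by rewrite lerXn2r ?nnegrE ?opnorm_ge0 ?supnorm_ge0 ?opnorm_supnorm.
set g := pt_mul _ _.
rewrite -[leRHS]sqr_sqrtr ?supnorm_ge0//.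
rewrite lerXn2r ?nnegrE ?supnorm_ge0 ?sqrtr_ge0//.
apply: supnorm_le => x; rewrite -[leLHS]ger0_norm ?opnorm_ge0// -sqrtr_sqr.
by rewrite ler_wsqrtr// -opnorm_star_sqr (opnorm_supnorm g).
Qed.

HB.instance Definition _ := Banach_isCStarAlgebra.Build R W
  pt_mulA pt_mulDl pt_mulDr pt_mulZl pt_mulZr pt_normM
  pt_starK pt_starD pt_starZ pt_starM pt_norm_star.
End PtCstar.

Section ConcreteTower.
Variables (R : realType) (A : cStarAlgType R).
Local Notation C := R[i].

Definition zfib n : set {ptws A -> 'M[C]_n} := [set pi | is_rep pi].
Arguments zfib n : clear implicits.

(* The disjoint union of the spaces of n-dimensional representations over n >= 1,
   with the index shifted by one. *)
Definition zspace : Type := {i : nat & zfib i.+1}.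

HB.instance Definition _ := Topological.copy zspace {i : nat & zfib i.+1}.

Definition zdeg (p : zspace) : nat := (projT1 p).+1.

Definition zrep (p : zspace) : A -> 'M[C]_(zdeg p) := \val (projT2 p).

Lemma zrepP p : is_rep (zrep p).
Proof. exact: set_valP (projT2 p). Qed.

Definition zmk i (pi : A -> 'M[C]_i.+1) (h : is_rep pi) : zspace :=
  existT (fun i => zfib i.+1 : Type) i (exist _ (pi : {ptws A -> 'M[C]_i.+1}) (mem_set h)).

Lemma rep_dsum n k (pi : A -> 'M[C]_n) (rho : A -> 'M[C]_k) :
  is_rep pi -> is_rep rho -> is_rep (fun a => dsum (pi a) (rho a)).
Proof.
move=> [pl pm ps] [rl rm rs]; split=> [c a b|a b|a].
- by rewrite pl rl dsum_lin.
- by rewrite pm rm dsum_mul.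
- by rewrite ps rs dsum_star.
Qed.

Lemma rep_conj n (V : 'M[C]_n) (pi : A -> 'M[C]_n) :
  V \is unitarymx -> is_rep pi -> is_rep (fun a => V *m pi a *m invmx V).
Proof.
move=> Vu [pl pm ps]; split=> [c a b|a b|a].
- by rewrite pl mulmxDr mulmxDl -scalemxAr -scalemxAl.
- rewrite pm -!mulmxA; congr (_ *m (_ *m _)).
  by rewrite [invmx V *m _]mulmxA unitary_invmx// mul1mx.
- by rewrite ps invmx_unitary// !trmx_mul !map_mxM trmxCK mulmxA.
Qed.

Lemma rep_zero n : is_rep (fun _ : A => 0 : 'M[C]_n).
Proof.
split=> [c a b|a b|a]; first by rewrite scaler0 addr0.
- by rewrite mul0mx.
- by rewrite trmx0 map_mx0.
Qed.

(* U itself when U is a unitary matrix of size m, and a junk value otherwise. *)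
Definition unitarize n m (U : 'M[C]_n) : 'M[C]_m :=
  let V := conform_mx 1%:M U in if V \is unitarymx then V else 1%:M.

Lemma unitarize_unitary n m (U : 'M[C]_n) : unitarize m U \is unitarymx.
Proof.
by rewrite /unitarize; case: ifP => // _; apply/unitarymxP;
  rewrite trmx1 map_mx1 mulmx1.
Qed.

Lemma unitarizeE n (U : 'M[C]_n) : U \is unitarymx -> unitarize n U = U.
Proof. by rewrite /unitarize conform_mx_id => ->. Qed.

Definition zplus (p q : zspace) : zspace :=
  @zmk (projT1 p + (projT1 q).+1) _ (rep_dsum (zrepP p) (zrepP q)).

Definition zact n (U : 'M[C]_n) (p : zspace) : zspace :=
  zmk (rep_conj (unitarize_unitary (zdeg p) U) (zrepP p)).

Definition ztower : towerData R := TowerData zdeg zplus zact.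

Definition zzero : ztower := @zmk 0 _ (rep_zero 1).

End ConcreteTower.

Section PointEvaluation.
Variables (R : realType) (T : towerData R) (theta : T).

Lemma rep_eval s n :
  is_rep (fun u : ptCstar theta => conform_mx (0 : 'M[R[i]]_n) (u s)).
Proof.
split=> [k u v|u v|u].
- by rewrite pt_addE pt_scaleE conform_lin.
- by rewrite conform_mul.
- by rewrite conform_star.
Qed.

(* The evaluation pi_s as a point of the concrete tower; since degrees are
   positive, (tdeg s).-1.+1 is tdeg s and [conform_mx 0] is a transport. *)
Definition eval_at (s : T) : ztower (ptCstar theta) :=
  zmk (rep_eval s (tdeg s).-1.+1).

End PointEvaluation.
Arguments eval_at {R T theta} s.

(* Main.v *)
(** Part (I).  The GNS construction at an extreme point gives, for every element of a
    subhomogeneous algebra [A], a matrix representation in which its norm is attained.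
    The m-tower axioms for Z(A) are statements about spaces of intertwiners.  J is onto
    by a Stone-Weierstrass argument by induction on the degree: the bicommutant
    separates inequivalent irreducible representations, and products of elements with
    scalar values in the top degree play the role of a partition of unity.

    Part (II).  After adding copies of [kappa], an element of [S] is a sum of irreducible
    elements; by (mT1)-(mT4) this sum is unique up to a unitary that commutes with every
    assignment of values to the irreducible elements, so such an assignment extends
    additively.  With Tietze's theorem, made equivariant by taking Chebyshev centres of
    orbits, this yields, degree by degree, functions in C*(S, kappa) with a prescribed
    value at an irreducible point.  The kernel of an irreducible representation of
    C*(S, kappa) is prime, so by compactness it contains the kernel of the evaluation at
    some point.  Hence all finite-dimensional representations are evaluations; the
    uniqueness of sums of irreducibles, now in the tower of representations, shows that
    the point is determined, and compactness makes the bijection a homeomorphism. *)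
Require Import Defs.
From HB Require Import structures.
From mathcomp Require Import all_boot all_order all_algebra.
From mathcomp Require Import complex mxtens.
From mathcomp Require Import all_classical all_reals all_analysis.
From mathcomp Require Import ring lra zify.

Set Implicit Arguments.
Unset Strict Implicit.
Unset Printing Implicit Defensive.

Import Order.TTheory GRing.Theory Num.Theory.
Import numFieldNormedType.Exports.

Local Open Scope classical_set_scope.
Local Open Scope ring_scope.
Local Open Scope complex_scope.
Local Open Scope sesquilinear_scope.

(** No spectral theory of C*-algebras is presupposed, and this shapes Part (I). Square roots and
    inverses near a unit are fixed points of contractions, spectra are compared through norms of
    powers with exponent 2^n, and [lamp] stands for the top of the spectrum. Being sublinear, [lamp]
    is also the functional whose extreme linear minorants are pure states, so positivity of x* x and
    the existence of pure states come from one object. Once norms are attained in matrices, later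
    functional calculus is only checked on eigenvectors. Neither a unit nor nondegenerate
    representations are available: polynomials have no constant term, partitions of unity become
    iterations, and the zero representation needs separate care. Degrees are equal only up to proof,
    so points are compared after [mat n], which reads a matrix in size n and gives 0 in any other.
    Compactness is used through ultrafilters, since nothing makes the fibres metrizable: data chosen
    point by point, such as unitaries or summands, converge along an ultrafilter without any
    continuous selection. *)

Section LinearNormalForm.
Variables (K : pzRingType) (V : lmodType K).

(** Syntax for linear combinations of atoms, so that module identities can be proved by reflection,
    one coefficient at a time. *)
Inductive lexp :=
  | LVar of nat | LZero | LAdd of lexp & lexp | LOpp of lexp | LScale of K & lexp.

Fixpoint leval (env : seq V) (x : lexp) : V :=
  match x with
  | LVar n => env`_n
  | LZero => 0
  | LAdd x y => leval env x + leval env y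
  | LOpp x => - leval env x
  | LScale c x => c *: leval env x
  end.

(** [Nat.eqb] on numerals reduces under [simpl], so [ring] meets plain 0 and 1 as the coefficients
    of the atoms. *)
Fixpoint lcoef (x : lexp) (i : nat) : K :=
  match x with
  | LVar n => if Nat.eqb n i then 1 else 0
  | LZero => 0
  | LAdd x y => lcoef x i + lcoef y i
  | LOpp x => - lcoef x i
  | LScale c x => c * lcoef x i
  end.

Fixpoint lcheck n x y : Prop :=
  if n is n'.+1 then lcoef x n' = lcoef y n' /\ lcheck n' x y else True.

Lemma leval_coef env x : leval env x = \sum_(i < size env) lcoef x i *: env`_i.
Proof.
elim: x => [n||x hx y hy|x hx|c x hx] /=.
- have [ns|ns] := ltnP n (size env).
    rewrite (bigD1 (Ordinal ns))//= PeanoNat.Nat.eqb_refl scale1r big1 ?addr0//.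
    move=> i; rewrite -val_eqE /= => ni.
    by case: PeanoNat.Nat.eqb_spec => [e|_]; [rewrite e eqxx in ni|rewrite scale0r].
  rewrite nth_default// big1// => i _.
  case: PeanoNat.Nat.eqb_spec => [e|_]; last by rewrite scale0r.
  by move: ns; rewrite e leqNgt ltn_ord.
- by rewrite big1// => i _; rewrite scale0r.
- by rewrite hx hy -big_split; apply: eq_bigr => i _; rewrite scalerDl.
- by rewrite hx -sumrN; apply: eq_bigr => i _; rewrite scaleNr.
- by rewrite hx scaler_sumr; apply: eq_bigr => i _; rewrite scalerA.
Qed.

Lemma lmod_eq env x y : lcheck (size env) x y -> leval env x = leval env y.
Proof.
move=> h; rewrite !leval_coef; apply: eq_bigr => i _; congr (_ *: _).
elim: (size env) i h => [[]//|n ih] i /= [h1 h2].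
by have [->//|ni] := eqVneq (val i) n; apply: (ih (Ordinal (_ : i < n)%N)) => //;
  rewrite ltn_neqAle ni -ltnS ltn_ord.
Qed.

End LinearNormalForm.

Ltac lmod_find x l :=
  match l with
  | x :: _ => constr:(0%N)
  | _ :: ?l' => let n := lmod_find x l' in constr:(S n)
  end.

Ltac lmod_add x l :=
  match l with
  | _ => let _ := lmod_find x l in constr:(l)
  | _ => constr:(x :: l)
  end.

Ltac lmod_atoms t l :=
  lazymatch t with
  | (?a + ?b)%R => let l1 := lmod_atoms a l in lmod_atoms b l1
  | (- ?a)%R => lmod_atoms a l
  | (?c *: ?a)%R => lmod_atoms a l
  | 0%R => constr:(l)
  | _ => lmod_add t l
  end.

Ltac lmod_reify K t l :=
  lazymatch t with
  | (?a + ?b)%R => let x := lmod_reify K a l in let y := lmod_reify K b l in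
                   constr:(LAdd x y)
  | (- ?a)%R => let x := lmod_reify K a l in constr:(LOpp x)
  | (?c *: ?a)%R => let x := lmod_reify K a l in constr:(LScale (c : K) x)
  | 0%R => constr:(@LZero K)
  | _ => let n := lmod_find t l in constr:(@LVar K n)
  end.

(* Reduces an equality between linear combinations in a [K]-module to the
   equalities between the coefficients, which it leaves when [ring] fails. *)
Ltac lmod_ K V :=
  lazymatch goal with
  | |- @eq _ ?s ?t =>
    let l0 := lmod_atoms s (@nil (GRing.Lmodule.sort V)) in
    let l := lmod_atoms t l0 in
    let x := lmod_reify K s l in
    let y := lmod_reify K t l in
    refine (@lmod_eq K V l x y _); simpl lcheck; repeat split; simpl lcoef; try ring
  end.

Ltac lmod R V :=
  let K := constr:(complex R : pzRingType) in let W := constr:(V : lmodType (complex R)) in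
  lmod_ K W.

(** * Real-valued norms and a fixed-point principle *)

Section RealNorm.
Variables (R : realType) (V : normedModType R[i]).
Implicit Types x y z : V.

(** The norm takes values in the complex numbers; its real version is what [lra] and [nra] can
    handle. *)
Definition nrm x : R := complex.Re `|x|.

Lemma nrmE x : `|x| = (nrm x)%:C.
Proof. by have /ger0_Im := normr_ge0 x; rewrite /nrm; case: `|x| => a b /= ->. Qed.

Lemma nrm_ge0 x : 0 <= nrm x.
Proof. by rewrite -lecR -nrmE normr_ge0. Qed.

Lemma nrmD x y : nrm (x + y) <= nrm x + nrm y.
Proof. by rewrite -lecR rmorphD /= -!nrmE ler_normD. Qed.

Lemma nrmZ k x : nrm (k *: x) = normc k * nrm x.
Proof. by apply: (@complexI R); rewrite -nrmE normrZ nrmE rmorphM. Qed.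

Lemma nrmZr (r : R) x : nrm (r%:C *: x) = `|r| * nrm x.
Proof. by rewrite nrmZ normc_real. Qed.

Lemma nrmN x : nrm (- x) = nrm x.
Proof. by rewrite /nrm normrN. Qed.

Lemma nrmB x y : nrm (x - y) <= nrm x + nrm y.
Proof. by rewrite (le_trans (nrmD _ _))// nrmN. Qed.

Lemma nrmBC x y : nrm (x - y) = nrm (y - x).
Proof. by rewrite -nrmN opprB. Qed.

Lemma nrm0 : nrm (0 : V) = 0.
Proof. by rewrite /nrm normr0. Qed.

Lemma nrm_eq0 x : nrm x = 0 -> x = 0.
Proof. by move=> x0; apply/normr0_eq0; rewrite nrmE x0. Qed.

Lemma nrm_dist x y z : nrm (x - z) <= nrm (x - y) + nrm (y - z).
Proof. by rewrite -[x - z](subrKA y) nrmD. Qed.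

Lemma ler_dist_nrm x y : `|nrm x - nrm y| <= nrm (x - y).
Proof.
have h1 : nrm x <= nrm (x - y) + nrm y by rewrite -[x in leLHS](subrK y) nrmD.
have h2 : nrm y <= nrm (x - y) + nrm x.
  by rewrite nrmBC -[y in leLHS](subrK x) nrmD.
by rewrite ler_norml; lra.
Qed.

Lemma nrm_small x : (forall e, 0 < e -> nrm x <= e) -> x = 0.
Proof.
move=> h; apply/nrm_eq0/eqP; rewrite eq_le nrm_ge0 andbT.
by apply/ler_addgt0Pl => e e0; rewrite addr0 h.
Qed.

(** Closedness stated with approximations, so that properties of iterates pass to their limit
    without any filter. *)
Definition aclosed (P : V -> Prop) :=
  forall x, (forall e, 0 < e -> exists2 y, P y & nrm (x - y) <= e) -> P x.

End RealNorm.

Section SeqComplete.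
Variables (R : realType) (V : completeNormedModType R[i]).

Lemma complete_seq (u : nat -> V) :
  (forall e : R, 0 < e -> exists N, forall n m, (N <= n)%N -> (N <= m)%N ->
     nrm (u n - u m) <= e) ->
  exists x, forall e : R, 0 < e -> exists N, forall n, (N <= n)%N -> nrm (x - u n) <= e.
Proof.
move=> uc; have : cvg (u @ \oo).
  apply: cauchy_cvg; apply: cauchy_exP => e e0.
  have [r r0 ->] := gt0_complexP e0.
  have [N hN] := uc _ (divr_gt0 r0 (ltr0n R 2)).
  exists (u N); exists N => // n /= Nn; rewrite -ball_normE /= nrmE ltcR.
  by rewrite (le_lt_trans (hN _ _ _ _))// ltr_pdivrMr// mulrDr mulr1 ltrDl.
move=> /cvg_ex[/= x ux]; exists x => e e0.
have eC : 0 < e%:C :> R[i] by rewrite ltcR.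
move/cvgrPdist_le : ux => /(_ _ eC)[N _ hN]; exists N => n Nn.
by have := hN n Nn; rewrite /= nrmE lecR.
Qed.

(** The iterates of 0 form a geometric Cauchy sequence inside the ball of radius k, where k also
    bounds the Lipschitz constant. The second clause carries to the fixed point every closed
    property that holds at 0 and is preserved by F; selfadjointness and commutation are obtained
    this way. *)
Lemma contraction_fix (F : V -> V) (k : R) : 0 <= k < 1 ->
  (forall x, nrm x <= k -> nrm (F x) <= k) ->
  (forall x y, nrm x <= k -> nrm y <= k -> nrm (F x - F y) <= k * nrm (x - y)) ->
  exists2 x, x = F x & forall P, aclosed P -> P 0 -> (forall y, P y -> P (F y)) -> P x.
Proof.
move=> /andP[k0 k1] Fk Fc; pose u n := iter n F 0.
have uk n : nrm (u n) <= k by elim: n => [|n ih]; rewrite ?nrm0//=; exact: Fk.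
have ugeo n : nrm (u n.+1 - u n) <= k ^+ n * k.
  elim: n => [|n ih]; first by rewrite subr0 expr0 mul1r uk.
  apply: le_trans (Fc (u n.+1) (u n) (uk _) (uk _)) _.
  by rewrite exprS -mulrA ler_wpM2l.
have k1' : 0 < 1 - k by rewrite subr_gt0.
have utail n p : nrm (u (n + p)%N - u n) <= k ^+ n / (1 - k).
  suff : nrm (u (n + p)%N - u n) <= k ^+ n * (1 - k ^+ p) / (1 - k).
    move=> /le_trans -> //; rewrite ler_pM2r ?invr_gt0// ler_piMr ?exprn_ge0//.
    by rewrite gerBl exprn_ge0.
  elim: p => [|p ih]; first by rewrite addn0 subrr nrm0 expr0 subrr mulr0 mul0r.
  rewrite addnS (le_trans (nrm_dist _ (u (n + p)%N) _))//.
  rewrite (le_trans (lerD (ugeo _) ih))// exprD exprS.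
  rewrite ler_pdivlMr// mulrDl divfK ?gt_eqF//.
  have : 0 <= k ^+ n by rewrite exprn_ge0.
  have : 0 <= k ^+ p by rewrite exprn_ge0.
  move: (k ^+ n) (k ^+ p) => a b a0 b0.
  by have := mulr_ge0 (mulr_ge0 a0 b0) (sqr_ge0 (1 - k)); lra.
have kn0 : forall e : R, 0 < e -> exists N, forall n, (N <= n)%N -> k ^+ n / (1 - k) <= e.
  move=> e e0; have /cvgrPdist_le/(_ (e * (1 - k))) : k ^+ n @[n --> \oo] --> 0.
    by apply: cvg_expr; rewrite ger0_norm.
  rewrite mulr_gt0// => /(_ isT)[N _ hN]; exists N => n Nn.
  rewrite ler_pdivrMr//; have := hN n Nn.
  by rewrite /= sub0r normrN ger0_norm ?exprn_ge0.
have [x ux] : exists x, forall e : R, 0 < e ->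
    exists N, forall n, (N <= n)%N -> nrm (x - u n) <= e.
  apply: complete_seq => e e0.
  have [N hN] := kn0 _ (divr_gt0 e0 (ltr0n R 2)); exists N => n m Nn Nm.
  rewrite (le_trans (nrm_dist _ (u N) _))// (splitr e) lerD//.
    by have := utail N (n - N)%N; rewrite subnKC// => /le_trans -> //; exact: hN.
  by have := utail N (m - N)%N; rewrite subnKC// nrmBC => /le_trans -> //; exact: hN.
have xk : nrm x <= k.
  apply/ler_addgt0Pl => e e0; have [N hN] := ux _ e0.
  by rewrite -[x](subrK (u N)) (le_trans (nrmD _ _))// lerD ?uk ?hN.
exists x.
  apply/eqP; rewrite -subr_eq0; apply/eqP/nrm_small => e e0.
  have [N hN] := ux _ (divr_gt0 e0 (ltr0n R 2)).
  rewrite (le_trans (nrm_dist _ (u N.+1) _))// (splitr e) lerD ?hN//.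
  apply: le_trans (Fc (u N) x (uk _) xk) _.
  by rewrite nrmBC (le_trans _ (hN N _))// ler_piMl ?nrm_ge0// ltW.
move=> P Pc P0 PF; apply: Pc => e e0; have [N hN] := ux _ e0.
by exists (u N); [elim: N {hN} => [//|n ih]; exact: PF|exact: hN].
Qed.

End SeqComplete.

(** * Square roots and quasi-inverses in a C*-algebra without unit *)

Section CStarBasics.
Variables (R : realType) (A : cStarAlgType R).
Local Notation C := R[i].
Implicit Types a b c x y z : A.
Local Notation "x ** y" := (cmul x y) (at level 40, left associativity).
Local Notation "x ^*c" := (cstar x) (at level 2, format "x ^*c").

Lemma nrm_cmul a b : nrm (a ** b) <= nrm a * nrm b.
Proof. by rewrite -lecR rmorphM /= -!nrmE cnormM. Qed.

Lemma nrm_star_mul a : nrm (a^*c ** a) = nrm a ^+ 2.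
Proof. by apply: (@complexI R); rewrite -nrmE cnorm_star nrmE rmorphXn. Qed.

Lemma cmul0r a : a ** 0 = 0.
Proof. by apply: (addrI (a ** 0)); rewrite -cmulDr !addr0. Qed.

Lemma cmul0l a : 0 ** a = 0.
Proof. by apply: (addrI (0 ** a)); rewrite -cmulDl !addr0. Qed.

Lemma cmulNr a b : a ** (- b) = - (a ** b).
Proof. by apply: (addrI (a ** b)); rewrite -cmulDr !subrr cmul0r. Qed.

Lemma cmulNl a b : (- a) ** b = - (a ** b).
Proof. by apply: (addrI (a ** b)); rewrite -cmulDl !subrr cmul0l. Qed.

Lemma cmulBr a b c : a ** (b - c) = a ** b - a ** c.
Proof. by rewrite cmulDr cmulNr. Qed.

Lemma cmulBl a b c : (a - b) ** c = a ** c - b ** c.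
Proof. by rewrite cmulDl cmulNl. Qed.

Lemma cstar0 : (0 : A)^*c = 0.
Proof. by apply: (addrI (0^*c)); rewrite -cstarD !addr0. Qed.

Lemma cstarN a : (- a)^*c = - a^*c.
Proof. by apply: (addrI (a^*c)); rewrite -cstarD !subrr cstar0. Qed.

Lemma cstarB a b : (a - b)^*c = a^*c - b^*c.
Proof. by rewrite cstarD cstarN. Qed.

Lemma cstarZr (r : R) a : (r%:C *: a)^*c = r%:C *: a^*c.
Proof. by rewrite cstarZ; congr (_ *: _); apply/eqP; rewrite eq_complex /= oppr0 !eqxx. Qed.

Lemma nrm_cstar_le a : nrm a <= nrm a^*c.
Proof.
have [->|a0] := eqVneq (nrm a) 0; first exact: nrm_ge0.
have a1 : 0 < nrm a by rewrite lt_neqAle eq_sym a0 nrm_ge0.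
by rewrite -(ler_pM2r a1) -expr2 -nrm_star_mul nrm_cmul.
Qed.

Lemma nrm_cstar a : nrm a^*c = nrm a.
Proof. by apply/eqP; rewrite eq_le nrm_cstar_le -{2}[a]cstarK nrm_cstar_le. Qed.

Lemma nrm_sa a : a^*c = a -> nrm (a ** a) = nrm a ^+ 2.
Proof. by move=> h; rewrite -{1}h nrm_star_mul. Qed.

Lemma aclosed_sa : aclosed (fun y : A => y^*c = y).
Proof.
move=> x hx; apply/eqP; rewrite -subr_eq0; apply/eqP/nrm_small => e e0.
have [y hy xy] := hx _ (divr_gt0 e0 (ltr0n R 2)).
rewrite -[_ - x](subrKA y) (le_trans (nrmD _ _))// (splitr e) lerD//.
  by rewrite -hy -cstarB nrm_cstar.
by rewrite nrmBC.
Qed.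

Lemma aclosed_comm z : aclosed (fun y : A => y ** z = z ** y).
Proof.
move=> x hx; apply/eqP; rewrite -subr_eq0; apply/eqP/nrm_small => e e0.
have M0 : 0 < nrm z * 2 + 1 by rewrite ltr_wpDl// mulr_ge0 ?nrm_ge0.
have [y hy xy] := hx _ (divr_gt0 e0 M0).
have -> : x ** z - z ** x = (x - y) ** z - z ** (x - y).
  by rewrite cmulBl cmulBr hy opprB addrA subrK.
rewrite (le_trans (nrmB _ _))//.
apply: (@le_trans _ _ (nrm (x - y) * (nrm z * 2 + 1))).
  rewrite (le_trans (lerD (nrm_cmul _ _) (nrm_cmul _ _)))//.
  by have := nrm_ge0 (x - y); have := nrm_ge0 z; nra.
by rewrite -ler_pdivlMr.
Qed.

(** The equation says (1-y)^2 = 1-c without mentioning a unit. It is the fixed-point equation y = (c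
    + y^2)/2, whose right side maps the ball of radius |c| to itself and has Lipschitz constant |c|
    there. *)
Lemma sqrt_exists c : c^*c = c -> nrm c < 1 ->
  exists y, [/\ y^*c = y, y + y - y ** y = c &
    forall z, c ** z = z ** c -> y ** z = z ** y].
Proof.
move=> cs c1; pose h : C := (2^-1 : R)%:C.
pose F y := h *: (c + y ** y).
have nh x : nrm (h *: x) = 2^-1 * nrm x by rewrite nrmZr ger0_norm.
have [|x xk|x y xk yk|y yF yP] := @contraction_fix R A F (nrm c).
- by rewrite nrm_ge0.
- rewrite nh mulrC ler_pdivrMr// (le_trans (nrmD _ _))//.
  rewrite mulrDr mulr1 lerD2l (le_trans (nrm_cmul _ _))//.
  by have := nrm_ge0 x; nra.
- rewrite -scalerBr nh opprD addrACA subrr add0r mulrC ler_pdivrMr//.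
  have -> : x ** x - y ** y = (x - y) ** x + y ** (x - y).
    by rewrite cmulBl cmulBr addrA subrK.
  rewrite (le_trans (nrmD _ _))// (le_trans (lerD (nrm_cmul _ _) (nrm_cmul _ _)))//.
  by have := nrm_ge0 (x - y); nra.
exists y; split.
- apply: (yP (fun y => y^*c = y)) => [||x xs]; [exact: aclosed_sa|exact: cstar0|].
  by rewrite cstarZr cstarD cs cstarM xs.
- have -> : y + y = c + y ** y; last by rewrite addrK.
  have h2 : 2^-1 + 2^-1 = 1 :> R by field.
  by rewrite {1 2}yF /F -scalerDl -rmorphD /= h2 scale1r.
- move=> z cz; apply: (yP (fun y => y ** z = z ** y)).
  + exact: aclosed_comm.
  + by rewrite cmul0l cmul0r.
  + by move=> x xz; rewrite cmulZl cmulZr cmulDl cmulDr cz -cmulA xz cmulA xz cmulA.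
Qed.

(** Formally, 1+b is the inverse of 1-c. *)
Lemma quasi_inverse c : nrm c < 1 -> exists b, [/\ b = c + c ** b,
  forall z, c ** z = z ** c -> b ** z = z ** b & c^*c = c -> b^*c = b].
Proof.
move=> c1; have l0 : 0 < 1 - nrm c by rewrite subr_gt0.
(* The factor 1-|c| makes y = l c + c y preserve the ball of radius |c|, as [contraction_fix]
   requires; it is divided out at the end. *)
pose l : C := (1 - nrm c)%:C.
have lV : l != 0 by apply: contraTneq l0 => /complexI ->; rewrite ltxx.
have nl x : nrm (l *: x) = (1 - nrm c) * nrm x by rewrite nrmZr gtr0_norm.
have [|x xk|x y xk yk|y yF yP] := @contraction_fix R A (fun y => l *: c + c ** y) (nrm c).
- by rewrite nrm_ge0.
- rewrite (le_trans (nrmD _ _))// nl.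
  have := nrm_cmul c x; have := nrm_ge0 c; nra.
- by rewrite opprD addrACA subrr add0r -cmulBr nrm_cmul.
have lC : c ** (l *: c) = (l *: c) ** c by rewrite cmulZr cmulZl.
exists (l^-1 *: y); split.
- by rewrite {1}yF scalerDr scalerK// cmulZr.
- move=> z cz; rewrite cmulZl cmulZr; congr (_ *: _).
  apply: (yP (fun y => y ** z = z ** y)).
  + exact: aclosed_comm.
  + by rewrite cmul0l cmul0r.
  + by move=> x xz; rewrite cmulDl cmulDr cmulZl cmulZr cz -cmulA xz cmulA cz cmulA.
- move=> cs; rewrite -fmorphV /= cstarZr; congr (_ *: _).
  suff [] : y^*c = y /\ y ** c = c ** y by [].
  split; last first.
    apply: (yP (fun y => y ** c = c ** y)).
    + exact: aclosed_comm.
    + by rewrite cmul0l cmul0r.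
    + by move=> x xz; rewrite cmulDl cmulDr lC -cmulA xz.
  (* Selfadjointness of c x needs x to commute with c, so both properties are carried along
     together. *)
  pose P (y : A) := y^*c = y /\ y ** c = c ** y.
  suff [] : P y by [].
  apply: yP => [x hx||x [xs xc]]; last 2 first.
  + by split; rewrite ?cstar0// cmul0l cmul0r.
  + split; first by rewrite cstarD cstarZr cstarM cs xs xc.
    by rewrite cmulDl cmulDr lC -cmulA xc.
  split; [apply: aclosed_sa|apply: aclosed_comm] => e e0.
    by have [z [? _] ?] := hx e e0; exists z.
  by have [z [_ ?] ?] := hx e e0; exists z.
Qed.

End CStarBasics.

(** * Sublinear functionals and positivity *)

Section ExtremePoint.
Variables (R : realType) (V : lmodType R[i]).
Implicit Types (f q : V -> R) (x y h : V).

Definition rlin f :=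
  (forall x y, f (x + y) = f x + f y) /\ (forall (t : R) x, f (t%:C *: x) = t * f x).

Variable p : V -> R.
Hypothesis pD : forall x y, p (x + y) <= p x + p y.
Hypothesis pZ : forall (t : R) x, 0 <= t -> p (t%:C *: x) = t * p x.

(* Extreme points are found by minimising, instead of linear functionals, the
   sublinear functionals whose set of linear minorants is a face. *)
Definition facial q := [/\ forall x y, q (x + y) <= q x + q y,
  forall (t : R) x, 0 <= t -> q (t%:C *: x) = t * q x, forall x, q x <= p x &
  forall f1 f2, rlin f1 -> rlin f2 -> (forall x, f1 x <= p x) -> (forall x, f2 x <= p x) ->
    (forall x, f1 x + f2 x <= 2 * q x) ->
    (forall x, f1 x <= q x) /\ (forall x, f2 x <= q x)].

Lemma facial_p : facial p.
Proof. by split. Qed.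

Lemma facial0 q : facial q -> q 0 = 0.
Proof. by move=> [_ qZ _ _]; rewrite -(scale0r 0) -[0 : R[i]]/((0 : R)%:C) qZ// mul0r. Qed.

Lemma facial_lb q x : facial q -> - p (- x) <= q x.
Proof.
move=> qf; have [qD qZ qp _] := qf.
rewrite lerNl -subr_ge0 opprK addrC -(facial0 qf) -(subrr x) (le_trans (qD _ _))//.
by rewrite lerD2l.
Qed.

(** For a sublinear q, the linear minorants of this functional are exactly the linear minorants f of
    q with f h = q h, that is, the face on which the value at h is maximal. *)
Definition tilt q h x := inf [set q (x + t%:C *: h) - t * q h | t in [set t : R | 0 <= t]].

Lemma tilt_inf q h x : facial q ->
  has_inf [set q (x + t%:C *: h) - t * q h | t in [set t : R | 0 <= t]].
Proof.
move=> qf; have [qD qZ qp _] := qf.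
split; first by exists (q (x + (0 : R)%:C *: h) - 0 * q h), 0 => /=.
exists (- q (- x)) => _ [t /= t0 <-].
have : q (t%:C *: h) <= q (x + t%:C *: h) + q (- x).
  by rewrite (le_trans _ (qD _ _))// addrAC subrr add0r.
by rewrite qZ//; lra.
Qed.

Lemma tilt_le q h x t : facial q -> 0 <= t -> tilt q h x <= q (x + t%:C *: h) - t * q h.
Proof. by move=> qf t0; apply: ge_inf; [case: (tilt_inf h x qf)|exists t]. Qed.

Lemma tilt_lt q h x v : facial q -> tilt q h x < v ->
  exists2 t : R, 0 <= t & q (x + t%:C *: h) - t * q h < v.
Proof. by move=> qf /(inf_lt (tilt_inf h x qf).1)[_ [t t0 <-]]; exists t. Qed.

Lemma tilt_le_q q h x : facial q -> tilt q h x <= q x.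
Proof. by move=> qf; rewrite (le_trans (tilt_le h x qf (lexx 0)))// mul0r subr0 scale0r addr0. Qed.

Lemma tilt_N q h : facial q -> tilt q h (- h) <= - q h.
Proof.
move=> qf; rewrite (le_trans (tilt_le h _ qf ler01))// scale1r addNr (facial0 qf); lra.
Qed.

Lemma facial_tilt q h : facial q -> facial (tilt q h).
Proof.
move=> qf; have [qD qZ qp qF] := qf.
have tZ (t : R) x : 0 < t -> tilt q h (t%:C *: x) <= t * tilt q h x.
  move=> t0; apply/ler_addgt0Pl => d d0.
  have [|s s0 hs] := @tilt_lt q h x (tilt q h x + d / t) qf; first by rewrite ltrDl divr_gt0.
  have ts0 : 0 <= t * s by rewrite mulr_ge0// ltW.
  apply: le_trans (tilt_le h _ qf ts0) _.
  have -> : t%:C *: x + (t * s)%:C *: h = t%:C *: (x + s%:C *: h).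
    by rewrite scalerDr scalerA -rmorphM.
  rewrite qZ ?(ltW t0)//.
  have -> : d + t * tilt q h x = t * (tilt q h x + d / t) by field; rewrite gt_eqF.
  by rewrite -mulrA -mulrBr ler_pM2l// ltW.
split.
- move=> x y; apply/ler_addgt0Pl => d d0; have d2 : 0 < d / 2 by rewrite divr_gt0.
  have [|t t0 ht] := @tilt_lt q h x (tilt q h x + d / 2) qf; first by rewrite ltrDl.
  have [|s s0 hs] := @tilt_lt q h y (tilt q h y + d / 2) qf; first by rewrite ltrDl.
  apply: le_trans (tilt_le h _ qf (addr_ge0 t0 s0)) _.
  have -> : x + y + (t + s)%:C *: h = (x + t%:C *: h) + (y + s%:C *: h).
    by rewrite rmorphD scalerDl addrACA.
  by have := qD (x + t%:C *: h) (y + s%:C *: h); lra.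
- move=> t x; rewrite le_eqVlt => /predU1P[<-|t0].
    rewrite mul0r scale0r; apply/eqP; rewrite eq_le; apply/andP; split.
      by rewrite -(facial0 qf) tilt_le_q.
    apply: lb_le_inf; first by case: (tilt_inf h 0 qf).
    by move=> _ [s /= s0 <-]; rewrite add0r qZ// subrr.
  apply/eqP; rewrite eq_le tZ//= -ler_pdivlMl//.
  have tn : t != 0 by rewrite gt_eqF.
  have {1}-> : x = t^-1%:C *: (t%:C *: x) by rewrite scalerA -rmorphM mulVf// scale1r.
  by rewrite tZ ?invr_gt0.
- by move=> x; rewrite (le_trans (tilt_le_q h x qf)).
- move=> f1 f2 l1 l2 p1 p2 h12.
  have [q1 q2] := qF _ _ l1 l2 p1 p2 (fun x => le_trans (h12 x) (ler_wpM2l (ler0n R 2) (tilt_le_q h x qf))).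
  have N f : rlin f -> f (- h) = - f h.
    by move=> [_ fZ]; rewrite -scaleN1r -[-1 : R[i]]/(- (1 : R)%:C) -rmorphN fZ mulN1r.
  (* At -h the hypothesis reads f1 h + f2 h >= 2 q h, while each of the two values is at most q
     h. *)
  have e12 : f1 h = q h /\ f2 h = q h.
    have := h12 (- h); rewrite (N _ l1) (N _ l2); have := tilt_N h qf; have := q1 h; have := q2 h.
    by move=> *; split; apply: le_anti; apply/andP; split; lra.
  have fin f : rlin f -> (forall x, f x <= q x) -> f h = q h -> forall x, f x <= tilt q h x.
    move=> [fD fZ] fq fh x; apply: lb_le_inf; first by case: (tilt_inf h x qf).
    move=> _ [t /= t0 <-]; have := fq (x + t%:C *: h); rewrite fD fZ fh; lra.
  by split; apply: fin => //; case: e12.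
Qed.

(** A minimal facial functional q is linear, because tilting it in a direction k cannot lower it and
    hence q(-k) = -q k. For a linear q the facial property is extremality. Starting below [tilt p h]
    forces the value p h at h. *)
Lemma extreme_point h : exists f, [/\ rlin f, forall x, f x <= p x, f h = p h &
  forall f1 f2, rlin f1 -> rlin f2 -> (forall x, f1 x <= p x) -> (forall x, f2 x <= p x) ->
    (forall x, f1 x + f2 x = 2 * f x) -> forall x, f1 x = f x].
Proof.
pose T := {q : V -> R | facial q /\ forall x, q x <= tilt p h x}.
(* The order is reversed: a maximal element for r is a minimal functional. *)
pose r (s t : T) := `[< forall x, sval t x <= sval s x >].
have [||t st|X totX|[q [qf qh]] qmax] := @ZL_preorder T _ r.
- by exists (tilt p h); split => //; exact/facial_tilt/facial_p.
- by move=> t; apply/asboolP.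
- by move=> s /asboolP h1 /asboolP h2; apply/asboolP => x; exact: le_trans (h2 x) (h1 x).
(* A chain is bounded by its pointwise infimum, which is finite by [facial_lb]; the empty chain is
   bounded by [tilt p h]. *)
- have [[b0 Xb0]|X0] := pselect (exists t, X t); last first.
    exists (exist _ (tilt p h) (conj (facial_tilt h facial_p) (fun=> lexx _))) => s Xs.
    by case: X0; exists s.
  pose E x := [set sval t x | t in X].
  have Einf x : has_inf (E x).
    split; first by exists (sval b0 x), b0.
    by exists (- p (- x)) => _ [t Xt <-]; apply: facial_lb; case: (svalP t).
  pose q x := inf (E x).
  have ql x t : X t -> q x <= sval t x.
    by move=> Xt; apply: ge_inf; [case: (Einf x)|exists t].
  have qlt x v : q x < v -> exists2 t, X t & sval t x < v.
    by move=> /(inf_lt (Einf x).1)[_ [t Xt <-]]; exists t.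
  have qge x v : (forall t, X t -> v <= sval t x) -> v <= q x.
    by move=> hv; apply: lb_le_inf; [case: (Einf x)|move=> _ [t Xt <-]; exact: hv].
  have qf : facial q.
    split.
    + move=> x y; apply/ler_addgt0Pl => d d0; have d2 : 0 < d / 2 by rewrite divr_gt0.
      have [|t Xt ht] := @qlt x (q x + d / 2); first by rewrite ltrDl.
      have [|s Xs hs] := @qlt y (q y + d / 2); first by rewrite ltrDl.
      have [u [Xu ux uy]] : exists u, [/\ X u, sval u x <= sval t x & sval u y <= sval s y].
        by have [/asboolP ts|/asboolP ts] := totX _ _ Xt Xs; [exists s|exists t].
      rewrite (le_trans (ql _ _ Xu))//; have [[uD _ _ _] _] := svalP u.
      by have := uD x y; lra.
    + move=> t x t0; apply/eqP; rewrite eq_le; apply/andP; split.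
        apply/ler_addgt0Pl => d d0.
        have t1 : 0 < t + 1 by rewrite ltr_wpDl.
        have [|s Xs hs] := @qlt x (q x + d / (t + 1)); first by rewrite ltrDl divr_gt0.
        have [[_ sZ _ _] _] := svalP s.
        rewrite (le_trans (ql _ _ Xs))// sZ//.
        apply: le_trans (ler_wpM2l t0 (ltW hs)) _.
        rewrite mulrDr addrC lerD2r mulrCA ler_piMr ?(ltW d0)//.
        by rewrite ler_pdivrMr// mul1r lerDl.
      apply: qge => s Xs; have [[_ sZ _ _] _] := svalP s.
      by rewrite sZ// ler_wpM2l// ql.
    + by move=> x; rewrite (le_trans (ql _ _ Xb0))//; have [[_ _ ? _] _] := svalP b0.
    + move=> f1 f2 l1 l2 p1 p2 h12.
      have F s : X s -> (forall x, f1 x <= sval s x) /\ (forall x, f2 x <= sval s x).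
        move=> Xs; have [[_ _ _ sF] _] := svalP s; apply: sF => // x.
        by rewrite (le_trans (h12 x))// ler_wpM2l// ql.
      by split => x; apply: qge => s /F[].
  have qh : forall x, q x <= tilt p h x.
    by move=> x; rewrite (le_trans (ql _ _ Xb0))//; have [_] := svalP b0.
  by exists (exist _ q (conj qf qh)) => s Xs; apply/asboolP => x /=; exact: ql.
have [qD qZ qp qF] := qf.
have qN k : q (- k) = - q k.
  have tf := facial_tilt k qf.
  have th x : tilt q k x <= tilt p h x by rewrite (le_trans (tilt_le_q k x qf)).
  have /(_ _)/asboolP := qmax (exist _ (tilt q k) (conj tf th)).
  move=> /= tq; apply/eqP; rewrite eq_le; apply/andP; split.
    rewrite (le_trans _ (tilt_N k qf))//; apply: tq.
    by apply/asboolP => x /=; exact: tilt_le_q.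
  by rewrite lerNl -subr_ge0 opprK -(facial0 qf) -(subrr k) qD.
have ql : rlin q.
  split.
    move=> x y; apply: le_anti; rewrite qD/=.
    have := qD (x + y) (- y); rewrite addrK qN; lra.
  move=> t x; have [t0|t0] := leP 0 t; first exact: qZ.
  rewrite -[t]opprK rmorphN scaleNr qN qZ ?oppr_ge0 ?(ltW t0)//; lra.
exists q; split => //.
  have := le_trans (qh (- h)) (tilt_N h facial_p); rewrite qN.
  by have := qp h; move=> *; apply: le_anti; apply/andP; split; lra.
move=> f1 f2 l1 l2 p1 p2 h12.
have h12' x : f1 x + f2 x <= 2 * q x by rewrite h12.
have [q1 q2] := qF _ _ l1 l2 p1 p2 h12'.
move=> x; have := h12 x; have := q1 x; have := q2 x.
by move=> *; apply: le_anti; apply/andP; split; lra.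
Qed.

End ExtremePoint.

(** * The top of the spectrum and the positivity of x* x *)

Section Unital.
Variables (R : realType) (U : cStarAlgType R) (e : U).
Local Notation C := R[i].
Implicit Types a b c h k x y z : U.
Local Notation "x ** y" := (cmul x y) (at level 40, left associativity).
Local Notation "x ^*c" := (cstar x) (at level 2, format "x ^*c").
Hypothesis cmul1 : forall x, e ** x = x.
Hypothesis cmulr1 : forall x, x ** e = x.
Hypothesis nrm1 : nrm e = 1.

Definition rsc (t : R) x : U := t%:C *: x.
Local Notation "t *r x" := (rsc t x) (at level 40).

Lemma rscDr t x y : t *r (x + y) = t *r x + t *r y.
Proof. exact: scalerDr. Qed.
Lemma rscBr t x y : t *r (x - y) = t *r x - t *r y.
Proof. exact: scalerBr. Qed.
Lemma rscN t x : t *r (- x) = - (t *r x).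
Proof. exact: scalerN. Qed.
Lemma rscNl t x : (- t) *r x = - (t *r x).
Proof. by rewrite /rsc rmorphN scaleNr. Qed.
Lemma rscDl s t x : (s + t) *r x = s *r x + t *r x.
Proof. by rewrite /rsc rmorphD scalerDl. Qed.
Lemma rscA s t x : s *r (t *r x) = (s * t) *r x.
Proof. by rewrite /rsc scalerA -rmorphM. Qed.
Lemma rsc1 x : 1 *r x = x.
Proof. exact: scale1r. Qed.
Lemma rsc0 x : 0 *r x = 0.
Proof. exact: scale0r. Qed.
Lemma cmul_rscl t x y : (t *r x) ** y = t *r (x ** y).
Proof. exact: cmulZl. Qed.
Lemma cmul_rscr t x y : x ** (t *r y) = t *r (x ** y).
Proof. exact: cmulZr. Qed.
Lemma cstar_rsc t x : (t *r x)^*c = t *r x^*c.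
Proof. exact: cstarZr. Qed.
Lemma nrm_rsc t x : nrm (t *r x) = `|t| * nrm x.
Proof. exact: nrmZr. Qed.

Definition rscE := (rscDr, rscBr, rscN, cmul_rscl, cmul_rscr, @cmulDl R U, @cmulDr R U,
  @cmulBl R U, @cmulBr R U, @cmulNl R U, @cmulNr R U, rscA, cmul1, cmulr1, @cmulA R U).

Lemma cstar1 : e^*c = e.
Proof. by rewrite -[RHS]cstarK -[in RHS](cmulr1 e^*c) cstarM cstarK cmulr1. Qed.

Definition cre x : U := 2^-1 *r (x + x^*c).

Lemma cre_sa x : (cre x)^*c = cre x.
Proof. by rewrite /cre cstar_rsc cstarD cstarK addrC. Qed.

Lemma sa_cre x : x^*c = x -> cre x = x.
Proof.
by move=> xs; rewrite /cre xs -{1 2}[x]rsc1 -rscDl rscA -[RHS]rsc1; congr (_ *r _); field.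
Qed.

Lemma creD x y : cre (x + y) = cre x + cre y.
Proof. by rewrite /cre cstarD -rscDr addrACA. Qed.

Lemma cre_rsc t x : cre (t *r x) = t *r cre x.
Proof. by rewrite /cre cstar_rsc -rscDr !rscA mulrC. Qed.

Lemma nrm_cre x : nrm (cre x) <= nrm x.
Proof.
rewrite nrm_rsc ger0_norm// mulrC ler_pdivrMr// (le_trans (nrmD _ _))//.
by rewrite nrm_cstar mulrDr mulr1.
Qed.

Definition cim x : U := cre (- 'i%C *: x).

Lemma cre_cim x : x = cre x + 'i%C *: cim x.
Proof.
rewrite /cim /cre /rsc cstarZ.
have -> : (- 'i%C)^*%R = 'i%C :> C by apply/eqP; rewrite eq_complex /= oppr0 opprK !eqxx.
rewrite !scalerDr !scalerA.
have -> : 'i%C * (2^-1 : R)%:C * - 'i%C = (2^-1 : R)%:C :> C.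
  by apply/eqP; rewrite eq_complex /=; apply/andP; split; apply/eqP; ring.
have -> : 'i%C * (2^-1 : R)%:C * 'i%C = - (2^-1 : R)%:C :> C.
  by apply/eqP; rewrite eq_complex /=; apply/andP; split; apply/eqP; ring.
rewrite addrACA scaleNr subrr addr0 -scalerDl -rmorphD /=.
have -> : 2^-1 + 2^-1 = 1 :> R by field.
by rewrite scale1r.
Qed.

(* lamp x is the largest spectral value of the real part of x. *)
Definition lampset x : set R := [set nrm (t *r e + cre x) - t | t in [set t | 0 <= t]].
Definition lamp x : R := inf (lampset x).

Lemma lampset_inf x : has_inf (lampset x).
Proof.
split; first by exists (nrm (0 *r e + cre x) - 0), 0 => /=.
exists (- nrm (cre x)) => _ [t /= t0 <-].
have : nrm (t *r e) <= nrm (t *r e + cre x) + nrm (cre x).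
  by rewrite -{1}[t *r e](addrK (cre x)) nrmB.
by rewrite nrm_rsc ger0_norm// nrm1 mulr1; lra.
Qed.

Lemma lamp_le x t v : 0 <= t -> nrm (t *r e + cre x) <= t + v -> lamp x <= v.
Proof.
move=> t0 h; apply: le_trans (_ : nrm (t *r e + cre x) - t <= v); last by rewrite lerBlDl.
by apply: ge_inf; [case: (lampset_inf x)|exists t].
Qed.

Lemma lamp_lt x v : lamp x < v -> exists2 t, 0 <= t & nrm (t *r e + cre x) < t + v.
Proof.
move=> /(inf_lt (lampset_inf x).1)[_ [t t0 <-]]; rewrite ltrBlDl => h.
by exists t.
Qed.

Lemma lamp_nrm x : lamp x <= nrm x.
Proof. by apply: (@lamp_le _ 0) => //; rewrite rsc0 !add0r nrm_cre. Qed.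

Lemma lampD x y : lamp (x + y) <= lamp x + lamp y.
Proof.
apply/ler_addgt0Pl => d d0.
have d2 : 0 < d / 2 by rewrite divr_gt0.
have [t t0 ht] : exists2 t, 0 <= t & nrm (t *r e + cre x) < t + (lamp x + d / 2).
  by apply: lamp_lt; rewrite ltrDl.
have [s s0 hs] : exists2 t, 0 <= t & nrm (t *r e + cre y) < t + (lamp y + d / 2).
  by apply: lamp_lt; rewrite ltrDl.
apply: (@lamp_le _ (t + s)); first exact: addr_ge0.
by rewrite creD rscDl addrACA (le_trans (nrmD _ _))//; lra.
Qed.

Lemma lamp_rsc_le (c : R) x : 0 < c -> lamp (c *r x) <= c * lamp x.
Proof.
move=> c0; apply/ler_addgt0Pl => d d0.
have dc : 0 < d / c by rewrite divr_gt0.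
have [t t0 ht] : exists2 t, 0 <= t & nrm (t *r e + cre x) < t + (lamp x + d / c).
  by apply: lamp_lt; rewrite ltrDl.
apply: (@lamp_le _ (c * t)); first by rewrite mulr_ge0// ltW.
rewrite cre_rsc -rscA -rscDr nrm_rsc gtr0_norm//.
have -> : c * t + (d + c * lamp x) = c * (t + (lamp x + d / c)) by field; rewrite gt_eqF.
by rewrite ler_pM2l// ltW.
Qed.

Lemma lamp0 : lamp 0 = 0.
Proof.
apply/eqP; rewrite eq_le; apply/andP; split.
  by rewrite (le_trans (lamp_nrm _))// nrm0.
apply: lb_le_inf; first by case: (lampset_inf 0).
by move=> _ [t /= t0 <-]; rewrite -(rsc0 0) cre_rsc rsc0 addr0 nrm_rsc nrm1 mulr1 ger0_norm// subrr.
Qed.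

Lemma lamp_rsc (c : R) x : 0 <= c -> lamp (c *r x) = c * lamp x.
Proof.
rewrite le_eqVlt => /predU1P[<-|c0]; first by rewrite rsc0 mul0r lamp0.
apply/eqP; rewrite eq_le lamp_rsc_le//= -ler_pdivlMl//.
rewrite -{1}[x]rsc1 -(mulVf (lt0r_neq0 c0)) -rscA lamp_rsc_le// invr_gt0//.
Qed.

(** Here h = t (1-c) with |c| < 1, so the square root of 1-c given by [sqrt_exists] is scaled by the
    square root of t. *)
Lemma spos_sqrt h t : h^*c = h -> 0 < t -> nrm (t *r e - h) < t ->
  exists r, [/\ r^*c = r, r ** r = h & forall z, h ** z = z ** h -> r ** z = z ** r].
Proof.
move=> hs t0 ht; have tV : t != 0 by rewrite gt_eqF.
pose c := e - t^-1 *r h.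
have cs : c^*c = c by rewrite /c cstarB cstar_rsc cstar1 hs.
have c1 : nrm c < 1.
  have -> : c = t^-1 *r (t *r e - h) by rewrite rscBr rscA mulVf// rsc1.
  by rewrite nrm_rsc gtr0_norm ?invr_gt0// mulrC ltr_pdivrMr// mul1r.
have [y [ys yc yP]] := sqrt_exists cs c1.
have cz z : h ** z = z ** h -> c ** z = z ** c.
  by move=> hz; rewrite /c !rscE hz.
pose q := Num.sqrt t.
have qq : q * q = t by rewrite -expr2 sqr_sqrtr// ltW.
exists (q *r (e - y)); split.
- by rewrite cstar_rsc cstarB cstar1 ys.
- rewrite cmul_rscl cmul_rscr rscA qq.
  have -> : (e - y) ** (e - y) = e - c.
    by rewrite -yc !rscE; lmod R U.
  by rewrite /c subKr rscA divff// rsc1.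
- by move=> z /cz/yP hz; rewrite !rscE hz.
Qed.

Lemma spos_inv h t : h^*c = h -> 0 < t -> nrm (t *r e - h) < t ->
  exists q, [/\ q^*c = q, h ** q = e, q ** h = e & forall z, h ** z = z ** h -> q ** z = z ** q].
Proof.
move=> hs t0 ht; have tV : t != 0 by rewrite gt_eqF.
pose c := e - t^-1 *r h.
have cs : c^*c = c by rewrite /c cstarB cstar_rsc cstar1 hs.
have c1 : nrm c < 1.
  have -> : c = t^-1 *r (t *r e - h) by rewrite rscBr rscA mulVf// rsc1.
  by rewrite nrm_rsc gtr0_norm ?invr_gt0// mulrC ltr_pdivrMr// mul1r.
have [b [bc bP bs]] := quasi_inverse c1.
have cz z : h ** z = z ** h -> c ** z = z ** c.
  by move=> hz; rewrite /c !rscE hz.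
have hE : h = t *r (e - c) by rewrite /c subKr rscA divff// rsc1.
have hq : h ** (t^-1 *r (e + b)) = e.
  rewrite hE cmul_rscl cmul_rscr rscA divff// rsc1 cmulBl cmul1 cmulDr cmulr1 -bc addrK//.
have qP z : h ** z = z ** h -> (t^-1 *r (e + b)) ** z = z ** (t^-1 *r (e + b)).
  by move=> /cz/bP hz; rewrite !rscE hz.
exists (t^-1 *r (e + b)); split => //; last by rewrite qP.
by rewrite cstar_rsc cstarD cstar1 bs.
Qed.

(* [w = t - s^2 + i theta s] with [theta^2 = 2 t] satisfies [w^* w = t^2 + s^4]. *)
Lemma lamp_Nsqr s : s^*c = s -> lamp (- (s ** s)) <= 0.
Proof.
move=> ss; pose M := nrm s; apply/ler_addgt0Pl => d d0; rewrite addr0.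
have M0 : 0 <= M by exact: nrm_ge0.
(* Chosen so that t^2 + M^4 <= (t + d)^2, which bounds |w| by t + d; the summand 1 keeps t positive
   when M = 0. *)
pose t := M ^+ 4 / d + 1.
have t1 : 1 <= t by rewrite lerDr divr_ge0 ?exprn_ge0// ltW.
have t0 : 0 < t by rewrite (lt_le_trans ltr01).
pose th := Num.sqrt (2 * t).
have thth : th * th = 2 * t by rewrite -expr2 sqr_sqrtr// mulr_ge0// ltW.
pose i : C := 0 +i* 1.
have ii : i * i = - 1 by apply/eqP; rewrite eq_complex /=; apply/andP; split; apply/eqP; ring.
have ic : i^*%R = - i by apply/eqP; rewrite eq_complex /= oppr0 !eqxx.
pose g := t *r e - s ** s.
have gs : g^*c = g by rewrite /g cstarB cstar_rsc cstar1 cstarM ss.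
pose w := g + i *: (th *r s).
have ws : w^*c = g - i *: (th *r s).
  by rewrite /w cstarD gs cstarZ cstar_rsc ss ic scaleNr.
have ww : w^*c ** w = (t * t) *r e + (s ** s) ** (s ** s).
  have th2 : th%:C * th%:C = 2 * t%:C :> C by rewrite -rmorphM thth rmorphM rmorph_nat.
  rewrite ws /w /g /rsc !(cmulBl, cmulDl, cmulBr, cmulDr, cmulZl, cmulZr, cmulNl, cmulNr).
  rewrite ?cmul1 ?cmulr1 ?cmulA; lmod R U.
  transitivity (- (2 * t%:C) - (i * i) * (th%:C * th%:C)); first by ring.
  by rewrite ii th2; ring.
have nw : nrm w <= t + d.
  have : nrm w ^+ 2 <= (t + d) ^+ 2.
    rewrite -nrm_star_mul ww (le_trans (nrmD _ _))// nrm_rsc nrm1 mulr1 ger0_norm ?mulr_ge0 ?(ltW t0)//.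
    apply: (@le_trans _ _ (t * t + M ^+ 4)).
      rewrite lerD2l (le_trans (nrm_cmul _ _))// -[M ^+ 4]/(M * (M * (M * M))) mulrA.
      by rewrite ler_pM ?nrm_ge0 ?nrm_cmul// -/M.
    have : M ^+ 4 <= t * d by rewrite /t mulrDl divfK ?gt_eqF// mul1r lerDl ltW.
    nra.
  by rewrite ler_pXn2r// nnegrE ?nrm_ge0// addr_ge0// ltW.
apply: (@lamp_le _ t); first exact: ltW.
have -> : t *r e + cre (- (s ** s)) = cre w.
  rewrite sa_cre ?cstarN ?cstarM ?ss// /w creD (sa_cre gs).
  have -> : cre (i *: (th *r s)) = 0.
    by rewrite /cre cstarZ ic cstar_rsc ss scaleNr subrr /rsc scaler0.
  by rewrite addr0.
by rewrite (le_trans (nrm_cre _)).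
Qed.

(** If |t + h| < t + v, then v - h lies within less than t + v of the scalar t + v, which is the
    hypothesis of [spos_sqrt]. *)
Lemma lamp_lt_sqrt h v : h^*c = h -> lamp h < v ->
  exists r, [/\ r^*c = r, r ** r = v *r e - h & forall z, h ** z = z ** h -> r ** z = z ** r].
Proof.
move=> hs /lamp_lt[t t0 ht]; rewrite sa_cre// in ht.
have tv0 : 0 < t + v by apply: le_lt_trans ht; exact: nrm_ge0.
have [||r [rs rr rP]] := @spos_sqrt (v *r e - h) (t + v) _ tv0.
- by rewrite cstarB cstar_rsc cstar1 hs.
- by rewrite rscDl opprB addrA addrAC addrK.
- exists r; split => // z hz; apply: rP.
  by rewrite !rscE hz.
Qed.

Lemma lamp_lt_inv h v : h^*c = h -> lamp h < v ->
  exists q, [/\ q^*c = q, (v *r e - h) ** q = e, q ** (v *r e - h) = e &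
    forall z, h ** z = z ** h -> q ** z = z ** q].
Proof.
move=> hs /lamp_lt[t t0 ht]; rewrite sa_cre// in ht.
have tv0 : 0 < t + v by apply: le_lt_trans ht; exact: nrm_ge0.
have [||q [qs hq qh qP]] := @spos_inv (v *r e - h) (t + v) _ tv0.
- by rewrite cstarB cstar_rsc cstar1 hs.
- by rewrite rscDl opprB addrA addrAC addrK.
- exists q; split => // z hz; apply: qP.
  by rewrite !rscE hz.
Qed.

(* If [v - s^2 = r^2] with [r] selfadjoint commuting with [s], then [(s + i r)^* (s + i r) = v]. *)
Lemma nrm_sqr_lamp s : s^*c = s -> nrm s ^+ 2 <= lamp (s ** s).
Proof.
move=> ss; apply/ler_addgt0Pl => d d0; set v := d + _.
have ssa : (s ** s)^*c = s ** s by rewrite cstarM ss.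
have [|r [rs rr rP]] := @lamp_lt_sqrt (s ** s) v ssa; first by rewrite ltrDr.
have rsC : r ** s = s ** r by apply: rP; rewrite cmulA.
pose i : C := 0 +i* 1.
have ii : i * i = - 1 by apply/eqP; rewrite eq_complex /=; apply/andP; split; apply/eqP; ring.
have ic : i^*%R = - i by apply/eqP; rewrite eq_complex /= oppr0 !eqxx.
pose w := s + i *: r.
have ws : w^*c = s - i *: r by rewrite /w cstarD ss cstarZ rs ic scaleNr.
have ww : w^*c ** w = v *r e.
  rewrite ws /w !(cmulBl, cmulDr, cmulZl, cmulZr) rsC.
  transitivity (s ** s - (i * i) *: (r ** r)); first by lmod R U.
  by rewrite ii rr /rsc; lmod R U.
have -> : s = cre w.
  rewrite /w creD (sa_cre ss).
  have -> : cre (i *: r) = 0.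
    by rewrite /cre cstarZ ic rs scaleNr subrr /rsc scaler0.
  by rewrite addr0.
have v0 : 0 <= v.
  rewrite addr_ge0 ?(ltW d0)// -[leLHS]lamp0 -(subrr (s ** s)).
  by rewrite (le_trans (lampD _ _))// gerDl lamp_Nsqr.
have <- : nrm (v *r e) = v by rewrite nrm_rsc nrm1 mulr1 ger0_norm.
by rewrite -ww nrm_star_mul lerXn2r ?nnegrE ?nrm_ge0 ?nrm_cre.
Qed.

(** Bernoulli's inequality: if X = (1+d) W with d > 0, the powers (1+d)^(2^n) outgrow the constant
    c. It takes the place of the spectral radius formula. *)
Lemma root_bound (X W c : R) : 0 <= W -> (forall n, X ^+ (2 ^ n) <= c * W ^+ (2 ^ n)) -> X <= W.
Proof.
rewrite le_eqVlt => /predU1P[<-|W0] h.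
  have := h 1%N; rewrite expn1 expr0n mulr0 => X0.
  have : X ^+ 2 = 0 by apply/eqP; rewrite eq_le X0 sqr_ge0.
  by move/eqP; rewrite sqrf_eq0 => /eqP ->.
rewrite leNgt; apply/negP => WX.
pose d := X / W - 1.
have d0 : 0 < d by rewrite subr_gt0 ltr_pdivlMr// mul1r.
have hd n : 1 + d *+ 2 ^ n <= c.
  apply: (@le_trans _ _ ((X / W) ^+ (2 ^ n))); last by rewrite exprMn exprVn ler_pdivrMr ?exprn_gt0.
  have -> : X / W = 1 + d by rewrite /d addrC subrK.
  elim: (2 ^ n)%N => [|k ih]; first by rewrite mulr0n addr0 expr0.
  rewrite exprS mulrS; have : 0 <= d *+ k by rewrite mulrn_wge0// ltW.
  by move: (d *+ k) ((1 + d) ^+ k) ih => u v; nra.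
have [n hn] : exists n, c < d *+ n.
  exists (Num.truncn (c / d)).+1; rewrite -mulr_natr mulrC -ltr_pdivrMr//.
  by rewrite truncnS_gt// divr_ge0 ?(ltW d0)// (le_trans _ (hd 0%N))// addr_ge0// mulrn_wge0// ltW.
have := hd n; apply/negP; rewrite -ltNge (lt_le_trans hn)//.
rewrite (@le_trans _ _ (d *+ 2 ^ n)) ?lerDr//.
by rewrite ler_wpMn2l ?(ltW d0)// ltnW// ltn_expl.
Qed.

Definition csq n x := iter n (fun x => x ** x) x.

Lemma csq_sa n x : x^*c = x -> (csq n x)^*c = csq n x /\ nrm (csq n x) = nrm x ^+ (2 ^ n).
Proof.
move=> xs; elim: n => [|n [h1 h2]]; first by rewrite expn0 expr1.
by split; rewrite /= -/(csq n x) ?cstarM ?h1// nrm_sa// h2 -exprM mulnC -expnS.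
Qed.

(** The elements x y and y x have the same spectral radius, which for a selfadjoint element is its
    norm. *)
Lemma nrm_swap x y : (x ** y)^*c = x ** y -> (y ** x)^*c = y ** x -> nrm (x ** y) <= nrm (y ** x).
Proof.
(* W n is (y x)^(2^n - 1), so (x y)^(2^n) = x (W n) y. *)
move=> xy yx; pose W n := iter n (fun w => w ** (y ** x) ** w) e.
have hW n : csq n (x ** y) = x ** W n ** y.
  elim: n => [|n ih]; first by rewrite /= cmulr1.
  by rewrite /= -/(csq n _) ih !cmulA.
have nW n : nrm (W n) * nrm (y ** x) <= nrm (y ** x) ^+ (2 ^ n).
  elim: n => [|n ih]; first by rewrite /= nrm1 mul1r expn0 expr1.
  rewrite expnSr exprM expr2 /= -/(W n).
  apply: le_trans (_ : nrm (W n) * nrm (y ** x) * nrm (W n) * nrm (y ** x) <= _).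
    rewrite ler_wpM2r ?nrm_ge0// (le_trans (nrm_cmul _ _))// ler_wpM2r ?nrm_ge0//.
    exact: nrm_cmul.
  by rewrite -mulrA ler_pM// mulr_ge0 ?nrm_ge0.
have [yx0|yx0] := eqVneq (nrm (y ** x)) 0.
  have : csq 1 (x ** y) = 0.
    by rewrite hW /= cmul1 cmulr1 (nrm_eq0 yx0) cmul0r cmul0l.
  have [_] := csq_sa 1 xy => /[swap] ->; rewrite nrm0 => /esym/eqP.
  by rewrite expf_eq0 /= => /eqP ->; exact: nrm_ge0.
have yx1 : 0 < nrm (y ** x) by rewrite lt_neqAle eq_sym yx0 nrm_ge0.
apply: (@root_bound _ _ (nrm x * nrm y / nrm (y ** x))); first exact: nrm_ge0.
move=> n; have [_ <-] := csq_sa n xy; rewrite hW.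
rewrite mulrAC ler_pdivlMr//.
apply: le_trans (_ : nrm x * nrm (W n) * nrm y * nrm (y ** x) <= _).
  rewrite ler_wpM2r ?nrm_ge0// (le_trans (nrm_cmul _ _))// ler_wpM2r ?nrm_ge0//.
  exact: nrm_cmul.
rewrite -!mulrA ler_wpM2l ?nrm_ge0// mulrCA ler_wpM2l ?nrm_ge0//.
Qed.

(** The spectra of y y* and y* y agree away from 0, whence the maximum with 0. The powers of t + y
    y* and of t + y* y are compared by [nrm_swap], up to a constant factor that [root_bound]
    absorbs. *)
Lemma lamp_swap y : lamp (y ** y^*c) <= Num.max 0 (lamp (y^*c ** y)).
Proof.
move hE : (y^*c ** y) => h; move kE : (y ** y^*c) => k.
apply/ler_addgt0Pl => d d0; set v := d + _.
have hs : h^*c = h by rewrite -hE cstarM cstarK.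
have ks : k^*c = k by rewrite -kE cstarM cstarK.
have [t t0 ht] : exists2 t, 0 <= t & nrm (t *r e + cre h) < t + v.
  by apply: lamp_lt; rewrite (@le_lt_trans _ _ (Num.max 0 (lamp h)))// ?le_max ?lexx ?orbT// ltrDr.
have v0 : 0 < v by rewrite ltr_pwDl// le_max lexx.
apply: (@lamp_le _ t) => //; rewrite (sa_cre ks); rewrite (sa_cre hs) in ht.
(* The factor 3 pays for t^(2^n) in the expansion of the power of x, for the same term in the
   estimate of r h, and for the power of x'. *)
apply: (@root_bound _ _ 3); first by rewrite addr_ge0// ltW.
move=> n; set x := _ + k; set x' := _ + h in ht.
have xs : x^*c = x by rewrite cstarD cstar_rsc cstar1 ks.
have xs' : x'^*c = x' by rewrite cstarD cstar_rsc cstar1 hs.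
have [sx <-] := csq_sa n xs.
have [sx' nx'] := csq_sa n xs'.
have [r [rs rh h1 h2]] : exists r, [/\ r^*c = r, r ** h = h ** r,
   csq n x = (t ^+ (2 ^ n)) *r e + y ** r ** y^*c & csq n x' = (t ^+ (2 ^ n)) *r e + r ** h].
  elim: n {sx sx' nx'} => [|n [r [rs rh h1 h2]]].
    by exists e; rewrite cstar1 cmul1 !cmulr1 expn0 expr1 kE.
  set T := t ^+ _ in h1 h2.
  (* This is 2 T r + r h r, which comes from squaring T + y r y*. *)
  exists (T *r r + T *r r + r ** h ** r).
  rewrite expnSr exprM expr2 -/T; split.
  - by rewrite !cstarD !cstar_rsc rs cstarM (cstarM r) hs rs cmulA.
  - by rewrite !rscE rh -!cmulA rh.
  - rewrite /= -/(csq n x) h1 !rscE /rsc.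
    have -> : y ** r ** y^*c ** y ** r ** y^*c = y ** r ** h ** r ** y^*c by rewrite -hE !cmulA.
    by lmod R U.
  - rewrite /= -/(csq n x') h2 !rscE /rsc.
    by lmod R U.
have n1 : nrm (y ** r ** y^*c) <= nrm (r ** h).
  have -> : nrm (r ** h) = nrm (r ** y^*c ** y) by rewrite -hE cmulA.
  rewrite -cmulA nrm_swap//; first by rewrite !cstarM cstarK rs cmulA.
  by rewrite -cmulA hE cstarM hs rs rh.
have T0 : 0 <= t ^+ (2 ^ n) by rewrite exprn_ge0.
have nt : nrm ((t ^+ (2 ^ n)) *r e) = t ^+ (2 ^ n) by rewrite nrm_rsc nrm1 mulr1 ger0_norm.
have tW : t ^+ (2 ^ n) <= (t + v) ^+ (2 ^ n).
  by apply: lerXn2r; rewrite ?nnegrE; lra.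
have n2 : nrm (csq n x') <= (t + v) ^+ (2 ^ n).
  by rewrite nx'; apply: lerXn2r; rewrite ?nnegrE ?nrm_ge0//; lra.
have n3 : nrm (r ** h) <= nrm (csq n x') + t ^+ (2 ^ n).
  by rewrite -[X in _ + X]nt (le_trans _ (nrmB _ _))// h2 addrC addKr.
rewrite h1 (le_trans (nrmD _ _))// nt; lra.
Qed.


Lemma lamp_extreme x : exists f : U -> R, [/\ rlin f, forall y, f y <= lamp y, f x = lamp x &
  forall f1 f2, rlin f1 -> rlin f2 -> (forall x, f1 x <= lamp x) -> (forall x, f2 x <= lamp x) ->
    (forall x, f1 x + f2 x = 2 * f x) -> forall x, f1 x = f x].
Proof. exact: (extreme_point lampD lamp_rsc). Qed.

Section State.
Variable f : U -> R.
Hypotheses (fl : rlin f) (fp : forall x, f x <= lamp x).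

Let fD x y : f (x + y) = f x + f y. Proof. by case: fl. Qed.
Let fZ (t : R) x : f (t *r x) = t * f x. Proof. by case: fl => _ /(_ t x). Qed.

Lemma stateN x : f (- x) = - f x.
Proof. by rewrite -[- x]rsc1 rscN -rscNl fZ mulN1r. Qed.

Lemma stateB x y : f (x - y) = f x - f y.
Proof. by rewrite fD stateN. Qed.

Lemma state1 : f e = 1.
Proof.
apply: le_anti; apply/andP; split.
  by rewrite (le_trans (fp _))// (le_trans (lamp_nrm _))// nrm1.
rewrite -lerN2 -stateN (le_trans (fp _))//; apply: (@lamp_le _ 1) => //.
by rewrite sa_cre ?cstarN ?cstar1// rsc1 subrr nrm0 subrr.
Qed.

Lemma state_nrm x : f x <= nrm x.
Proof. by rewrite (le_trans (fp _))// lamp_nrm. Qed.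

Lemma state_sqr s : s^*c = s -> 0 <= f (s ** s).
Proof. by move=> ss; rewrite -lerN2 oppr0 -stateN (le_trans (fp _))// lamp_Nsqr. Qed.

Lemma state_CS u v : u^*c = u -> v^*c = v -> u ** v = v ** u ->
  f (u ** v) ^+ 2 <= f (u ** u) * f (v ** v).
Proof.
move=> us vs uv; pose a := f (u ** u); pose b := f (u ** v); pose c := f (v ** v).
have h t : 0 <= a + t * b * 2 + t * t * c.
  have -> : a + t * b * 2 + t * t * c = f ((u + t *r v) ** (u + t *r v)).
    rewrite !rscE -uv !fD !fZ -/a -/b -/c; ring.
  by rewrite state_sqr// cstarD us cstar_rsc vs.
rewrite -/a -/b -/c; have c0 : 0 <= c by rewrite state_sqr.
have [c00|c00] := eqVneq c 0.
  have a0 : 0 <= a by rewrite state_sqr.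
  have [->|b0] := eqVneq b 0; first by rewrite expr0n /= c00 mulr0.
  have := h (- (a + 1) / b / 2); rewrite c00 mulr0 addr0.
  have -> : a + - (a + 1) / b / 2 * b * 2 = -1 by field.
  by rewrite lerNr oppr0 ler10.
have c1 : 0 < c by rewrite lt_neqAle eq_sym c00.
have := h (- b / c).
have -> : a + - b / c * b * 2 + - b / c * (- b / c) * c = (a * c - b ^+ 2) / c by field.
by rewrite pmulr_lge0 ?invr_gt0// subr_ge0.
Qed.

End State.

Lemma cmul_cre_cim x : x^*c ** x + x ** x^*c =
  2 *r (cre x ** cre x) + 2 *r (cim x ** cim x).
Proof.
pose i : C := 'i%C; pose s := cre x; pose r := cim x.
have xE : x = s + i *: r by exact: cre_cim.
have ii : i * i = -1 by apply/eqP; rewrite eq_complex /=; apply/andP; split; apply/eqP; ring.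
have ic : i^*%R = - i by apply/eqP; rewrite eq_complex /= oppr0 !eqxx.
have xsE : x^*c = s - i *: r.
  by rewrite {1}xE cstarD (cstarZ i r) ic scaleNr !cre_sa.
rewrite -/s -/r xsE {1 2}xE; move: s r {xE xsE} => s r; rewrite !(cmulBl, cmulBr, cmulDl, cmulDr, cmulZl, cmulZr) /rsc.
transitivity ((2 : C) *: (s ** s) - (2 * (i * i)) *: (r ** r)); first by lmod R U.
by rewrite ii; lmod R U.
Qed.

(* Kaplansky's argument: if the least spectral value [- d] of [x^* x] were negative,
   multiplying [x] by the resolvent [q] close to [- d] would give [y] with
   [y^* y] of huge norm but nearly negative; so is then [y y^*], whereas
   [y^* y + y y^* = 2 Re(y)^2 + 2 Im(y)^2] is positive. *)
Lemma lamp_Nstar x : lamp (- (x^*c ** x)) <= 0.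
Proof.
move hE : (x^*c ** x) => h; rewrite leNgt; apply/negP; set d := lamp _ => d0.
have hs : h^*c = h by rewrite -hE cstarM cstarK.
have hNs : (- h)^*c = - h by rewrite cstarN hs.
have [f [fl fp fh _]] := lamp_extreme (- h).
have fD := fl.1; have fZ : forall (t : R) x, f (t *r x) = t * f x := fl.2.
(* g lies a little above the largest spectral value d of -h. The ratio g / n = 5 makes g f(q^2) -
   f(q) at least 4 / n, too large for the upper bound 1 / g. *)
pose n := d / 4; pose g := d + n.
have n0 : 0 < n by rewrite divr_gt0.
have g0 : 0 < g by rewrite addr_gt0.
have dg : lamp (- h) < g by rewrite -/d ltrDl.
have [r [rs rr rP]] := lamp_lt_sqrt hNs dg.
have [q [qs hq qh qP]] := lamp_lt_inv hNs dg.
have hh : (- h) ** h = h ** (- h) by rewrite cmulNl cmulNr.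
have qhC : q ** h = h ** q by exact: qP.
have rh : r ** h = h ** r by exact: rP.
have qr : q ** r = r ** q by apply: qP; rewrite cmulNl cmulNr rh.
have qg : q ** h = e - g *r q by rewrite -qh !rscE opprK addrC addKr.
have qqg : q ** h ** q = q - g *r (q ** q) by rewrite qg !rscE.
have fr : f (r ** r) = n.
  by rewrite rr (stateB fl) fZ (state1 fl fp) mulr1 -/d fh /g addrAC subrr add0r.
(* Since r^2 = g + h and q is its inverse, z is the inverse of r; Cauchy-Schwarz for r and z bounds
   f q from below. *)
pose z := r ** q.
have zs : z^*c = z by rewrite cstarM qs rs qr.
have rz : r ** z = e by rewrite /z cmulA rr hq.
have zr : z ** r = e by rewrite /z -cmulA qr cmulA rr hq.
have zz : z ** z = q by rewrite /z -{1}qr -cmulA [r ** (_ ** _)]cmulA rr hq cmulr1.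
have nq : n^-1 <= f q.
  have := state_CS fl fp rs zs (etrans rz (esym zr)).
  by rewrite rz (state1 fl fp) expr1n fr zz -ler_pdivrMl// mulr1.
have e1 := cstar1.
have fqq : f q ^+ 2 <= f (q ** q).
  have := state_CS fl fp qs e1 (etrans (cmulr1 q) (esym (cmul1 q))).
  by rewrite !cmulr1 (state1 fl fp) mulr1.
pose y := x ** q.
have yy : y^*c ** y = q - g *r (q ** q).
  by rewrite /y cstarM qs -cmulA [x^*c ** _]cmulA hE cmulA qqg.
have lyy : lamp (y^*c ** y) <= (4 * g)^-1.
  pose a := Num.sqrt g; have a0 : 0 < a by rewrite sqrtr_gt0.
  have aa : a * a = g by rewrite -expr2 sqr_sqrtr// ltW.
  (* Completing the square: q - g q^2 = 1/(4g) - w^2. *)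
  pose w := (2 * a)^-1 *r e - a *r q.
  have ws : w^*c = w by rewrite cstarB !cstar_rsc cstar1 qs.
  have -> : y^*c ** y = (4 * g)^-1 *r e + - (w ** w).
    have a1 : a != 0 by rewrite gt_eqF.
    have E1 : (2 * a)^-1 * a = 2^-1 by field.
    have E2 : a / (2 * a) = 2^-1 by field.
    have E3 : (4 * (a * a))^-1 = (2 * a)^-1 / (2 * a) by field.
    have h2 : (2^-1)%:C + (2^-1)%:C = 1 :> C by rewrite -rmorphD -mulr2n -[_ *+ 2]mulr_natr mulVf.
    rewrite yy /w !rscE -aa /rsc E1 E2 E3; lmod R U.
    by transitivity ((2^-1)%:C + (2^-1)%:C : C); [rewrite h2|]; ring.
  rewrite (le_trans (lampD _ _))// lamp_rsc ?invr_ge0 ?mulr_ge0 ?(ltW g0)//.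
  have := lamp_nrm e; have := lamp_Nsqr ws; rewrite nrm1.
  have : 0 < (4 * g)^-1 by rewrite invr_gt0 mulr_gt0.
  by nra.
have g4 : 0 <= (4 * g)^-1 by rewrite invr_ge0 mulr_ge0// ltW.
have lyy' : lamp (y ** y^*c) <= (4 * g)^-1.
  by rewrite (le_trans (lamp_swap _))// ge_max g4 lyy.
(* In 2 Re(y)^2 + 2 Im(y)^2 one of the two squares is dropped because it is positive, so each of |Re
   y|^2 and |Im y|^2 is at most 1/(4g) and |y|^2 is at most 1/g. *)
have half s : s^*c = s -> lamp (2 *r (s ** s)) <= 2 * (4 * g)^-1 -> nrm s ^+ 2 <= (4 * g)^-1.
  by move=> ss; rewrite lamp_rsc// ler_pM2l//; apply: le_trans; exact: nrm_sqr_lamp.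
have N2 s : s^*c = s -> lamp (- (2 *r (s ** s))) <= 0.
  move=> ss; rewrite -rscN lamp_rsc// pmulr_rle0// lamp_Nsqr//.
have ns : nrm (cre y) ^+ 2 <= (4 * g)^-1.
  apply: half; first exact: cre_sa.
  have -> : 2 *r (cre y ** cre y) = (y^*c ** y + y ** y^*c) - 2 *r (cim y ** cim y).
    by rewrite cmul_cre_cim addrK.
  have := lampD (y^*c ** y + y ** y^*c) (- (2 *r (cim y ** cim y))).
  have := lampD (y^*c ** y) (y ** y^*c); have := N2 (cim y) (cre_sa _).
  lra.
have nr : nrm (cim y) ^+ 2 <= (4 * g)^-1.
  apply: half; first exact: cre_sa.
  have -> : 2 *r (cim y ** cim y) = (y^*c ** y + y ** y^*c) - 2 *r (cre y ** cre y).
    by rewrite cmul_cre_cim addrAC subrr add0r.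
  have := lampD (y^*c ** y + y ** y^*c) (- (2 *r (cre y ** cre y))).
  have := lampD (y^*c ** y) (y ** y^*c); have := N2 (cre y) (cre_sa _).
  lra.
have ny : nrm y ^+ 2 <= g^-1.
  have : nrm y <= nrm (cre y) + nrm (cim y).
    rewrite {1}[y]cre_cim (le_trans (nrmD _ _))// (nrmZ 'i%C).
    have -> : normc 'i%C = 1 :> R by rewrite /= expr0n expr1n add0r sqrtr1.
    by rewrite mul1r.
  move: ns nr; rewrite invfM; have := nrm_ge0 y.
  have := nrm_ge0 (cre y); have := nrm_ge0 (cim y).
  move: (nrm y) (nrm (cre y)) (nrm (cim y)) (g^-1) => a b c k c0 b0 a0 hb hc abc.
  have : a * a <= (b + c) * (b + c) by rewrite ler_pM.
  by have := sqr_ge0 (b - c); move: hb hc; rewrite !expr2; lra.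
have : f (- (y^*c ** y)) <= g^-1.
  by rewrite (le_trans (state_nrm fp _))// nrmN nrm_star_mul.
rewrite yy (stateN fl) (stateB fl) fZ.
have gn : g * n^-1 = 5 by rewrite /g /n; field; rewrite gt_eqF.
have n1 : 0 < n^-1 by rewrite invr_gt0.
have : g^-1 < n^-1 by rewrite ltf_pV2// ltrDr.
have : g * f q ^+ 2 <= g * f (q ** q) by rewrite ler_pM2l.
have : f q * 5 <= g * f q ^+ 2.
  by rewrite -gn expr2 mulrC -!mulrA ler_pM2l// mulrC ler_pM2l// (lt_le_trans n1).
by move: (g^-1) (f q) (f (q ** q)) nq => a b c; nra.
Qed.

End Unital.

(** * Hilbert spaces *)

Section ComplexFacts.
Variable R : realType.
Local Notation C := R[i].
Implicit Types z w : C.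

Lemma conjCE z : z^*%R = complex.Re z -i* complex.Im z.
Proof. by case: z. Qed.

Lemma mul_conj_normc z : z * z^*%R = (normc z ^+ 2)%:C.
Proof. by rewrite -normCK rmorphXn. Qed.

Lemma normc_conj z : normc z^*%R = normc z.
Proof. by case: z => a b /=; rewrite sqrrN. Qed.

Lemma ReM_real (t : R) z : complex.Re (t%:C * z) = t * complex.Re z.
Proof. by case: z => a b /=; rewrite mul0r subr0. Qed.

Lemma ReB z w : complex.Re (z - w) = complex.Re z - complex.Re w.
Proof. by case: z; case: w. Qed.

Lemma Re_le_normc z : complex.Re z <= normc z.
Proof. by rewrite (le_trans (ler_norm _))// ler_Re_normc. Qed.

Lemma normc_small z : (forall e, 0 < e -> normc z <= e) -> z = 0.
Proof.
move=> h; apply/ComplexField.Normc.eq0_normc/eqP; rewrite eq_le normc_ge0 andbT.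
by apply/ler_addgt0Pl => e e0; rewrite addr0 h.
Qed.

Lemma conj_real (t : R) : (t%:C)^*%R = t%:C :> C.
Proof. by apply/eqP; rewrite eq_complex /= oppr0 !eqxx. Qed.

Lemma ge0_complexE z : 0 <= z -> z = (complex.Re z)%:C.
Proof. by move=> /ger0_Im; case: z => a b /= ->. Qed.

End ComplexFacts.

Section SemiInner.
Variables (R : realType) (V : lmodType R[i]) (s : V -> V -> R[i]).
Hypothesis sL : forall (k : R[i]) x y z, s (k *: x + y) z = k * s x z + s y z.
Hypothesis sC : forall x y, s y x = (s x y)^*%R.
Hypothesis sP : forall x, 0 <= s x x.
Implicit Types x y z : V.

Lemma semi0l z : s 0 z = 0.
Proof.
by have := sL (-1) 0 0 z; rewrite scaler0 addr0 mulN1r addNr.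
Qed.

Lemma semiZl k x z : s (k *: x) z = k * s x z.
Proof. by rewrite -[k *: x]addr0 sL semi0l addr0. Qed.

Lemma semiDl x y z : s (x + y) z = s x z + s y z.
Proof. by rewrite -[x]scale1r sL mul1r scale1r. Qed.

Lemma semiBl x y z : s (x - y) z = s x z - s y z.
Proof. by rewrite semiDl -scaleN1r semiZl mulN1r. Qed.

Lemma semiZr k x z : s z (k *: x) = k^*%R * s z x.
Proof. by rewrite sC semiZl rmorphM /= -sC. Qed.

Lemma semiDr x y z : s z (x + y) = s z x + s z y.
Proof. by rewrite sC semiDl rmorphD /= -!sC. Qed.

Lemma semiBr x y z : s z (x - y) = s z x - s z y.
Proof. by rewrite sC semiBl rmorphB /= -!sC. Qed.

Definition sq x : R := complex.Re (s x x).

Lemma sqE x : s x x = (sq x)%:C.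
Proof. exact: ge0_complexE. Qed.

Lemma sq_ge0 x : 0 <= sq x.
Proof. by rewrite -lecR -sqE. Qed.

(** Nonnegativity of s at x - t s(x,y) y for real t. The form may be degenerate, so the case sq y =
    0 is refuted by a large t. *)
Lemma semi_CS x y : normc (s x y) ^+ 2 <= sq x * sq y.
Proof.
set z := s x y; set w := normc z ^+ 2.
have Q (t : R) : 0 <= sq x - 2 * t * w + t * t * w * sq y.
  rewrite -lecR; have := sP (x - (t%:C * z) *: y).
  rewrite semiBl !semiBr !semiZl !semiZr !sqE -/z [s y x]sC -/z.
  rewrite rmorphM /= conj_real.
  have e : z * z^*%R = w%:C by exact: mul_conj_normc.
  move=> h; apply: le_trans h _; rewrite le_eqVlt; apply/orP; left; apply/eqP.
  transitivity ((sq x)%:C - 2 * t%:C * (z * z^*%R) + t%:C * t%:C * (z * z^*%R) * (sq y)%:C).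
    ring.
  by rewrite e; ring.
have x0 := sq_ge0 x; have y0 := sq_ge0 y; have w0 : 0 <= w by rewrite sqr_ge0.
have [y00|y00] := eqVneq (sq y) 0.
  rewrite y00 mulr0; have := Q (sq x + 1); rewrite y00 mulr0 addr0 => h.
  rewrite leNgt; apply/negP => w1.
  have [x1|x1] := leP w 1; last by nra.
  have := Q ((sq x + 1) / w); rewrite y00 mulr0 addr0.
  have -> : 2 * ((sq x + 1) / w) * w = 2 * (sq x + 1) by field; rewrite gt_eqF.
  lra.
have y1 : 0 < sq y by rewrite lt_neqAle eq_sym y00.
have := Q (sq y)^-1.
have -> : sq x - 2 * (sq y)^-1 * w + (sq y)^-1 * (sq y)^-1 * w * sq y = (sq x * sq y - w) / sq y.
  by field.
by rewrite pmulr_lge0 ?invr_gt0// subr_ge0.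
Qed.

End SemiInner.

Section MakeHilbert.
Variables (R : realType) (H : completeNormedModType R[i]) (d : H -> H -> R[i]).
Hypothesis dL : forall (k : R[i]) x y z, d (k *: x + y) z = k * d x z + d y z.
Hypothesis dC : forall x y, d y x = (d x y)^*%R.
Hypothesis dN : forall x, `|x| ^+ 2 = d x x.

(** A named copy of d to which the instances below can be attached. *)
Definition mk_dot (x y : H) : R[i] := d x y.

Let dDl z : zmod_morphism (mk_dot ^~ z).
Proof. by move=> x y; rewrite /mk_dot addrC -scaleN1r dL mulN1r addrC. Qed.

Let d0l z : d 0 z = 0.
Proof. by have := dDl z 0 0; rewrite /mk_dot !subrr. Qed.

Let dDr x : zmod_morphism (mk_dot x).
Proof.
by move=> y z; rewrite /mk_dot [LHS]dC [d (y - z) x]dDl rmorphB /= -!dC.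
Qed.

Let dZl z : scalable_for *%R (mk_dot ^~ z).
Proof. by move=> k x; rewrite /mk_dot -[k *: x]addr0 dL d0l addr0. Qed.

Let dZr x : scalable_for (Num.Def.conjC \; *%R) (mk_dot x).
Proof. by move=> k y; rewrite /mk_dot /= [LHS]dC [d (k *: y) x]dZl rmorphM /= -dC. Qed.

HB.instance Definition _ := isBilinear.Build R[i] H H R[i] *%R (Num.Def.conjC \; *%R) mk_dot
  dDl dDr dZl dZr.

Let dH x y : mk_dot x y = (-1) ^+ false * (mk_dot y x)^*%R.
Proof. by rewrite expr0 mul1r /mk_dot -dC. Qed.

HB.instance Definition _ := isHermitianSesquilinear.Build R[i] H false Num.Def.conjC mk_dot dH.

Let dP x : x != 0 -> 0 < mk_dot x x.
Proof. by move=> x0; rewrite /mk_dot -dN exprn_gt0// normr_gt0. Qed.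

HB.instance Definition _ := isDotProduct.Build R[i] H mk_dot dP.

Definition mk_hilbert : hilbertType R := @HilbertType R H mk_dot dN.

End MakeHilbert.

Section HilbertFacts.
Variables (R : realType) (H : hilbertType R).
Local Notation C := R[i].
Implicit Types x y z : H.
Local Notation "<| x , y |>" := (hdot H x y) (at level 0).

Lemma hdotC x y : <| y, x |> = (<| x, y |>)^*%R.
Proof. by rewrite [LHS]hermitian_subproof expr0 mul1r. Qed.

Lemma hdotBl x y z : <| x - y, z |> = <| x, z |> - <| y, z |>.
Proof. exact: linearBl. Qed.
Lemma hdotDl x y z : <| x + y, z |> = <| x, z |> + <| y, z |>.
Proof. exact: linearDl. Qed.
Lemma hdotZl k x z : <| k *: x, z |> = k * <| x, z |>.
Proof. exact: linearZl_LR. Qed.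
Lemma hdot0l z : <| 0, z |> = 0.
Proof. exact: linear0l. Qed.
Lemma hdotBr x y z : <| z, x - y |> = <| z, x |> - <| z, y |>.
Proof. by rewrite hdotC hdotBl rmorphB /= -!hdotC. Qed.
Lemma hdotDr x y z : <| z, x + y |> = <| z, x |> + <| z, y |>.
Proof. by rewrite hdotC hdotDl rmorphD /= -!hdotC. Qed.
Lemma hdotZr k x z : <| z, k *: x |> = k^*%R * <| z, x |>.
Proof. by rewrite hdotC hdotZl rmorphM /= -!hdotC. Qed.
Lemma hdot0r z : <| z, 0 |> = 0.
Proof. by rewrite hdotC hdot0l rmorph0. Qed.

Lemma hdot_nrm x : <| x, x |> = (nrm x ^+ 2)%:C.
Proof. by rewrite -hdotE nrmE rmorphXn. Qed.

Lemma hdot_CS x y : normc <| x, y |> <= nrm x * nrm y.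
Proof.
have := @semi_CS R H (hdot H) _ hdotC _ x y; rewrite /sq !hdot_nrm /= -exprMn.
rewrite ler_pXn2r ?nnegrE ?normc_ge0 ?mulr_ge0 ?nrm_ge0//; apply.
  by move=> k u v z; rewrite hdotDl hdotZl.
by move=> u; rewrite hdot_nrm ler0c sqr_ge0.
Qed.

Lemma nrm_sqrD x y : nrm (x + y) ^+ 2 = nrm x ^+ 2 + nrm y ^+ 2 + 2 * complex.Re <| x, y |>.
Proof.
apply: (@complexI R); rewrite -hdot_nrm hdotDl !hdotDr !hdot_nrm [<| y, x |>]hdotC conjCE.
by case: <| x, y |> => a b /=; apply/eqP; rewrite eq_complex /=; apply/andP; split; apply/eqP; ring.
Qed.

Lemma nrm_sqrB x y : nrm (x - y) ^+ 2 = nrm x ^+ 2 + nrm y ^+ 2 - 2 * complex.Re <| x, y |>.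
Proof.
rewrite nrm_sqrD nrmN -scaleN1r hdotZr rmorphN1 mulN1r.
by rewrite raddfN mulrN.
Qed.

Lemma Re_hdot_le x y : complex.Re <| x, y |> <= nrm x * nrm y.
Proof. exact: le_trans (Re_le_normc _) (hdot_CS _ _). Qed.

(** A minimising sequence in M is Cauchy by the parallelogram identity. Orthogonality follows from
    minimality under the perturbations k y, with k a real multiple of the inner product of x - m and
    y. *)
Lemma hilbert_projection (M : H -> Prop) : aclosed M -> M 0 ->
  (forall (k : C) x y, M x -> M y -> M (k *: x + y)) ->
  forall x, exists2 m, M m & forall y, M y -> <| x - m, y |> = 0.
Proof.
move=> Mc M0 ML x.
have MZ k y : M y -> M (k *: y) by move=> My; rewrite -[_ *: _]addr0; apply: ML.
have MD y z : M y -> M z -> M (y + z) by move=> *; rewrite -[y]scale1r; apply: ML.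
pose E : set R := [set nrm (x - m) | m in M].
have Einf : has_inf E.
  split; first by exists (nrm (x - 0)), 0.
  by exists 0 => _ [m _ <-]; exact: nrm_ge0.
pose d := inf E.
have d0 : 0 <= d by apply: lb_le_inf; [case: Einf|move=> _ [m _ <-]; exact: nrm_ge0].
have dle m : M m -> d <= nrm (x - m) by move=> Mm; apply: ge_inf; [case: Einf|exists m].
have near e : 0 < e -> exists2 m, M m & nrm (x - m) < d + e.
  by move=> e0; have [|_ [m Mm <-] h] := @inf_lt _ E (d + e) Einf.1; [rewrite ltrDl|exists m].
have close m1 m2 e : 0 < e -> e <= 1 -> M m1 -> M m2 -> nrm (x - m1) < d + e ->
    nrm (x - m2) < d + e -> nrm (m1 - m2) ^+ 2 <= 4 * (2 * d + 1) * e.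
  move=> e0 e1 M1 M2 h1 h2; pose h : C := (2^-1 : R)%:C.
  have := nrm_sqrD (x - m1) (x - m2); have := nrm_sqrB (x - m1) (x - m2).
  have -> : x - m1 - (x - m2) = m2 - m1 by lmod R H.
  have mE : x - m1 + (x - m2) = (2 : R)%:C *: (x - h *: (m1 + m2)).
    rewrite scalerBr scalerA -rmorphM divff// scale1r.
    have -> : (2 : R)%:C *: x = x + x by rewrite rmorph_nat scaler_nat mulr2n.
    by rewrite opprD addrACA.
  rewrite mE nrmZr ger0_norm// exprMn nrmBC.
  have : d <= nrm (x - h *: (m1 + m2)) by apply: dle; apply: MZ; apply: MD.
  have := nrm_ge0 (x - m1); have := nrm_ge0 (x - m2).
  move: (nrm (x - m1)) (nrm (x - m2)) h1 h2 (nrm (x - h *: _)) (complex.Re _) => a b ad bd c r b0 a0 dc h1 h2.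
  have hc : d * d <= c * c by rewrite ler_pM.
  have ha : a * a <= (d + e) * (d + e) by rewrite ler_pM// ltW.
  have hb : b * b <= (d + e) * (d + e) by rewrite ler_pM// ltW.
  have he : e * e <= e by rewrite ler_piMl// ltW.
  move: h1 h2; rewrite !expr2; nra.
have [u uP] : exists u : nat -> H, forall n, M (u n) /\ nrm (x - u n) < d + n.+1%:R^-1.
  have h n : {m | M m /\ nrm (x - m) < d + n.+1%:R^-1}.
    by apply: cid; have [|m Mm hm] := near n.+1%:R^-1; [rewrite invr_gt0|exists m].
  by exists (fun n => sval (h n)) => n; case: (h n).
have invN (e : R) : 0 < e -> exists N : nat, forall n, (N <= n)%N -> (n.+1%:R^-1 : R) <= e.
  move=> e0; exists (Num.truncn e^-1) => n Nn.
  rewrite -[e]invrK lef_pV2 ?posrE ?invr_gt0//.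
  rewrite (le_trans (ltW (truncnS_gt _)))// ler_nat ltnS//.
have [m hm] : exists m, forall e : R, 0 < e -> exists N, forall n, (N <= n)%N -> nrm (m - u n) <= e.
  apply: complete_seq => e e0.
  pose K := 4 * (2 * d + 1); have K0 : 0 < K by rewrite mulr_gt0// ltr_wpDl// mulr_ge0.
  pose e' := Num.min 1 (e ^+ 2 / K).
  have e'0 : 0 < e' by rewrite lt_min ltr01 divr_gt0// exprn_gt0.
  have [N hN] := invN _ e'0; exists N => n k Nn Nk.
  rewrite -(@ler_pXn2r _ 2)// ?nnegrE ?nrm_ge0 ?(ltW e0)//.
  have [Mn hn] := uP n; have [Mk hk] := uP k.
  apply: le_trans (close _ _ _ e'0 _ Mn Mk _ _) _; first by rewrite ge_min lexx.
  - by rewrite (lt_le_trans hn)// lerD2l hN.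
  - by rewrite (lt_le_trans hk)// lerD2l hN.
  - by rewrite -/K mulrC -ler_pdivlMr// ge_min lexx orbT.
have Mm : M m.
  by apply: Mc => e e0; have [N hN] := hm e e0; exists (u N); [case: (uP N)|exact: hN].
have md : nrm (x - m) <= d.
  apply/ler_addgt0Pl => e e0; have e2 : 0 < e / 2 by rewrite divr_gt0.
  have [N1 hN1] := hm _ e2; have [N2 hN2] := invN _ e2.
  pose n := maxn N1 N2.
  rewrite (le_trans (nrm_dist _ (u n) _))// [leRHS]addrC (splitr e) addrA lerD//.
    by rewrite (le_trans (ltW (uP n).2))// lerD2l hN2// leq_maxr.
  by rewrite nrmBC hN1// leq_maxl.
exists m => // y My.
have key k : 0 <= normc k ^+ 2 * nrm y ^+ 2 - 2 * complex.Re (k^*%R * <| x - m, y |>).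
  have : d <= nrm (x - m - k *: y).
    by rewrite -addrA -opprD; apply: dle; apply: MD => //; apply: MZ.
  move=> h; have : nrm (x - m) ^+ 2 <= nrm (x - m - k *: y) ^+ 2.
    by apply: lerXn2r; rewrite ?nnegrE ?nrm_ge0// (le_trans md).
  rewrite (nrm_sqrB (x - m)) nrmZ exprMn hdotZr; lra.
apply/ComplexField.Normc.eq0_normc/eqP; rewrite -sqrf_eq0; apply/eqP.
set z := <| _, _ |> in key *.
have Q t : 0 <= t * t * normc z ^+ 2 * nrm y ^+ 2 - 2 * t * normc z ^+ 2.
  have := key (t%:C * z); rewrite rmorphM /= conj_real -mulrA ReM_real [z^*%R * z]mulrC mul_conj_normc.
  rewrite ComplexField.Normc.normcM normc_real exprMn real_normK ?num_real//=; lra.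
have z0 : 0 <= normc z ^+ 2 by rewrite sqr_ge0.
have y0 : 0 <= nrm y ^+ 2 by rewrite sqr_ge0.
have y1 : 0 < nrm y ^+ 2 + 1 by rewrite ltr_wpDl.
have := Q (nrm y ^+ 2 + 1)^-1.
set w := normc z ^+ 2 in z0 *; set v := nrm y ^+ 2 in y0 y1 *.
have -> : (v + 1)^-1 * (v + 1)^-1 * w * v - 2 * (v + 1)^-1 * w = - (w * (v + 2)) / (v + 1) ^+ 2.
  by field; rewrite gt_eqF.
rewrite pmulr_lge0 ?invr_gt0 ?exprn_gt0// oppr_ge0 => h.
by apply: le_anti; rewrite z0 andbT; nra.
Qed.

End HilbertFacts.

(* The Hilbert space completion of [V] for the semi-inner product [s], realised as
   the antilinear functionals [F] on [V] that are limits of functionals [s x]. *)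
Section Completion.
Variables (R : realType) (V : lmodType R[i]) (s : V -> V -> R[i]).
Local Notation C := R[i].
Hypothesis sL : forall (k : R[i]) x y z, s (k *: x + y) z = k * s x z + s y z.
Hypothesis sC : forall x y, s y x = (s x y)^*%R.
Hypothesis sP : forall x, 0 <= s x x.
Implicit Types x y z : V.

Let sn x : R := Num.sqrt (sq s x).

Let sn_ge0 x : 0 <= sn x. Proof. exact: sqrtr_ge0. Qed.

Let sn_sqr x : sn x ^+ 2 = sq s x.
Proof. by rewrite sqr_sqrtr// sq_ge0. Qed.

Let CS x y : normc (s x y) <= sn x * sn y.
Proof.
rewrite -(@ler_pXn2r _ 2)// ?nnegrE ?normc_ge0 ?mulr_ge0//.
by rewrite exprMn !sn_sqr semi_CS.
Qed.

(** The seminorm [sn] on the right makes this the closure of the functionals s x in the dual norm,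
    so completeness reduces to pointwise limits. *)
Definition comp_pred (F : V -> C) :=
  forall e : R, 0 < e -> exists x, forall y, normc (F y - s x y) <= e * sn y.

Record completion := Completion { cfun :> V -> C; cfunP : comp_pred cfun }.

HB.instance Definition _ := gen_eqMixin completion.
HB.instance Definition _ := gen_choiceMixin completion.
Implicit Types F G : completion.

Lemma comp_eq F G : (forall y, F y = G y) -> F = G.
Proof.
case: F G => [F hF] [G hG] /= /funext FG.
by case: G / FG hG => hG; congr Completion; exact: Prop_irrelevance.
Qed.

Let emb_subproof x : comp_pred (s x).
Proof.
by move=> e e0; exists x => y; rewrite subrr ComplexField.Normc.normc0 mulr_ge0// ltW.
Qed.
Definition comp_emb x : completion := Completion (emb_subproof x).

Let lin_subproof (k : C) F G : comp_pred (fun y => k * F y + G y).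
Proof.
move=> e e0; have k0 : 0 < normc k + 1 by rewrite ltr_wpDl ?normc_ge0.
have [x hx] := cfunP F (divr_gt0 (divr_gt0 e0 (ltr0n R 2)) k0).
have [x' hx'] := cfunP G (divr_gt0 e0 (ltr0n R 2)).
exists (k *: x + x') => y; rewrite sL.
have -> : k * F y + G y - (k * s x y + s x' y) = k * (F y - s x y) + (G y - s x' y) by ring.
rewrite (le_trans (normcD _ _))// ComplexField.Normc.normcM (splitr e) mulrDl lerD//.
apply: (@le_trans _ _ ((normc k + 1) * normc (F y - s x y))).
  by rewrite ler_wpM2r ?normc_ge0// lerDl.
by rewrite mulrC -ler_pdivlMr// mulrAC hx.
Qed.
Definition comp_lin k F G := Completion (lin_subproof k F G).

Definition comp_zero := comp_emb 0.
Let zeroE y : comp_zero y = 0. Proof. exact: semi0l. Qed.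
Definition comp_add := comp_lin 1.
Definition comp_opp F := comp_lin (-1) F comp_zero.
Definition comp_scale k F := comp_lin k F comp_zero.

Let addA : associative comp_add.
Proof. by move=> F G H; apply: comp_eq => y /=; ring. Qed.
Let addC : commutative comp_add.
Proof. by move=> F G; apply: comp_eq => y /=; ring. Qed.
Let add0 : left_id comp_zero comp_add.
Proof. by move=> F; apply: comp_eq => y; rewrite /= (semi0l sL); ring. Qed.
Let addN : left_inverse comp_zero comp_opp comp_add.
Proof. by move=> F; apply: comp_eq => y; rewrite /= (semi0l sL); ring. Qed.
HB.instance Definition _ := GRing.isZmodule.Build completion addA addC add0 addN.

Let scaleA k l F : comp_scale k (comp_scale l F) = comp_scale (k * l) F.
Proof. by apply: comp_eq => y; rewrite /= (semi0l sL); ring. Qed.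
Let scale1 : left_id 1 comp_scale.
Proof. by move=> F; apply: comp_eq => y; rewrite /= (semi0l sL); ring. Qed.
Let scaleDr : right_distributive comp_scale +%R.
Proof. by move=> k F G; apply: comp_eq => y; rewrite /= (semi0l sL); ring. Qed.
Let scaleDl F : {morph comp_scale^~ F : k l / k + l}.
Proof. by move=> k l; apply: comp_eq => y; rewrite /= (semi0l sL); ring. Qed.
HB.instance Definition _ :=
  GRing.Zmodule_isLmodule.Build C completion scaleA scale1 scaleDr scaleDl.

Lemma comp_linE k F G y : (k *: F + G) y = k * F y + G y.
Proof. by rewrite /= (semi0l sL); ring. Qed.
Lemma comp_addE F G y : (F + G) y = F y + G y.
Proof. by rewrite -[F in LHS]scale1r comp_linE mul1r. Qed.
Lemma comp_scaleE k F y : (k *: F) y = k * F y.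
Proof. by rewrite -[k *: F]addr0 comp_linE [X in _ + X]zeroE addr0. Qed.
Lemma comp_subE F G y : (F - G) y = F y - G y.
Proof. by rewrite -scaleN1r addrC comp_linE mulN1r addrC. Qed.

Definition comp_bound F : set R := [set M | 0 <= M /\ forall y, normc (F y) <= M * sn y].
Definition comp_norm F : R := inf (comp_bound F).

Let bound_inf F : has_inf (comp_bound F).
Proof.
split; last by exists 0 => M [].
have [x hx] := cfunP F ltr01; exists (sn x + 1); split; first by rewrite addr_ge0.
move=> y; rewrite -[F y](subrK (s x y)) (le_trans (normcD _ _))// addrC mulrDl lerD ?CS//.
Qed.

Lemma comp_norm_ge0 F : 0 <= comp_norm F.
Proof. by apply: lb_le_inf; [case: (bound_inf F)|move=> M []]. Qed.

Lemma comp_normP F y : normc (F y) <= comp_norm F * sn y.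
Proof.
apply/ler_addgt0Pl => e e0; have y1 : 0 < sn y + 1 by rewrite ltr_wpDl.
have [|M [M0 hM] hlt] := @inf_lt _ (comp_bound F) (comp_norm F + e / (sn y + 1)) (bound_inf F).1.
  by rewrite ltrDl divr_gt0.
rewrite (le_trans (hM y))// (le_trans (ler_wpM2r (sn_ge0 y) (ltW hlt)))//.
rewrite mulrDl addrC lerD2r mulrAC ler_pdivrMr// ler_wpM2l ?(ltW e0)//.
by rewrite lerDl.
Qed.

Lemma comp_norm_le F M : 0 <= M -> (forall y, normc (F y) <= M * sn y) -> comp_norm F <= M.
Proof. by move=> M0 hM; apply: ge_inf; [case: (bound_inf F)|split]. Qed.

Let norm_eq0 F : comp_norm F = 0 -> F = 0.
Proof.
move=> F0; apply: comp_eq => y; rewrite [RHS]zeroE; apply: ComplexField.Normc.eq0_normc.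
by apply: le_anti; rewrite normc_ge0 andbT (le_trans (comp_normP F y))// F0 mul0r.
Qed.

Let normD F G : comp_norm (F + G) <= comp_norm F + comp_norm G.
Proof.
apply: comp_norm_le => [|y]; first by rewrite addr_ge0 ?comp_norm_ge0.
by rewrite comp_addE mulrDl (le_trans (normcD _ _))// lerD ?comp_normP.
Qed.

Let normZ_le k F : comp_norm (k *: F) <= normc k * comp_norm F.
Proof.
apply: comp_norm_le => [|y]; first by rewrite mulr_ge0 ?normc_ge0 ?comp_norm_ge0.
by rewrite comp_scaleE ComplexField.Normc.normcM -mulrA ler_wpM2l ?normc_ge0 ?comp_normP.
Qed.

Let normZ k F : comp_norm (k *: F) = normc k * comp_norm F.
Proof.
apply: le_anti; rewrite normZ_le /=.
have [->|k0] := eqVneq k 0.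
  by rewrite ComplexField.Normc.normc0 mul0r comp_norm_ge0.
have nk0 : 0 < normc k.
  rewrite lt_neqAle normc_ge0 andbT eq_sym; apply: contra k0.
  by move=> /eqP /ComplexField.Normc.eq0_normc ->.
rewrite -ler_pdivlMl// -ComplexField.Normc.normcV.
by rewrite -{1}[F](scalerK k0) normZ_le.
Qed.

Let cnormD F G : (comp_norm (F + G))%:C <= (comp_norm F)%:C + (comp_norm G)%:C :> C.
Proof. by rewrite -rmorphD lecR normD. Qed.
Let cnormZ (k : C) F : (comp_norm (k *: F))%:C = `|k| * (comp_norm F)%:C.
Proof. by rewrite normZ rmorphM. Qed.
Let cnorm_eq0 F : (comp_norm F)%:C = 0 :> C -> F = 0.
Proof. by move=> /complexI /norm_eq0. Qed.
HB.instance Definition _ := Lmodule_isNormed.Build C completion cnormD cnormZ cnorm_eq0.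

Lemma comp_nrm F : nrm F = comp_norm F.
Proof. by []. Qed.

Lemma comp_near F (e : R) : 0 < e -> exists x, nrm (F - comp_emb x) <= e.
Proof.
move=> e0; have [x hx] := cfunP F e0; exists x; rewrite comp_nrm.
by apply: comp_norm_le => [|y]; rewrite ?(ltW e0)// comp_subE.
Qed.

Let complete (Fl : set_system completion) : ProperFilter Fl -> cauchy Fl -> cvg Fl.
Proof.
move=> FF /cauchyP Fc.
have Fc' (e : R) : 0 < e -> exists F0 : completion, \forall F \near Fl, nrm (F0 - F) <= e.
  move=> e0; have eC : 0 < e%:C :> C by rewrite ltcR.
  have [F0 hF0] := Fc _ eC; exists F0; apply: filterS hF0 => F.
  by rewrite -ball_normE /= nrmE ltcR => /ltW.
have ev F G y : normc (F y - G y) <= nrm (F - G) * sn y.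
  by rewrite -comp_subE comp_nrm comp_normP.
have ptc y : cvg ((fun F : completion => F y) @ Fl).
  apply: cauchy_cvg; apply: cauchy_exP => e' e'0; have [e e0 ->] := gt0_complexP e'0.
  have y1 : 0 < sn y + 1 by rewrite ltr_wpDl.
  have [F0 hF0] := Fc' _ (divr_gt0 e0 y1); exists (F0 y).
  suff : \forall F \near Fl, ball (F0 y) e%:C ((F : completion) y) by [].
  apply: filterS hF0 => F hF; rewrite -ball_normE /= Defs.normcE ltcR.
  rewrite (le_lt_trans (ev _ _ _))// (le_lt_trans (ler_wpM2r (sn_ge0 y) hF))//.
  rewrite mulrAC ltr_pdivrMr// ltr_pM2l// ltrDl//.
pose G y := lim ((fun F : completion => F y) @ Fl).
have ptc' y (e : R) : 0 < e -> \forall F \near Fl, normc (G y - (F : completion) y) <= e.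
  move=> e0; have eC : 0 < e%:C :> C by rewrite ltcR.
  have /cvgrPdist_le/(_ _ eC) : (fun F : completion => F y) @ Fl --> G y by exact: ptc.
  by apply: filterS => F; rewrite Defs.normcE lecR.
have FG (e : R) : 0 < e -> \forall F \near Fl, forall y, normc ((F : completion) y - G y) <= e * sn y.
  move=> e0; have e2 : 0 < e / 2 by rewrite divr_gt0.
  have [F0 hF0] := Fc' _ e2; apply: (filterS _ hF0) => F hF y.
  apply/ler_addgt0Pl => d d0.
  have [H [hH hd]] := filter_ex (filterI hF0 (ptc' y _ d0)).
  have -> : F y - G y = (F y - H y) - (G y - H y) by ring.
  rewrite (le_trans (normcD _ _))// normcN addrC lerD//.
  rewrite (le_trans (ev _ _ _))// ler_wpM2r// (le_trans (nrm_dist _ F0 _))// (splitr e).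
  by rewrite lerD// nrmBC.
have Gp : comp_pred G.
  move=> e e0; have e2 : 0 < e / 2 by rewrite divr_gt0.
  have [F hF] := filter_ex (FG _ e2); have [x hx] := cfunP F e2; exists x => y.
  have -> : G y - s x y = - (F y - G y) + (F y - s x y) by ring.
  by rewrite (le_trans (normcD _ _))// normcN (splitr e) mulrDl lerD.
apply/cvg_ex; exists (Completion Gp); apply/cvgrPdist_le => e' e'0.
have [e e0 ->] := gt0_complexP e'0; apply: filterS (FG _ e0) => F hF.
rewrite nrmE lecR comp_nrm; apply: comp_norm_le => [|y]; first exact: ltW.
by rewrite comp_subE -normcN opprB; exact: hF.
Qed.
HB.instance Definition _ := Uniform_isComplete.Build completion complete.


Let nrmF F y : normc (F y) <= nrm F * sn y. Proof. exact: comp_normP. Qed.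

Lemma comp_lin_emb k x y : comp_emb (k *: x + y) = k *: comp_emb x + comp_emb y.
Proof. by apply: comp_eq => z; rewrite comp_linE /= sL. Qed.

Lemma comp_embB x y : comp_emb (x - y) = comp_emb x - comp_emb y.
Proof. by rewrite addrC -scaleN1r comp_lin_emb scaleN1r addrC. Qed.

Lemma comp_emb_nrm x : nrm (comp_emb x) = sn x.
Proof.
apply: le_anti; rewrite {1}comp_nrm comp_norm_le//=.
have [x0|x0] := eqVneq (sn x) 0; first by rewrite x0 nrm_ge0.
have x1 : 0 < sn x by rewrite lt_neqAle eq_sym x0 sn_ge0.
rewrite -(ler_pM2r x1); apply: le_trans (nrmF (comp_emb x) x).
by rewrite -expr2 sn_sqr /= (sqE sP) normc_real ger0_norm// sq_ge0.
Qed.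

Lemma comp_antilin F k x y : F (k *: x + y) = k^*%R * F x + F y.
Proof.
apply/eqP; rewrite -subr_eq0; apply/eqP/normc_small => e e0.
have K0 : 0 < sn (k *: x + y) + normc k * sn x + sn y + 1.
  by rewrite ltr_wpDl// !addr_ge0 ?mulr_ge0 ?normc_ge0.
have [z hz] := cfunP F (divr_gt0 e0 K0); set d := e / _ in hz.
have -> : F (k *: x + y) - (k^*%R * F x + F y) =
   (F (k *: x + y) - s z (k *: x + y)) - (k^*%R * (F x - s z x) + (F y - s z y)).
  by rewrite (semiDr sL sC) (semiZr sL sC); ring.
rewrite (le_trans (normcD _ _))// normcN.
apply: (@le_trans _ _ (d * sn (k *: x + y) + (normc k * (d * sn x) + d * sn y))).
  rewrite lerD// (le_trans (normcD _ _))// ComplexField.Normc.normcM normc_conj lerD//.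
  by rewrite ler_wpM2l ?normc_ge0.
have -> : e = d * (sn (k *: x + y) + normc k * sn x + sn y + 1) by rewrite /d divfK// gt_eqF.
have : 0 < d by rewrite divr_gt0.
by move: (sn _) (sn x) (sn y) (normc k) => a b c f; lra.
Qed.

Lemma comp_evB F x y : F (x - y) = F x - F y.
Proof. by rewrite addrC -scaleN1r comp_antilin rmorphN1 mulN1r addrC. Qed.

(** The inner product with F is extended from embedded vectors by continuity: c is the limit of F (u
    n) along embedded vectors converging to G. *)
Lemma comp_dot_ex F G : exists c : C, forall x, normc (c - F x) <= nrm F * nrm (G - comp_emb x).
Proof.
have [u hu] : exists u : nat -> V, forall n, nrm (G - comp_emb (u n)) <= n.+1%:R^-1.
  have h n : {x | nrm (G - comp_emb x) <= n.+1%:R^-1}.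
    by apply: cid; apply: comp_near; rewrite invr_gt0.
  by exists (fun n => sval (h n)) => n; case: (h n).
have invN (e : R) : 0 < e -> exists N : nat, forall n, (N <= n)%N -> (n.+1%:R^-1 : R) <= e.
  move=> e0; exists (Num.truncn e^-1) => n Nn.
  rewrite -[e]invrK lef_pV2 ?posrE ?invr_gt0//.
  rewrite (le_trans (ltW (truncnS_gt _)))// ler_nat ltnS//.
have dF x y : normc (F x - F y) <= nrm F * (nrm (G - comp_emb x) + nrm (G - comp_emb y)).
  rewrite -comp_evB (le_trans (nrmF _ _))// ler_wpM2l ?nrm_ge0// -comp_emb_nrm comp_embB.
  by rewrite (le_trans (nrm_dist _ G _))// nrmBC.
have F1 : 0 < nrm F + 1 by rewrite ltr_wpDl ?nrm_ge0.
have small (e X Y : R) : 0 < e -> X <= e / 2 / (nrm F + 1) -> Y <= e / 2 / (nrm F + 1) ->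
    nrm F * (X + Y) <= e.
  move=> e0 hX hY.
  apply: (@le_trans _ _ (nrm F * (e / 2 / (nrm F + 1) + e / 2 / (nrm F + 1)))).
    by rewrite ler_wpM2l ?nrm_ge0// lerD.
  by rewrite -mulrDl -splitr mulrCA ler_piMr ?(ltW e0)// ler_pdivrMr// mul1r lerDl.
have [|c hc] := @complete_seq R (R[i] : completeNormedModType R[i]) (fun n => F (u n)).
  move=> e e0; have e2 : 0 < e / 2 / (nrm F + 1) by rewrite !divr_gt0.
  have [N hN] := invN _ e2; exists N => n m Nn Nm.
  apply: le_trans (dF _ _) _; apply: small => //; first by rewrite (le_trans (hu n))// hN.
  by rewrite (le_trans (hu m))// hN.
exists c => x; apply/ler_addgt0Pl => e e0.
have e4 : 0 < e / 2 / (nrm F + 1) by rewrite !divr_gt0.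
have [N1 hN1] := invN _ e4; have [N2 hN2] := hc _ (divr_gt0 e0 (ltr0n R 2)).
pose n := maxn N1 N2.
have h3 : normc (c - F (u n)) <= e / 2 := hN2 n (leq_maxr _ _).
have h2 := dF (u n) x.
have h1 := le_trans (hu n) (hN1 n (leq_maxl _ _)).
rewrite -(subrKA (F (u n))) (le_trans (normcD _ _))//.
have h4 : nrm F * nrm (G - comp_emb (u n)) <= e / 2.
  rewrite (le_trans (ler_wpM2l (nrm_ge0 _) h1))//.
  by rewrite mulrCA ler_piMr ?divr_ge0 ?(ltW e0)// ler_pdivrMr// mul1r lerDl.
by rewrite mulrDr in h2; lra.
Qed.

Definition comp_dot F G : C := sval (cid (comp_dot_ex F G)).

Lemma comp_dotP F G x : normc (comp_dot F G - F x) <= nrm F * nrm (G - comp_emb x).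
Proof. by rewrite /comp_dot; case: cid. Qed.

Lemma comp_dot_eps F G (e : R) : 0 < e -> exists2 d : R, 0 < d & forall x,
  nrm (G - comp_emb x) <= d -> normc (comp_dot F G - F x) <= e.
Proof.
move=> e0; have F1 : 0 < nrm F + 1 by rewrite ltr_wpDl ?nrm_ge0.
exists (e / (nrm F + 1)) => [|x hx]; first by rewrite divr_gt0.
rewrite (le_trans (comp_dotP _ _ _))// (le_trans (ler_wpM2l (nrm_ge0 _) hx))//.
by rewrite mulrCA ler_piMr ?(ltW e0)// ler_pdivrMr// mul1r lerDl.
Qed.

Let dotL (k : C) F F' G : comp_dot (k *: F + F') G = k * comp_dot F G + comp_dot F' G.
Proof.
apply/eqP; rewrite -subr_eq0; apply/eqP/normc_small => e e0.
have k1 : 0 < normc k + 1 by rewrite ltr_wpDl ?normc_ge0.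
have e3 : 0 < e / 3 by rewrite divr_gt0.
have [d1 d10 h1] := @comp_dot_eps (k *: F + F') G _ e3.
have [d2 d20 h2] := @comp_dot_eps F G _ (divr_gt0 e3 k1).
have [d3 d30 h3] := @comp_dot_eps F' G _ e3.
have [|x hx] := @comp_near G (Num.min d1 (Num.min d2 d3)); first by rewrite !lt_min d10 d20.
move: hx; rewrite !le_min => /and3P[x1 x2 x3].
have -> : comp_dot (k *: F + F') G - (k * comp_dot F G + comp_dot F' G) =
  (comp_dot (k *: F + F') G - (k *: F + F') x) - k * (comp_dot F G - F x) - (comp_dot F' G - F' x).
  by rewrite comp_linE; ring.
have -> : e = e / 3 + e / 3 + e / 3 by field.
do 2![rewrite (le_trans (normcD _ _))// normcN lerD ?h1 ?h3//].
rewrite ComplexField.Normc.normcM (le_trans (ler_wpM2l (normc_ge0 _) (h2 _ x2)))//.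
by rewrite mulrCA ler_piMr ?(ltW e3)// ler_pdivrMr// mul1r lerDl.
Qed.

Lemma comp_dot_emb F x : comp_dot F (comp_emb x) = F x.
Proof.
apply/eqP; rewrite -subr_eq0; apply/eqP/normc_small => e e0.
by rewrite (le_trans (comp_dotP _ _ x))// subrr nrm0 mulr0 ltW.
Qed.

Let dotC F G : comp_dot G F = (comp_dot F G)^*%R.
Proof.
apply/eqP; rewrite -subr_eq0; apply/eqP/normc_small => e e0.
have e4 : 0 < e / 4 by rewrite divr_gt0.
have [d1 d10 h1] := @comp_dot_eps F G _ e4.
have [d2 d20 h2] := @comp_dot_eps G F _ e4.
pose K := nrm F + nrm G + 1; have K0 : 0 < K by rewrite ltr_wpDl// addr_ge0 ?nrm_ge0.
pose d3 := Num.min 1 (e / 4 / K); have d30 : 0 < d3 by rewrite lt_min ltr01 divr_gt0.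
have [|x hx] := @comp_near G (Num.min d1 d3); first by rewrite lt_min d10.
have [|y hy] := @comp_near F (Num.min d2 d3); first by rewrite lt_min d20.
move: hx hy; rewrite !le_min => /and3P[x1 x2 x3] /and3P[y1 y2 y3].
have bx : sn x <= nrm G + 1.
  by rewrite -comp_emb_nrm -lerBlDl (le_trans _ x2)// nrmBC (le_trans (ler_norm _))// ler_dist_nrm.
have by_ : sn y <= nrm F + 1.
  by rewrite -comp_emb_nrm -lerBlDl (le_trans _ y2)// nrmBC (le_trans (ler_norm _))// ler_dist_nrm.
have hF : normc (F x - s y x) <= e / 4.
  rewrite -[s y x]/(comp_emb y x) -comp_subE (le_trans (nrmF _ _))//.
  rewrite (le_trans (ler_wpM2r (sn_ge0 _) y3))// mulrAC ler_pdivrMr// ler_wpM2l ?(ltW e4)//.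
  by rewrite (le_trans bx)// /K -addrA lerDr nrm_ge0.
have hG : normc (G y - s x y) <= e / 4.
  rewrite -[s x y]/(comp_emb x y) -comp_subE (le_trans (nrmF _ _))//.
  rewrite (le_trans (ler_wpM2r (sn_ge0 _) x3))// mulrAC ler_pdivrMr// ler_wpM2l ?(ltW e4)//.
  by rewrite (le_trans by_)// /K lerD2r lerDl nrm_ge0.
have -> : comp_dot G F - (comp_dot F G)^*%R =
  (comp_dot G F - G y) + (G y - s x y) - (((comp_dot F G - F x) + (F x - s y x))^*%R).
  by rewrite (sC y x) !rmorphD !rmorphN /=; ring.
have -> : e = e / 4 + e / 4 + (e / 4 + e / 4) by field.
rewrite (le_trans (normcD _ _))// normcN normc_conj lerD// (le_trans (normcD _ _))// lerD//.
  exact: h2.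
exact: h1.
Qed.

Let dotN F : `|F| ^+ 2 = comp_dot F F.
Proof.
rewrite nrmE -rmorphXn /=; apply/eqP; rewrite -subr_eq0; apply/eqP/normc_small => e e0.
have e3 : 0 < e / 3 by rewrite divr_gt0.
have [d1 d10 h1] := @comp_dot_eps F F _ e3.
pose K := 2 * nrm F + 1; have K0 : 0 < K by rewrite ltr_wpDl// mulr_ge0 ?nrm_ge0.
pose d3 := Num.min 1 (e / 3 / K); have d30 : 0 < d3 by rewrite lt_min ltr01 divr_gt0.
have [|x hx] := @comp_near F (Num.min d1 d3); first by rewrite lt_min d10.
move: hx; rewrite !le_min => /and3P[x1 x2 x3].
have bx : sn x <= nrm F + 1.
  by rewrite -comp_emb_nrm -lerBlDl (le_trans _ x2)// nrmBC (le_trans (ler_norm _))// ler_dist_nrm.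
have hF : normc (F x - s x x) <= e / 3.
  rewrite -[s x x]/(comp_emb x x) -comp_subE (le_trans (nrmF _ _))//.
  rewrite (le_trans (ler_wpM2r (sn_ge0 _) x3))// mulrAC ler_pdivrMr// ler_wpM2l ?(ltW e3)//.
  by rewrite (le_trans bx)// /K lerD2r ler_peMl ?nrm_ge0// ler1n.
have hq : normc ((sn x ^+ 2)%:C - (nrm F ^+ 2)%:C) <= e / 3.
  rewrite -rmorphB normc_real subr_sqr normrM.
  have h : `|sn x - nrm F| <= e / 3 / K.
    by rewrite -comp_emb_nrm (le_trans (ler_dist_nrm _ _))// nrmBC.
  rewrite (le_trans (ler_wpM2r (normr_ge0 _) h))// mulrAC ler_pdivrMr// ler_wpM2l ?(ltW e3)//.
  rewrite ger0_norm ?addr_ge0 ?nrm_ge0//.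
  by rewrite (le_trans (lerD bx (lexx _)))// /K mulr_natl mulr2n addrAC.
have -> : (nrm F ^+ 2)%:C - comp_dot F F =
  - ((comp_dot F F - F x) + (F x - s x x) + ((sn x ^+ 2)%:C - (nrm F ^+ 2)%:C)).
  by rewrite sn_sqr -(sqE sP); ring.
rewrite normcN; have -> : e = e / 3 + e / 3 + e / 3 by field.
rewrite (le_trans (normcD _ _))// lerD// (le_trans (normcD _ _))// lerD//.
exact: h1.
Qed.

Definition comp_hilbert : hilbertType R := mk_hilbert dotL dotC dotN.

(** The last clause is a form of Riesz representation; operators on H are defined through it, by
    prescribing their inner products with the dense image of V. *)
Lemma hilbert_completion : exists (H : hilbertType R) (i : V -> H),
  [/\ forall k x y, i (k *: x + y) = k *: i x + i y,
      forall x y, hdot H (i x) (i y) = s x y,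
      forall (F : H) (e : R), 0 < e -> exists x, nrm (F - i x) <= e &
      forall F : V -> C, comp_pred F -> exists G : H, forall y, hdot H G (i y) = F y].
Proof.
exists comp_hilbert, comp_emb; split.
- exact: comp_lin_emb.
- by move=> x y; exact: comp_dot_emb.
- exact: comp_near.
- by move=> F hF; exists (Completion hF) => y; exact: comp_dot_emb.
Qed.

End Completion.

(** * The GNS construction *)

Lemma hdot_dense_eq0 (R : realType) (H : hilbertType R) (D : H -> Prop) (F : H) :
  (forall e : R, 0 < e -> exists2 G, D G & nrm (F - G) <= e) ->
  (forall G, D G -> hdot H F G = 0) -> F = 0.
Proof.
move=> dD F0; apply: nrm_small => e e0.
have [G DG FG] := dD _ e0.
have [->|F1] := eqVneq F 0; first by rewrite nrm0 ltW.
have nF : 0 < nrm F.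
  by rewrite lt_neqAle nrm_ge0 andbT eq_sym; apply: contra F1 => /eqP/nrm_eq0/eqP.
have : nrm F ^+ 2 <= nrm F * nrm (F - G).
  apply: le_trans (Re_hdot_le _ _).
  by rewrite hdotBr (F0 _ DG) subr0 hdot_nrm.
by rewrite expr2 ler_pM2l// => /le_trans; apply.
Qed.

Lemma hdot_dense_eq (R : realType) (H : hilbertType R) (D : H -> Prop) (F G : H) :
  (forall F (e : R), 0 < e -> exists2 G, D G & nrm (F - G) <= e) ->
  (forall x, D x -> hdot H F x = hdot H G x) -> F = G.
Proof.
move=> dD FG; apply/eqP; rewrite -subr_eq0; apply/eqP.
apply: (hdot_dense_eq0 (dD _)) => x Dx.
by rewrite hdotBl FG// subrr.
Qed.

Lemma linear_le_continuous (R : realType) (H : hilbertType R) (T : H -> H) (K : R) :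
  linear T -> (forall x, nrm (T x) <= K * nrm x) -> continuous T.
Proof.
move=> Tl TK x; apply/cvgrPdist_le => e' e'0; have [e e0 ->] := gt0_complexP e'0.
have K1 : 0 < `|K| + 1 by rewrite ltr_wpDl.
have eC : 0 < (e / (`|K| + 1))%:C :> R[i] by rewrite ltcR divr_gt0.
near=> y; rewrite nrmE lecR.
have -> : T x - T y = T (x - y).
  by rewrite addrC -scaleN1r -Tl scaleN1r addrC.
rewrite (le_trans (TK _))//.
have : nrm (x - y) <= e / (`|K| + 1).
  rewrite -lecR -nrmE; near: y.
  have /cvgrPdist_le : (id : H -> H) @ x --> x by exact: cvg_id.
  by move=> /(_ _ eC).
rewrite ler_pdivlMr// => h; rewrite (le_trans _ h)// mulrC ler_wpM2l ?nrm_ge0//.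
by rewrite (le_trans (ler_norm K))// lerDl.
Unshelve. all: by end_near. Qed.

Section GNS.
Variables (R : realType) (U : cStarAlgType R) (e : U).
Local Notation C := R[i].
Implicit Types a b h x y z : U.
Local Notation "x ** y" := (cmul x y) (at level 40, left associativity).
Local Notation "x ^*c" := (cstar x) (at level 2, format "x ^*c").
Hypothesis cmul1 : forall x, e ** x = x.
Hypothesis cmulr1 : forall x, x ** e = x.
Hypothesis nrm1 : nrm e = 1.

Section PureState.
Variable f : U -> R.
Hypotheses (fl : rlin f) (fp : forall x, f x <= lamp e x).
Hypothesis fext : forall f1 f2, rlin f1 -> rlin f2 -> (forall x, f1 x <= lamp e x) ->
  (forall x, f2 x <= lamp e x) -> (forall x, f1 x + f2 x = 2 * f x) -> forall x, f1 x = f x.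

Let fD x y : f (x + y) = f x + f y. Proof. by case: fl. Qed.
Let fZ (t : R) x : f (t%:C *: x) = t * f x. Proof. by case: fl => _ /(_ t x). Qed.
Let fN x : f (- x) = - f x. Proof. exact: stateN fl x. Qed.
Let fB x y : f (x - y) = f x - f y. Proof. by rewrite fD fN. Qed.

Let f_star x : f x^*c = f x.
Proof.
have h y : f y <= f y^*c.
  rewrite -subr_ge0 -fB -lerN2 oppr0 -fN opprB (le_trans (fp _))//.
  apply: (@lamp_le _ _ _ nrm1 _ 0) => //.
  have E : y - y^*c + (y^*c - y) = 0 by lmod R U.
  by rewrite /rsc scale0r add0r /cre cstarB cstarK E /rsc scaler0 nrm0 addr0.
by apply: le_anti; rewrite h -{2}[x]cstarK h.
Qed.

Let f_pos x : 0 <= f (x^*c ** x).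
Proof. by rewrite -lerN2 oppr0 -fN (le_trans (fp _))// lamp_Nstar. Qed.

Let i : C := 0 +i* 1.

(** The complex linear functional whose real part is f. *)
Definition cstate x : C := f x +i* - f (i *: x).

Let cstateL (k : C) x y : cstate (k *: x + y) = k * cstate x + cstate y.
Proof.
case: k => a b; have -> : a +i* b = a%:C + b%:C * i.
  by apply/eqP; rewrite eq_complex /=; apply/andP; split; apply/eqP; ring.
have E z : (a%:C + b%:C * i) *: z = a%:C *: z + b%:C *: (i *: z).
  by rewrite scalerDl scalerA.
have ii z : i *: (i *: z) = - z.
  rewrite scalerA; have -> : i * i = -1 by apply/eqP; rewrite eq_complex /=; apply/andP; split; apply/eqP; ring.
  by rewrite scaleN1r.
have iC z : i *: ((a%:C + b%:C * i) *: z) = a%:C *: (i *: z) - b%:C *: z.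
  rewrite E; transitivity (a%:C *: (i *: z) + b%:C *: (i *: (i *: z))); first by lmod R U.
  by rewrite ii scalerN.
rewrite /cstate scalerDr iC E !fD fN !fZ.
by apply/eqP; rewrite eq_complex /=; apply/andP; split; apply/eqP; ring.
Qed.

Let cstate_star x : cstate x^*c = (cstate x)^*%R.
Proof.
rewrite /cstate f_star conjCE /=.
have -> : i *: x^*c = - (i *: x)^*c.
  by rewrite cstarZ conjCE -scaleNr; congr (_ *: _); apply/eqP; rewrite eq_complex /= oppr0 opprK !eqxx.
by rewrite fN f_star.
Qed.

Let cstate_pos x : cstate (x^*c ** x) = (f (x^*c ** x))%:C.
Proof.
have := cstate_star (x^*c ** x); rewrite cstarM cstarK conjCE /cstate /= => -[h].
by congr (_ +i* _); lra.
Qed.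

Let s x y := cstate (y^*c ** x).

Let sL (k : C) x y z : s (k *: x + y) z = k * s x z + s y z.
Proof. by rewrite /s cmulDr cmulZr cstateL. Qed.
Let sC x y : s y x = (s x y)^*%R.
Proof. by rewrite /s -cstate_star cstarM cstarK. Qed.
Let sP x : 0 <= s x x.
Proof. by rewrite /s cstate_pos ler0c f_pos. Qed.

(** For v slightly above |a|^2 the element v - a* a is a square r^2, and f is nonnegative on (r x)*
    (r x). *)
Let sn_mul a x : Num.sqrt (sq s (a ** x)) <= nrm a * Num.sqrt (sq s x).
Proof.
rewrite -[nrm a]ger0_norm ?nrm_ge0// -sqrtr_sqr -sqrtrM ?sqr_ge0// ler_wsqrtr//.
rewrite /sq /s !cstate_pos /=; apply/ler_addgt0Pl => d d0.
set q := f (x^*c ** x); have q0 : 0 <= q by exact: f_pos.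
have q1 : 0 < q + 1 by rewrite ltr_wpDl.
pose v := nrm a ^+ 2 + d / (q + 1).
have av : lamp e (a^*c ** a) < v.
  by rewrite (le_lt_trans (lamp_nrm nrm1 _))// nrm_star_mul ltrDl divr_gt0.
have [|r [rs rr _]] := lamp_lt_sqrt cmul1 cmulr1 nrm1 _ av; first by rewrite cstarM cstarK.
have := f_pos (r ** x).
rewrite cstarM rs -cmulA [r ** (_ ** _)]cmulA rr cmulBl cmulBr /rsc cmulZl cmul1 cmulZr fB fZ -/q.
rewrite cstarM !cmulA.
have -> : v * q = nrm a ^+ 2 * q + d * q / (q + 1) by rewrite /v; field; rewrite gt_eqF.
have : d * q / (q + 1) <= d.
  by rewrite ler_pdivrMr// ler_wpM2l ?(ltW d0)// lerDl.
lra.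
Qed.

(** A closed invariant subspace M splits the cyclic vector as xi = m + xi2, and f into the positive
    functionals of m and xi2. Extremality of f makes these proportional to f, so m is a multiple of
    xi; then either m = 0 and M = 0, or xi is in M. *)
Lemma gns_pure : exists (H : hilbertType R) (pi : U -> H -> H) (xi : H),
  [/\ is_hrep pi, forall a, hdot H (pi a xi) xi = cstate a,
     forall F (d : R), 0 < d -> exists x, nrm (F - pi x xi) <= d,
     forall F, pi e F = F &
     forall M : H -> Prop, aclosed M -> M 0 ->
      (forall (k : C) v w, M v -> M w -> M (k *: v + w)) ->
      (forall a v, M v -> M (pi a v)) -> (forall v, M v -> v = 0) \/ (forall v, M v)].
Proof.
have [H [j [jL js jd jF]]] := hilbert_completion sL sC sP.
have jD F (d : R) : 0 < d -> exists2 G, (exists x, G = j x) & nrm (F - G) <= d.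
  by move=> d0; have [x hx] := jd F _ d0; exists (j x) => //; exists x.
have jext F G : (forall x, hdot H F (j x) = hdot H G (j x)) -> F = G.
  by move=> h; apply: (hdot_dense_eq jD) => _ [x ->].
have jn x : nrm (j x) = Num.sqrt (sq s x).
  have := js x x; rewrite (sqE sP) hdot_nrm => /complexI <-.
  by rewrite sqrtr_sqr ger0_norm ?nrm_ge0.
have piP a F : exists G : H, forall y, hdot H G (j y) = hdot H F (j (a^*c ** y)).
  apply: jF => d d0; have a1 : 0 < nrm a + 1 by rewrite ltr_wpDl ?nrm_ge0.
  have [x hx] := jd F _ (divr_gt0 d0 a1); exists (a ** x) => y.
  have -> : s (a ** x) y = hdot H (j x) (j (a^*c ** y)).
    by rewrite js /s cstarM cstarK cmulA.
  rewrite -hdotBl (le_trans (hdot_CS _ _))// jn.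
  apply: (@le_trans _ _ (d / (nrm a + 1) * ((nrm a + 1) * Num.sqrt (sq s y)))).
    apply: ler_pM; rewrite ?nrm_ge0 ?sqrtr_ge0//.
    rewrite (le_trans (sn_mul _ _))// nrm_cstar ler_wpM2r ?sqrtr_ge0//.
    by rewrite lerDl.
  by rewrite mulrA divfK// gt_eqF.
pose pi a F : H := sval (cid (piP a F)).
have piE a F y : hdot H (pi a F) (j y) = hdot H F (j (a^*c ** y)) by rewrite /pi; case: cid.
have piJ a x : pi a (j x) = j (a ** x).
  by apply: jext => y; rewrite piE !js /s cstarM cstarK cmulA.
have pi_lin a : linear (pi a).
  by move=> k F G; apply: jext => y; rewrite piE !(hdotDl, hdotZl) !piE.
have piB a F G : pi a (F - G) = pi a F - pi a G.
  by rewrite addrC -scaleN1r pi_lin scaleN1r addrC.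
(* The vector G = pi a F is approximated by an embedded j x, whose inner product with G is known
   from [piE]. *)
have pib a F : nrm (pi a F) <= nrm a * nrm F.
  apply/ler_addgt0Pl => d' d'0; set G := pi a F.
  pose d := d' / 2; have d0 : 0 < d by rewrite divr_gt0.
  have [x hx] := jd G _ d0.
  have key : nrm (j x) ^+ 2 <= nrm (j x) * (nrm a * nrm F + d).
    have -> : nrm (j x) ^+ 2 = complex.Re (hdot H G (j x)) - complex.Re (hdot H (G - j x) (j x)).
      by rewrite -raddfB -hdotBl opprB addrC subrK hdot_nrm.
    rewrite mulrDr lerD//.
      rewrite piE (le_trans (Re_hdot_le _ _))// [nrm (j x) * _]mulrC [nrm a * _]mulrC -mulrA.
      by rewrite ler_wpM2l ?nrm_ge0// !jn (le_trans (sn_mul _ _))// nrm_cstar.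
    rewrite -raddfN (le_trans (Re_le_normc _))// normcN (le_trans (hdot_CS _ _))// mulrC.
    by rewrite ler_wpM2l ?nrm_ge0.
  have : nrm (j x) <= nrm a * nrm F + d.
    have [j0|j0] := eqVneq (nrm (j x)) 0.
      by rewrite j0 addr_ge0 ?mulr_ge0 ?nrm_ge0 ?ltW.
    by move: key; rewrite expr2 ler_pM2l// lt_neqAle eq_sym j0 nrm_ge0.
  have -> : d' = d + d by rewrite /d -splitr.
  have := nrmD (G - j x) (j x); rewrite subrK; lra.
have pi_lin2 (k : C) a b F : pi (k *: a + b) F = k *: pi a F + pi b F.
  apply: jext => y; rewrite piE !(hdotDl, hdotZl) !piE cstarD cstarZ cmulDl cmulZl jL.
  by rewrite hdotDr hdotZr conjCK.
have pi_mul a b F : pi (a ** b) F = pi a (pi b F).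
  by apply: jext => y; rewrite !piE cstarM cmulA.
have pi_star a F G : hdot H (pi a F) G = hdot H F (pi a^*c G).
  apply/eqP; rewrite -subr_eq0; apply/eqP/normc_small => d d0.
  pose K := nrm (pi a F) + nrm F * nrm a + 1.
  have K0 : 0 < K by rewrite ltr_wpDl// addr_ge0 ?mulr_ge0 ?nrm_ge0.
  have [y hy] := jd G _ (divr_gt0 d0 K0).
  have -> : hdot H (pi a F) G - hdot H F (pi a^*c G) =
      hdot H (pi a F) (G - j y) - hdot H F (pi a^*c (G - j y)).
    by rewrite piB piJ !hdotBr piE; ring.
  rewrite (le_trans (normcD _ _))// normcN.
  have h1 := hdot_CS (pi a F) (G - j y); have h2 := hdot_CS F (pi a^*c (G - j y)).
  have h3 := pib a^*c (G - j y); rewrite nrm_cstar in h3.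
  have {}h2 : normc (hdot H F (pi a^*c (G - j y))) <= nrm F * nrm a * nrm (G - j y).
    by rewrite (le_trans h2)// -mulrA ler_wpM2l ?nrm_ge0.
  rewrite (le_trans (lerD h1 h2))// -mulrDl.
  apply: (@le_trans _ _ (K * (d / K))); last by rewrite mulrCA divff ?mulr1// gt_eqF.
  apply: ler_pM; rewrite ?nrm_ge0 ?addr_ge0 ?mulr_ge0 ?nrm_ge0//.
  by rewrite /K lerDl.
have xiE x : pi x (j e) = j x by rewrite piJ cmulr1.
have pi_e F : pi e F = F.
  by apply: jext => y; rewrite piE (cstar1 cmulr1) cmul1.
have hrep : is_hrep pi.
  split => // a; exact: (linear_le_continuous (pi_lin a) (pib a)).
have pixi a : hdot H (pi a (j e)) (j e) = cstate a.
  by rewrite xiE js /s (cstar1 cmulr1) cmul1.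
exists H, pi, (j e); split => //.
  by move=> F d d0; have [x hx] := jd F _ d0; exists x; rewrite xiE.
move=> M Mc M0 ML Mpi; set xi := j e in pixi *.
have MZ k v : M v -> M (k *: v) by move=> Mv; rewrite -[_ *: _]addr0; apply: ML.
have [m Mm mo] := hilbert_projection Mc M0 ML xi.
have Mall : M xi -> forall v, M v.
  move=> Mxi x; apply: Mc => d d0; have [y hy] := jd x _ d0.
  by exists (j y) => //; rewrite -xiE; apply: Mpi.
have [m0|m0] := eqVneq m 0.
  left => y My; apply: (hdot_dense_eq0 (jD y)) => _ [x ->].
  by rewrite -xiE hdotC pi_star -[j e](subr0 _) -m0 mo ?conjC0//; exact: Mpi.
right; have [m1|m1] := eqVneq (xi - m) 0.
  by apply: Mall; move/eqP: m1; rewrite subr_eq0 => /eqP ->.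
have pos (v : H) : v != 0 -> 0 < nrm v ^+ 2.
  by move=> x0; rewrite exprn_gt0// lt_neqAle nrm_ge0 andbT eq_sym; apply: contra x0 => /eqP/nrm_eq0/eqP.
pose xi2 := xi - m; pose al := nrm m ^+ 2; pose be := nrm xi2 ^+ 2.
have al0 : 0 < al by exact: pos.
have be0 : 0 < be by exact: pos.
pose g (v : H) x := complex.Re (hdot H (pi x v) v).
have gl v : rlin (g v).
  split; first by move=> x y; rewrite /g -[x]scale1r pi_lin2 !scale1r hdotDl raddfD.
  move=> t x; rewrite /g -[t%:C *: x]addr0 pi_lin2.
  have -> : pi 0 v = 0.
    by have := pi_lin2 (-1) 0 0 v; rewrite scaler0 addr0 scaleN1r addNr.
  by rewrite addr0 hdotZl ReM_real.
have gstar v x : g v x^*c = g v x.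
  by rewrite /g pi_star cstarK hdotC conjCE.
have gre v x : g v x = g v (cre x).
  by rewrite /cre /rsc (gl v).2 (gl v).1 gstar; field.
(* Apply the operator bound to t + Re x, with t such that |t + Re x| - t is close to [lamp]. *)
have gle v x : g v x <= nrm v ^+ 2 * lamp e x.
  rewrite gre; apply/ler_addgt0Pl => d d0.
  have v0 : 0 <= nrm v ^+ 2 by rewrite sqr_ge0.
  have v1 : 0 < nrm v ^+ 2 + 1 by rewrite ltr_wpDl.
  have [|t t0 ht] := @lamp_lt _ _ _ nrm1 x (lamp e x + d / (nrm v ^+ 2 + 1)).
    by rewrite ltrDl divr_gt0.
  have : g v (rsc t e + cre x) <= nrm (rsc t e + cre x) * nrm v ^+ 2.
    rewrite /g (le_trans (Re_hdot_le _ _))// expr2 mulrA ler_wpM2r ?nrm_ge0//.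
  rewrite (gl v).1 (gl v).2.
  have -> : g v e = nrm v ^+ 2 by rewrite /g pi_e hdot_nrm.
  have : nrm (rsc t e + cre x) * nrm v ^+ 2 <= (t + (lamp e x + d / (nrm v ^+ 2 + 1))) * nrm v ^+ 2.
    by rewrite ler_wpM2r// ltW.
  have : d / (nrm v ^+ 2 + 1) * nrm v ^+ 2 <= d.
    by rewrite mulrAC ler_pdivrMr// ler_wpM2l ?(ltW d0)// lerDl.
  by move: (d / _) (nrm (_ + _)) => a b; lra.
have cross x : hdot H (pi x xi) m = hdot H (pi x m) m.
  rewrite -{1}[xi](subrK m) -[xi - m]scale1r pi_lin scale1r hdotDl.
  by rewrite (pi_star x) mo ?add0r//; exact: Mpi.
have fg x : f x = g m x + g xi2 x.
  have -> : f x = g xi x by rewrite /g pixi.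
  have -> : xi2 = (-1) *: m + xi by rewrite scaleN1r addrC.
  rewrite /g pi_lin !(hdotDl, hdotDr, hdotZl, hdotZr) cross.
  have -> : hdot H (pi x m) xi = hdot H (pi x m) m.
    by rewrite hdotC -[pi x]/(pi x) [RHS]hdotC -[x]cstarK -!pi_star cross.
  by rewrite -!raddfD; congr complex.Re; rewrite rmorphN1; ring.
have ab : al + be = 1.
  have := fg e; rewrite (state1 cmulr1 nrm1 fl fp) /g !pi_e !hdot_nrm /=.
  by move=> ->.
have alN : al != 0 by rewrite gt_eqF.
have beE : be = 1 - al by rewrite -ab addrC addKr.
have beN : 1 - al != 0 by rewrite -beE gt_eqF.
(* Small enough for the coefficients 1 - de/al and 1 - de/be in f1 and f2 to stay nonnegative, so
   that both remain below [lamp]. *)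
pose de := Num.min al be; have de0 : 0 < de by rewrite lt_min al0.
pose f1 x := f x + de * (g m x / al - g xi2 x / be).
pose f2 x := f x - de * (g m x / al - g xi2 x / be).
have f12l : rlin f1 /\ rlin f2.
  have [gm1 gm2] := gl m; have [gx1 gx2] := gl xi2.
  by split; split; move=> *; rewrite /f1 /f2 ?fD ?fZ ?gm1 ?gm2 ?gx1 ?gx2; ring.
have dea : de <= al by rewrite ge_min lexx.
have deb : de <= be by rewrite ge_min lexx orbT.
have [c1 c2] : 0 <= 1 - de / al /\ 0 <= 1 - de / be.
  by rewrite !subr_ge0 !ler_pdivrMr// !mul1r.
have [c3 c4] : 0 <= 1 + de / al /\ 0 <= 1 + de / be.
  by split; rewrite addr_ge0// divr_ge0// ltW.
have f1p x : f1 x <= lamp e x.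
  rewrite /f1 fg.
  have -> : g m x + g xi2 x + de * (g m x / al - g xi2 x / be) =
     (1 + de / al) * g m x + (1 - de / be) * g xi2 x by ring.
  have -> : lamp e x = (1 + de / al) * (al * lamp e x) + (1 - de / be) * (be * lamp e x).
    by rewrite beE; field; rewrite ?alN ?beN.
  by rewrite lerD// ler_wpM2l ?gle.
have f2p x : f2 x <= lamp e x.
  rewrite /f2 fg.
  have -> : g m x + g xi2 x - de * (g m x / al - g xi2 x / be) =
     (1 - de / al) * g m x + (1 + de / be) * g xi2 x by ring.
  have -> : lamp e x = (1 - de / al) * (al * lamp e x) + (1 + de / be) * (be * lamp e x).
    by rewrite beE; field; rewrite ?alN ?beN.
  by rewrite lerD// ler_wpM2l ?gle.
have gf x : g m x = al * f x.
  have := fext f12l.1 f12l.2 f1p f2p _ x; rewrite {1}/f1 {1}/f2 => h.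
  have {}h : de * (g m x / al - g xi2 x / be) = 0.
    by move: h => /(_ _)/(congr1 (fun t => t - f x)); rewrite addrAC subrr add0r; apply => y; rewrite /f1 /f2; ring.
  have : g m x / al = g xi2 x / be.
    by apply/eqP; move/eqP: h; rewrite mulf_eq0 gt_eqF//= subr_eq0.
  rewrite fg => h2; have -> : g xi2 x = be * (g m x / al) by rewrite h2 mulrC divfK// gt_eqF.
  by rewrite beE; field; rewrite ?alN ?beN.
have mxi : m - al%:C *: xi = 0.
  apply: (hdot_dense_eq0 (jD _)) => _ [x ->].
  (* Only real parts are known to vanish; the imaginary part is obtained by replacing x with i x. *)
  have key y : complex.Re (hdot H (j y) (m - al%:C *: xi)) = 0.
    rewrite -xiE hdotBr hdotZr conj_real cross pixi ReB ReM_real.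
    by have := gf y; rewrite /g => ->; rewrite subrr.
  rewrite hdotC; have k1 := key x; have k2 := key (i *: x).
  have j0 : j 0 = 0.
    by have := jL (-1) 0 0; rewrite scaler0 addr0 scaleN1r addNr.
  have jZ : j (i *: x) = i *: j x by rewrite -[i *: x]addr0 jL j0 addr0.
  move: k2; rewrite jZ hdotZl; move: (hdot H (j x) _) k1 => [a b] /= ->.
  by rewrite mul0r mul1r sub0r => /eqP; rewrite oppr_eq0 => /eqP ->; exact: conjC0.
apply: Mall; have -> : xi = (al^-1)%:C *: m.
  move/eqP: mxi; rewrite subr_eq0 => /eqP ->; rewrite scalerA -rmorphM mulVf ?scale1r//.
exact: MZ.
Qed.

End PureState.

(** By positivity x* x + d/2 is a square, and [nrm_sqr_lamp] bounds its norm by its [lamp]. *)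
Lemma lamp_star_mul x : lamp e (x^*c ** x) = nrm x ^+ 2.
Proof.
apply: le_anti; rewrite -nrm_star_mul lamp_nrm//=.
move hE : (x^*c ** x) => h; have hs : h^*c = h by rewrite -hE cstarM cstarK.
apply/ler_addgt0Pl => d d0; have d2 : 0 < d / 2 by rewrite divr_gt0.
have lh : lamp e (- h) < d / 2.
  by rewrite (le_lt_trans _ d2)// -hE lamp_Nstar.
have hNs : (- h)^*c = - h by rewrite cstarN hs.
have [r [rs rr _]] := lamp_lt_sqrt cmul1 cmulr1 nrm1 hNs lh.
have ne : nrm (rsc (d / 2) e) = d / 2 by rewrite nrm_rsc nrm1 mulr1 gtr0_norm.
have le : lamp e (rsc (d / 2) e) <= d / 2 by rewrite -{2}ne lamp_nrm.
have hE2 : h = r ** r - rsc (d / 2) e by rewrite rr opprK addrC addKr.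
have := nrmB (r ** r) (rsc (d / 2) e); rewrite -hE2 ne nrm_sa//.
have := nrm_sqr_lamp cmul1 cmulr1 nrm1 rs.
have hE3 : h + rsc (d / 2) e = r ** r by rewrite hE2 subrK.
have := lampD nrm1 h (rsc (d / 2) e); rewrite hE3; lra.
Qed.

Theorem exists_irreducible_rep x : exists (H : hilbertType R) (pi : U -> H -> H) (xi : H),
  [/\ is_hrep pi, nrm xi = 1, nrm (pi x xi) = nrm x, forall v, pi e v = v &
    forall M : H -> Prop, aclosed M -> M 0 ->
      (forall (k : C) v w, M v -> M w -> M (k *: v + w)) ->
      (forall a v, M v -> M (pi a v)) -> (forall v, M v -> v = 0) \/ (forall v, M v)].
Proof.
have [f [fl fp fx fext]] := lamp_extreme nrm1 (x^*c ** x).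
have [H [pi [xi [hrep pixi _ pie irr]]]] := gns_pure fl fp fext.
have fst a : complex.Re (hdot H (pi a xi) xi) = f a by rewrite pixi.
exists H, pi, xi; split => //.
  have := fst e; rewrite pie hdot_nrm (state1 cmulr1 nrm1 fl fp) /= => h.
  by apply/eqP; rewrite -(@eqrXn2 _ 2)// ?nrm_ge0// h expr1n.
have h : nrm (pi x xi) ^+ 2 = nrm x ^+ 2.
  rewrite -lamp_star_mul -fx -fst (hrep_mul hrep).
  have -> : hdot H (pi x^*c (pi x xi)) xi = hdot H (pi x xi) (pi x xi).
    by rewrite (hrep_star hrep) cstarK.
  by rewrite hdot_nrm.
by apply/eqP; rewrite -(@eqrXn2 _ 2)// ?nrm_ge0// h.
Qed.

End GNS.

(** * Unitization and matrix representations *)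

Section Unitization.
Variables (R : realType) (A : cStarAlgType R).
Local Notation C := R[i].
Local Notation "x ** y" := (cmul x y) (at level 40, left associativity).
Local Notation "x ^*c" := (cstar x) (at level 2, format "x ^*c").

Definition unitz : Type := (A * R[i])%type.
HB.instance Definition _ := GRing.Lmodule.copy unitz (A * R[i]^o)%type.
Implicit Types x y z : unitz.

Lemma unitz_eq x y : x.1 = y.1 -> x.2 = y.2 -> x = y.
Proof. by case: x y => [a k] [b l] /= -> ->. Qed.

Definition uact x (b : A) : A := x.1 ** b + x.2 *: b.
Definition umul x y : unitz := (x.1 ** y.1 + x.2 *: y.1 + y.2 *: x.1, x.2 * y.2).
Definition ustar x : unitz := (x.1^*c, x.2^*%R).
Definition uone : unitz := (0, 1).
Definition uemb (a : A) : unitz := (a, 0).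

Lemma uadd1 x y : (x + y).1 = x.1 + y.1. Proof. by []. Qed.
Lemma uadd2 x y : (x + y).2 = x.2 + y.2. Proof. by []. Qed.
Lemma uscale1 (k : C) x : (k *: x).1 = k *: x.1. Proof. by []. Qed.
Lemma uscale2 (k : C) x : (k *: x).2 = k * x.2. Proof. by []. Qed.

Lemma uactD x y b : uact (x + y) b = uact x b + uact y b.
Proof. by rewrite /uact uadd1 uadd2 cmulDl; lmod R A. Qed.

Lemma uactZ k x b : uact (k *: x) b = k *: uact x b.
Proof. by rewrite /uact uscale1 uscale2 cmulZl; lmod R A. Qed.

Lemma uactM x y b : uact (umul x y) b = uact x (uact y b).
Proof. by rewrite /uact /umul /= !(cmulDl, cmulZl, cmulDr, cmulZr) cmulA; lmod R A. Qed.

Lemma uact_star x b : (uact x b)^*c ** uact x b = b^*c ** uact (umul (ustar x) x) b.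
Proof.
rewrite /uact /umul /ustar /= !(cstarD, cstarM, cstarZ) !(cmulDl, cmulZl, cmulDr, cmulZr) !cmulA.
by lmod R A.
Qed.

(** Left multiplication on A alone would not separate points when A already has a unit; the bound on
    the scalar part restores a norm. *)
Definition ubound x : set R := [set M | normc x.2 <= M /\ forall b, nrm (uact x b) <= M * nrm b].
Definition unorm x : R := inf (ubound x).

Let uhas_inf x : has_inf (ubound x).
Proof.
split; last by exists (normc x.2) => M [].
exists (nrm x.1 + normc x.2); split; first by rewrite lerDr nrm_ge0.
move=> b; rewrite /uact (le_trans (nrmD _ _))// mulrDl nrmZ lerD2r.
exact: nrm_cmul.
Qed.

Lemma unorm2 x : normc x.2 <= unorm x.
Proof. by apply: lb_le_inf; [case: (uhas_inf x)|move=> M []]. Qed.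

Lemma unorm_ge0 x : 0 <= unorm x.
Proof. exact: le_trans (normc_ge0 _) (unorm2 x). Qed.

Lemma unormP x b : nrm (uact x b) <= unorm x * nrm b.
Proof.
apply/ler_addgt0Pl => e e0; have y1 : 0 < nrm b + 1 by rewrite ltr_wpDl ?nrm_ge0.
have [|M [M0 hM] hlt] := @inf_lt _ (ubound x) (unorm x + e / (nrm b + 1)) (uhas_inf x).1.
  by rewrite ltrDl divr_gt0.
rewrite (le_trans (hM b))// (le_trans (ler_wpM2r (nrm_ge0 b) (ltW hlt)))//.
rewrite mulrDl addrC lerD2r mulrAC ler_pdivrMr// ler_wpM2l ?(ltW e0)//.
by rewrite lerDl.
Qed.

Lemma unorm_le x M : normc x.2 <= M -> (forall b, nrm (uact x b) <= M * nrm b) -> unorm x <= M.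
Proof. by move=> M0 hM; apply: ge_inf; [case: (uhas_inf x)|split]. Qed.

Lemma unorm_le_sum x : unorm x <= nrm x.1 + normc x.2.
Proof.
apply: unorm_le => [|b]; first by rewrite lerDr nrm_ge0.
by rewrite /uact (le_trans (nrmD _ _))// mulrDl nrmZ lerD2r nrm_cmul.
Qed.

(** Together with [unorm2] it makes Cauchy filters of pairs Cauchy in each component. *)
Lemma nrm_le_unorm x : nrm x.1 <= 2 * unorm x.
Proof.
have h b : nrm (x.1 ** b) <= 2 * unorm x * nrm b.
  have -> : x.1 ** b = uact x b - x.2 *: b by rewrite /uact addrK.
  have := unormP x b; have := unorm2 x; have := nrm_ge0 b.
  have := nrmB (uact x b) (x.2 *: b); rewrite nrmZ.
  move=> h1 h2 h3 h4; have : normc x.2 * nrm b <= unorm x * nrm b by rewrite ler_wpM2r.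
  lra.
have [->|x0] := eqVneq (nrm x.1) 0; first by rewrite mulr_ge0// unorm_ge0.
have x1 : 0 < nrm x.1 by rewrite lt_neqAle eq_sym x0 nrm_ge0.
rewrite -(ler_pM2r x1); have := h x.1^*c.
by rewrite nrm_cstar -{1}[x.1]cstarK nrm_star_mul nrm_cstar expr2.
Qed.

Let unormD x y : unorm (x + y) <= unorm x + unorm y.
Proof.
apply: unorm_le => [|b]; first by rewrite uadd2 (le_trans (normcD _ _))// lerD ?unorm2.
by rewrite uactD mulrDl (le_trans (nrmD _ _))// lerD ?unormP.
Qed.

Let unormZ_le k x : unorm (k *: x) <= normc k * unorm x.
Proof.
apply: unorm_le => [|b].
  by rewrite uscale2 ComplexField.Normc.normcM ler_wpM2l ?normc_ge0 ?unorm2.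
by rewrite uactZ nrmZ -mulrA ler_wpM2l ?normc_ge0 ?unormP.
Qed.

Let unormZ k x : unorm (k *: x) = normc k * unorm x.
Proof.
apply: le_anti; rewrite unormZ_le /=.
have [->|k0] := eqVneq k 0.
  by rewrite ComplexField.Normc.normc0 mul0r unorm_ge0.
have nk0 : 0 < normc k.
  rewrite lt_neqAle normc_ge0 andbT eq_sym; apply: contra k0.
  by move=> /eqP /ComplexField.Normc.eq0_normc ->.
rewrite -ler_pdivlMl// -ComplexField.Normc.normcV.
by rewrite -{1}[x](scalerK k0) unormZ_le.
Qed.

Let unorm_eq0 x : unorm x = 0 -> x = 0.
Proof.
move=> x0; have := nrm_le_unorm x; have := unorm2 x; rewrite x0 mulr0 => h1 h2.
case: x x0 h1 h2 => a k /= _ h1 h2; congr (_, _).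
  by apply: nrm_eq0; apply: le_anti; rewrite nrm_ge0 andbT.
by apply: ComplexField.Normc.eq0_normc; apply: le_anti; rewrite normc_ge0 andbT.
Qed.

Let ucnormD x y : (unorm (x + y))%:C <= (unorm x)%:C + (unorm y)%:C :> C.
Proof. by rewrite -rmorphD lecR unormD. Qed.
Let ucnormZ (k : C) x : (unorm (k *: x))%:C = `|k| * (unorm x)%:C.
Proof. by rewrite unormZ rmorphM. Qed.
Let ucnorm_eq0 x : (unorm x)%:C = 0 :> C -> x = 0.
Proof. by move=> /complexI /unorm_eq0. Qed.
HB.instance Definition _ := Lmodule_isNormed.Build C unitz ucnormD ucnormZ ucnorm_eq0.

Lemma unrmE x : nrm x = unorm x. Proof. by []. Qed.

Let ucomplete (F : set_system unitz) : ProperFilter F -> cauchy F -> cvg F.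
Proof.
move=> FF /cauchyP Fc.
have Fc' (e : R) : 0 < e -> exists x0 : unitz, \forall x \near F, nrm (x0 - x) <= e.
  move=> e0; have eC : 0 < e%:C :> C by rewrite ltcR.
  have [x0 hx0] := Fc _ eC; exists x0; apply: filterS hx0 => x.
  by rewrite -ball_normE /= nrmE ltcR => /ltW.
have /cvg_ex[/= a Fa] : cvg ((fun x : unitz => x.1) @ F).
  apply: cauchy_cvg; apply: cauchy_exP => e' e'0; have [e e0 ->] := gt0_complexP e'0.
  have e4 : 0 < e / 4 by rewrite divr_gt0.
  have [x0 hx0] := Fc' _ e4; exists x0.1.
  suff : \forall x \near F, ball x0.1 e%:C (x : unitz).1 by [].
  apply: filterS hx0 => x hx; rewrite -ball_normE /= nrmE ltcR.
  rewrite (le_lt_trans (nrm_le_unorm (x0 - x)))//.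
  by rewrite unrmE in hx; lra.
have /cvg_ex[/= k Fk] : cvg ((fun x : unitz => x.2) @ F).
  apply: cauchy_cvg; apply: cauchy_exP => e' e'0; have [e e0 ->] := gt0_complexP e'0.
  have e4 : 0 < e / 4 by rewrite divr_gt0.
  have [x0 hx0] := Fc' _ e4; exists x0.2.
  suff : \forall x \near F, ball x0.2 e%:C (x : unitz).2 by [].
  apply: filterS hx0 => x hx; rewrite -ball_normE /= Defs.normcE ltcR.
  rewrite (le_lt_trans (unorm2 (x0 - x)))//.
  by rewrite unrmE in hx; lra.
apply/cvg_ex; exists ((a, k) : unitz); apply/cvgrPdist_le => e' e'0.
have [e e0 ->] := gt0_complexP e'0.
have eC : 0 < (e / 2)%:C :> C by rewrite ltcR divr_gt0.
move/cvgrPdist_le : Fa => /(_ _ eC) Fa; move/cvgrPdist_le : Fk => /(_ _ eC) Fk.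
apply: filterS2 Fa Fk => x; rewrite nrmE lecR Defs.normcE lecR => ha hk.
rewrite nrmE lecR unrmE (le_trans (unorm_le_sum _))// (splitr e) lerD//.
Qed.
HB.instance Definition _ := Uniform_isComplete.Build unitz ucomplete.

Let umulA : associative umul.
Proof.
move=> [x k] [y l] [z m]; rewrite /umul /=; congr (_, _); last by ring.
by rewrite !(cmulDl, cmulZl, cmulDr, cmulZr) !cmulA; lmod R A.
Qed.
Let umulDl : left_distributive umul +%R.
Proof.
move=> [x k] [y l] [z m]; apply: unitz_eq => /=; last by ring.
by rewrite !(cmulDl, cmulZl, cmulDr, cmulZr); lmod R A.
Qed.
Let umulDr : right_distributive umul +%R.
Proof.
move=> [x k] [y l] [z m]; apply: unitz_eq => /=; last by ring.
by rewrite !(cmulDl, cmulZl, cmulDr, cmulZr); lmod R A.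
Qed.
Let umulZl (k : C) x y : umul (k *: x) y = k *: umul x y.
Proof.
case: x y => [x l] [y m]; apply: unitz_eq => /=; last exact: esym (mulrA k l m).
by rewrite -[k *: l]/(k * l) !(cmulDl, cmulZl, cmulDr, cmulZr); lmod R A.
Qed.
Let umulZr (k : C) x y : umul x (k *: y) = k *: umul x y.
Proof.
case: x y => [x l] [y m]; apply: unitz_eq => /=; last exact: mulrCA l k m.
by rewrite -[k *: m]/(k * m) !(cmulDl, cmulZl, cmulDr, cmulZr); lmod R A.
Qed.
Let unorm_mul x y : unorm (umul x y) <= unorm x * unorm y.
Proof.
apply: unorm_le => [|b]; rewrite /= ?ComplexField.Normc.normcM.
  by rewrite ler_pM ?normc_ge0 ?unorm2.
by rewrite uactM (le_trans (unormP _ _))// -mulrA ler_wpM2l ?unorm_ge0 ?unormP.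
Qed.
Let ustarK : involutive ustar.
Proof. by move=> [a k]; rewrite /ustar /= cstarK conjCK. Qed.
Let ustarD : {morph ustar : x y / x + y}.
Proof. by move=> x y; rewrite /ustar uadd1 uadd2 cstarD rmorphD. Qed.
Let ustarZ (k : C) x : ustar (k *: x) = k^*%R *: ustar x.
Proof. by rewrite /ustar uscale1 uscale2 cstarZ rmorphM. Qed.
Let ustarM x y : ustar (umul x y) = umul (ustar y) (ustar x).
Proof.
rewrite /ustar /umul /= rmorphM mulrC; congr (_, _).
by rewrite !cstarD !cstarZ cstarM; lmod R A.
Qed.
Let unorm_star_ge x : unorm x ^+ 2 <= unorm (umul (ustar x) x).
Proof.
set M := unorm (umul _ _); have M0 : 0 <= M by exact: unorm_ge0.
rewrite -[M]sqr_sqrtr//; apply: lerXn2r; rewrite ?nnegrE ?unorm_ge0 ?sqrtr_ge0//.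
apply: unorm_le => [|b].
  rewrite -[normc _]ger0_norm ?normc_ge0// -sqrtr_sqr ler_wsqrtr//.
  rewrite (le_trans _ (unorm2 _))//= ComplexField.Normc.normcM normc_conj expr2//.
rewrite -[nrm (uact x b)]ger0_norm ?nrm_ge0// -sqrtr_sqr.
rewrite -[nrm b]ger0_norm ?nrm_ge0// -sqrtr_sqr -sqrtrM// ler_wsqrtr//.
rewrite -nrm_star_mul uact_star (le_trans (nrm_cmul _ _))// nrm_cstar.
by rewrite expr2 mulrCA ler_wpM2l ?nrm_ge0// unormP.
Qed.
Let unorm_star_le x : unorm x <= unorm (ustar x).
Proof.
have [->|x0] := eqVneq (unorm x) 0; first exact: unorm_ge0.
have x1 : 0 < unorm x by rewrite lt_neqAle eq_sym x0 unorm_ge0.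
by rewrite -(ler_pM2r x1) -expr2 (le_trans (unorm_star_ge x)).
Qed.
Let ucnorm_mul x y : `|umul x y| <= `|x| * `|y|.
Proof. by rewrite !nrmE -rmorphM lecR unorm_mul. Qed.
Let ucnorm_star x : `|umul (ustar x) x| = `|x| ^+ 2.
Proof.
rewrite !nrmE -rmorphXn /=; congr _%:C; apply: le_anti; rewrite unorm_star_ge andbT.
rewrite (le_trans (unorm_mul _ _))// expr2 ler_wpM2r ?unorm_ge0//.
by rewrite -{2}[x]ustarK unorm_star_le.
Qed.

HB.instance Definition _ := Banach_isCStarAlgebra.Build R unitz
  umulA umulDl umulDr umulZl umulZr ucnorm_mul ustarK ustarD ustarZ ustarM ucnorm_star.

Lemma umul1 x : cmul uone x = x.
Proof.
rewrite /cmul /= /umul /= cmul0l scaler0 addr0 add0r scale1r mul1r.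
by case: x.
Qed.

Lemma umulr1 x : cmul x uone = x.
Proof.
rewrite /cmul /= /umul /= cmul0r scaler0 add0r add0r scale1r mulr1.
by case: x.
Qed.

Lemma unrm1 : nrm (uone : unitz) = 1.
Proof.
rewrite unrmE; apply: le_anti; apply/andP; split.
  rewrite (le_trans (unorm_le_sum _))//= nrm0 add0r.
  by rewrite expr1n expr0n addr0 sqrtr1.
by rewrite (le_trans _ (unorm2 _))//= expr1n expr0n addr0 sqrtr1.
Qed.

Lemma unrm_emb a : nrm (uemb a) = nrm a.
Proof.
rewrite unrmE; apply: le_anti; apply/andP; split.
  by rewrite (le_trans (unorm_le_sum _))//= expr0n addr0 sqrtr0 addr0.
have [->|x0] := eqVneq (nrm a) 0; first by rewrite unorm_ge0.
have x1 : 0 < nrm a by rewrite lt_neqAle eq_sym x0 nrm_ge0.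
rewrite -(ler_pM2r x1); have := unormP (uemb a) a^*c.
by rewrite /uact /= scale0r addr0 nrm_cstar -{1}[a]cstarK nrm_star_mul nrm_cstar expr2.
Qed.

End Unitization.

Lemma closed_aclosed (R : realType) (V : normedModType R[i]) (M : set V) :
  closed M -> aclosed M.
Proof.
move=> Mc x h; apply: Mc => B /nbhs_ballP[e' /= e'0 hB].
have [e e0 ee] := gt0_complexP e'0.
have [y My xy] := h _ (divr_gt0 e0 (ltr0n R 2)).
exists y; split => //; apply: hB; rewrite -ball_normE /= ee nrmE ltcR (le_lt_trans xy)//.
by rewrite ltr_pdivrMr// mulr_natr mulr2n ltrDl.
Qed.

(** * Orthonormal bases and matrices of representations *)

Section FiniteDim.
Variables (R : realType) (H : hilbertType R).
Local Notation C := R[i].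

Definition orthonormal m (v : 'I_m -> H) := forall i j, hdot H (v i) (v j) = (i == j)%:R.

Lemma hdot_suml (I : Type) (r : seq I) (v : I -> H) y :
  hdot H (\sum_(i <- r) v i) y = \sum_(i <- r) hdot H (v i) y.
Proof.
by elim: r => [|i r ih]; rewrite ?big_nil ?hdot0l// !big_cons hdotDl ih.
Qed.

Lemma hdot_sumr (I : Type) (r : seq I) (v : I -> H) y :
  hdot H y (\sum_(i <- r) v i) = \sum_(i <- r) hdot H y (v i).
Proof.
by elim: r => [|i r ih]; rewrite ?big_nil ?hdot0r// !big_cons hdotDr ih.
Qed.

Lemma orthonormal_coef m (v : 'I_m -> H) (c : 'I_m -> C) j : orthonormal v ->
  hdot H (\sum_i c i *: v i) (v j) = c j.
Proof.
move=> vo; rewrite hdot_suml (bigD1 j)//= hdotZl vo eqxx mulr1 big1 ?addr0// => i ij.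
by rewrite hdotZl vo (negPf ij) mulr0.
Qed.

Lemma orthonormal_size n m (v : 'I_m -> H) : hdim_le H n -> orthonormal v -> (m <= n)%N.
Proof.
move=> [u hu] vo; have [c hc] : exists c : 'I_m -> 'I_n -> C, forall i, v i = \sum_j c i j *: u j.
  have h i := cid (hu (v i)).
  by exists (fun i => sval (h i)) => i; case: (h i).
pose M : 'M[C]_(m, n) := \matrix_(i, j) c i j.
suff : row_free M by rewrite -row_leq_rank => /leq_trans -> //; exact: rank_leq_col.
apply/row_freeP; apply: contrapT => nf.
have : kermx M != 0 by apply: contra_notN nf => /eqP; rewrite -[_ = 0]/(kermx M = 0) => k0; apply/row_freeP; rewrite -kermx_eq0 k0.
case/rowV0Pn => w /sub_kermxP wM /eqP; apply.
apply/rowP => i; rewrite mxE.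
have : \sum_i w 0 i *: v i = 0.
  rewrite (eq_bigr (fun i => \sum_j (w 0 i * c i j) *: u j)); last first.
    by move=> k _; rewrite hc scaler_sumr; apply: eq_bigr => j _; rewrite scalerA.
  rewrite exchange_big big1// => j _; rewrite -scaler_suml.
  have := congr1 (fun X : 'rV_n => X 0 j) wM; rewrite !mxE.
  rewrite (eq_bigr (fun k => w 0 k * c k j)); last by move=> k _; rewrite mxE.
  by move=> ->; rewrite scale0r.
by move=> /(congr1 (fun x => hdot H x (v i))); rewrite orthonormal_coef// hdot0l.
Qed.

(** A maximal orthonormal family spans: a nonzero vector orthogonal to it could be normalised and
    added. *)
Lemma orthonormal_basis n : hdim_le H n -> exists m (v : 'I_m -> H), [/\ (m <= n)%N, orthonormal v &
  forall x, x = \sum_i hdot H x (v i) *: v i].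
Proof.
move=> Hn; pose P m := `[< exists v : 'I_m -> H, orthonormal v >].
have P0 : exists m, P m by exists 0%N; apply/asboolP; exists (fun _ => 0) => -[].
have Pn m : P m -> (m <= n)%N by move=> /asboolP[v vo]; exact: orthonormal_size vo.
case: (ex_maxnP P0 Pn) => m /asboolP[v vo] mmax; exists m, v; split => //.
  by apply: Pn; apply/asboolP; exists v.
move=> x; apply/eqP; rewrite -subr_eq0; apply/negPn/negP => z0.
set z := _ - _ in z0; have zo j : hdot H z (v j) = 0.
  by rewrite /z hdotBl (orthonormal_coef _ _ vo) subrr.
have nz : nrm z != 0 by apply: contra z0 => /eqP/nrm_eq0/eqP.
pose w := (nrm z)^-1%:C *: z.
have wo j : hdot H w (v j) = 0 by rewrite hdotZl zo mulr0.
have ww : hdot H w w = 1.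
  rewrite hdotZl hdotZr conj_real hdot_nrm -!rmorphM /=.
  have -> : (nrm z)^-1 * ((nrm z)^-1 * nrm z ^+ 2) = 1 by field.
  by [].
suff : P m.+1 by move=> /mmax; rewrite ltnn.
apply/asboolP; exists (fun i => if unlift ord0 i is Some j then v j else w) => i j.
case: unliftP => [i'|] ->; case: unliftP => [j'|] ->.
- by rewrite vo (inj_eq lift_inj).
- by rewrite hdotC wo conjC0.
- by rewrite wo.
- by rewrite ww eqxx.
Qed.

End FiniteDim.

Section MatrixOfRep.
Variables (R : realType) (A : cStarAlgType R) (H : hilbertType R) (pi : A -> H -> H).
Hypothesis hpi : is_hrep pi.
Variables (m : nat) (v : 'I_m -> H).
Hypotheses (vo : orthonormal v) (vb : forall x, x = \sum_i hdot H x (v i) *: v i).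

Definition mx_of_rep (a : A) : 'M[R[i]]_m := \matrix_(i, j) hdot H (pi a (v j)) (v i).

Lemma hrep_sum (I : Type) (r : seq I) (c : I -> R[i]) (w : I -> H) a :
  pi a (\sum_(i <- r) c i *: w i) = \sum_(i <- r) c i *: pi a (w i).
Proof.
have l := hrep_linear hpi a; have l0 : pi a 0 = 0.
  by have := l (-1) 0 0; rewrite scaler0 addr0 scaleN1r addNr.
by elim: r => [|i r ih]; rewrite ?big_nil// !big_cons l ih.
Qed.

Lemma mx_of_rep_is_rep : is_rep mx_of_rep.
Proof.
split=> [k a b|a b|a]; apply/matrixP => i j; rewrite !mxE.
- by rewrite (hrep_lin hpi) hdotDl hdotZl.
- rewrite (hrep_mul hpi) [pi b (v j)]vb hrep_sum hdot_suml; apply: eq_bigr => k _.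
  by rewrite hdotZl !mxE mulrC.
- by rewrite (hrep_star hpi) cstarK hdotC.
Qed.

Definition coord (x : H) : 'cV[R[i]]_m := \col_i hdot H x (v i).

Lemma coord_mul a x : mx_of_rep a *m coord x = coord (pi a x).
Proof.
apply/colP => i; rewrite !mxE [in RHS](vb x) hrep_sum hdot_suml; apply: eq_bigr => k _.
by rewrite !mxE hdotZl mulrC.
Qed.

Lemma vnorm_coord x : vnorm (coord x) = nrm x.
Proof.
apply/eqP; rewrite -(@eqrXn2 _ 2)// ?vnorm_ge0 ?nrm_ge0// vnorm_sqr.
apply/eqP/(@complexI R); rewrite -hdot_nrm.
transitivity (hdot H x (\sum_i hdot H x (v i) *: v i)); last by rewrite -vb.
rewrite hdot_sumr rmorph_sum.
apply: eq_bigr => i _; by rewrite hdotZr mxE [RHS]mulrC mul_conj_normc.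
Qed.

End MatrixOfRep.

(* The irreducible representations of the unitization restrict to irreducible
   representations of [A]. *)
Theorem matrix_rep_norm (R : realType) (A : cStarAlgType R) n :
  (forall (H : hilbertType R) (pi : A -> H -> H), is_hrep pi -> hirreducible pi -> hdim_le H n) ->
  forall a : A, a != 0 -> exists m (rho : A -> 'M[R[i]]_m), [/\ (m <= n)%N, is_rep rho &
    nrm a <= opnorm (rho a)].
Proof.
move=> An a a0.
have [H [pi [xi [hpi xi1 pia pie irr]]]] :=
  exists_irreducible_rep (@umul1 R A) (@umulr1 R A) (unrm1 A) (uemb a).
pose rho b := pi (uemb b).
have embL (k : R[i]) b c : uemb (k *: b + c) = k *: uemb b + uemb c.
  by apply: unitz_eq => //=; rewrite scaler0 addr0.
have hrho : is_hrep rho.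
  split.
  - by move=> b; exact: (hrep_linear hpi).
  - by move=> b; exact: (hrep_bounded hpi).
  - by move=> k b c x; rewrite /rho embL (hrep_lin hpi).
  - move=> b c x; rewrite /rho -(hrep_mul hpi); congr (pi _ x).
    by rewrite /cmul /= /umul /= !scale0r !addr0 mul0r.
  - move=> b x y; rewrite /rho (hrep_star hpi); congr (hdot H x (pi _ y)).
    by rewrite /cstar /= /ustar /= conjC0.
have hirr : hirreducible rho.
  split.
    exists a, xi; apply: contra a0 => /eqP h.
    by apply/eqP/nrm_eq0; rewrite -unrm_emb -pia -/(rho a) h nrm0.
  move=> M Mc M0 ML Mrho.
  have Mpi b x : M x -> M (pi b x).
    move=> Mx; have -> : b = b.2 *: uone A + uemb b.1.
      case: b => b k; apply: unitz_eq => /=.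
        by rewrite scaler0 add0r.
      by rewrite addr0 -[RHS]/(k * 1) mulr1.
    rewrite (hrep_lin hpi) pie; apply: ML => //.
    exact: Mrho.
  have [h|h] := irr M (closed_aclosed Mc) M0 ML Mpi; [left|right]; apply/seteqP; split => x //=.
    exact: h.
  by move=> ->.
have Hn := An H rho hrho hirr.
have [m [v [mn vo vb]]] := orthonormal_basis Hn.
exists m, (mx_of_rep rho v); split => //; first exact: mx_of_rep_is_rep.
have := opnormP (mx_of_rep rho v a) (coord v xi).
rewrite (coord_mul hrho vb) !(vnorm_coord vb) xi1 mulr1; apply: le_trans.
by rewrite /rho pia unrm_emb.
Qed.

Section HrepContractive.
Variables (R : realType) (A : cStarAlgType R) (H : hilbertType R) (pi : A -> H -> H).
Hypothesis hpi : is_hrep pi.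

Lemma hrepB a b x : pi (a - b) x = pi a x - pi b x.
Proof. by rewrite addrC -scaleN1r (hrep_lin hpi) scaleN1r addrC. Qed.

Lemma hrep0 x : pi 0 x = 0.
Proof. by have := hrepB 0 0 x; rewrite !subrr. Qed.

Lemma hrepZ k a x : pi (k *: a) x = k *: pi a x.
Proof. by rewrite -[k *: a]addr0 (hrep_lin hpi) hrep0 addr0. Qed.

Lemma hrepD a b x : pi (a + b) x = pi a x + pi b x.
Proof. by rewrite -[a]scale1r (hrep_lin hpi) !scale1r. Qed.

Lemma hrep_subr a x y : pi a (x - y) = pi a x - pi a y.
Proof.
have h := hrep_linear hpi a (-1) y x.
by rewrite !scaleN1r in h; rewrite [x - y]addrC h addrC.
Qed.

(* If [nrm a < 1] then [1 - a^* a = (1 - y)^2] with [y] selfadjoint in [A]. *)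
Lemma hrep_contractive a x : nrm (pi a x) <= nrm a * nrm x.
Proof.
have key b : nrm b < 1 -> nrm (pi b x) <= nrm x.
  move=> b1; pose c := cmul (cstar b) b.
  have cs : cstar c = c by rewrite cstarM cstarK.
  have c1 : nrm c < 1 by rewrite nrm_star_mul expr_lt1 ?nrm_ge0.
  have [y [ys yc _]] := sqrt_exists cs c1.
  rewrite -(@ler_pXn2r _ 2)// ?nnegrE ?nrm_ge0// -subr_ge0.
  have -> : nrm x ^+ 2 - nrm (pi b x) ^+ 2 = nrm (x - pi y x) ^+ 2.
    apply: (@complexI R); rewrite rmorphB /= -!hdot_nrm (hrep_star hpi) -(hrep_mul hpi).
    rewrite -/c -yc hrepB hrepD (hrep_mul hpi) !(hdotBl, hdotBr, hdotDr).
    have -> : hdot H (pi y x) (pi y x) = hdot H x (pi y (pi y x)).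
      by rewrite (hrep_star hpi) ys.
    have -> : hdot H (pi y x) x = hdot H x (pi y x) by rewrite (hrep_star hpi) ys.
    by ring.
  by rewrite exprn_ge0// nrm_ge0.
have key2 d : 0 < d -> nrm (pi a x) <= (nrm a + d) * nrm x.
  move=> d0; have s0 : 0 < nrm a + d by rewrite ltr_wpDl// nrm_ge0.
  have := key ((nrm a + d)^-1%:C *: a).
  rewrite nrmZr hrepZ nrmZr ger0_norm ?invr_ge0 ?(ltW s0)//.
  rewrite mulrC ltr_pdivrMr// mul1r ltrDl => /(_ d0).
  by rewrite mulrC ler_pdivrMr// mulrC.
apply/ler_addgt0Pl => d d0; have x1 : 0 < nrm x + 1 by rewrite ltr_wpDl// nrm_ge0.
rewrite (le_trans (key2 _ (divr_gt0 d0 x1)))// mulrDl addrC lerD2r mulrAC ler_pdivrMr//.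
by rewrite ler_wpM2l ?(ltW d0)// lerDl.
Qed.

End HrepContractive.

Section MatrixHilbert.
Variable R : realType.
Local Notation C := R[i].

(** The completion is reused and adds no vector here: every F is the image of the column of its
    inner products with the standard basis. *)
Lemma matrix_hilbert n : exists (H : hilbertType R) (j : 'cV[C]_n -> H),
  [/\ forall k v w, j (k *: v + w) = k *: j v + j w,
      forall v w, hdot H (j v) (j w) = dotmx v^T w^T,
      forall v, nrm (j v) = vnorm v & forall F, exists v, F = j v].
Proof.
pose s (v w : 'cV[C]_n) : C := dotmx v^T w^T.
have sL k x y z : s (k *: x + y) z = k * s x z + s y z.
  by rewrite /s linearP /= linearDl linearZl_LR.
have sC x y : s y x = (s x y)^*%R.
  by rewrite /s [LHS]hermitian_subproof expr0 mul1r.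
have sP x : 0 <= s x x by rewrite /s -vnorm_dot ler0c sqr_ge0.
have [H [j [jL js jd jF]]] := hilbert_completion sL sC sP.
exists H, j; split => //.
  move=> v; apply/eqP; rewrite -(@eqrXn2 _ 2)// ?nrm_ge0 ?vnorm_ge0//.
  by apply/eqP/(@complexI R); rewrite -hdot_nrm js /s vnorm_dot.
move=> F; pose e k : 'cV[C]_n := delta_mx k 0.
pose v : 'cV[C]_n := \col_k hdot H F (j (e k)); exists v.
apply: (@hdot_dense_eq _ H (fun G => exists x, G = j x)) => [G d d0|_ [w ->]].
  by have [x hx] := jd G _ d0; exists (j x) => //; exists x.
have wE : w = \sum_k w k 0 *: e k.
  apply/colP => k; rewrite summxE (bigD1 k)//= big1 ?addr0.
    by rewrite !mxE !eqxx mulr1.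
  by move=> l lk; rewrite !mxE eq_sym (negPf lk) mulr0.
have jsum : j w = \sum_k w k 0 *: j (e k).
  rewrite {1}wE; have j0 : j 0 = 0.
    by have := jL (-1) 0 0; rewrite scaler0 addr0 scaleN1r addNr.
  by elim/big_rec2 : _ => [//|k x y _ ih]; rewrite jL ih.
rewrite js jsum hdot_sumr /s dotmxE mxE; apply: eq_bigr => k _.
by rewrite hdotZr !mxE mulrC.
Qed.

Variable A : cStarAlgType R.

Lemma rep_hrep n (rho : A -> 'M[C]_n) : is_rep rho ->
  exists (H : hilbertType R) (j : 'cV[C]_n -> H) (pi : A -> H -> H),
  [/\ [/\ forall k v w, j (k *: v + w) = k *: j v + j w,
      forall v w, hdot H (j v) (j w) = dotmx v^T w^T,
      forall v, nrm (j v) = vnorm v & forall F, exists v, F = j v],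
      is_hrep pi & forall a v, pi a (j v) = j (rho a *m v)].
Proof.
move=> [rl rm rs]; have [H [j [jL js jn jsurj]]] := matrix_hilbert n.
pose cv F := sval (cid (jsurj F)); have cvE F : F = j (cv F) by rewrite /cv; case: cid.
have jinj v w : j v = j w -> v = w.
  move=> jvw; apply/eqP; rewrite -subr_eq0; apply/eqP/vnorm_eq0; rewrite -jn.
  by rewrite addrC -scaleN1r jL jvw scaleN1r addNr nrm0.
have cvj v : cv (j v) = v by apply: jinj; rewrite -cvE.
pose pi a F := j (rho a *m cv F).
have piE a v : pi a (j v) = j (rho a *m v) by rewrite /pi cvj.
have pil a : linear (pi a).
  by move=> k F G; rewrite [F]cvE [G]cvE -jL !piE mulmxDr -scalemxAr jL.
exists H, j, pi; split => //; split => //.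
- move=> a; have pib F : nrm (pi a F) <= opnorm (rho a) * nrm F.
    by rewrite [F]cvE piE !jn opnormP.
  exact: (linear_le_continuous (pil a) pib).
- by move=> k a b F; rewrite [F]cvE !piE rl mulmxDl -scalemxAl jL.
- by move=> a b F; rewrite [F]cvE !piE rm mulmxA.
- by move=> a F G; rewrite [F]cvE [G]cvE !piE !js adj_dot rs.
Qed.

Lemma rep_contractive n (rho : A -> 'M[C]_n) a : is_rep rho -> opnorm (rho a) <= nrm a.
Proof.
move=> hr; have [H [j [pi [[jL js jn jsurj] hpi pij]]]] := rep_hrep hr.
apply: opnorm_le => [|v]; first exact: nrm_ge0.
by rewrite -!jn -pij hrep_contractive.
Qed.

Lemma rep0 n (rho : A -> 'M[C]_n) : is_rep rho -> rho 0 = 0.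
Proof. by move=> [l _ _]; have := l (-1) 0 0; rewrite scaler0 addr0 scaleN1r addNr. Qed.

Lemma repB n (rho : A -> 'M[C]_n) a b : is_rep rho -> rho (a - b) = rho a - rho b.
Proof. by move=> [l _ _]; rewrite addrC -scaleN1r l scaleN1r addrC. Qed.

Lemma repD n (rho : A -> 'M[C]_n) a b : is_rep rho -> rho (a + b) = rho a + rho b.
Proof. by move=> [l _ _]; rewrite -[a]scale1r l !scale1r. Qed.

Lemma repZ n (rho : A -> 'M[C]_n) k a : is_rep rho -> rho (k *: a) = k *: rho a.
Proof. by move=> hr; rewrite -[k *: a]addr0 (rep_lin hr) (rep0 hr) addr0. Qed.

End MatrixHilbert.

(** * Row spaces, invariant subspaces and points of the unit circle *)

Section Subspaces.
Variable R : realType.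
Local Notation C := R[i].

(** Take G of maximal rank among the matrices with row space in S; a vector of S outside it would
    raise the rank. *)
Lemma subspace_mx n (S : 'rV[C]_n -> Prop) : S 0 ->
  (forall (k : C) v w, S v -> S w -> S (k *: v + w)) ->
  exists G : 'M[C]_n, forall v, S v <-> (v <= G)%MS.
Proof.
move=> S0 SL; pose P r := `[< exists G : 'M[C]_n, (forall v, (v <= G)%MS -> S v) /\ \rank G = r >].
have P0 : exists r, P r.
  by exists 0%N; apply/asboolP; exists 0; rewrite mxrank0; split => // v; rewrite submx0 => /eqP ->.
have Pn r : P r -> (r <= n)%N by move=> /asboolP[G [_ <-]]; exact: rank_leq_row.
case: (ex_maxnP P0 Pn) => r /asboolP[G [GS Gr]] rmax.
exists G => v; split => [Sv|]; last exact: GS.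
apply: contrapT => /negP vG.
suff /rmax : P (\rank (G + v)%MS).
  rewrite leqNgt -Gr; apply/negP/negPn; rewrite ltn_neqAle mxrankS ?addsmxSl// andbT.
  apply: contra vG => /eqP e; have := mxrank_leqif_sup (addsmxSl G v); rewrite -e.
  by move=> /leqif_refl; rewrite addsmx_sub => /andP[].
apply/asboolP; exists (G + v)%MS; split => // w /sub_addsmxP[[u1 u2] -> /=].
have -> : u2 *m v = u2 0 0 *: v by apply/rowP => i; rewrite !mxE big_ord1.
rewrite addrC; apply: SL => //; apply: GS; exact: submxMl.
Qed.

Lemma row_onb m n (E : 'M[C]_(m, n)) :
  exists2 V : 'M[C]_(\rank E, n), V \is unitarymx & (V :=: E)%MS.
Proof.
exists (schmidt (row_base E)); first by rewrite schmidt_unitarymx// rank_leq_col.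
exact: eqmx_trans (eqmx_schmidt_free (row_base_free E)) (eq_row_base E).
Qed.

Lemma unitary_completion k n (V : 'M[C]_(k, n)) : V \is unitarymx ->
  exists2 W : 'M[C]_(n - k, n), W \is unitarymx & V *m W ^t* = 0.
Proof.
move=> Vu; have rV : \rank (V ^t*) = k by rewrite mxrank_map mxrank_tr mxrank_unitary.
have [W Wu WE] := row_onb (kermx (V ^t*)).
move: W Wu WE; rewrite mxrank_ker rV => W Wu WE; exists W => //.
have /sub_kermxP WV : (W <= kermx (V ^t*))%MS by rewrite WE.
by rewrite -[V]trmxCK -map_mxM -trmx_mul WV trmx0 map_mx0.
Qed.

Lemma rep_restrict (A : cStarAlgType R) k n (rho : A -> 'M[C]_n) (V : 'M[C]_(k, n)) :
  is_rep rho -> V \is unitarymx -> (forall a, (V *m rho a <= V)%MS) ->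
  is_rep (fun a => V *m rho a *m V ^t*) /\
  forall a, V *m rho a = (V *m rho a *m V ^t*) *m V.
Proof.
move=> [rl rm rs] /unitarymxP Vu Vinv.
have Vr a : V *m rho a = (V *m rho a *m V ^t*) *m V.
  have /submxP[D ->] := Vinv a.
  by rewrite -[D *m V *m _]mulmxA Vu mulmx1.
split => //; split=> [c a b|a b|a].
- by rewrite rl mulmxDr mulmxDl -scalemxAr -scalemxAl.
- by rewrite rm mulmxA {1}Vr -!mulmxA.
- by rewrite rs !trmx_mul !map_mxM trmxCK mulmxA.
Qed.

(** The Cayley transform on the natural numbers: infinitely many distinct points of the unit circle,
    so some of them avoid any given spectrum. *)
Definition cayley (t : nat) : C := (1 +i* t%:R) / (1 -i* t%:R).

Lemma cayley_norm t : cayley t * (cayley t)^*%R = 1.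
Proof.
have [z z0 ->] : exists2 z : C, z != 0 & cayley t = z / z^*%R.
  by exists (1 +i* t%:R); rewrite ?conjCE// eq_complex /= oner_eq0.
have z1 : z^*%R != 0 by rewrite conjC_eq0.
by rewrite rmorphM /= fmorphV /= conjCK; field; rewrite z0 z1.
Qed.

Lemma cayley_inj : injective cayley.
Proof.
move=> s t; rewrite /cayley => /eqP.
have n1 (u : nat) : (1 -i* u%:R) != 0 :> C by rewrite eq_complex /= oner_eq0.
rewrite eqr_div// => /eqP [] _ h; apply/eqP; rewrite -(eqr_nat R); apply/eqP.
by move: h; lra.
Qed.

Lemma cayley_nonroot (p : {poly C}) : p != 0 -> exists t, ~~ root p (cayley t).
Proof.
move=> p0; apply: contrapT => h.
have := @max_poly_roots _ p [seq cayley t | t <- iota 0 (size p)] p0.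
rewrite map_inj_uniq ?iota_uniq ?size_map ?size_iota ?ltnn; last exact: cayley_inj.
suff -> : all (root p) [seq cayley t | t <- iota 0 (size p)] by move=> /(_ isT isT).
by apply/allP => _ /mapP[t _ ->]; apply: contrapT => /negP h2; apply: h; exists t.
Qed.

End Subspaces.

(** * Ultrafilters and convergence of matrices *)

Lemma ultra_fmap (T U : Type) (f : T -> U) (F : set_system T) :
  UltraFilter F -> UltraFilter (f @ F).
Proof.
move=> UF; split; first exact: fmap_proper_filter.
move=> G GF FG; apply/seteqP; split => // A GA /=.
have [//|FA] := in_ultra_setVsetC (f @^-1` A) UF.
by have [x [Ax]] := filter_ex (filterI GA (FG (~` A) FA)).
Qed.

Lemma initial_cvgP (S : choiceType) (T : topologicalType) (f : S -> T)
    (F : set_system (initial_topology f)) (FF : Filter F) (s : initial_topology f) :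
  F --> s <-> f @ F --> f s.
Proof.
split=> [Fs|fF]; first exact: cvg_trans (cvg_app f Fs) (@initial_continuous _ _ f s).
move=> A; rewrite nbhsE => -[_ [[B oB <-] Bs] BA].
have : nbhs (f s) B by exact: open_nbhs_nbhs.
by move=> /fF h; exact: (@filterS _ F FF _ _ BA h).
Qed.

Lemma set_val_cvgP (X : topologicalType) (A : set X) (F : set_system A) (FF : Filter F) (s : A) :
  F --> s <-> set_val @ F --> set_val s.
Proof. exact: (@initial_cvgP _ _ set_val). Qed.

Lemma compact_subtype (X : topologicalType) (A : set X) : compact A -> compact [set: A].
Proof.
rewrite !compact_ultra /= => cA F UF _.
have : F (set_val @^-1` A) by apply: filterE => x; exact: set_valP.
move=> hA; have [p [Ap Fp]] := cA (set_val @ F) (ultra_fmap _ UF) hA; exists (exist _ p (mem_set Ap)); split => //.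
exact/set_val_cvgP.
Qed.

Section MatrixLimits.
Variable R : realType.
Local Notation C := R[i].

Lemma cvg_normcP (T : Type) (F : set_system T) (FF : Filter F) (f : T -> C) (z : C) :
  f @ F --> z <-> forall e : R, 0 < e -> \forall x \near F, normc (z - f x) <= e.
Proof.
split=> [fz e e0|fz].
  have e0C : 0 < e%:C :> C by rewrite ltcR.
  move/cvgrPdist_le : fz => /(_ _ e0C); apply: filterS => x.
  by rewrite Defs.normcE lecR.
apply/cvgrPdist_le => e' e'0; have [e e0 ->] := gt0_complexP e'0.
by apply: filterS (fz _ e0) => x; rewrite Defs.normcE lecR.
Qed.

Variables (T : Type) (F : set_system T).

Lemma cvg_mulmx (FF : Filter F) n (f g : T -> 'M[C]_n) (X Y : 'M[C]_n) : f @ F --> X -> g @ F --> Y ->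
  (fun x => f x *m g x) @ F --> X *m Y.
Proof.
move=> /cvg_opnormP fX /cvg_opnormP gY; apply/cvg_opnormP => e e0.
pose K := opnorm X + opnorm Y + 1.
have K0 : 0 < K by rewrite ltr_wpDl// addr_ge0 ?opnorm_ge0.
pose d := Num.min 1 (e / 2 / K).
have d0 : 0 < d by rewrite lt_min ltr01 !divr_gt0.
apply: filterS2 (fX _ d0) (gY _ d0) => x hf hg.
apply: le_trans (opnorm_mulB _ _ _ _) _.
have d1 : d <= 1 by rewrite ge_min lexx.
have de : d * K <= e / 2 by rewrite -ler_pdivlMr// ge_min lexx orbT.
have hfK : opnorm (f x) <= K.
  rewrite -[f x](subKr X); apply: le_trans (opnormD _ _) _; rewrite opnormN.
  rewrite /K -addrA lerD2l; apply: le_trans (le_trans hf d1) _.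
  by rewrite lerDr opnorm_ge0.
have YK : opnorm Y <= K by rewrite /K addrAC lerDr addr_ge0 ?opnorm_ge0.
rewrite (splitr e); apply: lerD; apply: le_trans de.
  exact: (ler_pM (opnorm_ge0 _) (opnorm_ge0 _) hf YK).
by rewrite [leRHS]mulrC; exact: (ler_pM (opnorm_ge0 _) (opnorm_ge0 _) hfK hg).
Qed.

Lemma cvg_adjmx (FF : Filter F) n (f : T -> 'M[C]_n) (X : 'M[C]_n) : f @ F --> X ->
  (fun x => (f x) ^t*) @ F --> X ^t*.
Proof.
move=> /cvg_opnormP fX; apply/cvg_opnormP => e e0; apply: filterS (fX _ e0) => x.
by rewrite -map_mxB -linearB opnorm_star.
Qed.

Lemma cvg_linmx (FF : Filter F) n (f g : T -> 'M[C]_n) (k : C) (X Y : 'M[C]_n) : f @ F --> X -> g @ F --> Y ->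
  (fun x => k *: f x + g x) @ F --> k *: X + Y.
Proof.
move=> /cvg_opnormP fX /cvg_opnormP gY; apply/cvg_opnormP => e e0.
have k1 : 0 < normc k + 1 by rewrite ltr_wpDl// normc_ge0.
have d0 : 0 < e / 2 / (normc k + 1) by rewrite !divr_gt0.
have e2 : 0 < e / 2 by rewrite divr_gt0.
apply: filterS2 (fX _ d0) (gY _ e2) => x hf hg.
have -> : k *: X + Y - (k *: f x + g x) = k *: (X - f x) + (Y - g x).
  by rewrite scalerBr opprD addrACA.
apply: le_trans (opnormD _ _) _; rewrite (splitr e); apply: lerD hg.
rewrite opnormZ; apply: le_trans (ler_wpM2l (normc_ge0 k) hf) _.
rewrite mulrCA ler_piMr ?(ltW e2)// ler_pdivrMr// mul1r.
by rewrite lerDl.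
Qed.

Lemma cvg_entries (FF : Filter F) n (f : T -> 'M[C]_n) (X : 'M[C]_n) :
  (forall i j, (fun x => f x i j) @ F --> X i j) <-> f @ F --> X.
Proof.
split=> [fX|/cvg_opnormP fX i j]; last first.
  apply/cvg_normcP => e e0; apply: filterS (fX _ e0) => x; apply: le_trans.
  by have := opnorm_entry (X - f x) i j; rewrite !mxE.
apply/cvg_opnormP => e e0; pose K : R := n%:R * n%:R + 1.
have K0 : 0 < K by rewrite ltr_wpDl// mulr_ge0.
have eK : 0 < e / K by rewrite divr_gt0.
have : \forall x \near F, forall ij : 'I_n * 'I_n, normc (X ij.1 ij.2 - f x ij.1 ij.2) <= e / K.
  by apply: filter_forall => ij; have /cvg_normcP := fX ij.1 ij.2; exact.
apply: filterS => x h; have h' i j : normc ((X - f x) i j) <= e / K by rewrite !mxE (h (i, j)).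
apply: le_trans (opnorm_entries h') _; rewrite mulrA ler_pdivrMr// mulrC.
by apply: (ler_wpM2l (ltW e0)); rewrite lerDl.
Qed.

Lemma cvg_dsum (FF : Filter F) m n (f : T -> 'M[C]_m) (g : T -> 'M[C]_n) (X : 'M[C]_m) (Y : 'M[C]_n) :
  f @ F --> X -> g @ F --> Y -> (fun x => dsum (f x) (g x)) @ F --> dsum X Y.
Proof.
move=> /cvg_entries fX /cvg_entries gY; apply/cvg_entries => i j; rewrite /dsum.
have c0 : (fun _ : T => 0 : C) @ F --> (0 : C) by exact: cvg_cst.
case: (split_ordP i) => i' ->; case: (split_ordP j) => j' ->.
- by rewrite block_mxEul; under eq_fun do rewrite block_mxEul; exact: fX.
- by rewrite block_mxEur mxE; under eq_fun do rewrite block_mxEur mxE.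
- by rewrite block_mxEdl mxE; under eq_fun do rewrite block_mxEdl mxE.
- by rewrite block_mxEdr; under eq_fun do rewrite block_mxEdr; exact: gY.
Qed.

Lemma cvgmx_unique (FF : ProperFilter F) n (f : T -> 'M[C]_n) (X Y : 'M[C]_n) : f @ F --> X -> f @ F --> Y -> X = Y.
Proof.
move=> /cvg_opnormP fX /cvg_opnormP fY; apply: eq_opnorm => e e0.
have e2 : 0 < e / 2 by rewrite divr_gt0.
have [x [hX hY]] := filter_ex (filterI (fX _ e2) (fY _ e2)).
have -> : X - Y = (X - f x) - (Y - f x) by rewrite opprB addrA subrK.
apply: le_trans (opnormD _ _) _; rewrite opnormN (splitr e); exact: lerD hX hY.
Qed.

(** The real and imaginary parts of the entries lie in a compact interval, where ultrafilters
    converge. *)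
Lemma ultra_cvgmx (UF : UltraFilter F) n (f : T -> 'M[C]_n) (c : R) :
  (\forall x \near F, opnorm (f x) <= c) -> exists X : 'M[C]_n, f @ F --> X.
Proof.
move=> fc.
have re (g : T -> R) : (\forall x \near F, `|g x| <= c) -> exists l : R, g @ F --> l.
  move=> gc; have := @segment_compact R (- c) c; rewrite compact_ultra /=.
  move=> /(_ (g @ F) (ultra_fmap _ UF))[].
    by near=> x; rewrite /= in_itv /= -ler_norml; near: x.
  by move=> l [_ gl]; exists l.
have en i j : exists z : C, (fun x => f x i j) @ F --> z.
  have [a fa] : exists l : R, (fun x => complex.Re (f x i j)) @ F --> l.
    apply: re; apply: filterS fc => x; apply: le_trans.
    exact: le_trans (ler_Re_normc _) (opnorm_entry _ _ _).
  have [b fb] : exists l : R, (fun x => complex.Im (f x i j)) @ F --> l.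
    apply: re; apply: filterS fc => x; apply: le_trans.
    exact: le_trans (ler_Im_normc _) (opnorm_entry _ _ _).
  exists (a +i* b); apply/cvg_normcP => e e0.
  have e2 : 0 < e / 2 by rewrite divr_gt0.
  move/cvgrPdist_le : fa => /(_ _ e2) fa; move/cvgrPdist_le : fb => /(_ _ e2) fb.
  apply: filterS2 fa fb => x ha hb.
  apply: le_trans (normc_ReIm _) _; rewrite (splitr e) !raddfB.
  exact: lerD ha hb.
pose X : 'M[C]_n := \matrix_(i, j) sval (cid (en i j)).
by exists X; apply/cvg_entries => i j; rewrite mxE; case: cid.
Unshelve. all: by end_near. Qed.

End MatrixLimits.

(** * Spaces graded by a locally constant degree *)

Section Graded.
Variables (X : topologicalType) (d : X -> nat).
Hypothesis dc : forall x, \forall y \near x, d y = d x.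

Lemma graded_closed (B : set X) : (forall n, closed (B `&` [set x | d x = n])) -> closed B.
Proof.
move=> cB x clx; have : (B `&` [set y | d y = d x]) x; last by case.
apply: cB => A nA; have [y [By [Ay dy]]] := clx _ (filterI nA (dc x)).
by exists y; split.
Qed.

Hypothesis X2 : hausdorff_space X.
Hypothesis dK : forall n, compact [set x | d x = n].

Lemma fiber_closed n : closed [set x | d x = n].
Proof. exact: compact_closed. Qed.

Lemma graded_sigma : property_sigma X.
Proof.
have cK n : compact [set x | (d x <= n)%N].
  elim: n => [|n ih].
    by rewrite [X in compact X](_ : _ = [set x | d x = 0%N])//; apply/seteqP; split => x /=; lia.
  rewrite [X in compact X](_ : _ = [set x | (d x <= n)%N] `|` [set x | d x = n.+1]).
    exact: compactU.
  by apply/seteqP; split => x /=; [case: ltngtP => // h _; [left; lia|right]|move=> []; lia].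
exists (fun n => [set x | (d x <= n)%N]); split.
- by move=> n x /=; lia.
- by apply/seteqP; split => // x _; exists (d x) => /=.
- move=> n; split; first exact: cK.
  move=> x y cxy; apply: val_inj; apply: X2 => A B nA nB.
  have cv := @initial_continuous _ _ (@set_val _ [set x | (d x <= n)%N]).
  by have [z [Az Bz]] := cxy _ _ (cv x _ nA) (cv y _ nB); exists (set_val z).
- move=> B; split=> [cB n|cB]; first by apply: closedI => //; exact: compact_closed.
  apply: graded_closed => n.
  have -> : B `&` [set x | d x = n] = (B `&` [set x | (d x <= n)%N]) `&` [set x | d x = n].
    by apply/seteqP; split => x /= [] => [Bx <-|[Bx _] ->]; split => //; split.
  by apply: closedI => //; exact: fiber_closed.
Qed.

End Graded.

(** * Towers of matrices and of representations *)

Section WeakTowers.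
Variable R : realType.
Local Notation C := R[i].

(* The algebraic part of the tower axioms, in a form where the size of the acting
   matrix only has to be provably equal to the degree. *)
Record is_wtower (T : towerData R) : Prop := IsWtower {
  wdeg_gt0 : forall x : T, (0 < tdeg x)%N;
  wplusA : associative (@tplus R T);
  wdegD : forall x y : T, tdeg (x ⊕ y) = (tdeg x + tdeg y)%N;
  wdeg_act : forall n (U : 'M[C]_n) (x : T), tdeg x = n -> U \is unitarymx ->
    tdeg (U ∙ x) = n;
  wact1 : forall n (x : T), tdeg x = n -> (1%:M : 'M[C]_n) ∙ x = x;
  wactM : forall n (U V : 'M[C]_n) (x : T), tdeg x = n -> U \is unitarymx ->
    V \is unitarymx -> (U *m V) ∙ x = U ∙ (V ∙ x);
  wscalar : forall n (k : C) (x : T), tdeg x = n -> (k%:M : 'M[C]_n) \is unitarymx ->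
    (k%:M : 'M[C]_n) ∙ x = x;
  wplus : forall m n (U : 'M[C]_m) (V : 'M[C]_n) (x y : T), tdeg x = m -> tdeg y = n ->
    U \is unitarymx -> V \is unitarymx -> dsum U V ∙ (x ⊕ y) = (U ∙ x) ⊕ (V ∙ y);
  wswap : forall m n (x y : T), tdeg x = m -> tdeg y = n ->
    swap_mx R m n ∙ (x ⊕ y) = y ⊕ x
}.

Lemma tower_wtower (T : towerData R) : is_tower T -> is_wtower T.
Proof.
move=> [_ h1 _ h2 _ _ h3 h4 _ h5 h6 h7 h8 h9]; split => //.
- by move=> n U x e; case: n / e U => U; exact: h4.
- by move=> n x <-.
- by move=> n U V x e; case: n / e U V => U V; exact: h6.
- by move=> n k x <-; exact: h7.
- move=> m n U V x y em en; case: m / em U => U; case: n / en V => V; exact: h8.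
- by move=> m n x y <- <-.
Qed.

Lemma unitarymx1 n : (1%:M : 'M[C]_n) \is unitarymx.
Proof. by apply/unitarymxP; rewrite trmx1 map_mx1 mulmx1. Qed.

Lemma unitarymx_star n (U : 'M[C]_n) : U \is unitarymx -> U ^t* \is unitarymx.
Proof. by move=> Uu; apply/unitarymxP; rewrite trmxCK -invmx_unitary// unitary_invmx. Qed.

Lemma unitarymxKl n (U : 'M[C]_n) : U \is unitarymx -> U ^t* *m U = 1%:M.
Proof. by move=> Uu; rewrite -invmx_unitary// unitary_invmx. Qed.

Lemma unitarymxM n (U V : 'M[C]_n) : U \is unitarymx -> V \is unitarymx -> U *m V \is unitarymx.
Proof. exact: mul_unitarymx. Qed.

Lemma castmx_conform m n (e : m = n) (X : 'M[C]_m) : castmx (e, e) X = conform_mx 0 X.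
Proof. by case: n / e; rewrite castmx_id conform_mx_id. Qed.

Lemma dsumA m n k (X : 'M[C]_m) (Y : 'M[C]_n) (Z : 'M[C]_k) :
  conform_mx 0 (dsum (dsum X Y) Z) = dsum X (dsum Y Z).
Proof.
have := @block_mxA _ m n k m n k X 0 0 0 Y 0 0 0 Z.
by rewrite /= !row_mx0 !col_mx0 -/(dsum Y Z) -/(dsum X Y) /dsum => ->; rewrite castmx_conform.
Qed.

Lemma conform_conj m k N (e : m = N) (B : 'M[C]_(m, k)) (Z : 'M[C]_k) :
  castmx (e, erefl) B *m Z *m (castmx (e, erefl) B) ^t* = conform_mx 0 (B *m Z *m B ^t*).
Proof. by case: N / e; rewrite castmx_id conform_mx_id. Qed.

Lemma swap_mx_conj m n (X : 'M[C]_m) (Y : 'M[C]_n) :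
  swap_mx R m n *m dsum X Y *m (swap_mx R m n) ^t* = conform_mx 0 (dsum Y X).
Proof.
rewrite /swap_mx conform_conj /dsum; congr conform_mx.
rewrite tr_block_mx map_block_mx !trmx0 !trmx1 !map_mx0 !map_mx1.
by rewrite !mulmx_block !mul0mx !mulmx0 !mul1mx !mulmx1 !addr0 !add0r.
Qed.

Lemma swap_mx_unitary m n : swap_mx R m n \is unitarymx.
Proof.
apply/unitarymxP; have := swap_mx_conj (1%:M : 'M[C]_m) (1%:M : 'M[C]_n).
rewrite /dsum -!scalar_mx_block mulmx1 => ->.
by move: (m + n)%N (addnC n m) => k; case: k /; rewrite conform_mx_id.
Qed.

Lemma unitary_scalarP n (k : C) (X : 'M[C]_n) : (k%:M : 'M[C]_n) \is unitarymx ->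
  k%:M *m X *m (k%:M) ^t* = X.
Proof. by move=> ku; rewrite -scalar_mxC -mulmxA (unitarymxP ku) mulmx1. Qed.

End WeakTowers.

(** * The tower of square matrices *)

Section MatrixTower.
Variable R : realType.
Local Notation C := R[i].

(** Matrices of all positive sizes in one space. Maps into it need no casts between equal degrees:
    equality and convergence are tested on [mat n] once the degree is known to be n. *)
Definition mspace : Type := {n : nat & 'M[C]_n.+1}.

HB.instance Definition _ := Topological.copy mspace {n : nat & 'M[C]_n.+1}.

Definition mdeg (p : mspace) : nat := (projT1 p).+1.

Definition mval (p : mspace) : 'M[C]_(mdeg p) := projT2 p.

Definition mk n (X : 'M[C]_n.+1) : mspace := existT (fun n => 'M[C]_n.+1) n X.

(** Gives 0 when the size of p is not n. *)
Definition mat n (p : mspace) : 'M[C]_n := conform_mx 0 (mval p).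

Lemma mat_id p : mat (mdeg p) p = mval p. Proof. exact: conform_mx_id. Qed.

Lemma mat_mk n (X : 'M[C]_n.+1) : mat n.+1 (mk X) = X. Proof. exact: conform_mx_id. Qed.

Lemma mspace_eq n p q : mdeg p = n -> mdeg q = n -> mat n p = mat n q -> p = q.
Proof.
move=> <-; rewrite mat_id; case: p q => [n' X] [m Y]; rewrite /mdeg /= => -[e].
by case: n' / e X => X; rewrite /mat conform_mx_id /mval /= => ->.
Qed.

Definition mplus (p q : mspace) : mspace :=
  @mk (projT1 p + (projT1 q).+1) (dsum (mval p) (mval q)).

Definition mact n (U : 'M[C]_n) (p : mspace) : mspace :=
  let V := unitarize (mdeg p) U in mk (V *m mval p *m invmx V).

Definition mtower : towerData R := TowerData mdeg mplus mact.

Lemma mdegD p q : mdeg (mplus p q) = (mdeg p + mdeg q)%N.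
Proof. by rewrite /mdeg /= addSn. Qed.

Lemma mat_plus m n p q : mdeg p = m -> mdeg q = n ->
  mat (m + n) (mplus p q) = dsum (mat m p) (mat n q).
Proof. by move=> <- <-; rewrite !mat_id; exact: conform_mx_id. Qed.

Lemma mat_act n (U : 'M[C]_n) p : mdeg p = n -> U \is unitarymx ->
  mat n (mact U p) = U *m mat n p *m U ^t*.
Proof.
move=> e; case: n / e U => U Uu; rewrite mat_id /mact unitarizeE//.
by rewrite invmx_unitary//; exact: conform_mx_id.
Qed.

Lemma mdeg_act n (U : 'M[C]_n) p : mdeg (mact U p) = mdeg p. Proof. by []. Qed.

Lemma mtower_wtower : is_wtower mtower.
Proof.
have dact n (U : 'M[C]_n) p : mdeg (mact U p) = mdeg p by [].
split => //.
- move=> p q r; apply: (@mspace_eq (mdeg p + (mdeg q + mdeg r))).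
  + by rewrite !mdegD.
  + by rewrite !mdegD addnA.
  + rewrite (mat_plus (erefl _) (mdegD _ _)) (mat_plus (erefl _) (erefl _)).
    have -> : mat (mdeg p + (mdeg q + mdeg r)) (mplus (mplus p q) r) =
       conform_mx 0 (mat (mdeg p + mdeg q + mdeg r) (mplus (mplus p q) r)).
      rewrite /mat; move: (mval (mplus (mplus p q) r)); rewrite !mdegD.
      by move=> X; rewrite conform_mx_id.
    rewrite (mat_plus (mdegD _ _) (erefl _)) (mat_plus (erefl _) (erefl _)).
    by rewrite dsumA.
- by move=> n p pn; apply: (@mspace_eq n); rewrite // mat_act ?unitarymx1// trmx1 map_mx1 mulmx1 mul1mx.
- move=> n U V p pn Uu Vu; apply: (@mspace_eq n); [exact: pn|exact: pn|].
  rewrite (mat_act pn (unitarymxM Uu Vu)) (@mat_act n U (mact V p) pn Uu) (mat_act pn Vu).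
  by rewrite trmx_mul map_mxM !mulmxA.
- by move=> n k p pn ku; apply: (@mspace_eq n); rewrite // mat_act// unitary_scalarP.
- move=> m n U V p q pm' qn' Uu Vu; have pm : mdeg p = m := pm'; have qn : mdeg q = n := qn'; apply: (@mspace_eq (m + n)).
  + by rewrite /= mdeg_act mdegD pm qn.
  + by rewrite /= mdegD !mdeg_act pm qn.
  rewrite mat_act ?dsum_unitary ?mdegD ?pm ?qn// !mat_plus// !mat_act//.
  by rewrite !dsum_mul dsum_star.
- move=> m n p q pm' qn'; have pm : mdeg p = m := pm'; have qn : mdeg q = n := qn'; apply: (@mspace_eq (m + n)).
  + by rewrite /= mdeg_act mdegD pm qn.
  + by rewrite /= mdegD pm qn addnC.
  rewrite mat_act ?swap_mx_unitary ?mdegD ?pm ?qn// mat_plus// swap_mx_conj.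
  rewrite -(mat_plus qn pm) /mat; move: (mval _); rewrite mdegD pm qn => X.
  by rewrite conform_mx_id.
Qed.

Lemma mcvgP (F : set_system mspace) (FF : Filter F) (p : mspace) :
  F --> p <-> (\forall q \near F, mdeg q = mdeg p) /\ mat (mdeg p) @ F --> mval p.
Proof.
case: p => n X; split=> [Fp|[dF mF] A nA].
  split.
    apply: (Fp [set q | mdeg q = n.+1]).
    by apply: (@filterE _ (nbhs X)) => Y.
  move=> W nW; apply: (Fp (mat n.+1 @^-1` W)).
  by apply: (@filterS _ (nbhs X) _ W) => // Y WY; rewrite /preimage /= mat_mk.
have h := mF (mk (n:=n) @^-1` A) nA.
apply: (@filterS _ F FF _ _ _ (filterI dF h)) => q /= [dq].
by rewrite -(@mspace_eq n.+1 q (mk (mat n.+1 q)))// mat_mk.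
Qed.

Lemma mat_continuous n : continuous (mat n).
Proof.
move=> p; have [dp mp] : (\forall q \near p, mdeg q = mdeg p) /\ mat (mdeg p) @ p --> mval p.
  by apply/(mcvgP (nbhs_filter p)).
rewrite -mat_id in mp; have [<-//|ne] := eqVneq (mdeg p) n.
have z q : mdeg q = mdeg p -> mat n q = 0.
  by move=> e; rewrite /mat nonconform_mx// e ne.
apply/(@cvg_opnormP R _ _ (nbhs_filter p) n (mat n) (mat n p)) => e e0.
apply: filterS dp => q /z ->.
by rewrite [mat n p]z// subr0 opnorm0 ltW.
Qed.

Lemma mdeg_near p : \forall q \near p, mdeg q = mdeg p.
Proof. by have /(mcvgP (nbhs_filter p))[] : nbhs p --> p by []. Qed.

Lemma cvg_mspace (T : Type) (F : set_system T) (FF : Filter F) (f : T -> mspace) n p :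
  mdeg p = n -> (\forall t \near F, mdeg (f t) = n) ->
  (fun t => mat n (f t)) @ F --> mat n p -> f @ F --> p.
Proof. by move=> <- h1; rewrite mat_id => h2; apply/mcvgP; split. Qed.

Lemma mplus_cvg (T : Type) (F : set_system T) (FF : Filter F) (f g : T -> mspace) p q :
  f @ F --> p -> g @ F --> q -> (fun t => mplus (f t) (g t)) @ F --> mplus p q.
Proof.
move=> /mcvgP[fd' fm] /mcvgP[gd' gm].
have fd : \forall t \near F, mdeg (f t) = mdeg p := fd'.
have fm' : (fun t => mat (mdeg p) (f t)) @ F --> mval p := fm.
have gd : \forall t \near F, mdeg (g t) = mdeg q := gd'.
have gm' : (fun t => mat (mdeg q) (g t)) @ F --> mval q := gm.
apply: (@cvg_mspace _ _ _ _ (mdeg p + mdeg q)); first exact: mdegD.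
  by apply: filterS2 fd gd => t; rewrite !mdegD => -> ->.
rewrite mat_plus// !mat_id.
apply: cvg_trans (cvg_dsum _ fm' gm'); apply: near_eq_cvg.
by apply: filterS2 fd gd => t fp gq; rewrite (mat_plus fp gq).
Qed.

Lemma mact_cvg (T : Type) (F : set_system T) (FF : Filter F) n (u : T -> 'M[C]_n)
    (f : T -> mspace) (U : 'M[C]_n) p :
  mdeg p = n -> U \is unitarymx -> (\forall t \near F, u t \is unitarymx) ->
  u @ F --> U -> f @ F --> p -> (fun t => mact (u t) (f t)) @ F --> mact U p.
Proof.
move=> pn Uu uu uU /mcvgP[fd' fm].
have fd : \forall t \near F, mdeg (f t) = mdeg p := fd'.
have fm' : (fun t => mat (mdeg p) (f t)) @ F --> mval p := fm.
case: n / pn U Uu u uu uU => U Uu u uu uU.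
apply: (@cvg_mspace _ _ _ _ (mdeg p)); [by []|exact: fd|].
rewrite (mat_act (erefl _) Uu) mat_id.
apply: cvg_trans (cvg_mulmx _ (cvg_mulmx _ uU fm') (cvg_adjmx _ uU)).
by apply: near_eq_cvg; apply: filterS2 fd uu => t fp ut; rewrite (mat_act fp ut).
Qed.

Lemma mspace_cvg_unique (T : Type) (F : set_system T) (FF : ProperFilter F) (f : T -> mspace)
    (p q : mspace) :
  f @ F --> p -> f @ F --> q -> p = q.
Proof.
move=> fp gq; have [fd' fm] := (mcvgP _ _).1 fp; have [gd' _] := (mcvgP _ _).1 gq.
have fd : \forall t \near F, mdeg (f t) = mdeg p := fd'.
have gd : \forall t \near F, mdeg (f t) = mdeg q := gd'.
have e : mdeg q = mdeg p.
  by have [t [/= <-]] := filter_ex (filterI fd gd).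
apply: (@mspace_eq (mdeg p)) => //; rewrite mat_id; apply: cvgmx_unique fm _.
exact: cvg_trans (cvg_app (mat (mdeg p)) gq) (@mat_continuous (mdeg p) q).
Qed.

End MatrixTower.

Lemma ptws_cvgP (U : Type) (V : topologicalType) (F : set_system {ptws U -> V})
    (FF : Filter F) (f : {ptws U -> V}) :
  F --> f <-> forall t, (fun g : {ptws U -> V} => g t) @ F --> f t.
Proof.
split=> [/cvg_sup h t|h].
  exact: ((@initial_cvgP (U -> V) V (fun g => g t) F FF f).1 (h t)).
apply/cvg_sup => t; exact: ((@initial_cvgP (U -> V) V (fun g => g t) F FF f).2 (h t)).
Qed.

Lemma hausdorff_cvg (X : topologicalType) :
  (forall (F : set_system X) (x y : X), ProperFilter F -> F --> x -> F --> y -> x = y) ->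
  hausdorff_space X.
Proof.
by move=> h x y; rewrite cluster_cvgE => -[G GF [Gy xG]]; exact: (h G).
Qed.

Section ClosedEmbedding.
Variables (R : realType) (T : towerData R).
Hypothesis T2 : hausdorff_space T.
Hypothesis Tgt0 : forall x : T, (0 < tdeg x)%N.
Hypothesis Tdc : forall x : T, \forall y \near x, tdeg y = tdeg x.
Hypothesis TK : forall n, compact (tfib T n).
Hypothesis Tplus : continuous (fun p : T * T => p.1 ⊕ p.2).
Hypothesis TD : forall x y : T, tdeg (x ⊕ y) = (tdeg x + tdeg y)%N.
Hypothesis Tinj : forall x y x' y' : T, tdeg x = tdeg x' -> x ⊕ y = x' ⊕ y' -> x = x' /\ y = y'.

(** By compactness of the fibres: the part of the image in degree m is the continuous image of a
    compact subset of the product of the fibres over n and m - n. *)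
Lemma plus_closed_embedding n :
  closed_embedding (fun p : tfib T n * T => \val p.1 ⊕ p.2).
Proof.
have fc : continuous (fun p : tfib T n * T => \val p.1 ⊕ p.2).
  move=> p; have c1 : (fun q : tfib T n * T => (\val q.1, q.2)) @ p --> (\val p.1, p.2).
    apply: cvg_pair; last exact: cvg_snd.
    have := @initial_continuous _ _ (@set_val _ (tfib T n)) p.1.
    by apply: cvg_trans; exact: (cvg_app set_val (@cvg_fst _ _ (nbhs p.1) (nbhs p.2) _)).
  exact: cvg_trans (cvg_app _ c1) (@Tplus (\val p.1, p.2)).
have valE (p : tfib T n) : tdeg (\val p) = n by exact: (set_valP p).
split=> // [[[x hx] y] [[x' hx'] y'] /= e|F cF].
  have [dx dx'] := (set_mem hx, set_mem hx').
  have [e1 ->] := Tinj (etrans dx (esym dx')) e.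
  by congr pair; apply: val_inj.
(* For m <= n the subtraction gives 0, and the fibre over 0 is empty because degrees are
   positive. *)
apply: (graded_closed Tdc) => m; apply: compact_closed => //.
rewrite [X in compact X](_ : _ = (fun p : tfib T n * T => \val p.1 ⊕ p.2) @`
    ((setT `*` tfib T (m - n)) `&` F)).
  apply: continuous_compact; first exact: continuous_subspaceT.
  apply: compact_closedI => //; apply: compact_setX => //; exact: compact_subtype.
apply/seteqP; split=> z /=.
  move=> [[p Fp <-]]; rewrite /tfib /= TD valE => dm; exists p => //; split => //; split => //=.
  by rewrite /tfib /=; lia.
move=> [p [[_ /= dp] Fp] <-]; split; first by exists p.
by have := Tgt0 p.2; move: dp; rewrite /tfib /= TD valE; lia.
Qed.

End ClosedEmbedding.

(** * The tower of representations *)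

Section ZTower.
Variables (R : realType) (A : cStarAlgType R).
Local Notation C := R[i].
Local Notation Z := (ztower A).

(** Evaluation at a as a map of towers. It respects the operations by computation, so the algebraic
    axioms of the matrix tower transfer to representations. *)
Definition zev (a : A) (p : Z) : mspace R := @mk R (projT1 p) (zrep p a).

Lemma zspace_eq (p q : Z) : (forall a, zev a p = zev a q) -> p = q.
Proof.
case: p q => [n r] [m s] h.
have e : n = m by have := congr1 (@projT1 _ _) (h 0).
case: m / e s h => s h; congr existT; apply: val_inj; apply/funext => a.
by have := congr1 (mat n.+1) (h a); rewrite !mat_mk.
Qed.

Lemma ztower_wtower : is_wtower Z.
Proof.
have mw := mtower_wtower R; split => //.
- by move=> p q r; apply: zspace_eq => a; exact: (wplusA mw (zev a p) (zev a q) (zev a r)).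
- by move=> n p pn; apply: zspace_eq => a; exact: (@wact1 _ _ mw n (zev a p) pn).
- move=> n U V p pn Uu Vu; apply: zspace_eq => a.
  exact: (@wactM _ _ mw n U V (zev a p) pn Uu Vu).
- by move=> n k p pn ku; apply: zspace_eq => a; exact: (@wscalar _ _ mw n k (zev a p) pn ku).
- move=> m n U V p q pm qn Uu Vu; apply: zspace_eq => a.
  exact: (@wplus _ _ mw m n U V (zev a p) (zev a q) pm qn Uu Vu).
- move=> m n p q pm qn; apply: zspace_eq => a.
  exact: (@wswap _ _ mw m n (zev a p) (zev a q) pm qn).
Qed.

Definition zr n (p : Z) (a : A) : 'M[C]_n := mat n (zev a p).

Lemma zr_rep n p : is_rep (zr n p).
Proof.
have [l m s] := zrepP p; split=> [k a b|a b|a]; rewrite /zr /mat /mval /=.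
- by rewrite l conform_lin.
- by rewrite m conform_mul.
- by rewrite s conform_star.
Qed.

Lemma zr_eq n (p q : Z) : tdeg p = n -> tdeg q = n -> zr n p =1 zr n q -> p = q.
Proof. by move=> pn qn h; apply: zspace_eq => a; exact: (@mspace_eq R n (zev a p) (zev a q) pn qn (h a)). Qed.

Lemma zr_id (p : Z) : zr (tdeg p) p = zrep p.
Proof. by apply/funext => a; exact: conform_mx_id. Qed.

Lemma zr_zmk n (r : A -> 'M[C]_n.+1) (hr : is_rep r) : zr n.+1 (zmk hr : Z) = r.
Proof. by apply/funext => a; exact: conform_mx_id. Qed.

Lemma zr_plus m n (p q : Z) a : tdeg p = m -> tdeg q = n ->
  zr (m + n) (p ⊕ q) a = dsum (zr m p a) (zr n q a).
Proof. by move=> pm qn; exact: (@mat_plus R m n (zev a p) (zev a q)). Qed.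

Lemma zr_act n (U : 'M[C]_n) (p : Z) a : tdeg p = n -> U \is unitarymx ->
  zr n (U ∙ p) a = U *m zr n p a *m U ^t*.
Proof. by move=> pn; exact: (@mat_act R n U (zev a p)). Qed.

Lemma zr_exists n (r : A -> 'M[C]_n) : (0 < n)%N -> is_rep r ->
  exists p : Z, tdeg p = n /\ zr n p = r.
Proof. by case: n r => // n r _ hr; exists (zmk hr); split; [|exact: zr_zmk]. Qed.

Lemma zev_continuous a : continuous (zev a).
Proof.
case=> n r W nW.
have c : (fun s : @zfib R A n.+1 => mk (\val s a)) @ r --> mk (\val r a).
  have c1 : (fun s : @zfib R A n.+1 => \val s a) @ r --> \val r a.
    pose F : set_system {ptws A -> 'M[C]_n.+1} := [set B | nbhs r (\val @^-1` B)].
    have FF : Filter F := fmap_filter (\val : @zfib R A n.+1 -> _) (nbhs_filter r).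
    have c2 : F --> (\val r : {ptws A -> 'M[C]_n.+1}).
      by move=> B; exact: (@initial_continuous _ _ (@set_val _ (@zfib R A n.+1))).
    by have h := (ptws_cvgP FF (\val r)).1 c2 a => B /h.
  exact: cvg_trans (cvg_app (@mk R n) c1) (@existT_continuous _ _ n _).
exact: c.
Qed.

(** Pointwise convergence suffices even across the disjoint union: convergence at a single element
    of A already makes the degree eventually constant. *)
Lemma z_cvgP (F : set_system Z) (FF : Filter F) (p : Z) :
  F --> p <-> forall a, zev a @ F --> zev a p.
Proof.
split=> [Fp a|]; first exact: cvg_trans (cvg_app (zev a) Fp) (@zev_continuous a p).
case: p => n r h B nB.
(* Reads q in the summand that contains r, with r itself as the value on the other summands. *)
pose g (q : Z) : @zfib R A n.+1 :=
  if pselect (exists s, q = existT _ n s) is left e then sval (cid e) else r.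
have gE s : g (existT _ n s) = s.
  rewrite /g; case: pselect => [e|[]]; last by exists s.
  case: cid => s' /= e'; apply: val_inj; apply/funext => a.
  by have := congr1 (fun q => zr n.+1 q a) e'; rewrite /zr /zev /mat /mval /= !conform_mx_id.
have dF : \forall q \near F, tdeg q = n.+1.
  by have [] := (mcvgP _ _).1 (h 0).
have qE (q : Z) : tdeg q = n.+1 -> q = existT _ n (g q).
  by case: q => m s [e]; case: n / e r h B nB g gE dF => r h B nB g gE dF; rewrite gE.
have gF : g @ F --> r.
  apply/set_val_cvgP/ptws_cvgP => a.
  have [_ mF] := (mcvgP _ _).1 (h a).
  have mF' : (fun q => zr n.+1 q a) @ F --> \val r a := mF.
  apply: cvg_trans mF'; apply: (@near_eq_cvg _ _ F FF); apply: (@filterS _ F FF _ _ _ dF) => q /qE {1}->.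
  by rewrite /zr /zev /mat /mval /= conform_mx_id.
have nB' : F (g @^-1` (existT _ n @^-1` B)) := gF _ nB.
apply: (@filterS _ F FF _ _ _ (filterI dF nB')) => q /= [/qE {2}->].
by [].
Qed.

Lemma ztower_hausdorff : hausdorff_space Z.
Proof.
apply: hausdorff_cvg => F p q FF Fp Fq; apply: zspace_eq => a.
apply: (@mspace_cvg_unique _ _ F FF (zev a)).
  exact: ((z_cvgP _ _).1 Fp a).
exact: ((z_cvgP _ _).1 Fq a).
Qed.

(** Along an ultrafilter every value at a converges, being bounded by the norm of a, and the limits
    again form a representation. *)
Lemma ztower_compact n : compact (tfib Z n).
Proof.
case: n => [|n].
  rewrite [tfib Z 0%N](_ : _ = set0); first exact: compact0.
  by apply/seteqP; split => // p; rewrite /tfib /=.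
rewrite compact_ultra /= => F UF Fn.
have ex a : exists X : 'M[C]_n.+1, (fun p => zr n.+1 p a) @ F --> X.
  apply: (@ultra_cvgmx R _ F UF _ _ (nrm a)); apply: filterE => p.
  exact: rep_contractive (zr_rep _ _).
pose r a := sval (cid (ex a)).
have rP a : (fun p => zr n.+1 p a) @ F --> r a by rewrite /r; case: cid.
have hr : is_rep r.
  split=> [k a b|a b|a].
  - have h : (fun p => k *: zr n.+1 p a + zr n.+1 p b) @ F --> (k *: r a + r b : 'M[C]_n.+1).
      exact: cvg_linmx _ (rP a) (rP b).
    apply: (cvgmx_unique _ (rP _)); apply: cvg_trans h; apply: (@near_eq_cvg _ _ F).
    by apply: filterE => p; rewrite (rep_lin (zr_rep _ p)).
  - have h : (fun p => zr n.+1 p a *m zr n.+1 p b) @ F --> (r a *m r b : 'M[C]_n.+1).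
      exact: cvg_mulmx _ (rP a) (rP b).
    apply: (cvgmx_unique _ (rP _)); apply: cvg_trans h; apply: (@near_eq_cvg _ _ F).
    by apply: filterE => p; rewrite (rep_mul (zr_rep _ p)).
  - have h : (fun p => (zr n.+1 p a) ^t*) @ F --> ((r a) ^t* : 'M[C]_n.+1).
      exact: cvg_adjmx _ (rP a).
    apply: (cvgmx_unique _ (rP _)); apply: cvg_trans h; apply: (@near_eq_cvg _ _ F).
    by apply: filterE => p; rewrite (rep_star (zr_rep _ p)).
exists (zmk hr); split; first by [].
apply/z_cvgP => a; apply: (@cvg_mspace _ _ _ _ _ n.+1); [by []|exact: Fn|].
by rewrite [mat _ _]mat_mk; exact: rP.
Qed.

Lemma zdeg_near (p : Z) : \forall q \near p, tdeg q = tdeg p.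
Proof. exact: (zev_continuous (a := 0) (mdeg_near (zev 0 p))). Qed.

Lemma ztower_is_tower : is_tower Z.
Proof.
have zw := ztower_wtower.
have plusc : continuous (fun p : Z * Z => p.1 ⊕ p.2).
  move=> p; apply/z_cvgP => a.
  have c1 : (fun q : Z * Z => zev a q.1) @ p --> zev a p.1.
    exact: cvg_trans (cvg_app (zev a) (@cvg_fst _ _ (nbhs p.1) (nbhs p.2) _)) (@zev_continuous a p.1).
  have c2 : (fun q : Z * Z => zev a q.2) @ p --> zev a p.2.
    exact: cvg_trans (cvg_app (zev a) (@cvg_snd _ _ (nbhs p.1) (nbhs p.2) _)) (@zev_continuous a p.2).
  exact: (mplus_cvg _ c1 c2).
split.
- exact: ztower_hausdorff.
- exact: wdeg_gt0 zw.
- move=> p W /nbhs_singleton Wp.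
  by apply: (@filterS _ (nbhs p) _ _ _ _ (zdeg_near p)) => q /= ->.
- exact: wplusA zw.
- exact: plusc.
- move=> n; apply: (plus_closed_embedding ztower_hausdorff (wdeg_gt0 zw) zdeg_near
    ztower_compact plusc (wdegD zw)) => x y x' y' dx e.
  have dy : tdeg y = tdeg y'.
    by have := congr1 (@tdeg _ Z) e; rewrite !(wdegD zw) dx => /addnI.
  have h a : zr (tdeg x) x a = zr (tdeg x) x' a /\ zr (tdeg y) y a = zr (tdeg y) y' a.
    have := congr1 (fun p => zr (tdeg x + tdeg y) p a) e.
    by rewrite !zr_plus// /dsum => /eq_block_mx[].
  by split; [apply: (@zr_eq (tdeg x)) => // a; have [] := h a|
             apply: (@zr_eq (tdeg y)) => // a; have [] := h a].
- exact: wdegD zw.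
- by move=> x U Uu; exact: wdeg_act zw _ _ _ _ _.
- move=> n; apply/subspace_continuousP => p [/= pu pn].
  apply/z_cvgP => a.
  apply: (@mact_cvg R _ _ _ n (fun q : 'M[C]_n * Z => q.1) (fun q => zev a q.2) p.1 (zev a p.2)).
  + by [].
  + by [].
  + by apply: (@filterE _ (nbhs p)) => q [].
  + exact: (cvg_trans (cvg_app _ (cvg_within _)) (@cvg_fst _ _ (nbhs p.1) (nbhs p.2) _)).
  + apply: (cvg_trans (cvg_app _ (cvg_within _))).
    exact: (cvg_trans (cvg_app (zev a) (@cvg_snd _ _ (nbhs p.1) (nbhs p.2) _)) (@zev_continuous a p.2)).
- by move=> x; exact: (wact1 zw).
- by move=> x U V; exact: (wactM zw).
- by move=> x k; exact: (wscalar zw).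
- by move=> x y U V; exact: (wplus zw).
- by move=> x y; exact: (wswap zw).
Qed.

End ZTower.

(** * Intertwiners and the axioms of m-towers *)

Section Intertwiners.
Variables (R : realType) (A : cStarAlgType R).
Local Notation C := R[i].
Local Notation Z := (ztower A).

(** Rows carry the action: an X with X X* = 1 exhibits r as the restriction of s to the row space of
    X. *)
Definition rhom m n (r : A -> 'M[C]_m) (s : A -> 'M[C]_n) (X : 'M[C]_(m, n)) :=
  forall a, r a *m X = X *m s a.

Lemma hom_adj m n (r : A -> 'M[C]_m) (s : A -> 'M[C]_n) X :
  is_rep r -> is_rep s -> rhom r s X -> rhom s r (X ^t*).
Proof.
move=> [_ _ rs] [_ _ ss] h a; have := h (cstar a); rewrite rs ss => e.
have := congr1 (fun Y => Y ^t*) e.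
by rewrite !trmx_mul !map_mxM !trmxCK => ->.
Qed.

Lemma hom_mul m n k (r : A -> 'M[C]_m) (s : A -> 'M[C]_n) (t : A -> 'M[C]_k) X Y :
  rhom r s X -> rhom s t Y -> rhom r t (X *m Y).
Proof. by move=> hX hY a; rewrite mulmxA hX -!mulmxA hY. Qed.

Lemma act_hom n (p q : Z) (U : 'M[C]_n) : tdeg p = n -> tdeg q = n -> U \is unitarymx ->
  U ∙ p = q <-> rhom (zr n q) (zr n p) U.
Proof.
move=> pn qn Uu; split=> [<- a|h].
  by rewrite zr_act// -mulmxA unitarymxKl// mulmx1.
apply: (@zr_eq _ _ n) => // a; rewrite zr_act// -h -mulmxA.
by rewrite (unitarymxP Uu) mulmx1.
Qed.

Lemma tequiv_hom n (p q : Z) (U : 'M[C]_n) : tdeg p = n -> tdeg q = n -> U \is unitarymx ->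
  rhom (zr n p) (zr n q) U -> tequiv p q.
Proof.
move=> pn qn Uu h; case: n / pn U Uu h qn => U Uu h qn.
have U'u := unitarymx_star Uu; exists (U ^t*); split; first exact: U'u.
apply/(act_hom (erefl _) qn U'u).
exact: hom_adj (zr_rep _ _) (zr_rep _ _) h.
Qed.

Lemma tequiv_ex n (p q : Z) : tdeg p = n -> tequiv p q ->
  exists U : 'M[C]_n, [/\ tdeg q = n, U \is unitarymx & rhom (zr n p) (zr n q) U].
Proof.
move=> <- [U [Uu e]].
have qn : tdeg q = tdeg p by rewrite -e.
exists (U ^t*); split; [exact: qn|exact: (unitarymx_star Uu)|].
apply: hom_adj (zr_rep _ _) (zr_rep _ _) _; exact: (act_hom _ _ _).1 e.
Qed.

(** By the adjoint intertwiner the orthogonal complement of the rows of V is invariant too, and b is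
    the representation on it. *)
Lemma hom_complement m k (q p : Z) (V : 'M[C]_(m, m + k)) : tdeg q = m -> tdeg p = (m + k)%N ->
  (0 < k)%N -> V \is unitarymx -> rhom (zr m q) (zr (m + k) p) V ->
  exists b (W : 'M[C]_(m + k)), W \is unitarymx /\ W ∙ p = q ⊕ b.
Proof.
move=> qm pm k0 Vu h.
have := unitary_completion Vu; rewrite addKn => -[W Wu VW].
have WV : W *m V ^t* = 0 by rewrite -[W]trmxCK -map_mxM -trmx_mul VW trmx0 map_mx0.
have Wh := hom_adj (zr_rep _ _) (zr_rep _ _) h.
have col_u : col_mx V W \is unitarymx.
  apply/unitarymxP; rewrite tr_col_mx map_row_mx mul_col_row (unitarymxP Vu) (unitarymxP Wu).
  by rewrite VW WV -scalar_mx_block.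
have full : V ^t* *m V + W ^t* *m W = 1%:M.
  by rewrite -mul_row_col -map_row_mx -tr_col_mx unitarymxKl.
have WpV a : W *m zr (m + k) p a *m V ^t* = 0 by rewrite -mulmxA Wh mulmxA WV mul0mx.
have Wp a : W *m zr (m + k) p a = (W *m zr (m + k) p a *m W ^t*) *m W.
  rewrite -[RHS]add0r -(mul0mx _ V) -(WpV a) -!mulmxA -!mulmxDr.
  by rewrite full mulmx1.
have Winv a : (W *m zr (m + k) p a <= W)%MS by rewrite Wp submxMl.
have [brep _] := rep_restrict (zr_rep _ p) Wu Winv.
have [b [bk bE]] := zr_exists k0 brep.
exists b, (col_mx V W); split => //; apply/act_hom => //.
  by rewrite (wdegD (ztower_wtower A)) qm bk.
move=> a; rewrite zr_plus// bE /dsum mul_block_col !mul0mx addr0 add0r.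
by rewrite mul_col_mx h -Wp.
Qed.

Lemma tsubP m n (q p : Z) : tdeg q = m -> tdeg p = n ->
  tsub q p <-> exists2 V : 'M[C]_(m, n), V \is unitarymx & rhom (zr m q) (zr n p) V.
Proof.
move=> qm pn; split=> [[e|[a [b [qa pab]]]]|[V Vu h]].
- have [U [pm Uu h]] := tequiv_ex qm e.
  by have e' := etrans (esym pm) pn; case: n / e' pn => _; exists U.
- have [U [am Uu hU]] := tequiv_ex qm qa.
  have [W [abn Wu hW]] := tequiv_ex pn pab.
  have e : (m + tdeg b)%N = n by rewrite -abn (wdegD (ztower_wtower A)) am.
  case: n / e W Wu hW pn abn => W Wu hW pn abn.
  have h1 : rhom (zr m a) (zr (m + tdeg b) (a ⊕ b)) (row_mx 1%:M 0).
    move=> c; rewrite zr_plus// /dsum mul_row_block mul_mx_row.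
    by rewrite !mul1mx !mulmx1 !mul0mx !mulmx0 !addr0.
  exists (U *m row_mx 1%:M 0 *m W ^t*).
    apply/unitarymxP; rewrite !trmx_mul !map_mxM !trmxCK.
    rewrite -!mulmxA [W ^t* *m _]mulmxA unitarymxKl// mul1mx.
    rewrite [row_mx _ _ *m _]mulmxA tr_row_mx map_col_mx mul_row_col.
    by rewrite trmx1 map_mx1 mulmx1 mul0mx addr0 mul1mx (unitarymxP Uu).
  apply: hom_mul (hom_adj (zr_rep _ _) (zr_rep _ _) hW).
  exact: hom_mul hU h1.
- have mn : (m <= n)%N by rewrite -(mxrank_unitary Vu) rank_leq_col.
  have [e|ne] := eqVneq m n.
    by case: n / e V Vu h pn mn => V Vu h pn _; left; exact: tequiv_hom h.
  have e : (m + (n - m))%N = n by rewrite subnKC.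
  have k0 : (0 < n - m)%N by lia.
  move: (n - m)%N k0 e => k k0 e; case: n / e V Vu h pn mn ne => V Vu h pn _ _.
  have [b [W [Wu e]]] := hom_complement qm pn k0 Vu h.
  right; exists q, b; split.
    by exists 1%:M; split; [exact: unitarymx1|rewrite (wact1 (ztower_wtower A))].
  by case: (m + k)%N / pn W Wu e => W Wu e; exists W.
Qed.

(* The eigenrows of [X X^*] for a nonzero eigenvalue intertwine isometrically. *)
Lemma hom_nonzero m n (r : A -> 'M[C]_m) (s : A -> 'M[C]_n) X : is_rep r -> is_rep s ->
  rhom r s X -> X != 0 -> exists k (V : 'M[C]_(k, m)) (W : 'M[C]_(k, n)) (t : A -> 'M[C]_k),
  [/\ (0 < k)%N, V \is unitarymx, W \is unitarymx, is_rep t & rhom t r V /\ rhom t s W].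
Proof.
move=> hr hs hX X0; pose Y := X *m X ^t*.
have Ystar : Y ^t* = Y by rewrite /Y trmx_mul map_mxM trmxCK.
have hY : rhom r r Y by apply: hom_mul (hom_adj hr hs hX).
have Y0 : Y != 0.
  apply: contra X0 => /eqP Y0; apply/eqP/matrixP => i j; rewrite mxE.
  have := congr1 (fun M : 'M[C]_m => M i i) Y0; rewrite !mxE.
  under eq_bigr do rewrite !mxE mul_conj_normc.
  rewrite -rmorph_sum => /complexI /eqP; rewrite psumr_eq0; last by move=> *; exact: sqr_ge0.
  by move=> /allP/(_ j); rewrite mem_index_enum sqrf_eq0 => /(_ isT)/eqP/ComplexField.Normc.eq0_normc.
have Ynorm : Y \is normalmx by apply/normalmxP; rewrite Ystar.
have YE := orthomx_spectralP Ynorm; set P := spectralmx Y in YE; set d := spectral_diag Y in YE.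
have Pu : P \is unitarymx := spectral_unitarymx Y.
have [i di] : exists i, d 0 i != 0.
  apply: contrapT => h; move/eqP: Y0; apply; rewrite YE.
  have -> : d = 0.
    by apply/rowP => i; rewrite mxE; apply/eqP; apply: contrapT => /negP di; apply: h; exists i.
  by rewrite [diag_mx 0](_ : _ = 0) ?mulmx0 ?mul0mx//; apply/matrixP => ? ?; rewrite !mxE mul0rn.
have PY : P *m Y = diag_mx d *m P by rewrite YE !mulmxA mulmxV ?mul1mx// unitarymx_unit.
have rowi : row i P *m Y = d 0 i *: row i P.
  by rewrite -row_mul PY mul_diag_mx; apply/rowP => j; rewrite !mxE.
pose v := row i P.
have vv : v *m v ^t* = 1%:M.
  apply/matrixP => a b; rewrite !ord1 tr_row map_col [RHS]mxE eqxx.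
  have := congr1 (fun M : 'M[C]_m => M i i) (unitarymxP Pu).
  rewrite [_%:M i i]mxE eqxx => <-; rewrite !mxE.
  by apply: eq_bigr => j _; rewrite !mxE.
have dE : d 0 i = ((vnorm (v *m X)^T) ^+ 2)%:C.
  have : v *m Y *m v ^t* = (d 0 i)%:M by rewrite rowi -scalemxAl vv scalemx1.
  rewrite vnorm_dot !trmxK dotmxE trmx_mul map_mxM /Y !mulmxA => ->.
  by rewrite mxE mulr1n.
pose g := (vnorm (v *m X)^T).
have g0 : g != 0 by apply: contra di => /eqP g0; rewrite dE -/g g0 expr0n.
have [V Vu VE] := row_onb (eigenspace Y (d 0 i)).
set k := \rank _ in V Vu VE.
have VY : V *m Y = d 0 i *: V by apply/eigenspaceP; rewrite VE.
have k0 : (0 < k)%N.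
  rewrite lt0n mxrank_eq0; apply/negP => /eqP e0.
  have /eigenspaceP : v *m Y = d 0 i *: v by [].
  rewrite e0 submx0 => /eqP v0; move/matrixP/(_ 0 0): vv.
  by rewrite v0 mul0mx !mxE => /eqP; rewrite eq_sym oner_eq0.
have Vinv a : (V *m r a <= V)%MS.
  by rewrite VE; apply/eigenspaceP; rewrite -mulmxA hY mulmxA VY -scalemxAl.
have [trep Vt] := rep_restrict hr Vu Vinv.
exists k, V, (g^-1%:C *: (V *m X)), (fun a => V *m r a *m V ^t*); split => //.
- apply/unitarymxP; rewrite linearZ /= map_mxZ -scalemxAl -scalemxAr scalerA trmx_mul map_mxM.
  rewrite [X in (_ * X) *: _](_ : _ = (g^-1)%:C); last exact: conj_real.
  have cc : (g^-1)%:C * (g^-1)%:C * (g ^+ 2)%:C = 1 :> C.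
    by rewrite -!rmorphM -(rmorph1 (real_complex R)); congr (_%:C); field.
  rewrite -[V *m X *m _]mulmxA [X *m _]mulmxA -/Y mulmxA VY -scalemxAl (unitarymxP Vu).
  by rewrite scalerA dE -/g cc scale1r.
- split=> [a|a]; first by rewrite -Vt.
  by rewrite -scalemxAr -scalemxAl mulmxA -Vt -!mulmxA hX.
Qed.

(** A nonzero intertwiner yields a common subrepresentation by [hom_nonzero]; conversely, the
    isometries V and W of a common part compose to the nonzero intertwiner V* W. *)
Lemma tdisjP m n (p q : Z) : tdeg p = m -> tdeg q = n ->
  tdisj p q <-> forall X : 'M[C]_(m, n), rhom (zr m p) (zr n q) X -> X = 0.
Proof.
move=> pm qn; split=> [dpq X hX|h [a [ap aq]]]; last first.
  have [V Vu hV] := (tsubP (erefl _) pm).1 ap; have [W Wu hW] := (tsubP (erefl _) qn).1 aq.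
  have := h _ (hom_mul (hom_adj (zr_rep _ _) (zr_rep _ _) hV) hW).
  move=> /(congr1 (fun Y => V *m Y *m W ^t*)).
  rewrite mulmx0 mul0mx !mulmxA (unitarymxP Vu) mul1mx (unitarymxP Wu).
  move=> /matrixP/(_ ord0 ord0)/eqP; rewrite !mxE oner_eq0; by [].
apply/eqP; apply: contrapT => /negP X0; apply: dpq.
have [k [V [W [t [k0 Vu Wu trep [hV hW]]]]]] := hom_nonzero (zr_rep _ _) (zr_rep _ _) hX X0.
have [a [ak aE]] := zr_exists k0 trep; rewrite -aE in hV hW.
by exists a; split; [apply/(tsubP ak pm); exists V|apply/(tsubP ak qn); exists W].
Qed.

End Intertwiners.

(** * The m-tower axioms for representations *)

Section ZMtower.
Variables (R : realType) (A : cStarAlgType R).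
Local Notation C := R[i].
Local Notation Z := (ztower A).
Let zw := ztower_wtower A.

Lemma ztower_disj (x y z : Z) : tdisj z x -> tdisj z y -> tdisj z (x ⊕ y).
Proof.
move=> /(tdisjP (erefl _) (erefl _)) zx /(tdisjP (erefl _) (erefl _)) zy.
apply/(tdisjP (erefl _) (wdegD zw x y)) => X hX.
rewrite -[X]hsubmxK; set X1 := lsubmx X; set X2 := rsubmx X.
have h a : zr (tdeg z) z a *m X1 = X1 *m zr (tdeg x) x a /\
           zr (tdeg z) z a *m X2 = X2 *m zr (tdeg y) y a.
  have := hX a; rewrite -[X]hsubmxK -/X1 -/X2 zr_plus// /dsum mul_mx_row mul_row_block.
  by rewrite !mulmx0 addr0 add0r => /eq_row_mx.
have -> : X1 = 0 by apply: zx => a; case: (h a).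
have -> : X2 = 0 by apply: zy => a; case: (h a).
exact: row_mx0.
Qed.

Lemma block_unitary m n (a : 'M[C]_m) b c (d : 'M[C]_n) :
  block_mx a b c d \is unitarymx -> [/\ a *m a ^t* + b *m b ^t* = 1%:M,
    c *m c ^t* + d *m d ^t* = 1%:M, a ^t* *m a + c ^t* *m c = 1%:M & b ^t* *m b + d ^t* *m d = 1%:M].
Proof.
move=> Uu; have := unitarymxKl Uu; move/unitarymxP: Uu.
rewrite tr_block_mx map_block_mx !mulmx_block !scalar_mx_block.
by move=> /eq_block_mx[-> _ _ ->] /eq_block_mx[-> _ _ ->].
Qed.

Lemma cayley_unit n (a : 'M[C]_n) : exists t, (cayley R t)%:M - a \in unitmx.
Proof.
have [t ht] := cayley_nonroot (monic_neq0 (char_poly_monic a)).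
exists t; rewrite -row_free_unit -kermx_eq0.
rewrite -eigenvalue_root_char /eigenvalue negbK /eigenspace in ht.
apply/eqP/row_matrixP => i; rewrite row0.
have : (row i (kermx ((cayley R t)%:M - a)) <= kermx (a - (cayley R t)%:M))%MS.
  by apply/sub_kermxP; rewrite -[a - _]opprB mulmxN -row_mul mulmx_ker row0 oppr0.
by rewrite (eqP ht) submx0 => /eqP.
Qed.

(* For [U = block_mx a b c d] unitary and [l] on the unit circle outside the
   spectrum of [a], the transfer matrix [d + c (l - a)^-1 b] is unitary. *)
Lemma ztower_cancel (x y z : Z) : tequiv (z ⊕ x) (z ⊕ y) -> tequiv x y.
Proof.
move=> /(tequiv_ex (wdegD zw _ _))[U [e Uu hU]].
have yx : tdeg y = tdeg x by move: e; rewrite (wdegD zw) => /addnI.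
pose a := ulsubmx U; pose b := ursubmx U; pose c := dlsubmx U; pose d := drsubmx U.
have UE : U = block_mx a b c d by rewrite submxK.
have h s : [/\ zr (tdeg z) z s *m a = a *m zr (tdeg z) z s,
    zr (tdeg z) z s *m b = b *m zr (tdeg x) y s,
    zr (tdeg x) x s *m c = c *m zr (tdeg z) z s &
    zr (tdeg x) x s *m d = d *m zr (tdeg x) y s].
  have := hU s; rewrite UE zr_plus// (zr_plus _ (erefl _) yx) /dsum !mulmx_block.
  by rewrite !mulmx0 !mul0mx !addr0 !add0r => /eq_block_mx[].
have [t lu] := cayley_unit a; set l := cayley R t in lu.
have ll : l * l^*%R = 1 := cayley_norm R t.
pose G := invmx (l%:M - a).
have hG : rhom (zr (tdeg z) z) (zr (tdeg z) z) G.
  move=> s; have [ha _ _ _] := h s.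
  rewrite -[LHS]mul1mx -{1}(mulVmx lu) -/G -!mulmxA; congr (G *m _).
  rewrite [RHS](_ : _ = (zr (tdeg z) z s *m (l%:M - a)) *m G); last by rewrite -mulmxA mulmxV ?mulmx1.
  by rewrite mulmxA; congr (_ *m G); rewrite mulmxBl mulmxBr ha scalar_mxC.
pose K := G *m b; pose Th := d + c *m K.
have aK : a *m K + b = l *: K.
  have : (l%:M - a) *m K = b by rewrite /K mulmxA mulmxV// mul1mx.
  by rewrite mulmxBl mul_scalar_mx => <-; rewrite addrCA subrr addr0.
have UK : U *m col_mx K 1%:M = col_mx (l *: K) Th.
  by rewrite UE mul_block_col !mulmx1 aK addrC.
have hTh : rhom (zr (tdeg x) x) (zr (tdeg x) y) Th.
  move=> s; have [_ hb hc hd] := h s; have hGs := hG s.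
  by rewrite /Th /K mulmxDr mulmxDl hd !mulmxA hc -!mulmxA [zr _ z s *m (G *m b)]mulmxA hGs -!mulmxA hb.
(* U preserves inner products and sends the column (K, 1) to (l K, Th); since |l| = 1, the terms K*
   K cancel. *)
have Thu : Th \is unitarymx.
  have e1 : Th ^t* *m Th = 1%:M.
    have := congr1 (fun M => M ^t* *m M) UK.
    rewrite trmx_mul map_mxM -mulmxA [U ^t* *m _]mulmxA unitarymxKl// mul1mx.
    rewrite !tr_col_mx !map_row_mx !mul_row_col trmx1 map_mx1 mulmx1.
    rewrite [(l *: K) ^t*](_ : _ = l^*%R *: K ^t*); last by rewrite linearZ /= map_mxZ.
    rewrite -scalemxAl -scalemxAr scalerA [_ * l]mulrC ll scale1r.
    by move=> /addrI.
  by rewrite -[Th]trmxCK; apply: unitarymx_star; apply/unitarymxP; rewrite trmxCK.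
exact: tequiv_hom Thu hTh.
Qed.

(** A stabilising unitary is an intertwiner; its off-diagonal blocks intertwine disjoint
    representations and therefore vanish. *)
Lemma ztower_stab_plus (x y : Z) : tdisj x y ->
  stab (tdeg x + tdeg y) (x ⊕ y) =
    [set dsum U V | U in stab (tdeg x) x & V in stab (tdeg y) y].
Proof.
move=> /(tdisjP (erefl _) (erefl _)) xy; apply/seteqP; split=> U.
  move=> [Uu /(act_hom (wdegD zw _ _) (wdegD zw _ _) Uu) hU].
  pose a := ulsubmx U; pose b := ursubmx U; pose c := dlsubmx U; pose d := drsubmx U.
  have UE : U = block_mx a b c d by rewrite submxK.
  have h s : [/\ zr (tdeg x) x s *m a = a *m zr (tdeg x) x s,
      zr (tdeg x) x s *m b = b *m zr (tdeg y) y s,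
      zr (tdeg y) y s *m c = c *m zr (tdeg x) x s &
      zr (tdeg y) y s *m d = d *m zr (tdeg y) y s].
    have := hU s; rewrite UE zr_plus// /dsum !mulmx_block.
    by rewrite !mulmx0 !mul0mx !addr0 !add0r => /eq_block_mx[].
  have b0 : b = 0 by apply: xy => s; have [] := h s.
  have c0 : c = 0.
    rewrite -[c]trmxCK [c ^t*]xy ?trmx0 ?map_mx0// => s.
    by apply: (hom_adj (zr_rep _ _) (zr_rep _ _)) => s'; have [] := h s'.
  have [au _ _ _] := block_unitary (etrans (congr1 (fun M => M \is unitarymx) (esym UE)) Uu : is_true (block_mx a b c d \is unitarymx)).
  have [_ du _ _] := block_unitary (etrans (congr1 (fun M => M \is unitarymx) (esym UE)) Uu : is_true (block_mx a b c d \is unitarymx)).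
  rewrite b0 mul0mx addr0 in au; rewrite c0 mul0mx add0r in du.
  have au' : a \is unitarymx by apply/unitarymxP.
  have du' : d \is unitarymx by apply/unitarymxP.
  exists a; first by split => //; apply/act_hom => // s; have [] := h s.
  exists d; first by split => //; apply/act_hom => // s; have [] := h s.
  by rewrite UE b0 c0.
move=> [a [au ax] [d [du dy] <-]]; split; first exact: dsum_unitary.
by rewrite (wplus zw) ?ax ?dy.
Qed.

Lemma reducible_sub n k (x : Z) (V : 'M[C]_(k, n)) : tdeg x = n -> (0 < k)%N -> (k < n)%N ->
  V \is unitarymx -> (forall a, (V *m zr n x a <= V)%MS) -> reducible x.
Proof.
move=> xn k0 kn Vu Vinv; have [hr hV] := rep_restrict (zr_rep n x) Vu Vinv.
have [q [qk qE]] := zr_exists k0 hr.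
have e : (k + (n - k))%N = n by rewrite subnKC// ltnW.
have nk : (0 < n - k)%N by rewrite subn_gt0.
move: (n - k)%N nk e => j j0 e; case: n / e x xn V Vu Vinv hr hV q qk qE kn => x xn V Vu Vinv hr hV q qk qE kn.
have h : rhom (zr k q) (zr (k + j) x) V by move=> a; rewrite qE -hV.
have [b [W [Wu Wx]]] := hom_complement qk xn j0 Vu h.
by exists q, b; case: (k + j)%N / xn W Wu Wx => W Wu Wx; exists W.
Qed.

(** An eigenspace of X is a nonzero invariant subspace, hence everything. *)
Lemma schur n (x : Z) (X : 'M[C]_n) : tdeg x = n -> ~ reducible x ->
  rhom (zr n x) (zr n x) X -> exists k, X = k%:M.
Proof.
move=> xn xirr hX; have n0 : (0 < n)%N by rewrite -xn (wdeg_gt0 zw).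
have [l lX] : exists l, root (char_poly X) l.
  by apply/closed_rootP; rewrite size_char_poly eqSS -lt0n.
rewrite -eigenvalue_root_char /eigenvalue -mxrank_eq0 -lt0n in lX.
have [V Vu VE] := row_onb (eigenspace X l); set k := \rank _ in lX V Vu VE.
have VX : V *m X = l *: V by apply/eigenspaceP; rewrite VE.
have Vinv a : (V *m zr n x a <= V)%MS.
  by rewrite VE; apply/eigenspaceP; rewrite -mulmxA hX mulmxA VX -scalemxAl.
have kn : k = n.
  apply/eqP; rewrite eqn_leq rank_leq_col /= leqNgt; apply/negP => kn; apply: xirr.
  exact: (reducible_sub xn lX kn Vu Vinv).
exists l; move: kn V Vu VE VX Vinv; rewrite /k => -> V Vu VE VX Vinv.
have Vun := unitarymx_unit Vu.
by rewrite -[X]mul1mx -(mulVmx Vun) -mulmxA VX -scalemxAr mulVmx// scalemx1.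
Qed.

Lemma tdeg_nfold (T : towerData R) (wT : is_wtower T) (x : T) n : (0 < n)%N ->
  tdeg (nfold n x) = (n * tdeg x)%N.
Proof.
case: n => // n _; rewrite /nfold /=; elim: n => [|n ih]; first by rewrite mul1n.
by rewrite iterS (wdegD wT) ih [RHS]mulSn.
Qed.

(** With this index convention the tensor product of 1 and X is block diagonal with equal blocks X,
    which identifies n-fold sums with tensor products. *)
Lemma dsum_tens p n (X : 'M[C]_p) :
  dsum X ((1%:M : 'M[C]_n.+1) *t X) = (1%:M : 'M[C]_n.+2) *t X :> 'M[C]_(p + n.+1 * p).
Proof.
have lE (k : 'I_p) : lshift (n.+1 * p) k = mxtens_index (ord0 : 'I_n.+2, k) :> 'I_(n.+2 * p).
  by apply: val_inj.
have rE (i : 'I_n.+1) (k : 'I_p) : rshift p (mxtens_index (i, k)) = mxtens_index (lift ord0 i, k) :> 'I_(n.+2 * p).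
  by apply: val_inj; rewrite /= /bump /= mulSn addnA.
have T (i j : 'I_n.+2) k l : ((1%:M : 'M[C]_n.+2) *t X) (mxtens_index (i, k)) (mxtens_index (j, l)) =
    (i == j)%:R * X k l by rewrite tensmxE mxE.
apply/matrixP => u v; rewrite /dsum.
case: (split_ordP u) => i ->; case: (split_ordP v) => j ->.
- by rewrite block_mxEul !lE -[LHS]mul1r; exact: esym (T ord0 ord0 i j).
- case: (mxtens_indexP j) => j1 j2.
  rewrite block_mxEur mxE lE rE; have := T ord0 (lift ord0 j1) i j2.
  by rewrite (negPf (neq_lift _ _)) mul0r => h; exact: esym h.
- case: (mxtens_indexP i) => i1 i2.
  rewrite block_mxEdl mxE lE rE; have := T (lift ord0 i1) ord0 i2 j.
  by rewrite eq_sym (negPf (neq_lift _ _)) mul0r => h; exact: esym h.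
- case: (mxtens_indexP i) => i1 i2; case: (mxtens_indexP j) => j1 j2.
  rewrite block_mxEdr tensmxE mxE !rE; apply: esym; apply: etrans (T _ _ _ _) _.
  by rewrite (inj_eq lift_inj).
Qed.

Lemma zr_nfold p n (x : Z) a : tdeg x = p -> (0 < n)%N ->
  zr (n * p) (nfold n x) a = (1%:M : 'M[C]_n) *t zr p x a.
Proof.
move=> xp; case: n => // n _; elim: n => [|n ih].
  by rewrite /nfold /= tens_scalar1mx; move: (mul1n p); rewrite mul1n => e; rewrite castmx_id.
rewrite -dsum_tens -ih -zr_plus//.
by have := tdeg_nfold zw x (ltn0Sn n); rewrite xp.
Qed.

(** Cut a stabilising matrix into blocks: each block commutes with the irreducible x and is scalar
    by Schur's lemma. *)
Lemma ztower_stab_nfold (x : Z) n : ~ reducible x -> (0 < n)%N ->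
  stab (n * tdeg x) (nfold n x) =
    [set U *t (1%:M : 'M[C]_(tdeg x)) | U in [set U : 'M[C]_n | U \is unitarymx]].
Proof.
move=> xirr n0; have dn := tdeg_nfold zw x n0.
have tadj (U : 'M[C]_n) : (U *t (1%:M : 'M[C]_(tdeg x))) ^t* = (U ^t*) *t 1%:M.
  by rewrite trmx_tens map_mxT trmx1 map_mx1.
have tens1 : (1%:M : 'M[C]_n) *t (1%:M : 'M[C]_(tdeg x)) = 1%:M.
  by apply/matrixP => i j; case: (mxtens_indexP i) => i1 i2; case: (mxtens_indexP j) => j1 j2;
    rewrite tensmxE !mxE (can_eq (@mxtens_indexK _ _)) -natrM mulnb xpair_eqE.
apply/seteqP; split=> [U [Uu]|_ [U /= Uu <-]].
  move=> /(act_hom dn dn Uu) hU.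
  pose B i j : 'M[C]_(tdeg x) := \matrix_(k, l) U (mxtens_index (i, k)) (mxtens_index (j, l)).
  have hB i j : rhom (zr (tdeg x) x) (zr (tdeg x) x) (B i j).
    move=> a; apply/matrixP => k l.
    have := congr1 (fun M : 'M[C]_(n * tdeg x) => M (mxtens_index (i, k)) (mxtens_index (j, l))) (hU a).
    rewrite zr_nfold// !mxE.
    rewrite (reindex (@mxtens_index n (tdeg x))) /=; last first.
      by exists (@mxtens_unindex _ _) => ? _; rewrite ?mxtens_indexK ?mxtens_unindexK.
    rewrite [X in _ = X -> _](reindex (@mxtens_index n (tdeg x))) /=; last first.
      by exists (@mxtens_unindex _ _) => ? _; rewrite ?mxtens_indexK ?mxtens_unindexK.
    pose F1 q1 q2 := (i == q1)%:R * zr (tdeg x) x a k q2 * U (mxtens_index (q1, q2)) (mxtens_index (j, l)).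
    pose F2 q1 q2 := U (mxtens_index (i, k)) (mxtens_index (q1, q2)) * ((q1 == j)%:R * zr (tdeg x) x a q2 l).
    have e1 (q : 'I_n * 'I_(tdeg x)) :
       ((1%:M : 'M[C]_n) *t zr (tdeg x) x a) (mxtens_index (i, k)) (mxtens_index q) *
       U (mxtens_index q) (mxtens_index (j, l)) = F1 q.1 q.2.
      by case: q => q1 q2; rewrite tensmxE mxE.
    have e2 (q : 'I_n * 'I_(tdeg x)) :
       U (mxtens_index (i, k)) (mxtens_index q) *
       ((1%:M : 'M[C]_n) *t zr (tdeg x) x a) (mxtens_index q) (mxtens_index (j, l)) = F2 q.1 q.2.
      by case: q => q1 q2; rewrite tensmxE mxE.
    under eq_bigr do rewrite e1; under [X in _ = X -> _]eq_bigr do rewrite e2.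
    rewrite -(pair_bigA _ F1) -(pair_bigA _ F2) /= /F1 /F2.
    rewrite (bigD1 i)//= [X in _ + X = _ -> _]big1 ?addr0; last first.
      by move=> q qi; rewrite big1// => r _; rewrite eq_sym (negPf qi) !mul0r.
    rewrite [X in _ = X -> _](bigD1 j)//= [X in _ = _ + X -> _]big1 ?addr0; last first.
      by move=> q qj; rewrite big1// => r _; rewrite (negPf qj) mul0r mulr0.
    move=> h; rewrite [LHS](_ : _ = \sum_q2 (i == i)%:R * zr (tdeg x) x a k q2 * U (mxtens_index (i, q2)) (mxtens_index (j, l))).
      by rewrite h; apply: eq_bigr => q _; rewrite !mxE eqxx mul1r.
    by apply: eq_bigr => q _; rewrite !mxE eqxx mul1r.
  pose u : 'M[C]_n := \matrix_(i, j) sval (cid (schur (erefl _) xirr (hB i j))).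
  have UE : U = u *t 1%:M.
    apply/matrixP => i j; case: (mxtens_indexP i) => i1 i2; case: (mxtens_indexP j) => j1 j2.
    rewrite tensmxE !mxE; case: cid => k /= /matrixP/(_ i2 j2); rewrite !mxE => ->.
    by rewrite mulr_natr.
  exists u => //=; apply/unitarymxP.
  move/unitarymxP: Uu; rewrite UE tadj tensmx_mul mulmx1 -tens1 => /matrixP e.
  have x0 : (0 < tdeg x)%N by exact: wdeg_gt0 zw x.
  apply/matrixP => i j; have := e (mxtens_index (i, Ordinal x0)) (mxtens_index (j, Ordinal x0)).
  by rewrite !tensmxE [_%:M (Ordinal x0) _]mxE eqxx !mulr1.
have Vu : U *t (1%:M : 'M[C]_(tdeg x)) \is unitarymx.
  by apply/unitarymxP; rewrite tadj tensmx_mul (unitarymxP Uu) mulmx1 tens1.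
split => //; apply/(act_hom dn dn Vu) => a.
by rewrite zr_nfold// !tensmx_mul !mulmx1 !mul1mx.
Qed.

Lemma ztower_mtower : is_mtower Z.
Proof.
have zt := ztower_is_tower A; split => //.
- exact: graded_sigma (@zdeg_near _ A) (tower_hausdorff zt) (@ztower_compact _ A).
- exact: ztower_disj.
- exact: ztower_cancel.
- exact: ztower_stab_plus.
- exact: ztower_stab_nfold.
Qed.

(** The maximum with 1 accounts for the zero representation of dimension one, which is irreducible
    in the tower but not in the sense of [hirreducible]. *)
Lemma core_hdim (N : nat) (x : Z) :
  (forall (H : hilbertType R) (pi : A -> H -> H), is_hrep pi -> hirreducible pi -> hdim_le H N) ->
  ~ reducible x -> (tdeg x <= maxn 1 N)%N.
Proof.
move=> hN xirr; set p := tdeg x; have p0 : (0 < p)%N := wdeg_gt0 zw x.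
have [[a0 a0x]|zero] := pselect (exists a, zr p x a != 0); last first.
  have z0 a : zr p x a = 0 by apply/eqP; apply: contrapT => /negP h; apply: zero; exists a.
  rewrite leq_max; apply/orP; left; rewrite leqNgt; apply/negP => p1; apply: xirr.
  apply: (@reducible_sub p 1 x (delta_mx 0 (Ordinal p0))) => //.
    by apply/unitarymxP; rewrite trmx_delta map_delta_mx mul_delta_mx; apply/matrixP => i j; rewrite !ord1 !mxE.
  by move=> a; rewrite z0 mulmx0 sub0mx.
rewrite leq_max; apply/orP; right.
have [H [j [pi [[jL js jn jsurj] hpi pij]]]] := rep_hrep (zr_rep p x).
have j0 : j 0 = 0 by have := jL (-1) 0 0; rewrite scaler0 addr0 scaleN1r addNr.
have jinj v : j v = 0 -> v = 0 by move=> e; apply: vnorm_eq0; rewrite -jn e nrm0.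
have irr : hirreducible pi.
  split.
    have [i [k aik]] : exists i k, zr p x a0 i k != 0.
      apply: contrapT => h; move/eqP: a0x; apply; apply/matrixP => i k; rewrite mxE.
      by apply/eqP; apply: contrapT => /negP h2; apply: h; exists i, k.
    exists a0, (j (delta_mx k 0)); rewrite pij; apply: contra aik => /eqP /jinj.
    by rewrite -colE => /matrixP/(_ i 0); rewrite !mxE => ->.
  move=> M _ M0 ML Minv.
  (* Adjoints turn invariant subspaces of columns into invariant row spaces, to match
     [reducible_sub]. *)
  pose S (v : 'rV[C]_p) := M (j (v ^t*)).
  have S0 : S 0 by rewrite /S trmx0 map_mx0 j0.
  have SL k v w : S v -> S w -> S (k *: v + w).
    move=> Sv Sw; rewrite /S linearD linearZ /= map_mxD map_mxZ jL; exact: ML.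
  have [G GE] := subspace_mx S0 SL.
  have [V Vu VE] := row_onb G.
  have Vinv a : (V *m zr p x a <= V)%MS.
    apply/row_subP => i; rewrite VE; apply/GE; rewrite /S row_mul.
    have : S (row i V) by apply/GE; rewrite -VE row_sub.
    rewrite /S => /(Minv (cstar a)); rewrite pij (rep_star (zr_rep _ _)).
    by rewrite trmx_mul map_mxM.
  have [V0|rk0] := posnP (\rank G).
    left; apply/seteqP; split=> [F MF|_ ->//]; have [v ev] := jsurj F.
    have : S (v ^t*) by rewrite /S trmxCK -ev.
    move/GE; move/eqP: V0; rewrite mxrank_eq0 => /eqP ->; rewrite submx0 => /eqP v0.
    by rewrite /= ev -[v]trmxCK v0 trmx0 map_mx0 j0.
  right; apply/seteqP; split=> // F _; have [v ev] := jsurj F.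
  have : (\rank G = p)%N.
    apply/eqP; rewrite eqn_leq rank_leq_col /= leqNgt; apply/negP => kp; apply: xirr.
    exact: (reducible_sub (erefl _) rk0 kp Vu Vinv).
  move=> rG; have : S (v ^t*).
    by apply/GE; apply: submx_full; rewrite /row_full rG.
  by rewrite /S trmxCK -ev.
pose w (i : 'I_p) := j (delta_mx i 0).
refine (orthonormal_size (v := w) (hN H pi hpi irr) _) => i k; rewrite /w js dotmxE !mxE (bigD1 i)//= !mxE !eqxx mul1r big1 ?addr0.
  by rewrite andbT; case: (i == k); rewrite ?conjC1 ?conjC0.
by move=> l li; rewrite !mxE (negPf li) mul0r.
Qed.

Lemma ztower_ppm : subhomogeneous A -> is_proper_pointed_mtower_fh (zzero A).
Proof.
move=> [N hN]; split => //.
- exact: ztower_mtower.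
- exact: ztower_compact.
- apply: (@le_lt_trans _ _ ((maxn 1 N)%:R)%:E); last exact: ltry.
  apply: ge_ereal_sup => _ [->|[x xc <-]]; first by rewrite lee_fin.
  by rewrite lee_fin ler_nat; exact: core_hdim hN xc.
Qed.

End ZMtower.

(** * Functional calculus and separation of representations *)

(** If no finite list works, the complements of finite unions generate a proper filter on K without
    cluster point. *)
Lemma compact_list_cover (T : topologicalType) (K : set T) (U : T -> set T) :
  compact K -> (forall x, K x -> nbhs x (U x)) ->
  exists s : seq T, (forall x, x \in s -> K x) /\
    forall y, K y -> exists2 x, x \in s & U x y.
Proof.
move=> cK KU; apply: contrapT => nc.
pose G : set_system T := [set B | exists s : seq T, (forall x, x \in s -> K x) /\
  forall y, K y -> (forall x, x \in s -> ~ U x y) -> B y].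
have FG : ProperFilter G.
  split.
    move=> [s [sK sB]]; apply: nc; exists s; split => // y Ky.
    by apply: contrapT => h; apply: (sB y Ky) => x xs Uxy; apply: h; exists x.
  split.
  - by exists [::]; split.
  - move=> P Q [s [sK sP]] [t [tK tQ]]; exists (s ++ t); split.
      by move=> x; rewrite mem_cat => /orP[/sK|/tK].
    move=> y Ky h; split.
      by apply: sP => // x xs; apply: h; rewrite mem_cat xs.
    by apply: tQ => // x xt; apply: h; rewrite mem_cat xt orbT.
  - by move=> P Q PQ [s [sK sP]]; exists s; split => // y Ky h; apply/PQ/sP.
have GK : G K by exists [::]; split.
have [p [Kp clp]] := cK G FG GK.
have GU : G (~` U p).
  by exists [:: p]; split=> [x|y _ h]; [rewrite inE => /eqP ->|apply: h; rewrite inE].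
by have [y [nU Uy]] := clp _ _ GU (KU p Kp).
Qed.

(** * Diagonalisation of Hermitian matrices *)

Section HermitianMatrices.
Variable R : realType.
Local Notation C := R[i].

Lemma col_mulmx m n k (X : 'M[C]_(m, n)) (Y : 'M[C]_(n, k)) j : col j (X *m Y) = X *m col j Y.
Proof. by rewrite !colE mulmxA. Qed.

Lemma herm_spectral n (X : 'M[C]_n) : X ^t* = X ->
  exists (Q : 'M[C]_n) (d : 'I_n -> R), Q \is unitarymx /\
    forall i, X *m col i Q = (d i)%:C *: col i Q.
Proof.
move=> Xs.
have Xh : X \is hermsymmx by apply/is_hermitianmxP; rewrite expr0 scale1r Xs.
have XE := orthomx_spectralP (hermitian_normalmx Xh).
have dr := hermitian_spectral_diag_real Xh.
set P := spectralmx X in XE; set d := spectral_diag X in XE dr.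
have Pu : P \is unitarymx := spectral_unitarymx X.
exists (P ^t*), (fun i => complex.Re (d 0 i)); split; first exact: unitarymx_star.
move=> i; have dE : (complex.Re (d 0 i))%:C = d 0 i.
  by have /mxOverP/(_ 0 i)/RRe_real := dr.
rewrite dE -col_mulmx {1}XE invmx_unitary// -!mulmxA (unitarymxP Pu) mulmx1.
by rewrite mul_mx_diag; apply/colP => j; rewrite !mxE mulrC.
Qed.

Lemma mx_eq_cols n (Q X Y : 'M[C]_n) : Q \is unitarymx ->
  (forall i, X *m col i Q = Y *m col i Q) -> X = Y.
Proof.
move=> Qu h; rewrite -[X]mulmx1 -[Y]mulmx1 -(unitarymxP Qu) !mulmxA.
by congr (_ *m _); apply/matrixP => i j; have := congr1 (fun M : 'cV[C]_n => M i 0) (h j);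
  rewrite -!col_mulmx !mxE.
Qed.

Lemma vnorm_unitary n (U : 'M[C]_n) v : U \is unitarymx -> vnorm (U *m v) = vnorm v.
Proof.
move=> Uu; apply/eqP; rewrite -(@eqrXn2 _ 2)// ?vnorm_ge0//; apply/eqP/(@complexI R).
by rewrite !vnorm_dot adj_dot mulmxA (unitarymxKl Uu) mul1mx.
Qed.

Lemma vnorm_col_unitary n (Q : 'M[C]_n) i : Q \is unitarymx -> vnorm (col i Q) = 1.
Proof.
move=> Qu; rewrite colE vnorm_unitary// /vnorm (bigD1 i)//= mxE !eqxx.
rewrite ComplexField.Normc.normc1 expr1n big1 ?addr0 ?sqrtr1// => k ki.
by rewrite mxE (negPf ki) ComplexField.Normc.normc0 expr0n.
Qed.

Lemma opnorm_eigen n (Q X : 'M[C]_n) (c : 'I_n -> C) (M : R) : Q \is unitarymx -> 0 <= M ->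
  (forall i, X *m col i Q = c i *: col i Q) -> (forall i, normc (c i) <= M) -> opnorm X <= M.
Proof.
move=> Qu M0 Xc cM.
have XE : X = Q *m diag_mx (\row_i c i) *m Q ^t*.
  apply: (mx_eq_cols Qu) => i; rewrite Xc -mulmxA -col_mulmx unitarymxKl//.
  by rewrite -mulmxA mul_diag_mx; apply/colP => j; rewrite !mxE (bigD1 i)//= big1 ?addr0;
    [rewrite !mxE eqxx mulr1 mulrC|move=> k ki; rewrite !mxE (negPf ki) !mulr0].
apply: opnorm_le => // v; rewrite XE -!mulmxA vnorm_unitary//.
rewrite -(vnorm_unitary v (unitarymx_star Qu)); set w := Q ^t* *m v.
rewrite -[leRHS]ger0_norm ?mulr_ge0 ?vnorm_ge0// -sqrtr_sqr ler_wsqrtr//.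
rewrite exprMn vnorm_sqr mulr_sumr ler_sum// => i _.
rewrite mul_diag_mx !mxE ComplexField.Normc.normcM exprMn ler_wpM2r ?sqr_ge0//.
by rewrite ler_pXn2r// nnegrE ?normc_ge0.
Qed.

Lemma opnorm_unitary n (U : 'M[C]_n) : U \is unitarymx -> opnorm U <= 1.
Proof. by move=> Uu; apply: opnorm_le => // v; rewrite vnorm_unitary// mul1r. Qed.

Lemma eigenvalue_opnorm n (Q X : 'M[C]_n) (c : C) i : Q \is unitarymx ->
  X *m col i Q = c *: col i Q -> normc c <= opnorm X.
Proof.
move=> Qu e; have := opnormP X (col i Q).
by rewrite e vnormZ (vnorm_col_unitary _ Qu) !mulr1.
Qed.

End HermitianMatrices.

(** * Functional calculus through matrix representations *)

Section FunctionalCalculus.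
Variables (R : realType) (A : cStarAlgType R).
Local Notation C := R[i].
Local Notation "a ** b" := (cmul a b) (at level 40, left associativity).

(** An estimate holds in the algebra once it holds in all matrix representations. C*(S, kappa) has
    this property through its point evaluations, before it is known to be subhomogeneous. *)
Definition mx_normed := forall (a : A) (M : R), 0 <= M ->
  (forall n (r : A -> 'M[C]_n), is_rep r -> opnorm (r a) <= M) -> nrm a <= M.

Lemma subhom_mx_normed : subhomogeneous A -> mx_normed.
Proof.
move=> [n hn] a M M0 h; have [->|a0] := eqVneq a 0; first by rewrite nrm0.
by have [m [r [_ hr ar]]] := matrix_rep_norm hn a0; exact: le_trans ar (h _ _ hr).
Qed.

(* Newton's iteration for [|t|]. *)
Fixpoint abs_real (n : nat) (t : R) : R :=
  if n is m.+1 then abs_real m t + (t ^+ 2 - abs_real m t ^+ 2) / 2 else 0.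

(** With u = |t|, one step multiplies the error u - s by 1 - (u + s)/2 <= 1 - (u - s)/2; the
    function x (1 - x/2) increases on [0, 1] and takes 2/(n+2) to a value below 2/(n+3). *)
Lemma abs_realP n t : `|t| <= 1 -> 0 <= abs_real n t <= `|t| /\
  `|t| - abs_real n t <= 2 / n.+2%:R.
Proof.
move=> t1; elim: n => [|n [/andP[h0 h1] h2]] /=.
  by rewrite lexx normr_ge0 subr0 divff.
set s := abs_real n t in h0 h1 h2 *; set u := `|t| in t1 h1 h2 *.
have u0 : 0 <= u by exact: normr_ge0.
have -> : t ^+ 2 = u ^+ 2 by rewrite /u real_normK// num_real.
set b := _ / n.+2%:R in h2.
have n2 : 0 < n.+2%:R :> R by [].
have b0 : 0 < b by rewrite divr_gt0.
have b1 : b <= 1 by rewrite ler_pdivrMr// mul1r ler_nat.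
have bb : b * (1 - b / 2) <= 2 / n.+3%:R.
  rewrite ler_pdivlMr// /b.
  have -> : 2 / n.+2%:R * (1 - 2 / n.+2%:R / 2) * n.+3%:R =
     2 * ((n.+2%:R ^+ 2 - 1) / n.+2%:R ^+ 2) :> R.
    by rewrite -[n.+3]addn1 natrD; field; rewrite gt_eqF.
  by rewrite ler_piMr// ler_pdivrMr ?exprn_gt0// mul1r gerBl.
split; last first.
  apply: le_trans bb; nra.
by apply/andP; split; nra.
Qed.

Fixpoint abs_alg (n : nat) (x : A) : A :=
  if n is m.+1 then abs_alg m x + (2^-1)%:C *: (x ** x - abs_alg m x ** abs_alg m x) else 0.

Lemma abs_alg_sa n x : cstar x = x -> cstar (abs_alg n x) = abs_alg n x.
Proof.
move=> xs; elim: n => [|n ih] /=; first exact: cstar0.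
by rewrite cstarD cstarZr cstarB !cstarM xs ih.
Qed.

Lemma abs_alg_eigen n x m (r : A -> 'M[C]_m) (w : 'cV[C]_m) (t : R) : is_rep r ->
  r x *m w = t%:C *: w -> r (abs_alg n x) *m w = (abs_real n t)%:C *: w.
Proof.
move=> hr xw; elim: n => [|n ih] /=; first by rewrite (rep0 hr) mul0mx scale0r.
rewrite (repD _ _ hr) (repZ _ _ hr) (repB _ _ hr) !(rep_mul hr).
rewrite mulmxDl -scalemxAl mulmxBl -!mulmxA xw ih -!scalemxAr xw ih !scalerA.
rewrite -scalerBl scalerA -scalerDl; congr (_ *: _).
by rewrite -!rmorphM -rmorphB -rmorphM -rmorphD /=; congr (_%:C); field.
Qed.

Hypothesis An : mx_normed.

(** The iterates form a Cauchy sequence because in every representation their differences are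
    diagonal in an eigenbasis of the image of x, where the scalar estimate is uniform in t. *)
Lemma abs_exists x : cstar x = x -> nrm x <= 1 -> exists2 y, cstar y = y &
  forall m (r : A -> 'M[C]_m) (w : 'cV[C]_m) (t : R), is_rep r -> `|t| <= 1 ->
    r x *m w = t%:C *: w -> r y *m w = `|t|%:C *: w.
Proof.
move=> xs x1.
have cauchy n m : (n <= m)%N -> nrm (abs_alg n x - abs_alg m x) <= 2 / n.+2%:R.
  move=> nm; apply: An => [|k r hr]; first by rewrite divr_ge0.
  have rs : (r x) ^t* = r x by rewrite -(rep_star hr) xs.
  have [Q [d [Qu Qd]]] := herm_spectral rs.
  have dn i : `|d i| <= 1.
    rewrite -normc_real (le_trans (eigenvalue_opnorm Qu (Qd i)))//.
    exact: le_trans (rep_contractive x hr) x1.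
  apply: (@opnorm_eigen _ _ Q _ (fun i => (abs_real n (d i) - abs_real m (d i))%:C)) => //.
    move=> i; rewrite (repB _ _ hr) mulmxBl !(abs_alg_eigen _ hr (Qd i)).
    by rewrite -scalerBl -rmorphB.
  move=> i; rewrite normc_real.
  have [/andP[a1 a2] a3] := abs_realP n (dn i); have [/andP[b1 b2] b3] := abs_realP m (dn i).
  have mn : 2 / m.+2%:R <= 2 / n.+2%:R :> R.
    by rewrite ler_pM2l// lef_pV2 ?posrE// ler_nat.
  move: (2 / n.+2%:R) (2 / m.+2%:R) a3 b3 mn => u v a3 b3 mn.
  by rewrite ler_norml; apply/andP; split; lra.
have small (e : R) : 0 < e -> exists N, forall n, (N <= n)%N -> 2 / n.+2%:R <= e.
  move=> e0.
  exists (Num.bound (2 / e)) => n Nn; rewrite ler_pdivrMr// mulrC -ler_pdivrMr//.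
  apply: le_trans (ltW (archi_boundP (divr_ge0 (ler0n R 2) (ltW e0)))) _.
  by rewrite ler_nat (leq_trans Nn)// -addn2 leq_addr.
have [y hy] : exists y, forall e : R, 0 < e -> exists N, forall n, (N <= n)%N -> nrm (y - abs_alg n x) <= e.
  apply: complete_seq => e e0; have [N hN] := small _ e0; exists N => n m Nn Nm.
  have [nm|mn] := leqP n m; first exact: le_trans (cauchy _ _ nm) (hN _ Nn).
  by rewrite nrmBC; exact: le_trans (cauchy _ _ (ltnW mn)) (hN _ Nm).
exists y.
  apply: aclosed_sa => e e0; have [N hN] := hy _ e0.
  by exists (abs_alg N x); [exact: abs_alg_sa|exact: hN].
move=> m r w t hr t1 xw; apply/eqP; rewrite -subr_eq0; apply/eqP/vnorm_eq0/eqP.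
rewrite eq_le vnorm_ge0 andbT; apply/ler_addgt0Pr => e e0; rewrite add0r.
have W : 0 < 2 * (vnorm w + 1) by rewrite mulr_gt0// ltr_wpDl ?vnorm_ge0.
have d0 : 0 < e / (2 * (vnorm w + 1)) by rewrite divr_gt0.
have [N hN] := hy _ d0; have [N' hN'] := small _ d0; pose k := maxn N N'.
have -> : r y *m w - `|t|%:C *: w = r (y - abs_alg k x) *m w + (abs_real k t - `|t|)%:C *: w.
  rewrite (repB _ _ hr) mulmxBl (abs_alg_eigen _ hr xw) rmorphB /= scalerBl.
  by rewrite addrA subrK.
apply: le_trans (vnormD _ _) _; rewrite vnormZ normc_real.
have k1 : opnorm (r (y - abs_alg k x)) <= e / (2 * (vnorm w + 1)).
  by apply: le_trans (rep_contractive _ hr) (hN _ (leq_maxl _ _)).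
have k2 : `|abs_real k t - `|t| | <= e / (2 * (vnorm w + 1)).
  have [/andP[_ a2] a3] := abs_realP k t1.
  by rewrite ler0_norm ?subr_le0// opprB (le_trans a3)// hN'// leq_maxr.
have w0 := vnorm_ge0 w.
have -> : e = e / (2 * (vnorm w + 1)) * (vnorm w + 1) + e / (2 * (vnorm w + 1)) * (vnorm w + 1).
  by field; rewrite gt_eqF// ltr_wpDl.
have ww : vnorm w <= vnorm w + 1 by rewrite lerDl.
apply: lerD; last by apply: ler_pM => //.
by apply: le_trans (opnormP _ _) _; apply: ler_pM => //; exact: opnorm_ge0.
Qed.

(** The positive part of t is (|t| + t)/2; x is first scaled into the unit ball. *)
Lemma pos_exists x : cstar x = x -> exists2 y, cstar y = y &
  forall m (r : A -> 'M[C]_m) (w : 'cV[C]_m) (t : R), is_rep r ->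
    r x *m w = t%:C *: w -> r y *m w = (Num.max 0 t)%:C *: w.
Proof.
move=> xs; pose s := nrm x + 1; have s0 : 0 < s by rewrite ltr_wpDl// nrm_ge0.
pose x' := (s^-1)%:C *: x.
have xs' : cstar x' = x' by rewrite cstarZr xs.
have x1' : nrm x' <= 1.
  by rewrite nrmZr [`|s^-1|]ger0_norm ?invr_ge0 ?(ltW s0)// mulrC ler_pdivrMr// mul1r lerDl.
have [y ys hy] := abs_exists xs' x1'.
exists (2^-1%:C *: (s%:C *: y + x)); first by rewrite cstarZr cstarD cstarZr ys xs.
move=> m r w t hr xw; have [->|w0] := eqVneq w 0; first by rewrite mulmx0 scaler0.
have wn : 0 < vnorm w.
  by rewrite lt_neqAle vnorm_ge0 andbT eq_sym; apply: contra w0 => /eqP/vnorm_eq0 ->.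
have ts : `|t| <= s.
  have : normc t%:C * vnorm w <= nrm x * vnorm w.
    rewrite -vnormZ -xw; apply: le_trans (opnormP _ _) _.
    by rewrite ler_wpM2r ?vnorm_ge0// rep_contractive.
  by rewrite normc_real ler_pM2r// => h; rewrite (le_trans h)// lerDl.
have t1 : `|t / s| <= 1.
  by rewrite normrM [`|s^-1|]gtr0_norm ?invr_gt0// ler_pdivrMr// mul1r.
have xw' : r x' *m w = (t / s)%:C *: w.
  by rewrite (repZ _ _ hr) -scalemxAl xw scalerA -rmorphM mulrC.
rewrite (repZ _ _ hr) (repD _ _ hr) (repZ _ _ hr) -scalemxAl mulmxDl -scalemxAl xw.
rewrite (hy _ _ _ _ hr t1 xw') scalerA -scalerDl scalerA -!rmorphM -rmorphD -rmorphM; congr (_%:C *: _).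
rewrite normrM [`|s^-1|]gtr0_norm ?invr_gt0// mulrCA divff ?gt_eqF// mulr1.
case: (lerP 0 t) => t0; rewrite ?max_l ?max_r ?(ltW t0)//.
  by rewrite ger0_norm//; field.
by rewrite ltr0_norm// addNr mulr0.
Qed.

End FunctionalCalculus.

(** * Bicommutant and separation of disjoint representations *)

Section Bicommutant.
Variables (R : realType) (A : cStarAlgType R).
Local Notation C := R[i].
Local Notation Z := (ztower A).
Let zw := ztower_wtower A.

(* [E] is the orthogonal projection of the matrices onto the range of [r]; it is
   left linear over this range, so its blocks [T k l] lie in the commutant. *)
Lemma bicommutant N (r : A -> 'M[C]_N) (Y : 'M[C]_N) : is_rep r ->
  (forall T, rhom r r T -> T *m Y = Y *m T) ->
  exists e y, (forall a, r a *m r e = r a) /\ Y *m r e = r y.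
Proof.
move=> hr hY; pose S (v : 'rV[C]_(N * N)) := exists a, v = mxvec (r a).
have S0 : S 0 by exists 0; rewrite (rep0 hr) linear0.
have SL (k : C) v w : S v -> S w -> S (k *: v + w).
  by move=> [a ->] [b ->]; exists (k *: a + b); rewrite (rep_lin hr) linearP.
have [G GE] := subspace_mx S0 SL; have [V Vu VE] := row_onb G.
pose E (X : 'M[C]_N) : 'M[C]_N := vec_mx (mxvec X *m V ^t* *m V).
have ER X : exists a, E X = r a.
  have /GE[a ea] : (mxvec X *m V ^t* *m V <= G)%MS by rewrite -VE submxMl.
  by exists a; rewrite /E ea mxvecK.
have Er a : E (r a) = r a.
  have : (mxvec (r a) <= V)%MS by rewrite VE; apply/GE; exists a.
  by move=> /submxP[D eD]; rewrite /E eD -[_ *m V ^t*]mulmxA (unitarymxP Vu) mulmx1 -eD mxvecK.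
have orth X : (mxvec X *m V ^t* = 0) <-> forall a, \tr (X *m (r a) ^t*) = 0.
  have dotE (X1 X2 : 'M[C]_N) : mxvec X1 *m (mxvec X2) ^t* = (\tr (X1 *m X2 ^t*))%:M.
    apply/matrixP => i j; rewrite !ord1 [RHS]mxE mulr1n mxE /mxtrace.
    rewrite (reindex _ (curry_mxvec_bij _ _)) /=.
    transitivity (\sum_(q : 'I_N * 'I_N) X1 q.1 q.2 * (X2 q.1 q.2)^*%R).
      by apply: eq_bigr => -[a b] _ /=; rewrite [(_ ^t*) _ _]mxE [_^T _ _]mxE !mxvecE.
    rewrite -(pair_bigA _ (fun a b => X1 a b * (X2 a b)^*%R)) /=.
    by apply: eq_bigr => a _; rewrite mxE; apply: eq_bigr => b _; rewrite !mxE.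
  split=> [h a|h].
    have : (mxvec (r a) <= V)%MS by rewrite VE; apply/GE; exists a.
    move=> /submxP[D eD]; have := dotE X (r a).
    rewrite eD trmx_mul map_mxM mulmxA h mul0mx => /matrixP/(_ 0 0).
    by rewrite !mxE mulr1n => <-.
  apply/matrixP => i j; rewrite !ord1 mxE.
  have /GE[a ea] : (row j V <= G)%MS by rewrite -VE row_sub.
  have := dotE X (r a); rewrite h -ea tr_row map_col -col_mulmx => /matrixP/(_ 0 0).
  by rewrite !mxE mul0rn.
have ED X X' : E (X - X') = E X - E X' by rewrite /E linearB !mulmxBl linearB.
have EM b X : E (r b *m X) = r b *m E X.
  have [x ex] := ER X.
  have h0 : mxvec (X - E X) *m V ^t* = 0.
    by rewrite linearB mulmxBl /= /E vec_mxK -[_ *m V *m _]mulmxA (unitarymxP Vu) mulmx1 subrr.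
  have h1 : mxvec (r b *m (X - E X)) *m V ^t* = 0.
    apply/orth => a; have /orth/(_ (cmul (cstar b) a)) := h0.
    by rewrite (rep_mul hr) (rep_star hr) trmx_mul map_mxM trmxCK mulmxA mxtrace_mulC mulmxA.
  have : E (r b *m X - r b *m E X) = 0 by rewrite -mulmxBr /E h1 mul0mx linear0.
  have e2 : E (r b *m E X) = r b *m E X by rewrite ex -(rep_mul hr) Er.
  by rewrite ED e2 => /eqP; rewrite subr_eq0 => /eqP.
pose T k l : 'M[C]_N := \matrix_(i, j) (E (delta_mx j l)) i k.
have Esum (I : Type) (s : seq I) (c : I -> C) (F : I -> 'M[C]_N) :
    E (\sum_(q <- s) c q *: F q) = \sum_(q <- s) c q *: E (F q).
  rewrite /E !linear_sum /= !mulmx_suml linear_sum; apply: eq_bigr => q _.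
  by rewrite linearZ /= -!scalemxAl linearZ.
have ET X i k : (E X) i k = \sum_l (T k l *m col l X) i 0.
  rewrite {1}[X]matrix_sum_delta exchange_big /=.
  have -> : E (\sum_j \sum_i0 X i0 j *: delta_mx i0 j) = \sum_j \sum_i0 X i0 j *: E (delta_mx i0 j).
    transitivity (\sum_j E (\sum_i0 X i0 j *: delta_mx i0 j)); last by apply: eq_bigr => j _; exact: Esum.
    have := Esum _ (index_enum 'I_N) (fun _ => 1) (fun j => \sum_i0 X i0 j *: delta_mx i0 j).
    by under eq_bigr do rewrite scale1r; move=> ->; apply: eq_bigr => j _; rewrite scale1r.
  rewrite summxE; apply: eq_bigr => l _; rewrite summxE mxE; apply: eq_bigr => j _.
  by rewrite !mxE mulrC.
have TC k l : rhom r r (T k l).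
  move=> b; apply/matrixP => i j; rewrite !mxE.
  transitivity ((r b *m E (delta_mx j l)) i k).
    by rewrite mxE; apply: eq_bigr => i' _; rewrite mxE.
  rewrite -EM; have -> : r b *m delta_mx j l = \sum_j' r b j' j *: delta_mx j' l.
    apply/matrixP => u v; rewrite summxE !mxE (bigD1 j)//= big1 ?addr0; last first.
      by move=> w wj; rewrite mxE (negPf wj) mulr0.
    rewrite (bigD1 u)//= big1 ?addr0; last by move=> w wu; rewrite !mxE eq_sym (negPf wu) mulr0.
    by rewrite !mxE !eqxx.
  by rewrite Esum summxE; apply: eq_bigr => j' _; rewrite !mxE mulrC.
have YE : Y *m E 1%:M = E Y.
  apply/matrixP => i k; rewrite ET mxE.
  under eq_bigr do rewrite ET mulr_sumr.
  rewrite exchange_big /=; apply: eq_bigr => l _.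
  have -> : col l Y = Y *m col l 1%:M by rewrite -col_mulmx mulmx1.
  by rewrite mulmxA hY// -mulmxA mxE.
(* The identity matrix may lie outside the range of r; its projection r e is a right unit for that
   range. *)
have [e ee] := ER 1%:M; have [y ey] := ER Y.
exists e, y; split=> [a|]; last by rewrite -ee YE ey.
by rewrite -ee -EM mulmx1 Er.
Qed.

(** Apply [bicommutant] to the sum of p and q and to the matrix with blocks X and 0: the commutant
    has no off-diagonal blocks and is scalar on p. Since p is irreducible and nonzero, the right
    unit becomes the identity there. *)
Lemma rep_separate m n (p q : Z) (X : 'M[C]_m) : tdeg p = m -> tdeg q = n ->
  ~ reducible p -> (exists a, zr m p a != 0) -> tdisj p q ->
  exists2 a, zr m p a = X & zr n q a = 0.
Proof.
move=> pm qn pirr [a0 a0p] pq.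
have hom0 := (tdisjP pm qn).1 pq.
have hr : is_rep (fun a => dsum (zr m p a) (zr n q a)) by exact: rep_dsum (zr_rep _ _) (zr_rep _ _).
have [T|e [y [he]]] := @bicommutant _ _ (dsum X 0) hr.
  rewrite -[T]submxK; move: (ulsubmx T) (ursubmx T) (dlsubmx T) (drsubmx T) => a b c d hT.
  have h s : [/\ zr m p s *m a = a *m zr m p s, zr m p s *m b = b *m zr n q s,
      zr n q s *m c = c *m zr m p s & zr n q s *m d = d *m zr n q s].
    have := hT s; rewrite /dsum !mulmx_block.
    by rewrite !mulmx0 !mul0mx !addr0 !add0r => /eq_block_mx[].
  have [k ->] : exists k, a = k%:M by apply: (schur pm pirr) => s; case: (h s).
  have -> : b = 0 by apply: hom0 => s; case: (h s).
  have -> : c = 0.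
    rewrite -[c]trmxCK [c ^t*]hom0 ?trmx0 ?map_mx0//.
    by apply: (hom_adj (zr_rep _ _) (zr_rep _ _)) => s; case: (h s).
  by rewrite /dsum !mulmx_block !mulmx0 !mul0mx !addr0 scalar_mxC.
rewrite -dsum_mul mul0mx /dsum => /eq_block_mx[Xe _ _ /esym qy].
have pe a : zr m p a *m zr m p e = zr m p a.
  by have := he a; rewrite -dsum_mul /dsum => /eq_block_mx[].
suff e1 : zr m p e = 1%:M by exists y => //; rewrite -Xe e1 mulmx1.
(* the range of [p e - 1] is killed by [p] *)
pose D := (zr m p e - 1%:M) ^t*.
have pD a : zr m p a *m (zr m p e - 1%:M) = 0 by rewrite mulmxBr pe mulmx1 subrr.
have Dp a : D *m zr m p a = 0.
  by rewrite -[zr m p a]trmxCK -map_mxM -trmx_mul -(rep_star (zr_rep _ _)) pD trmx0 map_mx0.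
have D0 : D = 0.
  apply/eqP; apply: contrapT => /negP D0.
  have [V Vu VE] := row_onb D.
  have Vp a : V *m zr m p a = 0.
    have /submxP[B ->] : (V <= D)%MS by rewrite VE.
    by rewrite -mulmxA Dp mulmx0.
  have k0 : (0 < \rank D)%N by rewrite lt0n mxrank_eq0.
  have [km|km] := ltnP (\rank D) m.
    by apply: pirr; apply: (reducible_sub pm k0 km Vu) => a; rewrite Vp sub0mx.
  have Dfull : row_full D by rewrite /row_full eqn_leq rank_leq_col.
  move/eqP: a0p; apply; apply: (row_full_inj Dfull).
  by rewrite Dp mulmx0.
move: D0; rewrite /D => /(congr1 (fun M => M ^t*)); rewrite trmxCK trmx0 map_mx0.
by move=> /eqP; rewrite subr_eq0 => /eqP.
Qed.

End Bicommutant.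

(** * Equivalence, order and disjointness in a tower *)

Section WeakTowerFacts.
Variables (R : realType) (T : towerData R).
Hypothesis wT : is_wtower T.
Local Notation C := R[i].
Implicit Types x y z : T.

Lemma tequiv_deg x y : tequiv x y -> tdeg y = tdeg x.
Proof. by move=> [U [Uu <-]]; exact: (wdeg_act wT). Qed.

Lemma tequivI n (U : 'M[C]_n) x : tdeg x = n -> U \is unitarymx -> tequiv x (U ∙ x).
Proof. by move=> xn; case: n / xn U => U Uu; exists U. Qed.

Lemma tequivE n x y : tdeg x = n -> tequiv x y -> exists2 U : 'M[C]_n, U \is unitarymx & U ∙ x = y.
Proof. by move=> <- [U [Uu e]]; exists U. Qed.

Lemma wactK n (U : 'M[C]_n) x : tdeg x = n -> U \is unitarymx -> U ^t* ∙ (U ∙ x) = x.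
Proof.
move=> xn Uu; rewrite -(wactM wT xn (unitarymx_star Uu) Uu) (unitarymxKl Uu).
exact: (wact1 wT xn).
Qed.

Lemma tequiv_refl x : tequiv x x.
Proof. by exists 1%:M; split; [exact: unitarymx1|exact: (wact1 wT)]. Qed.

Lemma tequiv_sym x y : tequiv x y -> tequiv y x.
Proof.
move=> e; have [U Uu <-] := tequivE (erefl _) e.
have h := tequivI (wdeg_act wT (erefl _) Uu) (unitarymx_star Uu).
by rewrite wactK in h.
Qed.

Lemma tequiv_trans x y z : tequiv x y -> tequiv y z -> tequiv x z.
Proof.
move=> xy yz; have [U Uu e1] := tequivE (erefl _) xy.
have [V Vu <-] := tequivE (tequiv_deg xy) yz; rewrite -e1 -(wactM wT (erefl (tdeg x)) Vu Uu).
exact: (tequivI (erefl (tdeg x)) (unitarymxM Vu Uu)).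
Qed.

Lemma tequiv_plus x y x' y' : tequiv x x' -> tequiv y y' -> tequiv (x ⊕ y) (x' ⊕ y').
Proof.
move=> [U [Uu <-]] [V [Vu <-]]; rewrite -(wplus wT)//.
by apply: tequivI (dsum_unitary Uu Vu); exact: (wdegD wT).
Qed.

Lemma tequiv_swap x y : tequiv (x ⊕ y) (y ⊕ x).
Proof.
rewrite -(wswap wT (erefl (tdeg x)) (erefl (tdeg y))).
by apply: tequivI (swap_mx_unitary _ _ _); exact: (wdegD wT).
Qed.

Lemma reducible_plus x a b : tequiv x (a ⊕ b) -> reducible x.
Proof. by move=> [U [Uu e]]; exists a, b, U. Qed.

Lemma reducibleE n x : tdeg x = n -> reducible x ->
  exists a b (V : 'M[C]_n), V \is unitarymx /\ V ∙ x = a ⊕ b.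
Proof. by move=> <- [a [b [V h]]]; exists a, b, V. Qed.

Lemma irreducible_tequiv x y : tequiv x y -> ~ reducible x -> ~ reducible y.
Proof.
move=> xy xirr [a [b [V [Vu e]]]]; apply: xirr; apply: (@reducible_plus _ a b).
by apply: tequiv_trans xy _; exists V.
Qed.

Lemma deg1_irreducible x : tdeg x = 1%N -> ~ reducible x.
Proof.
move=> x1 [a [b [V [Vu e]]]]; have := congr1 (@tdeg _ T) e.
rewrite (wdeg_act wT)// (wdegD wT) x1; have := wdeg_gt0 wT a; have := wdeg_gt0 wT b; lia.
Qed.

Lemma tsub_refl x : tsub x x. Proof. by left; exact: tequiv_refl. Qed.

Lemma tsub_plusl x y : tsub x (x ⊕ y).
Proof. by right; exists x, y; split; exact: tequiv_refl. Qed.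

Lemma tsub_irr a x : ~ reducible x -> tsub a x -> tequiv a x.
Proof. by move=> xirr [//|[a' [b [_ xab]]]]; case: xirr; exact: reducible_plus xab. Qed.

Lemma tsub_equivr a x y : tsub a x -> tequiv x y -> tsub a y.
Proof.
move=> [ax|[a' [b [aa xab]]]] xy; first by left; exact: tequiv_trans ax xy.
by right; exists a', b; split => //; exact: tequiv_trans (tequiv_sym xy) xab.
Qed.

Lemma tsub_equivl a x y : tsub x a -> tequiv x y -> tsub y a.
Proof.
move=> [ax|[a' [b [aa xab]]]] xy; first by left; exact: tequiv_trans (tequiv_sym xy) ax.
by right; exists a', b; split => //; exact: tequiv_trans (tequiv_sym xy) aa.
Qed.

Lemma tdisj_sym x y : tdisj x y -> tdisj y x.
Proof. by move=> xy [a [ay ax]]; apply: xy; exists a. Qed.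

Lemma tdisj_irr x y : ~ reducible x -> ~ tsub x y -> tdisj x y.
Proof.
move=> xirr xy [a [ax ay]]; apply: xy; exact: tsub_equivl ay (tsub_irr xirr ax).
Qed.

Lemma tsub_same_deg x y : tdeg x = tdeg y -> tsub x y -> tequiv x y.
Proof.
move=> d [//|[a [b [xa yab]]]]; have := tequiv_deg yab; rewrite (wdegD wT) (tequiv_deg xa) d.
by have := wdeg_gt0 wT b; lia.
Qed.

Lemma tdisj_irr2 x y : ~ reducible x -> ~ reducible y -> ~ tequiv x y -> tdisj x y.
Proof.
move=> xirr yirr xy; apply: tdisj_irr => // h; apply: xy; exact: tsub_irr yirr h.
Qed.

End WeakTowerFacts.

(** * Values of elements of C*(T, theta) *)

Section PointValues.
Variables (R : realType) (T : towerData R) (theta : T).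
Hypothesis wT : is_wtower T.
Local Notation C := R[i].
Implicit Types (x y : T) (u : ptCstar theta).

(** Gives 0 at points of degree other than n. *)
Definition pv n u x : 'M[C]_n := conform_mx 0 (u x).

Lemma pv_id u x : pv (tdeg x) u x = u x. Proof. exact: conform_mx_id. Qed.

Lemma opnorm_pv n u x : tdeg x = n -> opnorm (pv n u x) = opnorm (u x).
Proof. by move=> <-; rewrite pv_id. Qed.

Lemma pv_act n (U : 'M[C]_n) u x : tdeg x = n -> U \is unitarymx ->
  pv n u (U ∙ x) = U *m pv n u x *m U ^t*.
Proof.
move=> xn; case: n / xn U => U Uu; rewrite pv_id -invmx_unitary//.
exact: (cstar_act (ptval_in u)).
Qed.

Lemma pv_plus m n u x y : tdeg x = m -> tdeg y = n ->
  pv (m + n) u (x ⊕ y) = dsum (pv m u x) (pv n u y).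
Proof. by move=> <- <-; rewrite !pv_id; exact: (cstar_plus (ptval_in u)). Qed.

Lemma pvB n u v x : pv n (u - v) x = pv n u x - pv n v x.
Proof. by rewrite /pv pt_subE conform_sub. Qed.

Lemma pv_lin n k u v x : pv n (k *: u + v) x = k *: pv n u x + pv n v x.
Proof. by rewrite /pv pt_addE pt_scaleE conform_lin. Qed.

Lemma pv_is_rep n x : is_rep (fun u => pv n u x).
Proof. exact: rep_eval. Qed.

Hypothesis Tdc : forall x, \forall y \near x, tdeg y = tdeg x.

Lemma pv_cvg n u x : pv n u y @[y --> x] --> pv n u x.
Proof.
have [e|ne] := eqVneq (tdeg x) n.
  have /subspace_continuousP/(_ x e) c := @cstar_cont _ _ _ (ptval_in u) n.
  move=> W nW; have h := c W nW; apply: (@filterS _ (nbhs x) _ _ _ _ (filterI (Tdc x) h)).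
  by move=> y [dy]; apply; rewrite /tfib /= dy.
have z y : tdeg y = tdeg x -> pv n u y = 0.
  by move=> e; rewrite /pv nonconform_mx// e ne.
apply/(@cvg_opnormP R _ _ (nbhs_filter x) n (pv n u) (pv n u x)) => e e0.
apply: (@filterS _ (nbhs x) _ _ _ _ (Tdc x)) => y /z ->.
by rewrite [pv n u x]z// subr0 opnorm0 ltW.
Qed.

Lemma opnorm_dsum m n (X : 'M[C]_m) (Y : 'M[C]_n) (c : R) : opnorm X <= c -> opnorm Y <= c ->
  opnorm (dsum X Y) <= c.
Proof.
move=> Xc Yc; have c0 : 0 <= c := le_trans (opnorm_ge0 X) Xc.
apply: opnorm_le => // v; rewrite -[v]vsubmxK; move: (usubmx v) (dsubmx v) => v1 v2.
have vn (w1 : 'cV[C]_m) (w2 : 'cV[C]_n) : vnorm (col_mx w1 w2) ^+ 2 = vnorm w1 ^+ 2 + vnorm w2 ^+ 2.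
  rewrite !vnorm_sqr big_split_ord /=; congr (_ + _); apply: eq_bigr => i _.
    by rewrite col_mxEu.
  by rewrite col_mxEd.
rewrite /dsum mul_block_col !mul0mx addr0 add0r.
rewrite -(@ler_pXn2r _ 2)// ?nnegrE ?mulr_ge0 ?vnorm_ge0// exprMn !vn mulrDr.
by apply: lerD; rewrite -exprMn ler_pXn2r ?nnegrE ?mulr_ge0 ?vnorm_ge0//;
  apply: le_trans (opnormP _ _) _; rewrite ler_wpM2r// vnorm_ge0.
Qed.

Lemma opnorm_conj n (U X : 'M[C]_n) : U \is unitarymx -> opnorm (U *m X *m U ^t*) <= opnorm X.
Proof.
move=> Uu; apply: le_trans (opnorm_mul _ _) _.
apply: le_trans (_ : opnorm (U *m X) * 1 <= _).
  by apply: (ler_wpM2l (opnorm_ge0 _)); exact: opnorm_unitary (unitarymx_star Uu).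
rewrite mulr1; apply: le_trans (opnorm_mul _ _) _.
by rewrite ler_piMl ?opnorm_ge0// opnorm_unitary.
Qed.

Lemma pv_reducible n u x a b (V : 'M[C]_n) (c : R) : tdeg x = n -> V \is unitarymx ->
  V ∙ x = a ⊕ b -> opnorm (u a) <= c -> opnorm (u b) <= c -> opnorm (u x) <= c.
Proof.
move=> xn Vu e ua ub; rewrite -(opnorm_pv u xn).
have -> : pv n u x = V ^t* *m pv n u (V ∙ x) *m V.
  by rewrite pv_act// -!mulmxA unitarymxKl// mulmx1 mulmxA unitarymxKl// mul1mx.
have h := opnorm_conj (pv n u (V ∙ x)) (unitarymx_star Vu); rewrite trmxCK in h.
apply: le_trans h _.
have abn : (tdeg a + tdeg b)%N = n by rewrite -(wdegD wT) -e (wdeg_act wT).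
rewrite e; case: n / abn V xn Vu e => V xn Vu e.
by rewrite pv_plus// !pv_id; exact: opnorm_dsum.
Qed.

(** A reducible point is unitarily a sum of points of smaller degree, and a block sum has the larger
    of the two norms. *)
Lemma opnorm_core u (c : R) : (forall x, ~ reducible x -> opnorm (u x) <= c) ->
  forall x, opnorm (u x) <= c.
Proof.
move=> uc x; have [n] := ubnP (tdeg x); elim: n x => // n ih x xn.
have [xr|] := pselect (reducible x); last exact: uc.
have [a [b [V [Vu e]]]] := xr.
have dab : (tdeg a + tdeg b)%N = tdeg x by rewrite -(wdegD wT) -e (wdeg_act wT).
have a0 := wdeg_gt0 wT a; have b0 := wdeg_gt0 wT b.
by apply: (pv_reducible (erefl _) Vu e); apply: ih; lia.
Qed.

End PointValues.

(** * Stone-Weierstrass theorem *)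

Section ScalarElements.
Variables (R : realType) (A : cStarAlgType R).
Hypothesis An : mx_normed A.
Local Notation C := R[i].
Local Notation Z := (ztower A).
Local Notation "a ** b" := (cmul a b) (at level 40, left associativity).
Let zw := ztower_wtower A.

(** Supported within 1/2 of l + 1, so distinct bumps have disjoint supports. The factor t^2 keeps
    the polynomial free of a constant term, so that it can be evaluated in an algebra without
    unit. *)
Definition bump (K : nat) (l : 'I_K) (t : R) : R :=
  Num.max 0 (t ^+ 2 * (4^-1 - (t - l.+1%:R) ^+ 2)).

Lemma bump_neq0 K (l : 'I_K) t : bump l t != 0 -> (t - l.+1%:R) ^+ 2 < 4^-1.
Proof.
apply: contraR; rewrite -leNgt => h; rewrite /bump max_l//.
by rewrite mulr_ge0_le0 ?sqr_ge0// subr_le0.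
Qed.

Lemma bump_inj K (l m : 'I_K) t : bump l t != 0 -> bump m t != 0 -> l = m.
Proof.
have ab (x : R) : x ^+ 2 < 4^-1 -> -2^-1 < x < 2^-1.
  rewrite -real_normK ?num_real// (_ : 4^-1 = 2^-1 ^+ 2) ?ltr_pXn2r ?nnegrE ?invr_ge0//; last by field.
  by rewrite ltr_norml.
move=> /bump_neq0 hl /bump_neq0 hm; apply/val_inj/eqP; rewrite eqn_leq.
have key (i j : 'I_K) : (t - i.+1%:R) ^+ 2 < 4^-1 -> (t - j.+1%:R) ^+ 2 < 4^-1 -> (i <= j)%N.
  move=> hi hj; rewrite leqNgt; apply/negP => ji.
  have : (j.+1%:R + 1 <= i.+1%:R :> R) by rewrite -[1]/(1%:R) -natrD ler_nat addn1 ltnS.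
  move: (ab _ hi) (ab _ hj) => /andP[h1 h2] /andP[h3 h4].
  by move: h1 h2 h3 h4; move: (i.+1%:R) (j.+1%:R) => p q; lra.
by rewrite !key.
Qed.

Lemma bump_small K (l : 'I_K) t : `|t| <= 2^-1 -> bump l t = 0.
Proof.
move=> t2; apply/eqP; apply: contrapT => /negP /bump_neq0.
have : 1 <= l.+1%:R :> R by rewrite ler1n.
move: t2; rewrite ler_norml => /andP[]; move: (l.+1%:R) => c; nra.
Qed.

Lemma bump_center K (l : 'I_K) : bump l l.+1%:R != 0.
Proof.
rewrite /bump subrr expr0n /= subr0 max_r; last by rewrite mulr_ge0 ?sqr_ge0.
by rewrite mulf_neq0// expf_neq0// pnatr_eq0.
Qed.

Lemma bump_elements K (a : A) : cstar a = a -> exists2 e : 'I_K -> A, (forall l, cstar (e l) = e l) &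
  forall l m (r : A -> 'M[C]_m) (w : 'cV[C]_m) (t : R), is_rep r ->
    r a *m w = t%:C *: w -> r (e l) *m w = (bump l t)%:C *: w.
Proof.
move=> ast.
have ex (l : 'I_K) : exists y, cstar y = y /\ forall m (r : A -> 'M[C]_m) (w : 'cV[C]_m) (t : R), is_rep r ->
    r a *m w = t%:C *: w -> r y *m w = (bump l t)%:C *: w.
  pose c : R := l.+1%:R.
  pose x := (4^-1 - c ^+ 2)%:C *: (a ** a) + (2 * c)%:C *: (a ** (a ** a)) + (-1)%:C *: (a ** (a ** (a ** a))).
  have xs : cstar x = x by rewrite /x !cstarD !cstarZr !cstarM ast !cmulA.
  have [y ys hy] := pos_exists An xs; exists y; split => // m r w t hr aw.
  apply: hy => //; rewrite /x !(repD _ _ hr) !(repZ _ _ hr) !(rep_mul hr) !mulmxDl -!scalemxAl -!mulmxA.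
  rewrite !(aw, =^~ scalemxAr) !scalerA -!scalerDl; congr (_ *: _).
  by rewrite -!rmorphM -!rmorphD /=; congr (_%:C); rewrite /c; ring.
by exists (fun l => sval (cid (ex l))) => [l|l]; case: cid => y [].
Qed.

Lemma rank_one_sum n (Q : 'M[C]_n) : Q \is unitarymx ->
  \sum_i col i Q *m (col i Q) ^t* = 1%:M.
Proof.
move=> /unitarymxP <-; apply/matrixP => i j; rewrite summxE mxE; apply: eq_bigr => k _.
by rewrite !mxE big_ord1 !mxE.
Qed.

(** An explicit analogue of a central polynomial. In degree K, e l cuts out the eigenvector of a
    with eigenvalue near l + 1, and u l maps it to a multiple be l of the vector of slot 0. If some
    slot is empty, as always below degree K, then z vanishes; if each slot holds exactly one
    eigenvector, z is the product of all |be l|^2 times the identity. *)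
Lemma scalar_element_aux K (a : A) : (0 < K)%N -> cstar a = a -> forall b : 'I_K -> A,
  exists z : A, [/\ forall n p, tdeg p = n -> (n < K)%N -> zr n p z = 0,
      forall p : Z, exists2 t : R, 0 <= t & zr K p z = t%:C%:M,
      forall p : Z, zr K p a = \matrix_(i, j) (if i == j then i.+1%:R else 0) ->
        (forall l : 'I_K, exists o, zr K p (b l) = delta_mx o l /\ nat_of_ord o = 0%N) -> zr K p z != 0 &
      forall n (p : Z), opnorm (zr n p a) <= 2^-1 -> zr n p z = 0].
Proof.
move=> K0 ast b; pose o : 'I_K := Ordinal K0.
have [e es eE] := bump_elements K ast.
pose u l := e o ** (b l ** e l).
pose rr l := [seq m <- index_enum 'I_K | m != l].
(* Inserting u m (u m)* for every m other than l puts the same product of all |be m|^2 in front of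
   each diagonal projection. *)
pose w l := foldr (fun m acc => u m ** (cstar (u m) ** acc)) (u l) (rr l).
pose z := \sum_l cstar (u l) ** w l; exists z.
have zsum n (p : Z) : zr n p z = \sum_l (zr n p (u l)) ^t* *m zr n p (w l).
  have hr := zr_rep n p; rewrite /z.
  elim: (index_enum _) => [|l r ih]; first by rewrite !big_nil (rep0 hr).
  by rewrite !big_cons (repD _ _ hr) ih (rep_mul hr) (rep_star hr).
have wE n (p : Z) l : zr n p (w l) = foldr (fun m acc => zr n p (u m) *m ((zr n p (u m)) ^t* *m acc))
    (zr n p (u l)) (rr l).
  have hr := zr_rep n p; rewrite /w; elim: (rr l) => [//|m r ih] /=.
  by rewrite (rep_mul hr (u m)) (rep_mul hr (cstar (u m))) (rep_star hr) ih.
have uE n (p : Z) l : zr n p (u l) = zr n p (e o) *m (zr n p (b l) *m zr n p (e l)).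
  by rewrite (rep_mul (zr_rep n p) (e o)) (rep_mul (zr_rep n p) (b l)).
have zero n (p : Z) l : zr n p (e l) = 0 -> zr n p z = 0.
  move=> el0; have ul0 : zr n p (u l) = 0 by rewrite uE el0 !mulmx0.
  rewrite zsum big1// => k _; have [->|kl] := eqVneq k l.
    by rewrite ul0 trmx0 map_mx0 mul0mx.
  have : l \in rr k by rewrite mem_filter eq_sym kl mem_index_enum.
  rewrite wE => lr; suff -> : foldr (fun m acc => zr n p (u m) *m ((zr n p (u m)) ^t* *m acc))
    (zr n p (u k)) (rr k) = 0 by rewrite mulmx0.
  elim: (rr k) lr => [//|m r ih] /=; rewrite inE => /orP[/eqP <-|/ih ->].
    by rewrite ul0 mul0mx.
  by rewrite !mulmx0.
have pst n (p : Z) : (zr n p a) ^t* = zr n p a by rewrite -(rep_star (zr_rep n p)) ast.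
(* Either some bump vanishes on the whole spectrum of a, or the bumps select K distinct
   eigenvectors; the latter needs n >= K. *)
have slots n (p : Z) : (exists l, zr n p (e l) = 0) \/
    exists (Q : 'M[C]_n) (d : 'I_n -> R) (f : 'I_K -> 'I_n),
    [/\ Q \is unitarymx, forall i, zr n p a *m col i Q = (d i)%:C *: col i Q,
        injective f & forall l, bump l (d (f l)) != 0].
  have [Q [d [Qu Qd]]] := herm_spectral (pst n p).
  have [h|h] := pselect (forall l : 'I_K, exists i, bump l (d i) != 0).
    right; pose f l := sval (cid (h l)).
    have fP l : bump l (d (f l)) != 0 by rewrite /f; case: cid.
    exists Q, d, f; split => // l m lm; apply: (@bump_inj K l m (d (f l))) => //.
    by rewrite lm.
  left; have [l hl] : exists l : 'I_K, forall i, bump l (d i) = 0.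
    apply: contrapT => h2; apply: h => l; apply: contrapT => h3; apply: h2; exists l => i.
    by apply/eqP; apply: contrapT => /negP h4; apply: h3; exists i.
  exists l; apply: (mx_eq_cols Qu) => i.
  by rewrite (eE _ _ _ _ _ (zr_rep n p) (Qd i)) hl scale0r mul0mx.
have scal (p : Z) (Q : 'M[C]_K) (d : 'I_K -> R) (f : 'I_K -> 'I_K) :
    Q \is unitarymx -> (forall i, zr K p a *m col i Q = (d i)%:C *: col i Q) ->
    injective f -> (forall l, bump l (d (f l)) != 0) ->
    exists be : 'I_K -> C, (forall l, be l = 0 -> zr K p (u l) = 0) /\
      zr K p z = (\prod_l normc (be l) ^+ 2)%:C%:M.
  move=> Qu Qd finj fb; pose v l := col (f l) Q; pose P l m := v l *m (v m) ^t*.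
  have vv l m : (v l) ^t* *m v m = ((l == m)%:R)%:M.
    rewrite /v tr_col map_row -row_mul -col_mulmx unitarymxKl//.
    apply/matrixP => i j; rewrite !ord1 !mxE (inj_eq finj) mulr1n.
    by case: eqVneq.
  have PP l m m' k : P l m *m P m' k = ((m == m')%:R) *: P l k.
    by rewrite /P -mulmxA [(v m) ^t* *m _]mulmxA vv mul_scalar_mx -scalemxAr.
  have Pst l m : (P l m) ^t* = P m l by rewrite /P trmx_mul map_mxM trmxCK.
  have fbij : bijective f := injF_bij finj.
  have eP l : zr K p (e l) = (bump l (d (f l)))%:C *: P l l.
    apply: (mx_eq_cols Qu) => i; have [g gK fK] := fbij; rewrite -(fK i) -/(v (g i)).
    rewrite (eE _ _ _ _ _ (zr_rep K p) (Qd _)) -scalemxAl /P -mulmxA vv mul_mx_scalar scalerA.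
    have [<-|lg] := eqVneq l (g i); first by rewrite mulr1.
    rewrite mulr0 scale0r; have [->|h] := eqVneq (bump l (d (f (g i)))) 0; first by rewrite scale0r.
    by move/eqP: lg; case; exact: bump_inj h (fb (g i)).
  have uP l : exists be, zr K p (u l) = be *: P o l.
    rewrite uE !eP -!scalemxAr -scalemxAl scalerA.
    rewrite /P -!mulmxA [(v o) ^t* *m _]mulmxA [(v o) ^t* *m _ *m _]mulmxA.
    rewrite [(v o) ^t* *m zr K p (b l) *m v l]mx11_scalar mul_scalar_mx -scalemxAr scalerA.
    by eexists; reflexivity.
  pose be l := sval (cid (uP l)).
  have beP l : zr K p (u l) = be l *: P o l by rewrite /be; case: cid.
  have buP l : (zr K p (u l)) ^t* = (be l)^*%R *: P l o by rewrite beP linearZ /= map_mxZ Pst.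
  exists be; split; first by move=> l b0; rewrite beP b0 scale0r.
  have uu (m : 'I_K) (X : 'M[C]_K) : zr K p (u m) *m ((zr K p (u m)) ^t* *m X) = (normc (be m) ^+ 2)%:C *: (P o o *m X).
    rewrite beP linearZ /= map_mxZ Pst -!scalemxAl -scalemxAr scalerA mulmxA PP eqxx scale1r.
    by congr (_ *: _); exact: mul_conj_normc.
  have wP l : zr K p (w l) = ((\prod_(m <- rr l) normc (be m) ^+ 2)%:C * be l) *: P o l.
    rewrite wE; elim: (rr l) => [|m r ih] /=; first by rewrite big_nil mul1r beP.
    rewrite ih uu -scalemxAr PP eqxx scale1r scalerA big_cons; congr (_ *: _).
    by rewrite mulrA -rmorphM.
  rewrite zsum; have -> : \sum_l zr K p (u l) ^t* *m zr K p (w l) =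
      \sum_l (\prod_l normc (be l) ^+ 2)%:C *: P l l.
    apply: eq_bigr => l _; rewrite wP buP -scalemxAl -scalemxAr PP eqxx scale1r scalerA.
    congr (_ *: _); rewrite (bigD1 l)//= /rr big_filter.
    rewrite [RHS]rmorphM /= mulrCA mulrC; congr (_ * _).
    by rewrite mulrC; exact: mul_conj_normc.
  rewrite -scaler_sumr [X in _ *: X](_ : _ = 1%:M) ?scalemx1//.
  by rewrite -(rank_one_sum Qu) [RHS](reindex f)//; exact: onW_bij.
split.
- move=> n p pn nK; have [[l /zero//]|[Q [d [f [_ _ finj _]]]]] := slots n p.
  by have := leq_card f finj; rewrite !card_ord leqNgt nK.
- move=> p; have [[l /zero ->]|[Q [d [f [Qu Qd finj fb]]]]] := slots K p.
    by exists 0 => //; rewrite raddf0.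
  have [be [_ ->]] := scal p Q d f Qu Qd finj fb.
  by exists (\prod_l normc (be l) ^+ 2) => //; rewrite prodr_ge0// => l _; exact: sqr_ge0.
- move=> p pa pb; pose dl (l : 'I_K) : 'cV[C]_K := delta_mx l 0.
  have dl0 l : dl l != 0.
    by apply/eqP => /matrixP/(_ l 0); rewrite !mxE !eqxx => /eqP; rewrite oner_eq0.
  have ad l : zr K p a *m dl l = (l.+1%:R)%:C *: dl l.
    rewrite -colE; apply/colP => i; rewrite pa !mxE eqxx andbT rmorph_nat.
    by case: eqVneq => [->|_]; rewrite ?mulr1 ?mulr0.
  have ed l : zr K p (e l) *m dl l = (bump l l.+1%:R)%:C *: dl l := eE _ _ _ _ _ (zr_rep K p) (ad l).
  have bc (l : 'I_K) : (bump l l.+1%:R)%:C != 0 :> C.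
    by apply: contra (bump_center l) => /eqP /complexI ->.
  have ud l : zr K p (u l) *m dl l != 0.
    rewrite uE -!mulmxA ed -!scalemxAr; case: (pb l) => o' [-> o'0].
    have -> : o' = o by apply: val_inj.
    rewrite mul_delta_mx -/(dl o) ed scalerA scaler_eq0 negb_or dl0 andbT.
    by rewrite mulf_neq0.
  have [[l el]|[Q [d [f [Qu Qd finj fb]]]]] := slots K p.
    have := ed l; rewrite el mul0mx => /esym/eqP; rewrite scaler_eq0 (negPf (bc l)).
    by rewrite (negPf (dl0 l)).
  have [be [be0 ->]] := scal p Q d f Qu Qd finj fb.
  have pi0 : \prod_l normc (be l) ^+ 2 != 0.
    apply/prodf_neq0 => l _; rewrite sqrf_eq0; apply/negP => /eqP/ComplexField.Normc.eq0_normc/be0 ul.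
    by move/eqP: (ud l); rewrite ul mul0mx.
  apply/eqP => /matrixP/(_ o o); rewrite !mxE eqxx mulr1n => /complexI h.
  by rewrite h eqxx in pi0.
- move=> n p pa; apply: (zero n p o).
  have [Q [d [Qu Qd]]] := herm_spectral (pst n p).
  apply: (mx_eq_cols Qu) => i.
  rewrite (eE _ _ _ _ _ (zr_rep n p) (Qd i)) bump_small ?scale0r ?mul0mx//.
  by rewrite -normc_real; exact: le_trans (eigenvalue_opnorm Qu (Qd i)) pa.
Qed.

(** The diagonal entries l + 1 at s place one eigenvalue at the centre of each bump; dividing by the
    nonzero scalar at s normalises z. *)
Lemma scalar_element K (s : Z) (a : A) : tdeg s = K -> cstar a = a ->
  zr K s a = \matrix_(i, j) (if i == j then i.+1%:R else 0) ->
  (forall X, exists b, zr K s b = X) -> exists z : A,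
  [/\ forall n p, tdeg p = n -> (n < K)%N -> zr n p z = 0,
      forall p : Z, exists2 t : R, 0 <= t & zr K p z = t%:C%:M,
      zr K s z = 1%:M &
      forall n (p : Z), opnorm (zr n p a) <= 2^-1 -> zr n p z = 0].
Proof.
move=> sK ast sa sb; have K0 : (0 < K)%N by rewrite -sK (wdeg_gt0 zw).
pose o : 'I_K := Ordinal K0; pose b l := sval (cid (sb (delta_mx o l))).
have bE l : zr K s (b l) = delta_mx o l by rewrite /b; case: cid.
have [z [z1 z2 z3 z4]] := scalar_element_aux K0 ast b.
have sz : zr K s z != 0 by apply: z3 => // l; exists o.
have [t t0 zt] := z2 s.
have tn0 : t != 0 by apply: contra sz => /eqP t00; rewrite zt t00 raddf0.
exists (t^-1%:C *: z); split.
- by move=> n p pn nK; rewrite (repZ _ _ (zr_rep n p)) z1// scaler0.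
- move=> p; have [t' t'0 zt'] := z2 p; exists (t^-1 * t').
    by rewrite mulr_ge0// invr_ge0.
  by rewrite (repZ _ _ (zr_rep K p)) zt' scale_scalar_mx; congr (_%:M); rewrite rmorphM.
- rewrite (repZ _ _ (zr_rep K s)) zt scale_scalar_mx -rmorphM mulVf//.
- by move=> n p /z4 h; rewrite (repZ _ _ (zr_rep n p)) h scaler0.
Qed.

End ScalarElements.

Lemma half_le (R : realType) (y : R) : `|1 - y| <= 2^-1 -> 2^-1 <= y.
Proof. by rewrite ler_norml => /andP[_]; lra. Qed.

(** In [approx_step], o is the error of an iterate and x the relaxation weight, bounded below by q;
    the excess y of the error over e shrinks by the factor 1 - q. *)
Lemma averaging_step (R : realType) (e y o x q : R) : 0 <= y -> o <= e + y -> q <= x -> x <= 1 ->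
  (1 - x) * o + x * e <= e + (1 - q) * y.
Proof.
move=> y0 oy qx x1.
have h1 : 0 <= (1 - x) * (e + y - o) by rewrite mulr_ge0// subr_ge0.
have h2 : 0 <= (x - q) * y by rewrite mulr_ge0// subr_ge0.
lra.
Qed.

(** * Approximation degree by degree *)

Section StoneWeierstrass.
Variables (R : realType) (A : cStarAlgType R).
Hypothesis An : mx_normed A.
Local Notation C := R[i].
Local Notation Z := (ztower A).
Local Notation B := (ptCstar (zzero A)).
Local Notation "a ** b" := (cmul a b) (at level 40, left associativity).
Let zw := ztower_wtower A.

Lemma gelfand_in a : in_cstar (fun p : Z => zrep p a).
Proof.
split.
- move=> n; apply: continuous_subspaceT => p.
  exact: (cvg_trans (cvg_app (mat n) (@zev_continuous R A a p)) (@mat_continuous R n (zev a p))).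
- move=> p U Uu; have := zr_act a (erefl (tdeg p)) Uu.
  by rewrite zr_id invmx_unitary.
- by move=> p q; have := zr_plus a (erefl (tdeg p)) (erefl (tdeg q)); rewrite !zr_id.
- exists (nrm a) => p; exact: rep_contractive (zrepP p).
Qed.

Lemma gelfand_zzero a : zrep (zzero A) a = 0.
Proof. by []. Qed.

Definition gelfand a : B := PtCstar (gelfand_in a) (gelfand_zzero a).

Lemma pv_gelfand n a (p : Z) : pv n (gelfand a) p = zr n p a. Proof. by []. Qed.

Lemma zr_zzero n a : zr n (zzero A) a = 0.
Proof. exact: conform0. Qed.

(** A zero representation of dimension above one is reducible, so the base point is the only
    irreducible point at which all of A vanishes. *)
Lemma zero_irreducible (s : Z) : ~ reducible s -> (forall a, zr (tdeg s) s a = 0) -> s = zzero A.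
Proof.
move=> sirr s0; have p0 : (0 < tdeg s)%N := wdeg_gt0 zw s.
have s1 : tdeg s = 1%N.
  apply/eqP; rewrite eqn_leq p0 andbT leqNgt; apply/negP => p1; apply: sirr.
  apply: (@reducible_sub _ _ (tdeg s) 1 s (delta_mx 0 (Ordinal p0))) => //.
    by apply/unitarymxP; rewrite trmx_delta map_delta_mx mul_delta_mx; apply/matrixP => i j; rewrite !ord1 !mxE.
  by move=> a; rewrite s0 mulmx0 sub0mx.
by apply: (@zr_eq _ _ 1) => // a; rewrite zr_zzero; move: (s0 a); rewrite s1.
Qed.

Lemma tdisj_zzero (s : Z) : ~ reducible s -> s <> zzero A -> tdisj s (zzero A).
Proof.
move=> sirr s0; apply: (tdisj_irr2 zw sirr); first exact: (deg1_irreducible zw).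
move=> h; have [U Uu e] := tequivE (erefl : tdeg (zzero A) = 1%N) (tequiv_sym zw h).
apply: s0; rewrite -e; apply: (@zr_eq _ _ 1) => // a.
by rewrite zr_act// !zr_zzero mulmx0 mul0mx.
Qed.

Lemma compact_value_set n (f : Z -> 'M[C]_n) (c : R) :
  (forall p, f q @[q --> p] --> f p) -> compact [set p : Z | tdeg p = n /\ c <= opnorm (f p)].
Proof.
move=> fc; rewrite [X in compact X](_ : _ = tfib Z n `&` [set p | c <= opnorm (f p)]).
  apply: compact_closedI; first exact: ztower_compact.
  move=> p clp; apply/ler_addgt0Pr => e e0.
  have /cvg_opnormP/(_ _ e0) h := fc p.
  have [q [/= cq fq]] := clp _ h.
  rewrite (le_trans cq)// -[f q](subKr (f p)); apply: le_trans (opnormD _ _) _.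
  by rewrite opnormN lerD2l.
by apply/seteqP; split => p [].
Qed.

Lemma tdisj_same_deg (s y : Z) : ~ reducible s -> tdeg y = tdeg s -> ~ tequiv s y -> tdisj s y.
Proof. by move=> sirr d h; apply: (tdisj_irr zw sirr) => /(tsub_same_deg zw (esym d)). Qed.

(** A finite product of scalar elements, one for each member of a cover of F; in degree K it is
    again scalar, and it vanishes as soon as one factor does. *)
Lemma scalar_cover K (s : Z) (F : set Z) : tdeg s = K -> ~ reducible s -> s <> zzero A ->
  compact F -> (forall p, F p -> tdeg p = K /\ tdisj s p) -> exists z : A,
  [/\ forall n p, tdeg p = n -> (n < K)%N -> zr n p z = 0,
      forall p : Z, exists2 t : R, 0 <= t & zr K p z = t%:C%:M,
      zr K s z = 1%:M & forall p, F p -> zr K p z = 0].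
Proof.
move=> sK sirr s0 cF Fd.
have snz : exists a, zr K s a != 0.
  apply: contrapT => h; apply: s0; apply: zero_irreducible => // a.
  by rewrite sK; apply/eqP; apply: contrapT => /negP h2; apply: h; exists a.
have sb X : exists b, zr K s b = X.
  have [b h _] := rep_separate X sK (erefl _) sirr snz (tdisj_zzero sirr s0).
  by exists b.
pose D : 'M[C]_K := \matrix_(i, j) (if i == j then i.+1%:R else 0).
have Dst : D ^t* = D.
  apply/matrixP => i j; rewrite !mxE eq_sym; case: eqVneq => [->|_]; last by rewrite conjC0.
  exact: conjC_nat.
have ex (y : Z) : tdisj s y -> exists z : A, [/\ forall n p, tdeg p = n -> (n < K)%N -> zr n p z = 0,
    forall p : Z, exists2 t : R, 0 <= t & zr K p z = t%:C%:M,
    zr K s z = 1%:M & \forall p \near y, zr (tdeg y) p z = 0].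
  move=> sy; have [a sa ya] := rep_separate D sK (erefl _) sirr snz sy.
  pose a' := 2^-1%:C *: (a + cstar a).
  have a's : cstar a' = a' by rewrite cstarZr cstarD cstarK addrC.
  have sa' : zr K s a' = D.
    rewrite (repZ _ _ (zr_rep K s)) (repD _ _ (zr_rep K s)) (rep_star (zr_rep K s)) sa Dst.
    by rewrite -[D + D]mulr2n -[D *+ 2]scaler_nat scalerA -(rmorph_nat (real_complex R)) -rmorphM mulVf ?scale1r.
  have ya' : zr (tdeg y) y a' = 0.
    rewrite (repZ _ _ (zr_rep _ y)) (repD _ _ (zr_rep _ y)) (rep_star (zr_rep _ y)) ya.
    by rewrite trmx0 map_mx0 addr0 scaler0.
  have [z [z1 z2 z3 z4]] := scalar_element An sK a's sa' sb.
  exists z; split => //.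
  have c : zr (tdeg y) p a' @[p --> y] --> zr (tdeg y) y a'.
    exact: (cvg_trans (cvg_app (mat _) (@zev_continuous R A a' y)) (@mat_continuous R _ (zev a' y))).
  have h2 : (0 < 2^-1 :> R) by rewrite invr_gt0.
  have /cvg_opnormP/(_ _ h2) := c; apply: filterS => p.
  by rewrite ya' sub0r opnormN => /z4.
pose zf (y : Z) : A := if pselect (tdisj s y) is left h then sval (cid (ex y h)) else 0.
have zfP y : tdisj s y -> [/\ forall n p, tdeg p = n -> (n < K)%N -> zr n p (zf y) = 0,
    forall p : Z, exists2 t : R, 0 <= t & zr K p (zf y) = t%:C%:M,
    zr K s (zf y) = 1%:M & \forall p \near y, zr (tdeg y) p (zf y) = 0].
  by move=> h; rewrite /zf; case: pselect => // h'; case: cid.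
have [ys [ysF yscov]] := @compact_list_cover Z F (fun y => [set p | zr (tdeg y) p (zf y) = 0]) cF
  (fun y Fy => let: And4 _ _ _ h := zfP y (Fd y Fy).2 in h).
(* The product starts with the element for the zero representation, so that it makes sense for an
   empty cover in an algebra without unit. *)
pose z0 := zf (zzero A); pose z := foldr (fun y acc => zf y ** acc) z0 ys.
have z0P := zfP _ (tdisj_zzero sirr s0).
have ysd y : y \in ys -> tdisj s y by move=> /ysF /Fd[].
exists z; rewrite /z; split.
- move=> n p pn nK; elim: ys ysd {ysF yscov z} => [|y r ih] ysd /=; first by case: z0P => h _ _ _; exact: h.
  by rewrite (rep_mul (zr_rep n p)) ih ?mulmx0// => y' y'r; apply: ysd; rewrite inE y'r orbT.
- move=> p; elim: ys ysd {ysF yscov z} => [|y r ih] ysd /=; first by case: z0P => _ h _ _; exact: h.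
  have [|t t0 e] := ih; first by move=> y' y'r; apply: ysd; rewrite inE y'r orbT.
  have [_ /(_ p)[t' t'0 e'] _ _] := zfP y (ysd y (mem_head _ _)).
  exists (t' * t); first exact: mulr_ge0.
  by rewrite (rep_mul (zr_rep K p)) e e' -scalar_mxM; congr (_%:M); rewrite rmorphM.
- elim: ys ysd {ysF yscov z} => [|y r ih] ysd /=; first by case: z0P.
  rewrite (rep_mul (zr_rep K s)) ih; last by move=> y' y'r; apply: ysd; rewrite inE y'r orbT.
  by have [_ _ -> _] := zfP y (ysd y (mem_head _ _)); rewrite mulmx1.
- move=> p Fp; have [y yys /= h] := yscov p Fp; have h' : zr (tdeg y) p (zf y) = 0 := h.
  have yK : tdeg y = K by have [] := Fd y (ysF y yys).
  rewrite yK in h'; elim: ys yys {ysF yscov ysd z} => [//|y' r ih] /=.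
  rewrite inE => /orP[/eqP e|/ih e]; rewrite (rep_mul (zr_rep K p)).
    by rewrite -e h' mul0mx.
  by rewrite e mulmx0.
Qed.

(** The points of degree K where g has norm at least 2 e form a compact set G, and they are
    irreducible because reducible points are controlled by lower degrees. Near each of them some a
    approximates g, weighted by a scalar element that vanishes where a is off by e or more. Division
    by the sum of the weights is replaced by an iteration, since A may have no unit and the weights
    may all vanish off G. *)
Lemma approx_step K (g : B) (e : R) : 0 < e -> (forall p, (tdeg p < K)%N -> opnorm (g p) <= e) ->
  exists a, (forall n p, tdeg p = n -> (n < K)%N -> zr n p a = 0) /\
    forall p, tdeg p = K -> opnorm (pv K g p - zr K p a) <= 2 * e.
Proof.
move=> e0 glow; have zdc := @zdeg_near _ A.
pose G := [set p : Z | tdeg p = K /\ 2 * e <= opnorm (pv K g p)].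
have cG : compact G by apply: compact_value_set => p; exact: pv_cvg zdc K g p.
have Girr s : G s -> ~ reducible s.
  move=> [sK gs] [a [b [V [Vu ab]]]].
  have dab : (tdeg a + tdeg b)%N = tdeg s by rewrite -(wdegD zw) -ab (wdeg_act zw).
  have a0 := wdeg_gt0 zw a; have b0 := wdeg_gt0 zw b.
  have : opnorm (g s) <= e.
    by apply: (pv_reducible zw (erefl _) Vu ab); apply: glow; lia.
  by move: gs; rewrite opnorm_pv//; move: (opnorm _) => t; lra.
have Gnz s : G s -> s <> zzero A.
  move=> [sK gs] e1; move: gs; rewrite opnorm_pv// e1 ptval0 opnorm0; lra.
have ex s : G s -> exists az : A * A, [/\ zr K s az.2 = 1%:M,
    forall n p, tdeg p = n -> (n < K)%N -> zr n p az.2 = 0,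
    forall p : Z, exists2 t : R, 0 <= t & zr K p az.2 = t%:C%:M &
    forall p, tdeg p = K -> e <= opnorm (pv K g p - zr K p az.1) -> zr K p az.2 = 0].
  move=> Gs; have [sK gs] := Gs; have sirr := Girr s Gs; have snz := Gnz s Gs.
  have snz' : exists a, zr K s a != 0.
    apply: contrapT => h; apply: snz; apply: zero_irreducible => // a.
    by rewrite sK; apply/eqP; apply: contrapT => /negP h2; apply: h; exists a.
  have [a sa _] := rep_separate (pv K g s) sK (erefl _) sirr snz' (tdisj_zzero sirr snz).
  pose F := [set p : Z | tdeg p = K /\ e <= opnorm (pv K (g - gelfand a) p)].
  have cF : compact F by apply: compact_value_set => p; exact: pv_cvg zdc K _ p.
  have [|z [z1 z2 z3 z4]] := scalar_cover sK sirr snz cF.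
    move=> p [pK ep]; split => //; apply: tdisj_same_deg => //; first by rewrite pK.
    move=> sp; have [U Uu e'] := tequivE sK sp.
    move: ep; rewrite pvB pv_gelfand -e' pv_act// zr_act// sa subrr opnorm0.
    by move=> /(lt_le_trans e0); rewrite ltxx.
  exists (a, z); split; [exact: z3|exact: z1|exact: z2|] => p pK h.
  by apply: z4; split; [exact: pK|rewrite pvB; exact: h].
pose azf (s : Z) : A * A := if pselect (G s) is left h then sval (cid (ex s h)) else 0.
have azP s : G s -> [/\ zr K s (azf s).2 = 1%:M,
    forall n p, tdeg p = n -> (n < K)%N -> zr n p (azf s).2 = 0,
    forall p : Z, exists2 t : R, 0 <= t & zr K p (azf s).2 = t%:C%:M &
    forall p, tdeg p = K -> e <= opnorm (pv K g p - zr K p (azf s).1) -> zr K p (azf s).2 = 0].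
  by move=> h; rewrite /azf; case: pselect => // h'; case: cid.
have half : 0 < 2^-1 :> R by rewrite invr_gt0.
have nb s : G s -> nbhs s [set p | opnorm (zr K s (azf s).2 - zr K p (azf s).2) <= 2^-1].
  move=> Gs; have c : zr K p (azf s).2 @[p --> s] --> zr K s (azf s).2.
    exact: (cvg_trans (cvg_app (mat _) (@zev_continuous R A _ s)) (@mat_continuous R _ (zev _ s))).
  by have /cvg_opnormP/(_ _ half) := c.
have [ss [ssG sscov]] := compact_list_cover cG nb.
pose cc := \sum_(s <- ss) (azf s).2 ** (azf s).1; pose zz := \sum_(s <- ss) (azf s).2.
(* An upper bound for the total weight in every representation, so that t / M is in [0, 1]; the
   summand 1 makes it positive. *)
pose M := \sum_(s <- ss) nrm (azf s).2 + 1.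
have M1 : 0 < M by rewrite ltr_wpDl// sumr_ge0// => s _; exact: nrm_ge0.
(* Relaxation towards a solution b of zz b = cc: at p, where zz is the scalar t, the new error is at
   most 1 - t/M times the old one plus t/M times e. *)
pose fix bn n : A := if n is m.+1 then bn m + M^-1%:C *: (cc - zz ** bn m) else 0.
have blow j n p : tdeg p = n -> (n < K)%N -> zr n p (bn j) = 0.
  move=> pn nK; have hr := zr_rep n p.
  have zs (f : Z -> A) : (forall s, s \in ss -> zr n p (f s) = 0) -> zr n p (\sum_(s <- ss) f s) = 0.
    elim: ss {ssG sscov cc zz M M1 bn} => [|s r ih] h; first by rewrite big_nil (rep0 hr).
    rewrite big_cons (repD _ _ hr) h ?mem_head// ih ?addr0// => s' s'r.
    by apply: h; rewrite inE s'r orbT.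
  have c0 : zr n p cc = 0.
    by apply: zs => s /ssG/azP[_ h _ _]; rewrite (rep_mul hr) h// mul0mx.
  have z0 : zr n p zz = 0 by apply: zs => s /ssG/azP[_ h _ _]; exact: h.
  elim: j => [|j ih] /=; first exact: rep0 hr.
  by rewrite (repD _ _ hr) (repZ _ _ hr) (repB _ _ hr) (rep_mul hr) c0 z0 ih mul0mx subrr scaler0 addr0.
pose Gam := supnorm g.
(* On G the total weight is at least 1/2, which gives the contraction ratio 1 - 1/(2M); off G the
   initial error is at most 2 e and no iterate exceeds this. *)
pose kap := 1 - 2^-1 / M.
have main p : tdeg p = K -> exists2 t : R, 0 <= t <= M & (G p -> 2^-1 <= t) /\
    forall n, opnorm (pv K g p - zr K p (bn n.+1)) <=
      (1 - t / M) * opnorm (pv K g p - zr K p (bn n)) + t / M * e.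
  move=> pK; have hr := zr_rep K p; have K0 : (0 < K)%N by rewrite -pK (wdeg_gt0 zw).
  pose tf s : R := complex.Re (zr K p (azf s).2 (Ordinal K0) (Ordinal K0)).
  have tE s : s \in ss -> 0 <= tf s /\ zr K p (azf s).2 = (tf s)%:C%:M.
    move=> /ssG/azP[_ _ /(_ p)[t t0 te] _]; rewrite /tf te mxE eqxx mulr1n /=.
    by split.
  pose t := \sum_(s <- ss) tf s.
  have zt : zr K p zz = t%:C%:M.
    rewrite /zz /t; elim: ss tE {ssG sscov cc zz M M1 bn blow kap t} => [|s r ih] h.
      by rewrite !big_nil (rep0 hr) raddf0.
    rewrite !big_cons (repD _ _ hr) ih; last by move=> s' s'r; apply: h; rewrite inE s'r orbT.
    by have [_ ->] := h s (mem_head _ _); rewrite rmorphD /= raddfD.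
  have eta : opnorm (zr K p cc - t%:C *: pv K g p) <= t * e.
    rewrite /cc /t; elim: ss ssG tE {sscov cc zz M M1 bn blow kap t zt} => [|s r ih] hG h.
      by rewrite !big_nil (rep0 hr) scale0r subrr mul0r opnorm0.
    have sub s' : s' \in r -> s' \in s :: r by move=> s'r; rewrite inE s'r orbT.
    have ih' := ih (fun s' s'r => hG s' (sub s' s'r)) (fun s' s'r => h s' (sub s' s'r)).
    rewrite !big_cons (repD _ _ hr) rmorphD /= scalerDl mulrDl opprD addrACA.
    apply: le_trans (opnormD _ _) _; apply: lerD ih'.
    have [t0 te] := h s (mem_head _ _); rewrite (rep_mul hr) te mul_scalar_mx -scalerBr opnormZ.
    rewrite normc_real ger0_norm//.
    have [->|tn0] := eqVneq (tf s) 0; first by rewrite !mul0r.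
    apply: (ler_wpM2l t0); rewrite leNgt; apply/negP => he.
    have [_ _ _ /(_ p pK)] := azP s (hG s (mem_head _ _)).
    rewrite -opnormN opprB => /(_ (ltW he)); rewrite te => /matrixP/(_ (Ordinal K0) (Ordinal K0)).
    by rewrite !mxE eqxx mulr1n => /complexI/eqP; rewrite (negPf tn0).
  have t0 : 0 <= t by rewrite /t big_seq sumr_ge0// => s /tE[].
  have tM : t <= M.
    rewrite /t /M ler_wpDr// !big_seq ler_sum// => s sss; have [ts te] := tE s sss.
    have := rep_contractive (azf s).2 hr; rewrite te; apply: le_trans.
    have := opnorm_entry ((tf s)%:C%:M : 'M[C]_K) (Ordinal K0) (Ordinal K0).
    by rewrite mxE eqxx mulr1n normc_real ger0_norm.
  exists t; first by rewrite t0.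
  split=> [Gp|n].
    have [s sss /= hs] := sscov p Gp; have [ts te] := tE s sss.
    have : 2^-1 <= tf s.
      have [s1 _ _ _] := azP s (ssG s sss); rewrite s1 te in hs.
      have := le_trans (opnorm_entry _ (Ordinal K0) (Ordinal K0)) hs.
      rewrite !mxE eqxx !mulr1n -(rmorph1 (real_complex R)) -rmorphB normc_real.
      exact: half_le.
    move=> h; apply: le_trans h _; rewrite /t (big_rem s sss) /= lerDl big_seq.
    by apply: sumr_ge0 => s' /mem_rem /tE[].
  rewrite /= (repD _ _ hr) (repZ _ _ hr) (repB _ _ hr) (rep_mul hr) zt mul_scalar_mx.
  have -> : pv K g p - (zr K p (bn n) + M^-1%:C *: (zr K p cc - t%:C *: zr K p (bn n))) =
     (1 - t / M)%:C *: (pv K g p - zr K p (bn n)) - M^-1%:C *: (zr K p cc - t%:C *: pv K g p).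
    rewrite rmorphB rmorphM /=; move: (pv K g p) (zr K p (bn n)) (zr K p cc) => x y c.
    by lmod R ('M[C]_K).
  apply: le_trans (opnormD _ _) _; rewrite opnormN !opnormZ !normc_real.
  have tM1 : t / M <= 1 by rewrite ler_pdivrMr// mul1r.
  rewrite [`|1 - t / M|]ger0_norm ?subr_ge0// [`|M^-1|]gtr0_norm ?invr_gt0// lerD2l mulrAC.
  by rewrite mulrC ler_wpM2r// invr_ge0 ltW.
have kap1 : `|kap| < 1.
  have MM : 2^-1 / M < 1 by rewrite ltr_pdivrMr// mul1r /M; apply: lt_le_trans (_ : 1 <= _);
    [lra|rewrite lerDr sumr_ge0// => s _; exact: nrm_ge0].
  have : 0 < 2^-1 / M by rewrite divr_gt0.
  by rewrite /kap; move: (2^-1 / M) MM => q q1 q0; rewrite ltr_norml; apply/andP; split; lra.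
have [N hN] : exists N, kap ^+ N * Gam <= e.
  have G1 : 0 < e / (Gam + 1) by rewrite divr_gt0// ltr_wpDl ?supnorm_ge0.
  have /cvgrPdist_le/(_ _ G1)[N _ hN] := cvg_expr kap1.
  exists N; have := hN N (leqnn N); rewrite /= sub0r normrN => h.
  have G0 : 0 <= Gam by exact: supnorm_ge0.
  have G2 : 0 < Gam + 1 by rewrite ltr_wpDl.
  apply: le_trans (ler_norm _) _.
  rewrite normrM (ger0_norm G0); apply: le_trans (_ : `|kap ^+ N| * (Gam + 1) <= e).
    by rewrite ler_wpM2l// lerDl.
  by rewrite -ler_pdivlMr.
exists (bn N); split; first by move=> n p; exact: blow.
move=> p pK; have [t /andP[t0 tM] [tG step]] := main p pK.
have tM0 : 0 <= t / M by rewrite divr_ge0// ltW.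
have tM1 : t / M <= 1 by rewrite ler_pdivrMr// mul1r.
have [Gp|nG] := pselect (G p); last first.
  have g2 : opnorm (pv K g p) <= 2 * e.
    by rewrite leNgt; apply/negP => h; apply: nG; split => //; exact: ltW.
  have : forall n, opnorm (pv K g p - zr K p (bn n)) <= 2 * e.
    elim=> [|n ih]; first by rewrite /= (rep0 (zr_rep K p)) subr0.
    apply: le_trans (step n) _; move: (t / M) (opnorm _) tM0 tM1 ih => x y; nra.
  by move=> /(_ N).
have x0 : 2^-1 / M <= t / M by rewrite ler_pM2r ?invr_gt0// tG.
have : forall n, opnorm (pv K g p - zr K p (bn n)) <= e + kap ^+ n * Gam.
  elim=> [|n ih].
    rewrite /= (rep0 (zr_rep K p)) subr0 expr0 mul1r opnorm_pv//.
    by apply: le_trans (opnorm_supnorm g p) _; rewrite lerDr ltW.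
  have kn : 0 <= kap ^+ n * Gam.
    rewrite mulr_ge0 ?supnorm_ge0// exprn_ge0// /kap subr_ge0; apply: le_trans x0 tM1.
  apply: le_trans (step n) _; rewrite exprS -[kap * kap ^+ n * Gam]mulrA.
  move: kn ih; move: (kap ^+ n * Gam) (opnorm _) => y o y0 oy; rewrite /kap.
  move: (t / M) (2^-1 / M) x0 tM1 => x q qx x1.
  exact: averaging_step.
move=> /(_ N) h; apply: le_trans h _; have -> : 2 * e = e + e by ring.
by rewrite lerD2l; exact: hN.
Qed.

(** The correction in the top degree vanishes in lower degrees, so earlier approximations survive.
    Halving e compensates the factor 2 in [approx_step]. *)
Lemma gelfand_approx K (g : B) (e : R) : 0 < e -> exists a,
  forall p, (tdeg p <= K)%N -> opnorm (g p - gelfand a p) <= e.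
Proof.
elim: K g e => [|K ih] g e e0.
  by exists 0 => p; rewrite leqNgt (wdeg_gt0 zw).
have e3 : 0 < e / 2 by rewrite divr_gt0.
have [a0 h0] := ih g _ e3.
have low p : (tdeg p < K.+1)%N -> opnorm ((g - gelfand a0) p) <= e / 2.
  by move=> pK; rewrite pt_subE; apply: h0.
have [a1 [a1l a1K]] := approx_step e3 low.
exists (a0 + a1) => p; rewrite leq_eqVlt => /orP[/eqP pK|pK].
  have -> : e = 2 * (e / 2) by field.
  apply: le_trans (a1K p pK); rewrite -(pv_id g) -(pv_id (gelfand _)) pK pvB !pv_gelfand.
  by rewrite (repD _ _ (zr_rep K.+1 p)) opprD addrA.
have -> : g p - gelfand (a0 + a1) p = (g - gelfand a0) p.
  rewrite pt_subE -(pv_id (gelfand (a0 + a1))) -(pv_id (gelfand a0)) !pv_gelfand.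
  by rewrite (repD _ _ (zr_rep _ p)) (a1l _ _ (erefl _) pK) addr0.
by apply: le_trans (low p pK) _; lra.
Qed.

End StoneWeierstrass.

(** * The isomorphism of A with C*(Z(A), theta) *)

Section PartOne.
Variables (R : realType) (A : cStarAlgType R).
Hypothesis Asub : subhomogeneous A.
Local Notation Z := (ztower A).
Local Notation B := (ptCstar (zzero A)).
Let An := subhom_mx_normed Asub.

Lemma gelfand_lin : linear (@gelfand R A).
Proof. by move=> k a b; apply: ptCstar_eq => p; rewrite pt_addE pt_scaleE; exact: (rep_lin (zrepP p)). Qed.

Lemma gelfand_mul (a b : A) : gelfand (cmul a b) = cmul (gelfand a) (gelfand b).
Proof. by apply: ptCstar_eq => p; exact: (rep_mul (zrepP p)). Qed.

Lemma gelfand_star (a : A) : gelfand (cstar a) = cstar (gelfand a).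
Proof. by apply: ptCstar_eq => p; exact: (rep_star (zrepP p)). Qed.

Lemma gelfand_norm (a : A) : nrm a <= supnorm (gelfand a).
Proof.
apply: An => [|n r hr]; first exact: supnorm_ge0.
case: n r hr => [|n] r hr.
  have -> : r a = 0 by apply/matrixP => -[].
  by rewrite opnorm0 supnorm_ge0.
have [p [pn pr]] := zr_exists (ltn0Sn n) hr.
by rewrite -pr -[zr _ p a]/(pv n.+1 (gelfand a) p) opnorm_pv// opnorm_supnorm.
Qed.

Lemma gelfandB (a b : A) : gelfand (a - b) = gelfand a - gelfand b.
Proof.
have h := gelfand_lin (-1) b a; rewrite !scaleN1r in h.
by rewrite [a - b]addrC h addrC.
Qed.

Lemma gelfand_le (a : A) : supnorm (gelfand a) <= nrm a.
Proof. by apply: supnorm_le => p; exact: rep_contractive (zrepP p). Qed.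

(** The norm only sees irreducible points, whose degrees are bounded, so an approximation up to that
    degree is uniform; [gelfand_norm] makes the approximants Cauchy in A. *)
Lemma gelfand_surj (g : B) : exists a, gelfand a = g.
Proof.
have [N hN] := Asub.
have app (e : R) : 0 < e -> exists a, supnorm (g - gelfand a) <= e.
  move=> e0; have [a ha] := gelfand_approx An (maxn 1 N) g e0; exists a.
  apply: supnorm_le; apply: (opnorm_core (ztower_wtower A)) => p pirr.
  by rewrite pt_subE; apply: ha; exact: core_hdim hN pirr.
have ipos n : 0 < n.+1%:R^-1 :> R by rewrite invr_gt0.
pose u n := sval (cid (app _ (ipos n))).
have uP n : supnorm (g - gelfand (u n)) <= n.+1%:R^-1 by rewrite /u; case: cid.
have small (e : R) : 0 < e -> exists N, forall n, (N <= n)%N -> n.+1%:R^-1 <= e.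
  move=> e0; exists (Num.bound e^-1) => n Nn.
  rewrite -[e]invrK lef_pV2 ?posrE ?invr_gt0//.
  apply: le_trans (ltW (archi_boundP _)) _; first by rewrite invr_ge0 ltW.
  by rewrite ler_nat (leq_trans Nn).
have [a ha] : exists a, forall e : R, 0 < e -> exists N, forall n, (N <= n)%N -> nrm (a - u n) <= e.
  apply: complete_seq => e e0; have e2 : 0 < e / 2 by rewrite divr_gt0.
  have [M hM] := small _ e2; exists M => n m Mn Mm.
  apply: le_trans (gelfand_norm _) _; rewrite gelfandB.
  have -> : gelfand (u n) - gelfand (u m) = (g - gelfand (u m)) + (-1) *: (g - gelfand (u n)).
    by rewrite scaleN1r opprB [RHS]addrC subrKA.
  apply: le_trans (supnormD _ _) _; rewrite supnormZ normcN ComplexField.Normc.normc1 mul1r (splitr e).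
  by apply: lerD; apply: le_trans (uP _) _; exact: hM.
exists a; apply/eqP; rewrite -subr_eq0; apply/eqP/supnorm_eq0/eqP.
rewrite eq_le supnorm_ge0 andbT; apply/ler_addgt0Pr => e e0; rewrite add0r.
have e2 : 0 < e / 2 by rewrite divr_gt0.
have [M hM] := small _ e2; have [M' hM'] := ha _ e2; pose n := maxn M M'.
have -> : gelfand a - g = gelfand (a - u n) + (-1) *: (g - gelfand (u n)).
  by rewrite gelfandB scaleN1r opprB subrKA.
apply: le_trans (supnormD _ _) _; rewrite supnormZ normcN ComplexField.Normc.normc1 mul1r (splitr e).
apply: lerD; first by apply: le_trans (gelfand_le _) (hM' _ (leq_maxr _ _)).
exact: le_trans (uP _) (hM _ (leq_maxl _ _)).
Qed.

Lemma gelfand_inj : injective (@gelfand R A).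
Proof.
move=> a b ab; apply/eqP; rewrite -subr_eq0; apply/eqP/nrm_eq0/eqP.
rewrite eq_le nrm_ge0 andbT; apply: le_trans (gelfand_norm _) _.
by rewrite gelfandB ab subrr; apply: supnorm_le => p; rewrite opnorm0.
Qed.

Lemma gelfand_iso : is_star_iso (@gelfand R A).
Proof.
split; [|exact: gelfand_lin|exact: gelfand_mul|exact: gelfand_star].
pose f g := sval (cid (gelfand_surj g)); exists f => [a|g].
  by apply: gelfand_inj; rewrite /f; case: cid.
by rewrite /f; case: cid.
Qed.

End PartOne.

(** * Sums of irreducible elements *)

Section NFold.
Variables (R : realType) (T : towerData R).
Hypothesis wT : is_wtower T.
Implicit Types x y : T.

Lemma nfoldS n x : (0 < n)%N -> nfold n.+1 x = x ⊕ nfold n x.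
Proof. by case: n. Qed.

Lemma nfoldD m n x : (0 < m)%N -> (0 < n)%N -> nfold (m + n) x = nfold m x ⊕ nfold n x.
Proof.
move=> m0 n0; elim: m m0 => // m ih _; case: m ih => [|m] ih; first by rewrite add1n nfoldS.
by rewrite addSn nfoldS ?addn_gt0// ih// (wplusA wT).
Qed.

End NFold.

(** * Pairs of elements of equal degree *)

Section PairTower.
Variables (R : realType) (T T' : towerData R).
Hypotheses (wT : is_wtower T) (wT' : is_wtower T').
Local Notation C := R[i].

(** A correspondence between two towers is handled as a set of pairs; sums and unitary actions are
    then carried out on both sides at once. *)
Definition pair_set : set (T * T') := [set p | tdeg p.1 = tdeg p.2].

Definition pmk (x : T) (y : T') (e : tdeg x = tdeg y) : pair_set := exist _ (x, y) (mem_set e).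

Definition pfst (p : pair_set) : T := (\val p).1.
Definition psnd (p : pair_set) : T' := (\val p).2.

Lemma pdegE p : tdeg (psnd p) = tdeg (pfst p).
Proof. by apply: esym; exact: (set_valP p). Qed.

Lemma pair_tower_eq p q : pfst p = pfst q -> psnd p = psnd q -> p = q.
Proof.
rewrite /pfst /psnd => e1 e2; apply: val_inj.
by case: (\val p) (\val q) e1 e2 => [? ?] [? ?] /= -> ->.
Qed.

Lemma pplus_subproof (p q : pair_set) : tdeg (pfst p ⊕ pfst q) = tdeg (psnd p ⊕ psnd q).
Proof. by rewrite (wdegD wT) (wdegD wT') !pdegE. Qed.

Definition pplus p q := pmk (pplus_subproof p q).

Lemma pact_subproof n (U : 'M[C]_n) (p : pair_set) : tdeg (pfst p) = n /\ U \is unitarymx ->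
  tdeg (U ∙ pfst p) = tdeg (U ∙ psnd p).
Proof. by move=> [pn Uu]; rewrite (wdeg_act wT pn)// (wdeg_act wT')// pdegE. Qed.

(** The value p covers matrices that are not unitary of the right size, for which the result might
    leave [pair_set]. *)
Definition pact n (U : 'M[C]_n) (p : pair_set) : pair_set :=
  if pselect (tdeg (pfst p) = n /\ U \is unitarymx) is left h then pmk (pact_subproof h) else p.

Definition pair_tower : towerData R := @TowerData R pair_set (fun p => tdeg (pfst p)) pplus pact.

Lemma pfst_act n (U : 'M[C]_n) (p : pair_tower) : tdeg p = n -> U \is unitarymx ->
  pfst (U ∙ p) = U ∙ pfst p.
Proof. by move=> pn Uu; rewrite /= /pact; case: pselect => // -[]. Qed.

Lemma psnd_act n (U : 'M[C]_n) (p : pair_tower) : tdeg p = n -> U \is unitarymx ->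
  psnd (U ∙ p) = U ∙ psnd p.
Proof. by move=> pn Uu; rewrite /= /pact; case: pselect => // -[]. Qed.

Lemma pair_wtower : is_wtower pair_tower.
Proof.
have dact n (U : 'M[C]_n) (p : pair_tower) : tdeg p = n -> U \is unitarymx -> tdeg (U ∙ p) = n.
  move=> pn Uu; have := pfst_act pn Uu => e.
  by rewrite -[tdeg _]/(tdeg (pfst (U ∙ p))) e (wdeg_act wT pn).
have sn n (p : pair_tower) : tdeg p = n -> tdeg (psnd p) = n by move=> <-; exact: pdegE.
have dplus (p q : pair_tower) : tdeg (p ⊕ q) = (tdeg p + tdeg q)%N by exact: wdegD wT _ _.
have dgt0 (p : pair_tower) : (0 < tdeg p)%N by exact: wdeg_gt0 wT _.
split; [exact: dgt0| |exact: dplus|exact: dact| | | | |].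
- by move=> p q r; apply: pair_tower_eq; [exact: wplusA wT _ _ _|exact: wplusA wT' _ _ _].
- move=> n p pn; have u1 := unitarymx1 R n; apply: pair_tower_eq.
    by rewrite (pfst_act pn u1); exact: wact1 wT _ _ pn.
  by rewrite (psnd_act pn u1); exact: wact1 wT' _ _ (sn _ _ pn).
- move=> n U V p pn Uu Vu; have UV := unitarymxM Uu Vu.
  apply: pair_tower_eq.
    by rewrite (pfst_act pn UV) (pfst_act (dact _ V p pn Vu) Uu) (pfst_act pn Vu) (wactM wT pn Uu Vu).
  by rewrite (psnd_act pn UV) (psnd_act (dact _ V p pn Vu) Uu) (psnd_act pn Vu) (wactM wT' (sn _ _ pn) Uu Vu).
- move=> n k p pn ku; apply: pair_tower_eq.
    by rewrite (pfst_act pn ku) (wscalar wT pn ku).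
  by rewrite (psnd_act pn ku) (wscalar wT' (sn _ _ pn) ku).
- move=> m n U V p q pm qn Uu Vu.
  have d : tdeg (p ⊕ q) = (m + n)%N by rewrite dplus pm qn.
  have UV := dsum_unitary Uu Vu; apply: pair_tower_eq.
    rewrite (pfst_act d UV) [LHS](wplus wT pm qn Uu Vu) /= -(pfst_act pm Uu) -(pfst_act qn Vu).
    by [].
  rewrite (psnd_act d UV) [LHS](wplus wT' (sn _ _ pm) (sn _ _ qn) Uu Vu).
  by rewrite -(psnd_act pm Uu) -(psnd_act qn Vu).
- move=> m n p q pm qn.
  have d : tdeg (p ⊕ q) = (m + n)%N by rewrite dplus pm qn.
  have S := swap_mx_unitary R m n; apply: pair_tower_eq.
    by rewrite (pfst_act d S) [LHS](wswap wT pm qn).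
  by rewrite (psnd_act d S) [LHS](wswap wT' (sn _ _ pm) (sn _ _ qn)).
Qed.

Lemma pfst_plus (p q : pair_tower) : pfst (p ⊕ q) = pfst p ⊕ pfst q. Proof. by []. Qed.

Lemma psnd_plus (p q : pair_tower) : psnd (p ⊕ q) = psnd p ⊕ psnd q. Proof. by []. Qed.

Lemma pdeg (p : pair_tower) : tdeg p = tdeg (pfst p). Proof. by []. Qed.

Lemma pfst_nfold n (p : pair_tower) : pfst (nfold n p) = nfold n (pfst p).
Proof. by rewrite /nfold; elim: n.-1 => // k ih; rewrite !iterS pfst_plus ih. Qed.

Lemma psnd_nfold n (p : pair_tower) : psnd (nfold n p) = nfold n (psnd p).
Proof. by rewrite /nfold; elim: n.-1 => // k ih; rewrite !iterS psnd_plus ih. Qed.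

Lemma pfst_tequiv (p q : pair_tower) : tequiv p q -> tequiv (pfst p) (pfst q).
Proof. by move=> [U [Uu <-]]; rewrite (pfst_act (erefl _) Uu); exact: tequivI. Qed.

End PairTower.
Arguments pair_tower : simpl never.
Opaque pact.

(* A relation between an m-tower [T] and a tower [T'] that is generated by an
   equivariant map [phi] on irreducible elements is compatible with the unitary
   actions.  Summing with copies of [kappa] avoids empty sums. *)
Section Transfer.
Variables (R : realType) (T T' : towerData R).
Hypotheses (wT : is_wtower T) (wT' : is_wtower T').
Local Notation C := R[i].
Hypothesis mt_disj : forall x y z : T, tdisj z x -> tdisj z y -> tdisj z (x ⊕ y).
Hypothesis mt_cancel : forall x y z : T, tequiv (z ⊕ x) (z ⊕ y) -> tequiv x y.
Hypothesis mt_stab_plus : forall x y : T, tdisj x y ->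
    stab (tdeg x + tdeg y) (x ⊕ y) =
      [set dsum U V | U in stab (tdeg x) x & V in stab (tdeg y) y].
Hypothesis mt_stab_nfold : forall (x : T) n, ~ reducible x -> (0 < n)%N ->
    stab (n * tdeg x) (nfold n x) =
      [set U *t (1%:M : 'M[C]_(tdeg x)) | U in [set U : 'M[C]_n | U \is unitarymx]].
Hypothesis inj' : forall x y x' y' : T', tdeg x = tdeg x' -> x ⊕ y = x' ⊕ y' -> x = x'.
Variables (kappa : T) (P : set T) (phi : T -> T').
Hypothesis kappa1 : tdeg kappa = 1%N.
Hypothesis Pkappa : P kappa.
Hypothesis Pirr : forall x, P x -> ~ reducible x.
Hypothesis phi_deg : forall x, P x -> tdeg (phi x) = tdeg x.
Hypothesis phi_act : forall x (U : 'M[C]_(tdeg x)), P x -> U \is unitarymx -> phi (U ∙ x) = U ∙ phi x.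
Hypothesis phi_stab : forall x n (U : 'M[C]_n), P x -> (0 < n)%N -> U \is unitarymx ->
  (U *t (1%:M : 'M[C]_(tdeg x))) ∙ nfold n (phi x) = nfold n (phi x).

Local Notation PT := (pair_tower wT wT').
Let wP := pair_wtower wT wT'.

(** The pair of [kappa] stands in for points outside P. *)
Definition px (x : T) : PT :=
  if pselect (P x) is left h then pmk (esym (phi_deg h)) else pmk (esym (phi_deg Pkappa)).

Lemma px_fst x : P x -> pfst (px x) = x.
Proof. by move=> Px; rewrite /px; case: pselect. Qed.

Lemma px_snd x : P x -> psnd (px x) = phi x.
Proof. by move=> Px; rewrite /px; case: pselect. Qed.

Lemma px_deg x : P x -> tdeg (px x) = tdeg x.
Proof. by move=> Px; rewrite -[tdeg _]/(tdeg (pfst (px x))) px_fst. Qed.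

Definition psum L j : PT := foldr (fun x acc => px x ⊕ acc) (nfold j (px kappa)) L.

Lemma psum_cons x L j : psum (x :: L) j = px x ⊕ psum L j. Proof. by []. Qed.

Lemma psum_nil j : psum [::] j = nfold j (px kappa). Proof. by []. Qed.

(** Copies of [kappa] are counted by j instead of appearing in L, which makes L and j unique up to
    order and equivalence. *)
Definition plist (L : seq T) := forall x, x \in L -> P x /\ x <> kappa.

Lemma plist_cons x L : plist (x :: L) -> [/\ P x, x <> kappa & plist L].
Proof.
move=> h; have [Px xk] := h x (mem_head _ _); split => // y yL.
by apply: h; rewrite inE yL orbT.
Qed.

(** Unitaries of size one are scalars and act trivially. *)
Lemma tequiv_kappa x : tequiv x kappa -> x = kappa.
Proof.
move=> h; have [U Uu <-] := tequivE kappa1 (tequiv_sym wT h).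
rewrite [U]mx11_scalar; apply: (wscalar wT kappa1).
by rewrite -mx11_scalar.
Qed.

Lemma px_tequiv x y : P x -> P y -> tequiv x y -> tequiv (px x) (px y).
Proof.
move=> Px Py [U [Uu e]]; have d := px_deg Px.
have -> : px y = U ∙ px x; last exact: tequivI.
apply: pair_tower_eq; first by rewrite (pfst_act d Uu) !px_fst.
by rewrite (psnd_act d Uu) !px_snd// -phi_act// e.
Qed.

Lemma psum_perm L j x : x \in L -> exists L1, [/\ size L = (size L1).+1, {subset L1 <= L} &
  tequiv (psum L j) (px x ⊕ psum L1 j)].
Proof.
elim: L => // y L ih; rewrite inE => /orP[/eqP <-|/ih[L1 [sL sub e]]].
  by exists L; split => //; [move=> z zL; rewrite inE zL orbT|exact: tequiv_refl wP _].
exists (y :: L1); split; first by rewrite /= sL.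
  by move=> z; rewrite !inE => /orP[->//|/sub ->]; rewrite orbT.
rewrite !psum_cons; apply: (tequiv_trans wP (tequiv_plus wP (tequiv_refl wP _) e)).
rewrite !(wplusA wP); apply: (tequiv_plus wP); last exact: tequiv_refl.
exact: tequiv_swap.
Qed.

(** Collects the whole isotypic part of x, so that for x other than [kappa] the remainder is
    disjoint from x and (mT3) applies. *)
Lemma psum_iso L j x : P x -> plist L -> exists m L2, [/\ plist L2, (size L2 <= size L)%N,
  (forall y, y \in L2 -> ~ tequiv x y) &
  tequiv (psum (x :: L) j) (nfold m.+1 (px x) ⊕ psum L2 j)].
Proof.
move=> Px; elim: L => [|y L ih] Ls.
  by exists 0%N, [::]; split => //; exact: tequiv_refl wP _.
have [Py yk Ls'] := plist_cons Ls; have [m [L2 [L2s sL2 L2x e]]] := ih Ls'.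
have e1 : tequiv (psum (x :: y :: L) j) (px y ⊕ psum (x :: L) j).
  rewrite !psum_cons !(wplusA wP); apply: (tequiv_plus wP); last exact: tequiv_refl.
  exact: tequiv_swap.
have e2 := tequiv_trans wP e1 (tequiv_plus wP (tequiv_refl wP (px y)) e).
have [xy|xy] := pselect (tequiv x y).
  exists m.+1, L2; split => //; first exact: leq_trans sL2 (leqnSn _).
  apply: (tequiv_trans wP e2); rewrite (wplusA wP) (nfoldS _ (ltn0Sn m)).
  apply: (tequiv_plus wP); last exact: tequiv_refl.
  apply: (tequiv_plus wP); last exact: tequiv_refl.
  exact: px_tequiv (tequiv_sym wT xy).
exists m, (y :: L2); split => //.
- by move=> z; rewrite inE => /orP[/eqP ->|/L2s].
- by move=> z; rewrite inE => /orP[/eqP ->|/L2x].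
- apply: (tequiv_trans wP e2); rewrite psum_cons !(wplusA wP).
  apply: (tequiv_plus wP); last exact: tequiv_refl.
  exact: tequiv_swap.
Qed.

Lemma tdisj_nfold (z x : T) n : (0 < n)%N -> tdisj z x -> tdisj z (nfold n x).
Proof.
move=> n0 zx; elim: n n0 => // n ih _; case: n ih => [//|n] ih.
by rewrite nfoldS//; apply: mt_disj => //; exact: ih.
Qed.

Lemma psum_disj L j x : (0 < j)%N -> P x -> x <> kappa -> plist L ->
  (forall y, y \in L -> ~ tequiv x y) -> tdisj x (pfst (psum L j)).
Proof.
move=> j0 Px xk; elim: L => [|y L ih] Ls Lx.
  rewrite psum_nil pfst_nfold px_fst//; apply: tdisj_nfold => //.
  apply: (tdisj_irr2 wT); [exact: Pirr|exact: Pirr|].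
  by move=> /tequiv_kappa.
have [Py yk Ls'] := plist_cons Ls.
rewrite psum_cons pfst_plus px_fst//.
apply: mt_disj; last by apply: ih => // z zL; apply: Lx; rewrite inE zL orbT.
apply: (tdisj_irr2 wT); [exact: Pirr|exact: Pirr|].
exact: (Lx y (mem_head _ _)).
Qed.

(** This is what lets phi extend to sums: a unitary ambiguity in the first component must not be
    seen by the second. *)
Definition stab_good (p : PT) := forall n (U : 'M[C]_n), tdeg p = n -> U \is unitarymx ->
  U ∙ pfst p = pfst p -> U ∙ p = p.

Lemma stab_good_equiv (p q : PT) : tequiv p q -> stab_good q -> stab_good p.
Proof.
move=> pq gq n U pn Uu Up; have [W Wu e] := tequivE pn pq.
have dq : tdeg q = n by rewrite (tequiv_deg wP pq).
have W'u := unitarymx_star Wu.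
have WU1 : U *m W ^t* \is unitarymx := unitarymxM Uu W'u.
have WU : W *m (U *m W ^t*) \is unitarymx := unitarymxM Wu WU1.
have pW : W ^t* ∙ q = p by rewrite -e; exact: (wactK wP pn Wu).
have d1 : tdeg (pfst q) = n by rewrite -pdeg.
have d2 : tdeg (pfst p) = n by rewrite -pdeg.
have eW : W ∙ pfst p = pfst q by rewrite -(pfst_act pn Wu) e.
have h : (W *m (U *m W ^t*)) ∙ q = q.
  apply: (gq _ _ dq WU).
  rewrite (wactM wT d1 Wu WU1) (wactM wT d1 Uu W'u) -(pfst_act dq W'u) pW Up.
  exact: eW.
move: h; rewrite (wactM wP dq Wu WU1) (wactM wP dq Uu W'u) pW => h.
have du : tdeg (U ∙ p) = n by exact: (wdeg_act wP pn Uu).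
by rewrite -[LHS](wactK wP du Wu) h.
Qed.

Lemma stab_good_nfold x n : P x -> (0 < n)%N -> stab_good (nfold n (px x)).
Proof.
move=> Px n0 k U dk Uu Ux; have d : tdeg (nfold n (px x)) = (n * tdeg x)%N.
  by rewrite (tdeg_nfold wP _ n0) px_deg.
rewrite d in dk; case: k / dk U Uu Ux => U Uu; rewrite pfst_nfold px_fst// => Ux.
have : stab (n * tdeg x) (nfold n x) U by split.
rewrite (mt_stab_nfold (Pirr Px) n0) => -[u /= uu eU]; apply: pair_tower_eq.
  by rewrite (pfst_act d Uu) pfst_nfold px_fst.
rewrite (psnd_act d Uu) -eU psnd_nfold px_snd//; exact: phi_stab.
Qed.

Lemma stab_good_plus (N Q : PT) : tdisj (pfst N) (pfst Q) -> stab_good N -> stab_good Q ->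
  stab_good (N ⊕ Q).
Proof.
move=> disj gN gQ k U dk Uu; have d := wdegD wP N Q.
rewrite d !pdeg in dk; case: k / dk U Uu => U Uu; rewrite pfst_plus => UNQ.
have : stab (tdeg (pfst N) + tdeg (pfst Q)) (pfst N ⊕ pfst Q) U by split.
rewrite (mt_stab_plus disj) => -[a [au aN] [b [bu bQ] eU]].
rewrite -eU (wplus wP (erefl (tdeg (pfst N))) (erefl (tdeg (pfst Q))) au bu).
by rewrite (gN _ a (erefl _) au aN) (gQ _ b (erefl _) bu bQ).
Qed.

(** Split off isotypic parts: (mT3) splits a stabilising unitary along disjoint summands, and (mT4)
    describes it on multiples of one irreducible element. *)
Lemma stab_good_psum L j : (0 < j)%N -> plist L -> stab_good (psum L j).
Proof.
move=> j0; have [n] := ubnP (size L); elim: n L => // n ih [|x L] sL Ls.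
  by rewrite psum_nil; exact: stab_good_nfold.
have [Px xk Ls'] := plist_cons Ls.
have [m [L2 [L2s sL2 L2x e]]] := psum_iso j Px Ls'.
apply: (stab_good_equiv e).
apply: stab_good_plus; [|exact: stab_good_nfold|].
  apply: (tdisj_sym); rewrite pfst_nfold px_fst//; apply: tdisj_nfold => //.
  by apply: tdisj_sym; exact: psum_disj.
apply: ih => //; exact: leq_ltn_trans sL2 _.
Qed.

Lemma psum_mem_sub L j x : x \in L -> P x -> tsub x (pfst (psum L j)).
Proof.
move=> xL Px; have [L1 [_ _ e]] := psum_perm j xL.
apply: (tsub_equivr wT _ (tequiv_sym wT (pfst_tequiv e))).
rewrite pfst_plus px_fst//.
exact: tsub_plusl.
Qed.

(** An element of one list without equivalent in the other would be disjoint from the whole other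
    sum by (mT1); so it has a partner, which (mT2) cancels. When both lists are empty, the degree
    fixes the number of copies of [kappa]. *)
Lemma psum_uniq L j L' j' : (0 < j)%N -> (0 < j')%N -> plist L -> plist L' ->
  tequiv (pfst (psum L j)) (pfst (psum L' j')) -> tequiv (psum L j) (psum L' j').
Proof.
move=> j0 j'0; have [n] := ubnP (size L); elim: n L L' => // n ih [|x L] L' sL Ls Ls' e.
  case: L' Ls' e => [|x' L'] Ls' e.
    have := tequiv_deg wT e; rewrite !psum_nil !pfst_nfold px_fst// !(tdeg_nfold wT)//.
    by rewrite kappa1 !muln1 => ->; exact: tequiv_refl.
  have [Px xk _] := plist_cons Ls'; exfalso.
  have dx : tdisj x' (pfst (psum [::] j)) by apply: psum_disj.
  apply: dx; exists x'; split; first exact: tsub_refl.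
  apply: (tsub_equivr wT _ (tequiv_sym wT e)); apply: psum_mem_sub => //; exact: mem_head.
have [Px xk Ls1] := plist_cons Ls.
have [[y yL' xy]|nex] := pselect (exists2 y, y \in L' & tequiv x y); last first.
  exfalso; have dx : tdisj x (pfst (psum L' j')).
    by apply: psum_disj => // y yL' xy; apply: nex; exists y.
  apply: dx; exists x; split; first exact: tsub_refl.
  apply: (tsub_equivr wT _ e); apply: psum_mem_sub => //; exact: mem_head.
have [L1 [sL1 sub e1]] := psum_perm j' yL'.
have [Py yk] := Ls' y yL'.
have L1s : plist L1 by move=> z /sub /Ls'.
have pxy := px_tequiv Px Py xy.
apply: (tequiv_trans wP _ (tequiv_sym wP e1)).
apply: (tequiv_plus wP pxy); apply: ih => //.
apply: (mt_cancel (z := x)).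
have := tequiv_trans wT e (pfst_tequiv e1).
rewrite psum_cons !pfst_plus !px_fst//.
move=> h; apply: (tequiv_trans wT h); apply: (tequiv_plus wT); last exact: tequiv_refl.
exact: tequiv_sym.
Qed.

Definition related (p : PT) := exists L j j', [/\ (0 < j)%N, (0 < j')%N, plist L &
  tequiv (p ⊕ nfold j' (px kappa)) (psum L j)].

Lemma psum_cat L j L' j' : (0 < j)%N -> (0 < j')%N ->
  tequiv (psum L j ⊕ psum L' j') (psum (L ++ L') (j + j')).
Proof.
move=> j0 j'0; elim: L => [|x L ih]; last first.
  by rewrite cat_cons !psum_cons -(wplusA wP); apply: (tequiv_plus wP) => //; exact: tequiv_refl.
rewrite cat0s psum_nil; elim: L' => [|x L' ih]; first by rewrite !psum_nil (nfoldD wP)//; exact: tequiv_refl.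
rewrite !psum_cons; apply: (tequiv_trans wP _ (tequiv_plus wP (tequiv_refl wP (px x)) ih)).
rewrite !(wplusA wP); apply: (tequiv_plus wP); last exact: tequiv_refl.
exact: tequiv_swap.
Qed.

Lemma plist_cat L L' : plist L -> plist L' -> plist (L ++ L').
Proof. by move=> h h' x; rewrite mem_cat => /orP[/h|/h']. Qed.

Lemma related_plus p q : related p -> related q -> related (p ⊕ q).
Proof.
move=> [L [j [i [j0 i0 Ls e]]]] [L' [j' [i' [j'0 i'0 Ls' e']]]].
exists (L ++ L'), (j + j')%N, (i + i')%N; split; rewrite ?addn_gt0 ?j0 ?i0//.
  exact: plist_cat.
apply: (tequiv_trans wP _ (psum_cat _ _ j0 j'0)).
apply: (tequiv_trans wP _ (tequiv_plus wP e e')).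
rewrite (nfoldD wP)// -!(wplusA wP); apply: (tequiv_plus wP); first exact: tequiv_refl.
rewrite !(wplusA wP); apply: (tequiv_plus wP); last exact: tequiv_refl.
exact: tequiv_swap.
Qed.

Lemma related_equiv p q : related p -> tequiv p q -> related q.
Proof.
move=> [L [j [i [j0 i0 Ls e]]]] pq; exists L, j, i; split => //.
apply: (tequiv_trans wP _ e); apply: (tequiv_plus wP); last exact: tequiv_refl.
exact: tequiv_sym.
Qed.

Lemma related_px x : P x -> related (px x).
Proof.
move=> Px; have [->|xk] := pselect (x = kappa).
  exists [::], 2%N, 1%N; split => //; exact: tequiv_refl.
exists [:: x], 1%N, 1%N; split => //; last exact: tequiv_refl.
by move=> y; rewrite inE => /eqP ->.
Qed.

Lemma psum_pad (r : PT) M a b c : (0 < a)%N -> (0 < b)%N -> (0 < c)%N ->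
  tequiv (r ⊕ nfold b (px kappa)) (psum M a) ->
  tequiv (r ⊕ nfold (b + c) (px kappa)) (psum M (a + c)).
Proof.
move=> a0 b0 c0 h; rewrite (nfoldD wP)// (wplusA wP).
have -> : psum M (a + c) = psum M a ⊕ nfold c (px kappa).
  by elim: M {h} => [|x M ih]; [rewrite !psum_nil (nfoldD wP)|rewrite !psum_cons ih (wplusA wP)].
by apply: (tequiv_plus wP h); exact: tequiv_refl.
Qed.

Lemma related_pad p q : related p -> related q -> exists K : PT, exists L j L' j',
  [/\ (0 < j)%N, (0 < j')%N, plist L & plist L'] /\
  (tequiv (p ⊕ K) (psum L j) /\ tequiv (q ⊕ K) (psum L' j')).
Proof.
move=> [L [j [i [j0 i0 Ls e]]]] [L' [j' [i' [j'0 i'0 Ls' e']]]].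
exists (nfold (i + i') (px kappa)), L, (j + i')%N, L', (j' + i)%N; split; last split.
- by split => //; rewrite addn_gt0 ?j0 ?j'0.
- exact: psum_pad.
- by rewrite addnC; exact: psum_pad.
Qed.

(** If W carries p to q, then W* U fixes the first component of p, hence p itself. *)
Lemma act_of_equiv (p q : PT) n (U : 'M[C]_n) : tdeg p = n -> U \is unitarymx ->
  tequiv p q -> stab_good p -> U ∙ pfst p = pfst q -> U ∙ p = q.
Proof.
move=> pn Uu pq gp e; have [W Wu Wp] := tequivE pn pq.
have W'u := unitarymx_star Wu.
have d1 : tdeg (pfst p) = n by rewrite -pdeg.
have dq : tdeg q = n by rewrite (tequiv_deg wP pq).
have du : tdeg (U ∙ p) = n by exact: (wdeg_act wP pn Uu).
have h : (W ^t* *m U) ∙ p = p.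
  apply: (gp _ _ pn); first exact: (unitarymxM W'u Uu).
  by rewrite (wactM wT d1 W'u Uu) e -(pfst_act dq W'u) -Wp (wactK wP pn Wu).
rewrite (wactM wP pn W'u Uu) in h.
have : W ∙ (W ^t* ∙ (U ∙ p)) = W ∙ p by rewrite h.
by rewrite -(wactM wP du Wu W'u) (unitarymxP Wu) (wact1 wP du) Wp.
Qed.

(** After padding with a common K both pairs are equivalent to normal sums, and these are equivalent
    by [psum_uniq]; [act_of_equiv] then identifies the second components, and injectivity of the sum
    in T' removes K. *)
Theorem related_functional (p q : PT) n (U : 'M[C]_n) : tdeg p = n -> related p -> related q ->
  U \is unitarymx -> U ∙ pfst p = pfst q -> U ∙ psnd p = psnd q.
Proof.
move=> pn rp rq Uu Upq; have dq : tdeg q = n.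
  by rewrite pdeg -Upq; exact: (wdeg_act wT pn Uu).
have [K [L [j [L' [j' [[j0 j'0 Ls Ls'] [ep eq']]]]]]] := related_pad rp rq.
set k := tdeg K; have u1 := unitarymx1 R k.
have Vu : dsum U (1%:M : 'M[C]_k) \is unitarymx := dsum_unitary Uu u1.
have dpK : tdeg (p ⊕ K) = (n + k)%N by rewrite (wdegD wP) pn.
have VpK : dsum U (1%:M : 'M[C]_k) ∙ pfst (p ⊕ K) = pfst (q ⊕ K).
  by rewrite !pfst_plus (wplus wT pn (erefl k) Uu u1) Upq (wact1 wT (erefl k)).
have eT : tequiv (pfst (p ⊕ K)) (pfst (q ⊕ K)).
  by rewrite -VpK; apply: tequivI Vu; rewrite -pdeg.
have eP : tequiv (p ⊕ K) (q ⊕ K).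
  apply: (tequiv_trans wP ep); apply: (tequiv_trans wP _ (tequiv_sym wP eq')).
  apply: psum_uniq => //; apply: (tequiv_trans wT (tequiv_sym wT (pfst_tequiv ep))).
  have e3 := pfst_tequiv eq'; exact: (tequiv_trans wT eT e3).
have sg : stab_good (p ⊕ K) := stab_good_equiv ep (stab_good_psum j0 Ls).
have h := act_of_equiv dpK Vu eP sg VpK.
have := congr1 (@psnd R T T') h; rewrite (psnd_act dpK Vu) !psnd_plus.
have d1 : tdeg (psnd p) = n by rewrite pdegE -pdeg.
rewrite (wplus wT' d1 (pdegE K) Uu u1); apply: inj'.
by rewrite (wdeg_act wT' d1 Uu) pdegE -pdeg.
Qed.

End Transfer.

(** * Equivariant extension of functions *)

(** In compact fibres ultrafilters always converge, so continuity proofs reduce to identifying one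
    limit. *)
Lemma ultra_cvgP (T : Type) (U : topologicalType) (F : set_system T) (FF : Filter F) (f : T -> U) (l : U) :
  (forall G, UltraFilter G -> F `<=` G -> f @ G --> l) -> f @ F --> l.
Proof.
move=> h A nA; apply: contrapT => nFA.
have PF : ProperFilter (within (~` (f @^-1` A)) F).
  split; last exact: within_filter.
  by apply: contra_not nFA; apply: (@filterS _ F FF) => x; apply: contrapT.
have [G [UG sG]] := ultraFilterLemma PF.
have FG : F `<=` G.
  by move=> B FB; apply: sG; apply: (@filterS _ F FF _ _ _ FB) => x Bx _.
have GA : G (f @^-1` A) := h G UG FG A nA.
have GA' : G (~` (f @^-1` A)).
  by apply: sG; apply: (@filterE _ F FF) => x.
by have [x []] := filter_ex (filterI GA GA').
Qed.

(** * Limits in a proper tower *)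

Section TowerLimits.
Variables (R : realType) (T : towerData R).
Hypothesis tT : is_tower T.
Hypothesis pT : proper_tower T.
Local Notation C := R[i].
Let wT := tower_wtower tT.

Lemma tdeg_near (x : T) : \forall y \near x, tdeg y = tdeg x.
Proof.
have h : nbhs (tdeg x) [set tdeg x] by exact: discrete_set1.
exact: (@tdeg_continuous _ _ tT x _ h).
Qed.

Lemma tower_graded_compact N : compact [set x : T | (tdeg x <= N)%N].
Proof.
elim: N => [|N ih].
  rewrite [X in compact X](_ : _ = set0); first exact: compact0.
  by apply/seteqP; split => x //=; have := wdeg_gt0 wT x; lia.
rewrite [X in compact X](_ : _ = [set x | (tdeg x <= N)%N] `|` tfib T N.+1).
  exact: compactU.
by apply/seteqP; split => x /=; rewrite /tfib /=; [case: ltngtP => // h _; [left; lia|right]|move=> []; lia].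
Qed.

Lemma ultra_tower_cvg (I : Type) (F : set_system I) (UF : UltraFilter F) (f : I -> T) N :
  (\forall t \near F, (tdeg (f t) <= N)%N) -> exists x : T, f @ F --> x.
Proof.
move=> fN; have := @tower_graded_compact N; rewrite compact_ultra.
by move=> /(_ (f @ F) (ultra_fmap f UF) fN)[x [_ fx]]; exists x.
Qed.

Lemma tplus_cvg (I : Type) (F : set_system I) (FF : Filter F) (f g : I -> T) (x y : T) :
  f @ F --> x -> g @ F --> y -> (fun t => f t ⊕ g t) @ F --> x ⊕ y.
Proof.
move=> fx gy; have h : (fun t => (f t, g t)) @ F --> (x, y) by exact: cvg_pair.
exact: cvg_trans (cvg_app _ h) (@tplus_continuous _ _ tT (x, y)).
Qed.

Lemma tact_cvg (I : Type) (F : set_system I) (FF : Filter F) n (u : I -> 'M[C]_n) (f : I -> T) U (x : T) :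
  tdeg x = n -> U \is unitarymx -> (\forall t \near F, u t \is unitarymx) ->
  u @ F --> U -> f @ F --> x -> (fun t => u t ∙ f t) @ F --> U ∙ x.
Proof.
move=> xn Uu uu uU fx.
have /subspace_continuousP/(_ (U, x) (conj Uu xn)) c := @tact_continuous _ _ tT n.
have h : (fun t => (u t, f t)) @ F --> (U, x).
  move=> A [[P Q] [/= nP nQ] PQ].
  have hP : F (u @^-1` P) := uU _ nP.
  have hQ : F (f @^-1` Q) := fx _ nQ.
  by apply: (@filterS _ F FF _ _ _ (filterI hP hQ)) => t [Pt Qt]; apply: PQ.
have fn : \forall t \near F, tdeg (f t) = n.
  by have := fx _ (tdeg_near x); apply: (@filterS _ F FF) => t /= ->.
move=> A nA.
have h2 : F [set t | u t \is unitarymx /\ tdeg (f t) = n -> A (u t ∙ f t)] := h _ (c A nA).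
by apply: (@filterS _ F FF _ _ _ (filterI h2 (filterI uu fn))) => t /= [k [k1 k2]]; apply: k.
Qed.

Lemma tdeg_cvg (I : Type) (F : set_system I) (FF : Filter F) (f : I -> T) (x : T) :
  f @ F --> x -> \forall t \near F, tdeg (f t) = tdeg x.
Proof. by move=> fx; exact: (fx _ (tdeg_near x)). Qed.

Lemma tower_cvg_unique (I : Type) (F : set_system I) (FF : ProperFilter F) (f : I -> T) (x y : T) :
  f @ F --> x -> f @ F --> y -> x = y.
Proof. by move=> fx fy; exact: (cvg_unique (tower_hausdorff tT) fx fy). Qed.

Lemma ultra_unitary_cvg (I : Type) (F : set_system I) (UF : UltraFilter F) n (u : I -> 'M[C]_n) :
  (\forall t \near F, u t \is unitarymx) -> exists2 U, U \is unitarymx & u @ F --> U.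
Proof.
move=> uu; have [U uU] : exists U : 'M[C]_n, u @ F --> U.
  apply: (@ultra_cvgmx R _ F UF n u 1); apply: filterS uu => t tu.
  exact: opnorm_unitary.
exists U => //; apply/unitarymxP.
apply: (@cvgmx_unique R _ F _ n (fun t => u t *m (u t) ^t*)).
  exact: cvg_mulmx _ uU (cvg_adjmx _ uU).
apply: cvg_trans (@cvg_cst _ (1%:M : 'M[C]_n) _ F _); apply: near_eq_cvg.
by apply: filterS uu => t /unitarymxP ->.
Qed.

(** Along an ultrafilter the summands and the unitaries of arbitrarily chosen decompositions
    converge too, by compactness. *)
Lemma reducible_lim n (F : set_system T) (UF : UltraFilter F) z :
  (\forall y \near F, tdeg y = n /\ reducible y) -> F --> z ->
  exists (a b : T -> T) (V : T -> 'M[C]_n) a0 b0 V0,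
  [/\ \forall y \near F, [/\ V y \is unitarymx, V y ∙ (a y ⊕ b y) = y & tdeg (a y ⊕ b y) = n],
      V0 \is unitarymx /\ tdeg (a0 ⊕ b0) = n,
      a @ F --> a0 /\ b @ F --> b0,
      V @ F --> V0 & z = V0 ∙ (a0 ⊕ b0)].
Proof.
move=> hF Fz.
have dec (y : T) : exists p : T * T * 'M[C]_n, tdeg y = n -> reducible y ->
    [/\ p.2 \is unitarymx, p.2 ∙ (p.1.1 ⊕ p.1.2) = y & tdeg (p.1.1 ⊕ p.1.2) = n].
  have [[yn yr]|no] := pselect (tdeg y = n /\ reducible y); last first.
    by exists (y, y, 1%:M) => yn yr; case: no.
  have [a [b [V [Vu e]]]] := reducibleE yn yr.
  exists (a, b, V ^t*) => _ _ /=; split; first exact: unitarymx_star.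
    by rewrite -e (wactK wT yn Vu).
  by rewrite -e (wdeg_act wT yn Vu).
pose g y := sval (cid (dec y)).
have gP y : tdeg y = n -> reducible y -> [/\ (g y).2 \is unitarymx,
    (g y).2 ∙ ((g y).1.1 ⊕ (g y).1.2) = y & tdeg ((g y).1.1 ⊕ (g y).1.2) = n].
  by rewrite /g; case: cid.
have nF : \forall y \near F, [/\ (g y).2 \is unitarymx,
    (g y).2 ∙ ((g y).1.1 ⊕ (g y).1.2) = y & tdeg ((g y).1.1 ⊕ (g y).1.2) = n].
  by apply: filterS hF => y [yn yr]; exact: gP.
have [V0 V0u gV] : exists2 U, U \is unitarymx & (fun y => (g y).2) @ F --> U.
  by apply: ultra_unitary_cvg; apply: filterS nF => y [].
have [a0 ga] : exists x : T, (fun y => (g y).1.1) @ F --> x.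
  by apply: (@ultra_tower_cvg _ F UF _ n); apply: filterS nF => y [_ _]; rewrite (wdegD wT); lia.
have [b0 gb] : exists x : T, (fun y => (g y).1.2) @ F --> x.
  by apply: (@ultra_tower_cvg _ F UF _ n); apply: filterS nF => y [_ _]; rewrite (wdegD wT); lia.
have gab := tplus_cvg (@ultra_proper _ F UF) ga gb.
have d0 : tdeg (a0 ⊕ b0) = n.
  by have [y [[_ _ h1] h2]] := filter_ex (filterI nF (tdeg_cvg _ gab)); rewrite -h2.
exists (fun y => (g y).1.1), (fun y => (g y).1.2), (fun y => (g y).2), a0, b0, V0; split => //.
apply: (@tower_cvg_unique T F _ id) => //.
apply: cvg_trans (tact_cvg _ d0 V0u _ gV gab); last by apply: filterS nF => y [].
by apply: near_eq_cvg; apply: filterS nF => y [].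
Qed.

Lemma reducible_closed n : closed [set x : T | tdeg x = n /\ reducible x].
Proof.
move=> z clz.
have PF : ProperFilter (within [set x : T | tdeg x = n /\ reducible x] (nbhs z)).
  split; last exact: within_filter.
  by move=> h; have [y [yA]] := clz _ h; apply.
have [G [UG sG]] := ultraFilterLemma PF.
have GA : G [set x : T | tdeg x = n /\ reducible x].
  by apply: sG; apply: (@filterE _ (nbhs z)) => y.
have Gz : G --> z.
  by move=> B nB; apply: sG; apply: (@filterS _ (nbhs z) _ _ _ _ nB) => y By _.
have [a [b [V [a0 [b0 [V0 [_ [V0u d0] _ _ ->]]]]]]] := reducible_lim UG GA Gz.
split; first exact: (wdeg_act wT d0 V0u).
by apply: (reducible_plus (a := a0) (b := b0)); apply: (tequiv_sym wT); apply: tequivI V0u.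
Qed.

End TowerLimits.

(** * Chebyshev centres in the Hilbert-Schmidt norm *)

Section HilbertSchmidt.
Variable R : realType.
Local Notation C := R[i].

Lemma normc_sqr (z : C) : normc z ^+ 2 = complex.Re z ^+ 2 + complex.Im z ^+ 2.
Proof. by case: z => a b /=; rewrite sqr_sqrtr// addr_ge0// sqr_ge0. Qed.

Definition hsn n (M : 'M[C]_n) : R := \sum_i \sum_j normc (M i j) ^+ 2.

Lemma hsn_ge0 n (M : 'M[C]_n) : 0 <= hsn M.
Proof. by apply: sumr_ge0 => i _; apply: sumr_ge0 => j _; exact: sqr_ge0. Qed.

Lemma hsn_tr n (M : 'M[C]_n) : (hsn M)%:C = \tr (M *m M ^t*).
Proof.
rewrite /hsn rmorph_sum; apply: eq_bigr => i _; rewrite mxE rmorph_sum; apply: eq_bigr => j _.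
by rewrite !mxE -normCK rmorphXn.
Qed.

Lemma tr_conj n (U V M N : 'M[C]_n) : V *m U = 1%:M ->
  \tr (U *m M *m V *m (U *m (N *m V))) = \tr (M *m N).
Proof.
move=> h; rewrite -!mulmxA (mulmxA V U) h mul1mx mxtrace_mulC -!mulmxA h.
by rewrite mulmx1.
Qed.

Lemma cvg_sumR (T : Type) (F : set_system T) (FF : Filter F) (I : Type) (r : seq I)
    (f : I -> T -> R) (l : I -> R) : (forall i, f i @ F --> l i) ->
  (\sum_(i <- r) f i t) @[t --> F] --> \sum_(i <- r) l i.
Proof.
move=> fl; elim: r => [|i r ih].
  by rewrite big_nil; under eq_fun do rewrite big_nil; exact: cvg_cst.
by rewrite big_cons; under eq_fun do rewrite big_cons; apply: cvgD.
Qed.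

Lemma cvg_submx (T : Type) (F : set_system T) (FF : Filter F) n (f g : T -> 'M[C]_n) (X Y : 'M[C]_n) :
  f @ F --> X -> g @ F --> Y -> (fun t => f t - g t) @ F --> X - Y.
Proof.
move=> fX gY; have := @cvg_linmx R _ F FF n g f (-1) Y X gY fX.
rewrite scaleN1r addrC; apply: cvg_trans; apply: near_eq_cvg.
by apply: (@filterE _ F FF) => t; rewrite scaleN1r addrC.
Qed.

Lemma hsn_unitary n (U M : 'M[C]_n) : U \is unitarymx -> hsn (U *m M *m U ^t*) = hsn M.
Proof.
move=> Uu; apply: (@complexI R); rewrite !hsn_tr.
rewrite !trmx_mul !map_mxM trmxCK.
exact: tr_conj (unitarymxKl Uu).
Qed.

(** The parallelogram identity; it makes the centre of the smallest enclosing ball unique, which can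
    fail for the operator norm. *)
Lemma hsn_mid n (Z W X : 'M[C]_n) :
  hsn ((2^-1 : R)%:C *: (Z + W) - X) = hsn (Z - X) / 2 + hsn (W - X) / 2 - hsn (Z - W) / 4.
Proof.
rewrite /hsn !mulr_suml -big_split -sumrB; apply: eq_bigr => i _.
rewrite !mulr_suml -big_split -sumrB; apply: eq_bigr => j _; rewrite !mxE.
case: (Z i j) (W i j) (X i j) => [a b] [c d] [e f]; rewrite !normc_sqr /=.
by field.
Qed.

Lemma hsn_entry n (M : 'M[C]_n) i j : normc (M i j) ^+ 2 <= hsn M.
Proof.
rewrite /hsn (bigD1 i)//= (bigD1 j)//= -addrA lerDl.
apply: addr_ge0; first by apply: sumr_ge0 => k _; exact: sqr_ge0.
by apply: sumr_ge0 => k _; apply: sumr_ge0 => l _; exact: sqr_ge0.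
Qed.

Lemma hsn_eq0 n (M : 'M[C]_n) : hsn M <= 0 -> M = 0.
Proof.
move=> M0; apply/matrixP => i j; rewrite mxE; apply: ComplexField.Normc.eq0_normc.
by apply/eqP; rewrite -sqrf_eq0 eq_le sqr_ge0 andbT (le_trans (hsn_entry M i j)).
Qed.

Lemma hsn0 n : hsn (0 : 'M[C]_n) = 0.
Proof. by apply: big1 => i _; apply: big1 => j _; rewrite mxE ComplexField.Normc.normc0 expr0n. Qed.

Lemma opnorm_hsn n (M : 'M[C]_n) c : hsn M <= c -> opnorm M <= n%:R * n%:R * (c + 1).
Proof.
move=> Mc; apply: opnorm_entries => i j; have h := le_trans (hsn_entry M i j) Mc.
by have := normc_ge0 (M i j); move: (normc _) h => t; nra.
Qed.

Lemma hsn_opnorm n (M : 'M[C]_n) c : opnorm M <= c -> hsn M <= n%:R * (n%:R * c ^+ 2).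
Proof.
move=> Mc; rewrite mulr_natl -[X in _ *+ X]card_ord -sumr_const; apply: ler_sum => i _.
rewrite mulr_natl -[X in _ *+ X]card_ord -sumr_const; apply: ler_sum => j _.
have h := le_trans (opnorm_entry M i j) Mc.
by rewrite lerXn2r// nnegrE ?normc_ge0// (le_trans _ h)// normc_ge0.
Qed.

Lemma cvg_hsn (T : Type) (F : set_system T) (FF : Filter F) n (f : T -> 'M[C]_n) (X : 'M[C]_n) :
  f @ F --> X -> hsn (f t) @[t --> F] --> hsn X.
Proof.
move=> /cvg_entries fX; apply: cvg_sumR => i; apply: cvg_sumR => j.
have h : normc (f t i j) @[t --> F] --> normc (X i j).
  have /cvg_normcP fij := fX i j; apply/cvgrPdist_le => e e0; apply: filterS (fij _ e0) => t.
  apply: le_trans; rewrite ler_norml; apply/andP; split.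
    have := normcD (f t i j - X i j) (X i j); rewrite subrK -[f t i j - _]opprB normcN.
    lra.
  by have := normcD (X i j - f t i j) (f t i j); rewrite subrK; lra.
by rewrite expr2; under eq_fun do rewrite expr2; exact: cvgM.
Qed.

Lemma hsn_cvg_le (T : Type) (F : set_system T) (FF : ProperFilter F) n (f : T -> 'M[C]_n) (X : 'M[C]_n) c :
  f @ F --> X -> (\forall t \near F, hsn (f t) <= c) -> hsn X <= c.
Proof.
move=> /cvg_hsn/cvgrPdist_le h fc; apply/ler_addgt0Pr => e e0.
have [t [h1 h2]] := filter_ex (filterI (h _ e0) fc).
by move: h1 h2; rewrite ler_norml => /andP[_]; move: (hsn _) (hsn _) => *; lra.
Qed.

Lemma hsn_cvg_near (T : Type) (F : set_system T) (FF : Filter F) n (f : T -> 'M[C]_n) (X : 'M[C]_n) e :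
  f @ F --> X -> 0 < e -> \forall t \near F, hsn (f t) <= hsn X + e.
Proof.
move=> /cvg_hsn/cvgrPdist_le h e0; apply: filterS (h _ e0) => t; rewrite ler_norml => /andP[h1 _].
by lra.
Qed.

Section Chebyshev.
Variables (n : nat) (D : set 'M[C]_n).
Hypothesis D0 : D !=set0.
Hypothesis Db : exists c, forall X, D X -> opnorm X <= c.

(** The squared radius of the smallest ball around Z that contains D. *)
Definition crad (Z : 'M[C]_n) : R := sup [set hsn (Z - X) | X in D].

Lemma crad_has_sup Z : has_sup [set hsn (Z - X) | X in D].
Proof.
split; first by have [X DX] := D0; exists (hsn (Z - X)), X.
have [c Dc] := Db; exists (n%:R * (n%:R * (opnorm Z + c) ^+ 2)) => _ [X DX <-].
apply: hsn_opnorm; apply: le_trans (opnormD _ _) _; rewrite opnormN lerD2l; exact: Dc.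
Qed.

Lemma crad_ub Z X : D X -> hsn (Z - X) <= crad Z.
Proof. by move=> DX; apply: (sup_upper_bound (crad_has_sup Z)); exists X. Qed.

Lemma crad_le Z c : (forall X, D X -> hsn (Z - X) <= c) -> crad Z <= c.
Proof. by move=> h; apply: ge_sup; [have [] := crad_has_sup Z|move=> _ [X DX <-]; exact: h]. Qed.

Lemma crad_ge0 Z : 0 <= crad Z.
Proof. by have [X DX] := D0; exact: le_trans (hsn_ge0 _) (crad_ub Z DX). Qed.

Lemma crad_adherent Z e : 0 < e -> exists2 X, D X & crad Z - e < hsn (Z - X).
Proof.
move=> e0; have [_ [X DX <-] h] := sup_adherent e0 (crad_has_sup Z); exists X => //.
Qed.

Lemma crad_close Z W r e : (forall X, r <= crad X) -> crad Z <= r + e -> crad W <= r + e ->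
  hsn (Z - W) <= 4 * e.
Proof.
move=> rr Ze We; have := rr ((2^-1 : R)%:C *: (Z + W)).
have h : crad ((2^-1 : R)%:C *: (Z + W)) <= r + e - hsn (Z - W) / 4.
  apply: crad_le => X DX; rewrite hsn_mid.
  have := le_trans (crad_ub Z DX) Ze; have := le_trans (crad_ub W DX) We.
  by move: (hsn _) (hsn _) (hsn _) => *; lra.
by move: h; move: (crad _) (hsn _) => *; lra.
Qed.

Lemma chebyshev_exists : exists Z, forall W, crad Z <= crad W.
Proof.
pose E := [set crad Z | Z in [set: 'M[C]_n]].
have hE : has_inf E.
  by split; [exists (crad 0), 0|exists 0 => _ [Z _ <-]; exact: crad_ge0].
have rE X : inf E <= crad X by apply: (inf_lbound hE.2); exists X.
have ex k : exists Z, crad Z <= inf E + k.+1%:R^-1.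
  have k0 : 0 < k.+1%:R^-1 :> R by rewrite invr_gt0 ltr0n.
  by have [_ [Z _ <-] h] := inf_adherent k0 hE; exists Z; exact: ltW.
pose s k := sval (cid (ex k)).
have sP k : crad (s k) <= inf E + k.+1%:R^-1 by rewrite /s; case: cid.
(* A minimising sequence is bounded, so it converges along an ultrafilter finer than the filter at
   infinity. *)
have [G [UG sG]] := @ultraFilterLemma _ (@nbhs nat (set_system nat) \oo) _.
have k1 k : k.+1%:R^-1 <= 1 :> R by rewrite invf_le1 ?ltr0n// ler1n.
have [X0 DX0] := D0.
have [Z sZ] : exists Z : 'M[C]_n, s @ G --> Z.
  apply: (@ultra_cvgmx R _ G UG n s (n%:R * n%:R * (inf E + 1 + 1) + opnorm X0)).
  apply: filterE => k; rewrite -[s k](subrK X0); apply: le_trans (opnormD _ _) _.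
  rewrite lerD2r; apply: opnorm_hsn; apply: le_trans (crad_ub _ DX0) _.
  by apply: le_trans (sP k) _; rewrite lerD2l.
exists Z => W; apply: le_trans (rE W); apply: crad_le => X DX.
apply/ler_addgt0Pr => e e0.
have cX : (fun _ : nat => X) @ G --> X by exact: cvg_cst.
have cZX : (fun k => s k - X) @ G --> Z - X by exact: cvg_submx sZ cX.
apply: (@hsn_cvg_le _ G _ n _ _ _ cZX).
have inf0 : \forall k \near G, k.+1%:R^-1 <= e.
  by apply: sG; near=> k; apply: ltW; near: k; exact: near_infty_natSinv_lt (PosNum e0).
apply: filterS inf0 => k ke; apply: le_trans (crad_ub _ DX) _; apply: le_trans (sP k) _.
by rewrite lerD2l.
Unshelve. all: by end_near. Qed.

Lemma chebyshev_unique Z W : (forall X, crad Z <= crad X) -> (forall X, crad W <= crad X) -> Z = W.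
Proof.
move=> hZ hW; apply/eqP; rewrite -subr_eq0; apply/eqP; apply: hsn_eq0.
have := @crad_close Z W (crad Z) 0 hZ; rewrite addr0 mulr0; apply => //; exact: hW.
Qed.

End Chebyshev.

Definition cheb n (D : set 'M[C]_n) : 'M[C]_n :=
  xget 0 [set Z | forall W, crad D Z <= crad D W].

Lemma chebP n (D : set 'M[C]_n) : D !=set0 -> (exists c, forall X, D X -> opnorm X <= c) ->
  forall W, crad D (cheb D) <= crad D W.
Proof.
move=> D0 Db; have [Z hZ] := chebyshev_exists D0 Db.
by have := @xgetPex _ 0 [set Z | forall W, crad D Z <= crad D W] (ex_intro _ Z hZ).
Qed.

Lemma cheb1 n (X : 'M[C]_n) : cheb [set X] = X.
Proof.
have D0 : [set X] !=set0 by exists X.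
have Db : exists c, forall Y, [set X] Y -> opnorm Y <= c by exists (opnorm X) => Y ->.
apply: (chebyshev_unique D0 Db); first exact: chebP.
move=> W; apply: le_trans (crad_ge0 D0 Db W); apply: (crad_le D0 Db) => Y ->.
by rewrite subrr hsn0.
Qed.

(** Conjugation by U is an isometry, so it carries the unique centre to the unique centre. *)
Lemma cheb_conj n (D : set 'M[C]_n) (U : 'M[C]_n) : U \is unitarymx -> D !=set0 ->
  (exists c, forall X, D X -> opnorm X <= c) ->
  cheb [set U *m X *m U ^t* | X in D] = U *m cheb D *m U ^t*.
Proof.
move=> Uu D0 Db; set D' := [set _ | _ in _].
have D'0 : D' !=set0 by have [X DX] := D0; exists (U *m X *m U ^t*), X.
have D'b : exists c, forall X, D' X -> opnorm X <= c.
  have [c Dc] := Db; exists c => _ [X DX <-]; apply: le_trans (opnorm_conj _ Uu) _; exact: Dc.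
have radE Z : crad D' (U *m Z *m U ^t*) = crad D Z.
  congr sup; apply/seteqP; split=> y /=.
    move=> [_ [X DX <-] <-]; exists X => //.
    by rewrite -mulmxBl -mulmxBr hsn_unitary.
  move=> [X DX <-]; exists (U *m X *m U ^t*); first by exists X.
  by rewrite -mulmxBl -mulmxBr hsn_unitary.
apply: (chebyshev_unique D'0 D'b); first exact: chebP.
move=> W; have -> : W = U *m (U ^t* *m W *m U) *m U ^t*.
  by rewrite !mulmxA (unitarymxP Uu) mul1mx -mulmxA (unitarymxP Uu) mulmx1.
by rewrite !radE; exact: chebP.
Qed.

End HilbertSchmidt.

(** * Tietze extension for matrix-valued functions *)

Section Tietze.
Variable R : realType.
Local Notation C := R[i].

Lemma cvg_ReIm (T : Type) (F : set_system T) (FF : Filter F) (f : T -> C) (z : C) :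
  f @ F --> z -> complex.Re (f t) @[t --> F] --> complex.Re z /\
    complex.Im (f t) @[t --> F] --> complex.Im z.
Proof.
move=> /cvg_normcP fz; split; apply/cvgrPdist_le => e e0; apply: filterS (fz _ e0) => t.
  by apply: le_trans; rewrite -raddfB; exact: ler_Re_normc.
by apply: le_trans; rewrite -raddfB; exact: ler_Im_normc.
Qed.

Lemma cvg_complex (T : Type) (F : set_system T) (FF : Filter F) (a b : T -> R) (x y : R) :
  a @ F --> x -> b @ F --> y -> (a t +i* b t) @[t --> F] --> x +i* y.
Proof.
move=> /cvgrPdist_le ax /cvgrPdist_le by_; apply/cvg_normcP => e e0.
have e2 : 0 < e / 2 by rewrite divr_gt0.
apply: filterS2 (ax _ e2) (by_ _ e2) => t h1 h2; rewrite (splitr e).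
by apply: le_trans (normc_ReIm _) _; exact: lerD h1 h2.
Qed.

Lemma compact_opnorm_bounded (X : topologicalType) (K : set X) n (g : X -> 'M[C]_n) :
  compact K -> (forall x, K x -> g y @[y --> x] --> g x) ->
  exists c, forall x, K x -> opnorm (g x) <= c.
Proof.
move=> cK gc.
have nb y : K y -> nbhs y [set p | opnorm (g p) <= opnorm (g y) + 1].
  move=> Ky; have /(cvg_opnormP (nbhs_filter y)) h := gc y Ky.
  apply: filterS (h _ ltr01) => p hp; rewrite /= -[g p](subKr (g y)).
  by apply: le_trans (opnormD _ _) _; rewrite opnormN lerD2l.
have [ys [_ ysc]] := compact_list_cover cK nb.
exists (\sum_(y <- ys) (opnorm (g y) + 1)) => x Kx.
have [y yys /= xy] := ysc x Kx; apply: le_trans xy _.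
rewrite (big_rem y)//= lerDl; apply: sumr_ge0 => z _.
by apply: addr_ge0 => //; exact: opnorm_ge0.
Qed.

Variables (X : topologicalType) (n : nat).
Hypothesis X2 : hausdorff_space X.
Hypothesis cX : compact [set: X].

Lemma tietze_real (A : set X) (h : X -> R) : closed A -> {within A, continuous h} ->
  exists2 g : X -> R, continuous g & forall x, A x -> g x = h x.
Proof.
move=> cA hc; have cA' : compact A by exact: (subclosed_compact cA cX).
have := compact_bounded (continuous_compact hc cA').
move=> /ex_strict_bound_gt0[M M0 hM].
have hb x : A x -> `|h x| <= M by move=> Ax; apply: ltW; apply: hM; exists x.
have [g [gh gc _]] := continuous_bounded_extension (compact_normal X2 cX) cA M0 hc hb.
by exists g => // x Ax; rewrite -gh// inE.
Qed.

Lemma tietze_mx (A : set X) (f : X -> 'M[C]_n) : closed A -> {within A, continuous f} ->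
  exists2 g : X -> 'M[C]_n, continuous g & forall x, A x -> g x = f x.
Proof.
move=> cA fc.
have cRI i j : {within A, continuous (fun x => complex.Re (f x i j))} /\
    {within A, continuous (fun x => complex.Im (f x i j))}.
  by split=> x; have /cvg_entries/(_ i j)/cvg_ReIm[] := fc x.
have exR i j : exists g : X -> R, continuous g /\ forall x, A x -> g x = complex.Re (f x i j).
  by have [g ? ?] := tietze_real cA (cRI i j).1; exists g.
have exI i j : exists g : X -> R, continuous g /\ forall x, A x -> g x = complex.Im (f x i j).
  by have [g ? ?] := tietze_real cA (cRI i j).2; exists g.
pose g x : 'M[C]_n := \matrix_(i, j) (sval (cid (exR i j)) x +i* sval (cid (exI i j)) x).
exists g => [x|x Ax].
  apply/cvg_entries => i j; rewrite mxE; under eq_fun do rewrite mxE.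
  apply: cvg_complex.
    by have [ac _] := svalP (cid (exR i j)); exact: ac.
  by have [ac _] := svalP (cid (exI i j)); exact: ac.
apply/matrixP => i j; rewrite mxE.
have [_ ->//] := svalP (cid (exR i j)); have [_ ->//] := svalP (cid (exI i j)).
by case: (f x i j).
Qed.

End Tietze.

(** * Equivariance by centres of orbit values *)

Section EquivariantExtension.
Variables (R : realType) (T : towerData R).
Hypothesis tT : is_tower T.
Hypothesis pT : proper_tower T.
Local Notation C := R[i].
Let wT := tower_wtower tT.
Variable n : nat.

Lemma fiber_tietze (A : set T) (f : T -> 'M[C]_n) : (forall z, A z -> tdeg z = n) -> closed A ->
  (forall (G : set_system T) z, UltraFilter G -> A z -> G A -> G --> z -> f @ G --> f z) ->
  exists g : T -> 'M[C]_n, (forall z, A z -> g z = f z) /\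
    (forall z, tdeg z = n -> g y @[y --> z] --> g z).
Proof.
move=> An cA fc; have [[z0 z0n]|no] := pselect (exists z : T, tdeg z = n); last first.
  exists (fun=> 0); split => [z Az|z zn]; case: no; exists z => //; exact: An.
pose X : topologicalType := tfib T n.
pose x0 : X := exist _ z0 (mem_set z0n).
have valn (x : X) : tdeg (set_val x) = n by exact: (set_valP x).
have vc := @initial_continuous _ _ (@set_val _ (tfib T n)).
have cX : compact [set: X] by exact: compact_subtype (@pT n).
have X2 : hausdorff_space X.
  move=> x y cxy; apply: val_inj; apply: (tower_hausdorff tT) => P Q nP nQ.
  by have [z [Pz Qz]] := cxy _ _ (vc x _ nP) (vc y _ nQ); exists (set_val z).
have cA' : closed (set_val @^-1` A : set X) by apply: preimage_closed => // x _; exact: vc.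
have fc' : {within (set_val @^-1` A : set X), continuous (fun x : X => f (set_val x))}.
  apply/subspace_continuousP => x Ax; apply: ultra_cvgP => G UG sG.
  have GA : G (set_val @^-1` A) by apply: sG; apply: (@filterE _ (nbhs x)).
  have Gx : set_val @ G --> set_val x.
    by move=> P nP; apply: sG; apply: (@filterS _ (nbhs x) _ _ _ _ (vc x _ nP)) => y Py _.
  exact: (fc (set_val @ G) (set_val x) (ultra_fmap _ UG) Ax GA Gx).
have [g1 g1c g1f] := tietze_mx X2 cX cA' fc'.
(* A retraction onto the fibre; the value x0 outside it does no harm because degrees are locally
   constant. *)
pose h (y : T) : X := if pselect (tdeg y = n) is left e then exist _ y (mem_set e) else x0.
have hE y : tdeg y = n -> set_val (h y) = y by move=> e; rewrite /h; case: pselect.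
have hx (x : X) : h (set_val x) = x by apply: val_inj; exact: hE (valn x).
exists (g1 \o h); split => [z Az|z zn] /=.
  by rewrite g1f /= ?hE//; exact: An.
have hz : h @ z --> h z.
  apply/(@set_val_cvgP _ (tfib T n) (h @ z)); rewrite hE//.
  move=> P nP; have hP : nbhs z [set y | P (set_val (h y))].
    by apply: (@filterS _ (nbhs z) _ _ _ _ (filterI nP (tdeg_near tT z))) => y [Py e] /=; rewrite hE// e.
  exact: hP.
exact: cvg_trans (cvg_app g1 hz) (g1c (h z)).
Qed.

Lemma cheb_bounded (D : set 'M[C]_n) c : D !=set0 -> (forall X, D X -> opnorm X <= c) ->
  opnorm (cheb D) <= n%:R * n%:R * (n%:R * (n%:R * c ^+ 2) + 1) + c.
Proof.
move=> D0 Dc; have Db : exists c, forall X, D X -> opnorm X <= c by exists c.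
have [X DX] := D0; rewrite -[cheb D](subrK X); apply: le_trans (opnormD _ _) _.
apply: lerD (Dc X DX); apply: opnorm_hsn; apply: le_trans (crad_ub D0 Db _ DX) _.
apply: le_trans (chebP D0 Db 0) _; apply: (crad_le D0 Db) => Y DY.
by apply: hsn_opnorm; rewrite sub0r opnormN; exact: Dc.
Qed.

(* Replacing the values along an orbit by the centre of the smallest ball (in the
   Hilbert-Schmidt norm) that contains their translates plays the role of averaging
   over the unitary group. *)
Definition orbit_values (g : T -> 'M[C]_n) z : set 'M[C]_n :=
  [set U ^t* *m g (U ∙ z) *m U | U in [set U : 'M[C]_n | U \is unitarymx]].

Section Averaging.
Variable g : T -> 'M[C]_n.
Hypothesis gc : forall z, tdeg z = n -> g y @[y --> z] --> g z.
Let D := orbit_values g.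

Lemma orbit_values_neq0 z : D z !=set0.
Proof.
pose I : 'M[C]_n := 1%:M.
by exists (I ^t* *m g (I ∙ z) *m I), I => //; exact: unitarymx1.
Qed.

Lemma orbit_values_bounded : exists c, forall z X, tdeg z = n -> D z X -> opnorm X <= c.
Proof.
have [c gb] := compact_opnorm_bounded (@pT n) gc; exists c => z _ zn [U /= Uu <-].
have := opnorm_conj (g (U ∙ z)) (unitarymx_star Uu); rewrite trmxCK => h.
apply: le_trans h _; apply: gb; exact: (wdeg_act wT zn Uu).
Qed.

Lemma orbit_values_act z (V : 'M[C]_n) : tdeg z = n -> V \is unitarymx ->
  D (V ∙ z) = [set V *m X *m V ^t* | X in D z].
Proof.
move=> zn Vu; have V'u := unitarymx_star Vu.
apply/seteqP; split=> Y [].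
  move=> U /= Uu <-; have UVu : U *m V \is unitarymx := unitarymxM Uu Vu.
  exists ((U *m V) ^t* *m g ((U *m V) ∙ z) *m (U *m V)); first by exists (U *m V).
  rewrite (wactM wT zn Uu Vu) trmx_mul map_mxM !mulmxA (unitarymxP Vu) mul1mx.
  by rewrite -[X in X = _]mulmxA -!mulmxA (unitarymxP Vu) mulmx1.
move=> _ [U /= Uu <-] <-; have UVu : U *m V ^t* \is unitarymx := unitarymxM Uu V'u.
exists (U *m V ^t*); first exact: UVu.
rewrite -(wactM wT zn UVu Vu).
rewrite -[U *m V ^t* *m V]mulmxA (unitarymxKl Vu) mulmx1.
by rewrite trmx_mul map_mxM trmxCK !mulmxA.
Qed.

(** Let Z be the limit of the centres along an ultrafilter. For a competitor W, the radius at y is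
    nearly attained at some unitary V y; these converge, so in the limit the radii at y do not
    exceed the radius of W at z. Hence Z is a centre at z. *)
Lemma cheb_orbit_cvg z : tdeg z = n -> cheb (D y) @[y --> z] --> cheb (D z).
Proof.
move=> zn; have [c Dc] := orbit_values_bounded.
have Db y : tdeg y = n -> exists c, forall X, D y X -> opnorm X <= c.
  by move=> yn; exists c => X; exact: Dc.
have D0 := orbit_values_neq0.
apply: ultra_cvgP => G UG sG.
have Gn : \forall y \near G, tdeg y = n.
  by apply: sG; apply: filterS (tdeg_near tT z) => y ->.
have Gz : id @ G --> z by exact: sG.
have [Z gZ] : exists Z : 'M[C]_n, (fun y => cheb (D y)) @ G --> Z.
  apply: (@ultra_cvgmx R _ G UG n _ (n%:R * n%:R * (n%:R * (n%:R * c ^+ 2) + 1) + c)).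
  apply: filterS Gn => y yn; apply: cheb_bounded => // X; exact: Dc.
suff -> : cheb (D z) = Z by [].
apply: (chebyshev_unique (D0 z) (Db z zn)); first exact: (chebP (D0 z) (Db z zn)).
have conjc (u : T -> 'M[C]_n) U0 : U0 \is unitarymx -> (forall y, u y \is unitarymx) ->
    u @ G --> U0 -> (fun y => (u y) ^t* *m g (u y ∙ y) *m u y) @ G --> U0 ^t* *m g (U0 ∙ z) *m U0.
  move=> U0u uu uU; have h : (fun y => u y ∙ y) @ G --> U0 ∙ z.
    by apply: (tact_cvg tT _ zn U0u _ uU Gz); apply: filterE.
  have h2 : (fun y => g (u y ∙ y)) @ G --> g (U0 ∙ z).
    exact: cvg_trans (cvg_app g h) (gc (wdeg_act wT zn U0u)).
  exact: cvg_mulmx _ (cvg_mulmx _ (cvg_adjmx _ uU) h2) uU.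
move=> W; apply: (crad_le (D0 z) (Db z zn)) => _ [U /= Uu <-].
apply/ler_addgt0Pr => e e0; have e2 : 0 < e / 2 by rewrite divr_gt0.
have exU (y : T) : exists V : 'M[C]_n, V \is unitarymx /\
    (tdeg y = n -> crad (D y) W - e / 2 < hsn (W - V ^t* *m g (V ∙ y) *m V)).
  have [yn|yn] := pselect (tdeg y = n); last by exists 1%:M; split; [exact: unitarymx1|move=> /yn].
  by have [_ [V /= Vu <-] h] := crad_adherent (D0 y) (Db y yn) W e2; exists V.
pose V y := sval (cid (exU y)).
have Vu y : V y \is unitarymx by rewrite /V; case: cid => ? [].
have Vr y : tdeg y = n -> crad (D y) W - e / 2 < hsn (W - (V y) ^t* *m g (V y ∙ y) *m V y).
  by rewrite /V; case: cid => ? [].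
have [V0 V0u VV0] : exists2 V0 : 'M[C]_n, V0 \is unitarymx & V @ G --> V0.
  by apply: ultra_unitary_cvg; apply: filterE.
have cW : (fun _ : T => W) @ G --> W by exact: cvg_cst.
have FG : Filter G by typeclasses eauto.
have h1 := hsn_cvg_near FG (cvg_submx FG cW (conjc V V0 V0u Vu VV0)) e2.
have cU : (fun _ : T => U) @ G --> U by exact: cvg_cst.
have h2 := cvg_submx FG gZ (conjc (fun=> U) U Uu (fun=> Uu) cU).
apply: (@hsn_cvg_le R _ G _ n _ _ _ h2).
apply: filterS2 h1 Gn => y hy yn.
apply: le_trans (crad_ub (D0 y) (Db y yn) _ _) _; first exact: (ex_intro2 _ _ U Uu erefl).
apply: le_trans (chebP (D0 y) (Db y yn) W) _.
have h3 : hsn (W - V0 ^t* *m g (V0 ∙ z) *m V0) <= crad (D z) W.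
  by apply: (crad_ub (D0 z) (Db z zn)); exists V0.
by move: hy h3 (Vr y yn); move: (hsn _) (crad _ _) (hsn _) (crad _ _) => *; lra.
Qed.

End Averaging.

(** On A the function is already equivariant, so the set of translated values is a single point,
    which is its own centre. *)
Theorem equivariant_extension (A : set T) (f : T -> 'M[C]_n) :
  (forall z, A z -> tdeg z = n) -> closed A ->
  (forall z (U : 'M[C]_n), A z -> U \is unitarymx -> A (U ∙ z) /\ f (U ∙ z) = U *m f z *m U ^t*) ->
  (forall (G : set_system T) z, UltraFilter G -> A z -> G A -> G --> z -> f @ G --> f z) ->
  exists g : T -> 'M[C]_n, [/\ forall z, A z -> g z = f z,
    forall z (U : 'M[C]_n), tdeg z = n -> U \is unitarymx -> g (U ∙ z) = U *m g z *m U ^t* &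
    forall z, tdeg z = n -> g y @[y --> z] --> g z].
Proof.
move=> An cA fact fc; have [g0 [g0f g0c]] := fiber_tietze An cA fc.
exists (fun z => cheb (orbit_values g0 z)); split.
- move=> z Az; rewrite [X in cheb X](_ : _ = [set f z]); first exact: cheb1.
  have h (U : 'M[C]_n) : U \is unitarymx -> U ^t* *m g0 (U ∙ z) *m U = f z.
    move=> Uu; have [AUz e] := fact z U Az Uu; rewrite g0f// e !mulmxA unitarymxKl// mul1mx.
    by rewrite -mulmxA unitarymxKl// mulmx1.
  apply/seteqP; split=> [_ [U /= Uu <-]|_ ->]; first exact: h.
  by exists 1%:M; [exact: unitarymx1|apply: h; exact: unitarymx1].
- move=> z U zn Uu; rewrite orbit_values_act// cheb_conj//; first exact: orbit_values_neq0.
  by have [c h] := orbit_values_bounded g0c; exists c => X; exact: h.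
- exact: cheb_orbit_cvg.
Qed.

End EquivariantExtension.

(** * Interpolation at irreducible points *)

Section MatrixTowerFacts.
Variable R : realType.
Local Notation C := R[i].
Local Notation M := (mtower R).
Let wM := mtower_wtower R.

Lemma mtower_inj (p q p' q' : M) : tdeg p = tdeg p' -> p ⊕ q = p' ⊕ q' -> p = p'.
Proof.
move=> e e2; have dq : tdeg q = tdeg q'.
  by have := congr1 (@tdeg _ M) e2; rewrite !(wdegD wM) e => /addnI.
apply: (@mspace_eq R (tdeg p')) => //.
have := congr1 (mat (tdeg p' + tdeg q')) e2.
rewrite (mat_plus e dq) (mat_plus (erefl _) (erefl _)) => h.
have := congr1 (@ulsubmx _ (tdeg p') (tdeg q') (tdeg p') (tdeg q')) h.
by rewrite /dsum !block_mxKul.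
Qed.

Lemma mat_nfold p n (x : M) : tdeg x = p -> (0 < n)%N ->
  mat (n * p) (nfold n x) = (1%:M : 'M[C]_n) *t mat p x.
Proof.
move=> xp; case: n => // n _; elim: n => [|n ih].
  by rewrite /nfold /= tens_scalar1mx; move: (mul1n p); rewrite mul1n => e; rewrite castmx_id.
rewrite -dsum_tens -ih; apply: mat_plus => //.
by have := tdeg_nfold wM x (ltn0Sn n); rewrite xp.
Qed.

Lemma tens_unitary n p (U : 'M[C]_n) : U \is unitarymx -> U *t (1%:M : 'M[C]_p) \is unitarymx.
Proof.
move=> Uu; apply/unitarymxP; rewrite trmx_tens map_mxT trmx1 map_mx1 tensmx_mul (unitarymxP Uu) mulmx1.
by apply/matrixP => i j; case: (mxtens_indexP i) => i1 i2; case: (mxtens_indexP j) => j1 j2;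
  rewrite tensmxE !mxE (can_eq (@mxtens_indexK _ _)) -natrM mulnb xpair_eqE.
Qed.

Lemma mat_stab_nfold p n (U : 'M[C]_n) (x : M) : tdeg x = p -> (0 < n)%N ->
  U \is unitarymx -> (U *t (1%:M : 'M[C]_p)) ∙ nfold n x = nfold n x.
Proof.
move=> xp n0 Uu; have Vu := tens_unitary p Uu.
have dn : tdeg (nfold n x) = (n * p)%N by rewrite (tdeg_nfold wM)// xp.
apply: (@mspace_eq R (n * p)); rewrite ?[mdeg _](wdeg_act wM dn Vu)//.
rewrite [LHS](mat_act dn Vu) mat_nfold// trmx_tens map_mxT trmx1 map_mx1 !tensmx_mul.
by rewrite mulmx1 (unitarymxP Uu) mul1mx mulmx1.
Qed.

Lemma opnorm_mact n (U : 'M[C]_n) (x : M) : tdeg x = n -> U \is unitarymx ->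
  opnorm (mat n (U ∙ x)) <= opnorm (mat n x).
Proof. by move=> xn Uu; rewrite [mat n _](mat_act xn Uu); exact: opnorm_conj. Qed.

End MatrixTowerFacts.

Section Interpolation.
Variables (R : realType) (S : towerData R) (kappa : S).
Hypothesis hS : is_proper_pointed_mtower_fh kappa.
Local Notation C := R[i].
Local Notation M := (mtower R).
Let mS := ppm_mtower hS.
Let tS := mtower_tower mS.
Let wS := tower_wtower tS.
Let pS := ppm_proper hS.
Let wM := mtower_wtower R.

Lemma act_castmx m n (e : m = n) (U : 'M[C]_m) (x : S) : castmx (e, e) U ∙ x = U ∙ x.
Proof. by case: n / e; rewrite castmx_id. Qed.

Lemma unitary_castmx m n (e : m = n) (U : 'M[C]_m) :
  (castmx (e, e) U \is unitarymx) = (U \is unitarymx).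
Proof. by case: n / e; rewrite castmx_id. Qed.

(** The case n = 1 of (mT4). *)
Lemma irreducible_stab n (x : S) (U : 'M[C]_n) : tdeg x = n -> ~ reducible x ->
  U \is unitarymx -> U ∙ x = x -> exists k, U = k%:M.
Proof.
move=> xn; case: n / xn U => U xirr Uu Ux.
have e := esym (mul1n (tdeg x)).
have : stab (1 * tdeg x) (nfold 1 x) (castmx (e, e) U).
  by split; rewrite ?unitary_castmx// act_castmx.
rewrite (mtower_stab_nfold mS xirr (ltn0Sn 0)) => -[u /= uu].
rewrite [u]mx11_scalar tens_scalar_mx scalemx1 => h; exists (u 0 0).
have := congr1 (castmx (esym e, esym e)) h; rewrite castmxK.
by move=> <-; rewrite castmx_comp castmx_id.
Qed.

(** The two unitaries differ by a scalar, which conjugation does not see; hence a value prescribed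
    at x spreads consistently over its orbit. *)
Lemma irreducible_act_mx n (x : S) (U V X : 'M[C]_n) : tdeg x = n -> ~ reducible x ->
  U \is unitarymx -> V \is unitarymx -> U ∙ x = V ∙ x ->
  U *m X *m U ^t* = V *m X *m V ^t*.
Proof.
move=> xn xirr Uu Vu e; have V'u := unitarymx_star Vu.
have VUu : V ^t* *m U \is unitarymx := unitarymxM V'u Uu.
have h : (V ^t* *m U) ∙ x = x by rewrite (wactM wS xn V'u Uu) e (wactK wS xn Vu).
have [k kE] := irreducible_stab xn xirr VUu h.
have UE : U = V *m k%:M by rewrite -kE mulmxA (unitarymxP Vu) mul1mx.
rewrite UE trmx_mul map_mxM !mulmxA; congr (_ *m _).
rewrite -!mulmxA; congr (V *m _); rewrite mulmxA; apply: unitary_scalarP.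
by rewrite -kE.
Qed.

Lemma height_bound : exists h, forall x : S, ~ reducible x -> (tdeg x <= h)%N.
Proof.
have hf := ppm_height hS.
have h0 : (0 <= height S)%E by apply: ereal_sup_ubound; left.
have ub (x : S) : ~ reducible x -> (((tdeg x)%:R)%:E <= height S)%E.
  by move=> xirr; apply: ereal_sup_ubound; right; exists x.
move: hf h0 ub; case: (height S) => // r _ _ h.
exists (Num.bound `|r|) => x xirr; have := h x xirr; rewrite lee_fin => hx.
rewrite -(ler_nat R); apply: le_trans hx _.
by apply: le_trans (ler_norm r) _; apply: ltW; exact: (archi_boundP (normr_ge0 r)).
Qed.

(** A function that behaves like an element of C*(S) in degrees up to N; above N only the sizes of
    its values are prescribed. *)
Record stage N (G : S -> M) : Prop := Stage {
  stage_deg : forall x, tdeg (G x) = tdeg x;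
  stage_act : forall n x (U : 'M[C]_n), tdeg x = n -> (n <= N)%N -> U \is unitarymx ->
    G (U ∙ x) = U ∙ G x;
  stage_plus : forall x y, (tdeg x + tdeg y <= N)%N -> G (x ⊕ y) = G x ⊕ G y;
  stage_cont : forall x, (tdeg x <= N)%N -> G y @[y --> x] --> G x }.

Section Step.
Variables (N : nat) (G : S -> M).
Hypothesis N0 : (0 < N)%N.
Hypothesis sG : stage N G.
Let n := N.+1.

Definition stage_irr : set S := [set x | ~ reducible x /\ (tdeg x <= N)%N].

Local Notation PT := (pair_tower wS wM).
Let wP := pair_wtower wS wM.

Definition spair (x : S) : PT := pmk (esym (stage_deg sG x)).

Lemma spair_fst x : pfst (spair x) = x. Proof. by []. Qed.

Lemma spair_snd x : psnd (spair x) = G x. Proof. by []. Qed.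

Lemma stage_irr_kappa : stage_irr kappa.
Proof. by split; [exact: (deg1_irreducible wS (ppm_point hS))|rewrite (ppm_point hS)]. Qed.

Definition srelated : PT -> Prop :=
  @related R S M wS wM kappa stage_irr G stage_irr_kappa (fun x _ => stage_deg sG x).

Lemma srelated_spair x : (tdeg x <= N)%N -> srelated (spair x).
Proof.
have [m] := ubnP (tdeg x); elim: m x => // m ih x xm xN.
have [xr|xirr] := pselect (reducible x); last first.
  rewrite [spair x](_ : _ = px wS wM stage_irr_kappa (fun x _ => stage_deg sG x) x).
    by apply: related_px.
  by apply: pair_tower_eq; [rewrite px_fst|rewrite px_snd].
have [a [b [V [Vu e]]]] := xr.
have dab : (tdeg a + tdeg b)%N = tdeg x by rewrite -(wdegD wS) -e (wdeg_act wS).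
have a0 := wdeg_gt0 wS a; have b0 := wdeg_gt0 wS b.
have ra : srelated (spair a) by apply: ih; lia.
have rb : srelated (spair b) by apply: ih; lia.
apply: (related_equiv (related_plus ra rb)).
apply: (tequiv_sym wP); have d : tdeg (spair x) = tdeg x by [].
suff -> : spair a ⊕ spair b = V ∙ spair x by exact: (tequivI d Vu).
apply: pair_tower_eq.
  by rewrite (pfst_act d Vu) pfst_plus !spair_fst e.
rewrite (psnd_act d Vu) psnd_plus !spair_snd -(stage_act sG (erefl _) xN Vu) e.
by apply: esym; apply: (stage_plus sG); rewrite dab.
Qed.

(** Different decompositions of a reducible point of degree N + 1 give the same value:
    [related_functional] is applied with the matrices as T' and G as phi. *)
Lemma stage_functional (a b c d : S) (U : 'M[C]_n) : tdeg (a ⊕ b) = n -> tdeg (c ⊕ d) = n ->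
  U \is unitarymx -> U ∙ (a ⊕ b) = c ⊕ d -> U ∙ (G a ⊕ G b) = G c ⊕ G d.
Proof.
move=> abn cdn Uu e; have ab := wdegD wS a b; have cd := wdegD wS c d.
have a0 := wdeg_gt0 wS a; have b0 := wdeg_gt0 wS b.
have c0 := wdeg_gt0 wS c; have d0 := wdeg_gt0 wS d.
have r x y : (tdeg x <= N)%N -> (tdeg y <= N)%N -> srelated (spair x ⊕ spair y).
  by move=> xN yN; apply: related_plus; exact: srelated_spair.
have rab : srelated (spair a ⊕ spair b) by apply: r; rewrite /n in abn; lia.
have rcd : srelated (spair c ⊕ spair d) by apply: r; rewrite /n in cdn; lia.
have dP : tdeg (spair a ⊕ spair b) = n by rewrite pdeg pfst_plus !spair_fst.
have := @related_functional R S M wS wM (mtower_disj mS) (mtower_cancel mS) (mtower_stab_plus mS)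
  (mtower_stab_nfold mS) (@mtower_inj R) kappa stage_irr G (ppm_point hS) stage_irr_kappa
  (fun x h => h.1) (fun x _ => stage_deg sG x).
move=> /(_ _ _ (spair a ⊕ spair b) (spair c ⊕ spair d) n U dP rab rcd Uu); apply.
- by move=> x V [_ xN] Vu; exact: (stage_act sG (erefl _) xN Vu).
- by move=> x k V _ k0 Vu; apply: mat_stab_nfold => //; exact: (stage_deg sG).
- by rewrite !pfst_plus !spair_fst.
Qed.

Definition red_set : set S := [set z | tdeg z = n /\ reducible z].

(** The value forced on a reducible point by additivity and equivariance; [stage_functional] makes
    it independent of the decomposition. *)
Definition red_val (z : S) : 'M[C]_n :=
  xget 0 [set X | exists a b (V : 'M[C]_n), [/\ tdeg (a ⊕ b) = n, V \is unitarymx,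
    V ∙ (a ⊕ b) = z & X = mat n (V ∙ (G a ⊕ G b))]].

Lemma red_valE a b (V : 'M[C]_n) : tdeg (a ⊕ b) = n -> V \is unitarymx ->
  red_val (V ∙ (a ⊕ b)) = mat n (V ∙ (G a ⊕ G b)).
Proof.
move=> abn Vu; rewrite /red_val; case: xgetP => [X _ [c [d [W [cdn Wu e ->]]]]|no].
  have V'u := unitarymx_star Vu.
  have WVu : V ^t* *m W \is unitarymx := unitarymxM V'u Wu.
  have h : (V ^t* *m W) ∙ (c ⊕ d) = a ⊕ b.
    by rewrite (wactM wS cdn V'u Wu) e (wactK wS abn Vu).
  have := stage_functional cdn abn WVu h.
  have Gn x y : tdeg (x ⊕ y) = n -> tdeg (G x ⊕ G y) = n.
    by rewrite (wdegD wS) (wdegD wM) !(stage_deg sG).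
  move=> <-; rewrite -(wactM wM (Gn _ _ cdn) Vu WVu) mulmxA (unitarymxP Vu) mul1mx.
  by [].
by exfalso; apply: (no (mat n (V ∙ (G a ⊕ G b)))); exists a, b, V.
Qed.

Lemma red_setE z : red_set z -> exists a b (V : 'M[C]_n),
  [/\ tdeg (a ⊕ b) = n, V \is unitarymx & V ∙ (a ⊕ b) = z].
Proof.
move=> [zn zr]; have [a [b [V [Vu e]]]] := reducibleE zn zr.
exists a, b, (V ^t*); split; first by rewrite -e (wdeg_act wS zn Vu).
  exact: unitarymx_star.
by rewrite -e (wactK wS zn Vu).
Qed.

Lemma red_val_act z (U : 'M[C]_n) : red_set z -> U \is unitarymx ->
  red_set (U ∙ z) /\ red_val (U ∙ z) = U *m red_val z *m U ^t*.
Proof.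
move=> rz Uu; have [a [b [V [abn Vu <-]]]] := red_setE rz.
have UVu : U *m V \is unitarymx := unitarymxM Uu Vu.
have Gn : tdeg (G a ⊕ G b) = n by rewrite (wdegD wM) !(stage_deg sG) -(wdegD wS).
rewrite -(wactM wS abn Uu Vu) !red_valE//; split.
  split; first exact: (wdeg_act wS abn UVu).
  by apply: (reducible_plus (a := a) (b := b)); apply: (tequiv_sym wS); exact: (tequivI abn UVu).
rewrite (wactM wM Gn Uu Vu); apply: mat_act => //; exact: (wdeg_act wM Gn Vu).
Qed.

Lemma red_val_cvg (F : set_system S) z : UltraFilter F -> red_set z -> F red_set -> F --> z ->
  red_val @ F --> red_val z.
Proof.
move=> UF _ FA Fz.
have [a [b [V [a0 [b0 [V0 [nF [V0u d0] [Fa Fb] FV ->]]]]]]] := reducible_lim tS pS UF FA Fz.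
rewrite (red_valE d0 V0u).
have FF : Filter F by typeclasses eauto.
have ad := wdegD wS a0 b0; have a0' := wdeg_gt0 wS a0; have b0' := wdeg_gt0 wS b0.
have aN : (tdeg a0 <= N)%N by rewrite /n in d0; lia.
have bN : (tdeg b0 <= N)%N by rewrite /n in d0; lia.
have Ga : (fun y => G (a y)) @ F --> G a0 := cvg_trans (cvg_app G Fa) (stage_cont sG aN).
have Gb : (fun y => G (b y)) @ F --> G b0 := cvg_trans (cvg_app G Fb) (stage_cont sG bN).
have Gab := mplus_cvg FF Ga Gb.
have Gn : mdeg (mplus (G a0) (G b0)) = n.
  by have := wdegD wM (G a0) (G b0); rewrite !(stage_deg sG) -ad d0.
have Vu : \forall y \near F, V y \is unitarymx by apply: filterS nF => y [].
have GV := mact_cvg FF Gn V0u Vu FV Gab.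
have Gm := cvg_trans (cvg_app (mat n) GV) (@mat_continuous R n _).
apply: cvg_trans Gm; apply: near_eq_cvg; apply: filterS nF => y [Vyu e yn].
by rewrite -[in RHS]e (red_valE yn Vyu).
Qed.

(** In degree N + 1 additivity only constrains the reducible points, which form a closed invariant
    set; the equivariant extension supplies the rest. *)
Lemma stage_step : exists2 G' : S -> M, stage n G' & forall x, (tdeg x <= N)%N -> G' x = G x.
Proof.
have [g [gf gact gc]] := @equivariant_extension R S tS pS n red_set red_val
  (fun z h => h.1) (@reducible_closed R S tS pS n) red_val_act red_val_cvg.
pose G' x : M := if (tdeg x <= N)%N then G x else
  if tdeg x == n then mk (g x) else mk (0 : 'M[C]_((tdeg x).-1.+1)).
have GN x : (tdeg x <= N)%N -> G' x = G x by rewrite /G' => ->.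
have Gn x : tdeg x = n -> G' x = mk (g x) by rewrite /G' => ->; rewrite ltnn eqxx.
have Gd x : tdeg (G' x) = tdeg x.
  rewrite /G'; case: ifP => [_|_]; first exact: (stage_deg sG).
  case: ifP => [/eqP -> //|_]; rewrite -[tdeg _]/((tdeg x).-1.+1) prednK//; exact: (wdeg_gt0 wS x).
exists G' => //; split => //.
- move=> m x U xm mn Uu; have xU := wdeg_act wS xm Uu.
  have [mN|mN] := leqP m N; first by rewrite !GN ?xU ?xm// (stage_act sG xm mN Uu).
  have em : m = n by rewrite /n in mn *; lia.
  move: U xm Uu xU; rewrite em => U xm Uu xU; rewrite !Gn//.
  apply: (@mspace_eq R n) => //; rewrite mat_mk [RHS](mat_act _ Uu)// mat_mk; exact: gact.
- move=> x y xyn; have x0 := wdeg_gt0 wS x; have y0 := wdeg_gt0 wS y.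
  have d := wdegD wS x y.
  have xN : (tdeg x <= N)%N by rewrite /n in xyn; lia.
  have yN : (tdeg y <= N)%N by rewrite /n in xyn; lia.
  have [mN|mN] := leqP (tdeg x + tdeg y) N.
    by rewrite !GN ?d// (stage_plus sG mN).
  have em : tdeg (x ⊕ y) = n by rewrite /n in xyn *; lia.
  have Gxy : tdeg (G x ⊕ G y) = n by rewrite (wdegD wM) !(stage_deg sG) -d.
  rewrite (GN x xN) (GN y yN) Gn//; apply: (@mspace_eq R n) => //; rewrite mat_mk.
  have u1 := unitarymx1 R n.
  have := red_valE em u1; rewrite (wact1 wS em) (wact1 wM Gxy) => <-; apply: gf.
  by split => //; apply: (reducible_plus (a := x) (b := y)); exact: (tequiv_refl wS).
- move=> x xn; have [xN|xN] := leqP (tdeg x) N.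
    rewrite GN//; apply: cvg_trans (stage_cont sG xN); apply: near_eq_cvg.
    by apply: filterS (tdeg_near tS x) => y e; rewrite GN// e.
  have em : tdeg x = n by rewrite /n in xn *; lia.
  rewrite Gn//; apply: (@cvg_mspace R _ _ _ _ n) => //.
    by apply: filterS (tdeg_near tS x) => y e; rewrite -em -e -(Gd y).
  rewrite mat_mk; apply: cvg_trans (gc x em); apply: near_eq_cvg.
  by apply: filterS (tdeg_near tS x) => y e; rewrite Gn ?e// mat_mk.
Qed.

End Step.
End Interpolation.

Lemma opnorm_mval (R : realType) n (p : mspace R) : mdeg p = n -> opnorm (mat n p) = opnorm (mval p).
Proof. by move=> <-; rewrite mat_id. Qed.

(** * Functions with a prescribed value at an irreducible point *)

Section Interpolation.
Variables (R : realType) (S : towerData R) (kappa : S).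
Hypothesis hS : is_proper_pointed_mtower_fh kappa.
Local Notation C := R[i].
Local Notation M := (mtower R).
Let mS := ppm_mtower hS.
Let tS := mtower_tower mS.
Let wS := tower_wtower tS.
Let pS := ppm_proper hS.
Let wM := mtower_wtower R.

Section Base.
Variables (d : nat) (x0 y0 : S) (X : 'M[C]_d).
Hypothesis x0d : tdeg x0 = d.
Hypothesis y0d : tdeg y0 = d.
Hypothesis x0irr : ~ reducible x0.
Hypothesis x0y0 : ~ tequiv x0 y0.
Hypothesis x0k : x0 <> kappa.

Definition orbit_set (x : S) : set S := [set U ∙ x | U in [set U : 'M[C]_d | U \is unitarymx]].

Lemma orbit_set_deg x z : tdeg x = d -> orbit_set x z -> tdeg z = d.
Proof. by move=> xd [U /= Uu <-]; exact: (wdeg_act wS xd Uu). Qed.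

Lemma orbit_set_tequiv x z : tdeg x = d -> orbit_set x z -> tequiv x z.
Proof. by move=> xd [U /= Uu <-]; exact: (tequivI xd Uu). Qed.

Lemma orbit_set_act x z (U : 'M[C]_d) : tdeg x = d -> orbit_set x z -> U \is unitarymx ->
  orbit_set x (U ∙ z).
Proof.
move=> xd [V /= Vu <-] Uu; exists (U *m V); first exact: (unitarymxM Uu Vu).
exact: (wactM wS xd Uu Vu).
Qed.

Lemma orbit_lim x (F : set_system S) z : tdeg x = d -> UltraFilter F -> F (orbit_set x) -> F --> z ->
  exists (V : S -> 'M[C]_d) V0, [/\ \forall y \near F, V y \is unitarymx /\ V y ∙ x = y,
    V0 \is unitarymx, V @ F --> V0 & z = V0 ∙ x].
Proof.
move=> xd UF Fx Fz.
have ex (y : S) : exists V : 'M[C]_d, orbit_set x y -> V \is unitarymx /\ V ∙ x = y.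
  have [[V /= Vu e]|no] := pselect (orbit_set x y); first by exists V.
  by exists 0 => /no.
pose V y := sval (cid (ex y)).
have VP y : orbit_set x y -> V y \is unitarymx /\ V y ∙ x = y by rewrite /V; case: cid.
have nF : \forall y \near F, V y \is unitarymx /\ V y ∙ x = y by apply: filterS Fx => y /VP.
have Vu : \forall y \near F, V y \is unitarymx by apply: filterS nF => y [].
have [V0 V0u FV] := ultra_unitary_cvg UF Vu.
exists V, V0; split => //.
have FF : ProperFilter F by typeclasses eauto.
apply: (@tower_cvg_unique R S tS S F FF id) => //.
have cx : (fun _ : S => x) @ F --> x by exact: cvg_cst.
apply: cvg_trans (tact_cvg tS _ xd V0u Vu FV cx).
by apply: near_eq_cvg; apply: filterS nF => y [].
Qed.

Lemma orbit_closed x : tdeg x = d -> closed (orbit_set x).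
Proof.
move=> xd z clz.
have PF : ProperFilter (within (orbit_set x) (nbhs z)).
  split; last exact: within_filter.
  by move=> h; have [y [yA]] := clz _ h; apply.
have [G [UG sG]] := ultraFilterLemma PF.
have GA : G (orbit_set x) by apply: sG; apply: (@filterE _ (nbhs z)) => y.
have Gz : G --> z.
  by move=> B nB; apply: sG; apply: (@filterS _ (nbhs z) _ _ _ _ nB) => y By _.
by have [V [V0 [_ V0u _ ->]]] := orbit_lim xd UG GA Gz; exists V0.
Qed.

(** The function is to vanish in degrees below d, which forces 0 at reducible points of degree d; to
    these are added the orbit of y0 and, when d = 1, the base point. *)
Definition zero_set : set S :=
  [set z | tdeg z = d /\ reducible z] `|` orbit_set y0 `|` [set z | z = kappa /\ tdeg z = d].

Lemma zero_set_closed : closed zero_set.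
Proof.
apply: closedU; first (apply: closedU; [exact: (reducible_closed tS pS)|exact: orbit_closed]).
have -> : [set z : S | z = kappa /\ tdeg z = d] = [set kappa] `&` tfib S d by [].
apply: closedI; first exact: (accessible_closed_set1 (hausdorff_accessible (tower_hausdorff tS))).
exact: (compact_closed (tower_hausdorff tS) (@pS d)).
Qed.

Lemma zero_set_deg z : zero_set z -> tdeg z = d.
Proof. by move=> [[[]|/(orbit_set_deg y0d)]|[]]. Qed.

Lemma zero_set_act z (U : 'M[C]_d) : zero_set z -> U \is unitarymx -> zero_set (U ∙ z).
Proof.
move=> [[[zd zr]|yz]|[zk zd]] Uu.
- left; left; split; first exact: (wdeg_act wS zd Uu).
  apply: contrapT => h; apply: (irreducible_tequiv wS _ h zr).
  exact: (tequiv_sym wS (tequivI zd Uu)).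
- by left; right; exact: orbit_set_act.
- right; split; last exact: (wdeg_act wS zd Uu).
  have k1 := ppm_point hS; rewrite zk in zd *.
  have d1 : d = 1%N by rewrite -zd.
  have h n (e : n = 1%N) (W : 'M[C]_n) : W \is unitarymx -> W ∙ kappa = kappa.
    move: W; rewrite e => W; rewrite [W]mx11_scalar => Wu; exact: (wscalar wS k1 Wu).
  exact: h d1 _ Uu.
Qed.

Lemma zero_set_disj z : orbit_set x0 z -> zero_set z -> False.
Proof.
move=> xz; have e := orbit_set_tequiv x0d xz; move=> [[[zd zr]|yz]|[zk zd]].
- exact: (irreducible_tequiv wS e x0irr zr).
- apply: x0y0; apply: (tequiv_trans wS e); exact: (tequiv_sym wS (orbit_set_tequiv y0d yz)).
- have k1 := ppm_point hS; rewrite zk in e zd; apply: x0k.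
  have [U Uu <-] := tequivE k1 (tequiv_sym wS e).
  rewrite [U]mx11_scalar; apply: (wscalar wS k1).
  by rewrite -mx11_scalar.
Qed.

Definition orbit_val (z : S) : 'M[C]_d :=
  xget 0 [set Y | exists2 U : 'M[C]_d, U \is unitarymx & z = U ∙ x0 /\ Y = U *m X *m U ^t*].

Lemma orbit_valE (U : 'M[C]_d) : U \is unitarymx -> orbit_val (U ∙ x0) = U *m X *m U ^t*.
Proof.
move=> Uu; rewrite /orbit_val; case: xgetP => [Y _ [V Vu [e ->]]|no].
  by apply: (irreducible_act_mx hS X x0d x0irr Vu Uu).
by exfalso; apply: (no (U *m X *m U ^t*)); exists U.
Qed.

Lemma orbit_val0 z : ~ orbit_set x0 z -> orbit_val z = 0.
Proof.
move=> nz; rewrite /orbit_val; case: xgetP => // Y _ [V Vu [e _]].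
by case: nz; rewrite e; exists V.
Qed.

Lemma base_stage : exists2 G : S -> M, stage d G &
  [/\ mat d (G x0) = X, mat d (G y0) = 0 & mat 1 (G kappa) = 0].
Proof.
have d0 : (0 < d)%N by rewrite -x0d; exact: (wdeg_gt0 wS).
pose A := orbit_set x0 `|` zero_set.
have Ad z : A z -> tdeg z = d by move=> [/(orbit_set_deg x0d)|/zero_set_deg].
have Acl : closed A by apply: closedU; [exact: orbit_closed|exact: zero_set_closed].
have Z0 z : zero_set z -> orbit_val z = 0.
  by move=> z0; apply: orbit_val0 => xz; exact: zero_set_disj xz z0.
have Aact z (U : 'M[C]_d) : A z -> U \is unitarymx ->
    A (U ∙ z) /\ orbit_val (U ∙ z) = U *m orbit_val z *m U ^t*.
  move=> [xz|zz] Uu; last first.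
    have zUz := zero_set_act zz Uu.
    by split; [right|rewrite !Z0// mulmx0 mul0mx].
  split; first by left; exact: orbit_set_act.
  have [V /= Vu <-] := xz; have UVu : U *m V \is unitarymx := unitarymxM Uu Vu.
  by rewrite -(wactM wS x0d Uu Vu) (orbit_valE UVu) (orbit_valE Vu) trmx_mul map_mxM !mulmxA.
have Acvg (F : set_system S) z : UltraFilter F -> A z -> F A -> F --> z ->
    orbit_val @ F --> orbit_val z.
  move=> UF _ FA Fz; have FF : Filter F by typeclasses eauto.
  have [Fx|Fnx] := in_ultra_setVsetC (orbit_set x0) UF.
    have [V [V0 [nF V0u FV ->]]] := orbit_lim x0d UF Fx Fz.
    rewrite (orbit_valE V0u).
    have cX : (fun _ : S => X) @ F --> X by exact: cvg_cst.
    apply: cvg_trans (cvg_mulmx FF (cvg_mulmx FF FV cX) (cvg_adjmx FF FV)).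
    apply: near_eq_cvg; apply: filterS nF => y [Vyu e].
    by rewrite -[in RHS]e (orbit_valE Vyu).
  have FZ : F zero_set.
    by apply: (@filterS _ F FF _ _ _ (filterI FA Fnx)) => y [[|//]].
  have Zz : zero_set z.
    apply: zero_set_closed => B nB; have PF : ProperFilter F by typeclasses eauto.
    have FB : F B := Fz _ nB; have [y [Zy By]] := @filter_ex _ F PF _ (filterI FZ FB).
    by exists y.
  rewrite (Z0 z Zz); apply: cvg_trans (@cvg_cst _ (0 : 'M[C]_d) _ F FF).
  by apply: near_eq_cvg; apply: filterS FZ => y /Z0.
have [g [gA gact gc]] := equivariant_extension tS pS Ad Acl Aact Acvg.
(* [mk] expects a size of the form k + 1, whence the cast; outside degree d the value is the zero
   matrix of the right size. *)
pose G x : M := if tdeg x == d then mk (castmx (esym (prednK d0), esym (prednK d0)) (g x))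
  else mk (0 : 'M[C]_((tdeg x).-1.+1)).
have Gdeg x : tdeg (G x) = tdeg x.
  rewrite /G; case: ifP => [/eqP xd|_]; first by rewrite -[tdeg _]/(d.-1.+1) prednK.
  rewrite -[tdeg _]/((tdeg x).-1.+1) prednK//; exact: (wdeg_gt0 wS x).
have Gm x : tdeg x = d -> mat d (G x) = g x.
  move=> xd; rewrite /G xd eqxx /mat.
  have cf k (e : d = k) (Y : 'M[C]_d) : conform_mx 0 (castmx (e, e) Y) = Y.
    by case: k / e; rewrite castmx_id conform_mx_id.
  exact: cf.
have G0 x m : tdeg x <> d -> mat m (G x) = 0.
  by move=> /eqP xd; rewrite /G (negPf xd); exact: conform0.
have gk : g kappa = 0 \/ tdeg kappa <> d.
  have [e|] := pselect (tdeg kappa = d); last by right.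
  have Zk : zero_set kappa by right.
  by left; rewrite gA; [exact: Z0|right].
have u1 := unitarymx1 R d.
exists G; split.
- exact: Gdeg.
- move=> m x U xm mn Uu; have xU := wdeg_act wS xm Uu.
  have dG := Gdeg (U ∙ x); rewrite xU in dG.
  have dG2 : tdeg (G x) = m by rewrite Gdeg.
  apply: (@mspace_eq R m) => //; rewrite [RHS](mat_act dG2 Uu).
  have [em|em] := eqVneq m d; last first.
    by rewrite !G0 ?mulmx0 ?mul0mx ?xU ?xm//; exact/eqP.
  move: U xm Uu xU {dG dG2}; rewrite em => U xm Uu xU.
  by rewrite !Gm//; exact: gact.
- move=> x y xyd; have x1 := wdeg_gt0 wS x; have y1 := wdeg_gt0 wS y.
  have dxy := wdegD wS x y.
  have dG : tdeg (G (x ⊕ y)) = (tdeg x + tdeg y)%N by rewrite Gdeg.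
  have dG2 : tdeg (G x ⊕ G y) = (tdeg x + tdeg y)%N by rewrite (wdegD wM) !Gdeg.
  apply: (@mspace_eq R (tdeg x + tdeg y)) => //.
  rewrite [RHS](mat_plus (Gdeg x) (Gdeg y)) !(G0 x) ?(G0 y); [|lia..].
  rewrite dsum0; have [em|em] := eqVneq (tdeg x + tdeg y)%N d; last first.
    by apply: G0; rewrite dxy; exact/eqP.
  have xyr : zero_set (x ⊕ y).
    left; left; split; first by rewrite dxy.
    by apply: (reducible_plus (a := x) (b := y)); exact: (tequiv_refl wS).
  by rewrite em Gm ?dxy// gA; [exact: Z0|right].
- move=> x xd; have [em|em] := eqVneq (tdeg x) d; last first.
    apply: (@cvg_mspace R _ _ _ _ (tdeg x)); first exact: Gdeg.
      by apply: filterS (tdeg_near tS x) => y e; rewrite -e -(Gdeg y).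
    rewrite G0; last exact/eqP.
    apply: cvg_trans (@cvg_cst _ (0 : 'M[C]_(tdeg x)) _ (nbhs x) _); apply: near_eq_cvg.
    by apply: filterS (tdeg_near tS x) => y e; rewrite G0// e; exact/eqP.
  apply: (@cvg_mspace R _ _ _ _ d); first by rewrite -em -(Gdeg x).
    by apply: filterS (tdeg_near tS x) => y e; rewrite -em -e -(Gdeg y).
  rewrite Gm//; apply: cvg_trans (gc x em); apply: near_eq_cvg.
  by apply: filterS (tdeg_near tS x) => y e; rewrite Gm// e.
- rewrite Gm// gA; last by left; exists 1%:M => //; exact: (wact1 wS x0d).
  have := orbit_valE u1; rewrite (wact1 wS x0d) => ->.
  by rewrite mul1mx trmx1 map_mx1 mulmx1.
- have Zy : zero_set y0 by left; right; exists 1%:M => //; exact: (wact1 wS y0d).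
  by rewrite Gm// gA; [exact: Z0|right].
- case: gk => [gk|]; last exact: G0.
  have [e|/eqP] := eqVneq (tdeg kappa) d; last exact: G0.
  have d1 : d = 1%N by rewrite -e (ppm_point hS).
  have h := Gm _ e; rewrite gk in h.
  by move: h; rewrite d1.
Qed.

End Base.

(** Each step keeps the values in the degrees already treated, so F x can be read off at any stage
    that reaches the degree of x. *)
Lemma stage_limit d (G : S -> M) : (0 < d)%N -> stage d G ->
  exists2 F : S -> M, (forall N, stage N F) & forall x, (tdeg x <= d)%N -> F x = G x.
Proof.
move=> d0 sG.
have step N (G' : {G' : S -> M | stage (d + N) G'}) : {G'' : {G'' : S -> M | stage (d + N.+1) G''} |
    forall x, (tdeg x <= d + N)%N -> sval G'' x = sval G' x}.
  apply: cid; case: G' => G' sG'; have dN : (0 < d + N)%N by rewrite addn_gt0 d0.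
  have [G'' s'' e] := stage_step hS dN sG'.
  by rewrite -addnS in s''; exists (exist _ G'' s'').
have sG0 : stage (d + 0) G by rewrite addn0.
pose fix st (k : nat) : {G' : S -> M | stage (d + k) G'} :=
  if k is k'.+1 then sval (step k' (st k')) else exist _ G sG0.
have stS k x : (tdeg x <= d + k)%N -> sval (st k.+1) x = sval (st k) x.
  by move=> xk; rewrite /=; case: (step k (st k)) => G'' /= ->.
have stD l k x : (tdeg x <= d + k)%N -> sval (st (k + l)%N) x = sval (st k) x.
  move=> xk; elim: l => [|l ih]; first by rewrite addn0.
  by rewrite addnS stS ?ih// (leq_trans xk)// leq_add2l leq_addr.
pose F x := sval (st (tdeg x)) x.
have FE N x : (tdeg x <= N)%N -> F x = sval (st N) x.
  by move=> xN; rewrite /F -(subnKC xN) stD// leq_addl.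
exists F => [N|x xd]; last first.
  have e := stD (tdeg x) 0%N x; have xd0 : (tdeg x <= d + 0)%N by rewrite addn0.
  exact: e xd0.
have sN := svalP (st N).
split.
- by move=> x; exact: (stage_deg (svalP (st (tdeg x))) x).
- move=> n x U xn nN Uu; rewrite !(FE N) ?(wdeg_act wS xn Uu) ?xn//.
  by apply: (stage_act sN xn _ Uu); exact: leq_trans nN (leq_addl _ _).
- move=> x y xyN; rewrite !(FE N) ?(wdegD wS)//; [|lia..].
  by apply: (stage_plus sN); exact: leq_trans xyN (leq_addl _ _).
- move=> x xN; rewrite (FE N)//.
  apply: cvg_trans (stage_cont sN (leq_trans xN (leq_addl _ _))); apply: near_eq_cvg.
  by apply: filterS (tdeg_near tS x) => y e; rewrite (FE N)// e.
Qed.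

Section Total.
Variable F : S -> M.
Hypothesis sF : forall N, stage N F.

(** Compactness of the fibres bounds F in each degree up to the height; points of larger degree are
    reducible, and block sums do not increase the bound. *)
Lemma total_bounded : exists c, forall x, opnorm (mval (F x)) <= c.
Proof.
have [h hP] := height_bound hS.
have ex n : exists c, forall x, tdeg x = n -> opnorm (mval (F x)) <= c.
  have gc x : tfib S n x -> mat n (F y) @[y --> x] --> mat n (F x).
    move=> xn; exact: cvg_trans (cvg_app (mat n) (stage_cont (sF (tdeg x)) (leqnn _))) (@mat_continuous R n _).
  have [c hc] := compact_opnorm_bounded (@pS n) gc; exists c => x xn.
  have e : mdeg (F x) = n by rewrite -xn; exact: (stage_deg (sF 0) x).
  by rewrite -(opnorm_mval e); exact: hc.
pose cs n := sval (cid (ex n)).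
have csP n x : tdeg x = n -> opnorm (mval (F x)) <= cs n by rewrite /cs; case: cid => c; exact.
pose c := \sum_(n < h.+1) `|cs n|; exists c => x.
have [n] := ubnP (tdeg x); elim: n x => // n ih x xn.
have [xr|xirr] := pselect (reducible x); last first.
  apply: le_trans (csP _ x erefl) _; apply: le_trans (ler_norm _) _.
  have xh : (tdeg x < h.+1)%N by rewrite ltnS; exact: hP.
  by rewrite /c (bigD1 (Ordinal xh))//= lerDl; apply: sumr_ge0.
have [a [b [V [Vu e]]]] := xr.
have dab : (tdeg a + tdeg b)%N = tdeg x by rewrite -(wdegD wS) -e (wdeg_act wS).
have a0 := wdeg_gt0 wS a; have b0 := wdeg_gt0 wS b.
have Fd y := stage_deg (sF 0) y.
have dV : tdeg (V ∙ x) = tdeg x := wdeg_act wS (erefl _) Vu.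
have -> : F x = V ^t* ∙ (F a ⊕ F b).
  rewrite -(stage_plus (sF (tdeg a + tdeg b)) (leqnn _)) -e.
  rewrite -(stage_act (sF (tdeg x)) dV (leqnn _) (unitarymx_star Vu)).
  by rewrite (wactK wS erefl Vu).
have dF : tdeg (F a ⊕ F b) = tdeg x by rewrite (wdegD wM) !Fd.
have dF2 : mdeg (V ^t* ∙ (F a ⊕ F b) : M) = tdeg x := wdeg_act wM dF (unitarymx_star Vu).
rewrite -(opnorm_mval dF2); apply: le_trans (opnorm_mact dF (unitarymx_star Vu)) _.
rewrite -dab [mat _ _](mat_plus (Fd a) (Fd b)); apply: opnorm_dsum.
  by rewrite (opnorm_mval (Fd a)); apply: ih; lia.
by rewrite (opnorm_mval (Fd b)); apply: ih; lia.
Qed.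

Lemma total_in_cstar : in_cstar (fun x : S => mat (tdeg x) (F x)).
Proof.
have Fd y : tdeg (F y) = tdeg y := stage_deg (sF 0) y.
have cf n x : tdeg x = n -> conform_mx (0 : 'M[C]_n) (mat (tdeg x) (F x)) = mat n (F x).
  by move=> <-; rewrite conform_mx_id.
split.
- move=> n; apply/subspace_continuousP => x xn; rewrite /from_subspace (cf n x xn).
  apply: cvg_trans (_ : mat n (F y) @[y --> within (tfib S n) (nbhs x)] --> _); last first.
    apply: cvg_within_filter.
    exact: cvg_trans (cvg_app (mat n) (stage_cont (sF (tdeg x)) (leqnn _))) (@mat_continuous R n _).
  apply: near_eq_cvg; apply: (@filterE _ (nbhs x)) => y yn.
  by rewrite cf.
- move=> x U Uu; have dU := wdeg_act wS (erefl (tdeg x)) Uu.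
  by rewrite cf// (stage_act (sF (tdeg x)) erefl (leqnn _) Uu) [LHS](mat_act (Fd x) Uu) invmx_unitary.
- move=> x y; rewrite cf; last exact: (wdegD wS).
  by rewrite (stage_plus (sF _) (leqnn _)); exact: (mat_plus (Fd x) (Fd y)).
- have [c hc] := total_bounded; exists c => x.
  by rewrite (opnorm_mval (Fd x)).
Qed.

End Total.

Theorem interpolation d (x y : S) (X : 'M[C]_d) : tdeg x = d -> tdeg y = d -> ~ reducible x ->
  ~ tequiv x y -> x <> kappa -> exists u : ptCstar kappa, pv d u x = X /\ pv d u y = 0.
Proof.
move=> xd yd xirr xy xk.
have [G sG [GX Gy Gk]] := base_stage X xd yd xirr xy xk.
have d0 : (0 < d)%N by rewrite -xd; exact: (wdeg_gt0 wS).
have [F sF FG] := stage_limit d0 sG.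
have k0 : mat (tdeg kappa) (F kappa) = 0.
  by rewrite FG (ppm_point hS).
exists (PtCstar (total_in_cstar sF) k0).
have pvE z : tdeg z = d -> pv d (PtCstar (total_in_cstar sF) k0) z = mat d (G z).
  by move=> zd; rewrite /pv /= -FG ?zd// conform_mx_id.
by rewrite !pvE.
Qed.

End Interpolation.

(** * Irreducible representations of C*(S, kappa) *)

Section HilbertDensity.
Variables (R : realType) (H : hilbertType R).
Local Notation C := R[i].

(** The Gram system for c is solvable because a vector in the kernel of the Gram matrix gives a
    vanishing combination of the u i, whose inner product with x is 0. *)
Lemma span_projection m (u : 'I_m -> H) (x : H) : exists c : 'I_m -> C,
  forall j, hdot H (x - \sum_i c i *: u i) (u j) = 0.
Proof.
pose G : 'M[C]_m := \matrix_(i, j) hdot H (u i) (u j).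
pose b : 'rV[C]_m := \row_j hdot H x (u j).
have bG : (b <= G)%MS.
  rewrite submxE; apply/eqP/matrixP => i j; rewrite ord1 [RHS]mxE.
  pose v := cokermx G; pose w := \sum_k (v k j)^*%R *: u k.
  have Gv k : \sum_l hdot H (u k) (u l) * v l j = 0.
    have h : (G *m v) k j = 0 by rewrite mulmx_coker mxE.
    by rewrite mxE in h; rewrite -[RHS]h; apply: eq_bigr => l _; rewrite !mxE.
  have w0 : w = 0.
    apply: nrm_eq0; apply/eqP; rewrite -sqrf_eq0 -(inj_eq (@complexI R)) -hdot_nrm; apply/eqP.
    have uw k : hdot H (u k) w = 0.
      rewrite /w hdot_sumr -[RHS](Gv k); apply: eq_bigr => l _.
      by rewrite hdotZr conjCK mulrC.
    by rewrite {1}/w hdot_suml big1// => k _; rewrite hdotZl uw mulr0.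
  rewrite mxE -[RHS](hdot0r x) -w0 hdot_sumr; apply: eq_bigr => k _.
  by rewrite hdotZr conjCK !mxE mulrC.
have [c cG] := submxP bG; exists (fun i => c 0 i) => j.
rewrite hdotBl hdot_suml.
have := congr1 (fun M : 'rV[C]_m => M 0 j) cG; rewrite !mxE => ->.
apply/eqP; rewrite subr_eq0; apply/eqP; apply: eq_bigr => i _.
by rewrite hdotZl !mxE.
Qed.

(** The component of x orthogonal to a dense span vanishes. *)
Lemma hdim_le_dense m (u : 'I_m -> H) :
  (forall F (e : R), 0 < e -> exists2 G, (exists c : 'I_m -> C, G = \sum_i c i *: u i) & nrm (F - G) <= e) ->
  hdim_le H m.
Proof.
move=> dn; exists u => x; have [c hc] := span_projection u x; exists c.
apply/eqP; rewrite -subr_eq0; apply/eqP.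
apply: (hdot_dense_eq0 (dn _)) => _ [k ->]; rewrite hdot_sumr big1// => i _.
by rewrite hdotZr hc mulr0.
Qed.

Lemma hdim_le_widen m n : (m <= n)%N -> hdim_le H m -> hdim_le H n.
Proof.
move=> mn [u hu]; pose v (i : 'I_n) : H := if insub (val i) is Some k then u k else 0.
exists v => x; have [c ->] := hu x.
exists (fun i => if insub (val i) is Some k then c k else 0).
rewrite (bigID (fun i : 'I_n => (i < m)%N)) /= [X in _ = _ + X]big1 ?addr0; last first.
  by move=> i im; rewrite /v insubN// scaler0.
rewrite (big_ord_narrow mn); apply: eq_bigr => i _.
rewrite /v; have -> : insub (val (widen_ord mn i)) = Some i by rewrite /= valK.
by [].
Qed.

Lemma approx_closed (D : set H) :
  closed [set F : H | forall e : R, 0 < e -> exists2 G, D G & nrm (F - G) <= e].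
Proof.
move=> F clF e e0; have e2 : 0 < e / 2 by rewrite divr_gt0.
have e2C : 0 < (e / 2)%:C :> C by rewrite ltcR.
have [F' [hF' FF']] := clF _ (nbhsx_ballx F _ e2C).
have [G DG h] := hF' _ e2; exists G => //.
apply: le_trans (nrm_dist F F' G) _; rewrite (splitr e); apply: lerD h.
by move: FF'; rewrite -ball_normE /= nrmE ltcR => /ltW.
Qed.

End HilbertDensity.

Section Irreducible.
Variables (R : realType) (A : cStarAlgType R) (H : hilbertType R) (pi : A -> H -> H).
Hypothesis hpi : is_hrep pi.
Hypothesis irr : hirreducible pi.
Local Notation C := R[i].

(** The closure of pi(A) x is a closed invariant subspace, nonzero by hypothesis. *)
Lemma irreducible_dense x : (exists a, pi a x != 0) ->
  forall F (e : R), 0 < e -> exists a, nrm (F - pi a x) <= e.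
Proof.
move=> [a0 a0x].
pose D : set H := [set G | exists a, G = pi a x].
pose M := [set F : H | forall e : R, 0 < e -> exists2 G, D G & nrm (F - G) <= e].
have DM G : D G -> M G by move=> DG e e0; exists G => //; rewrite subrr nrm0 ltW.
have M0 : M 0 by apply: DM; exists 0; rewrite (hrep0 hpi).
have ML (k : C) F G : M F -> M G -> M (k *: F + G).
  move=> MF MG e e0; have k1 : 0 < normc k + 1 by rewrite ltr_wpDl// Defs.normc_ge0.
  have e2 : 0 < e / 2 by rewrite divr_gt0.
  have d0 : 0 < e / 2 / (normc k + 1) by rewrite divr_gt0.
  have [_ [a ->] h1] := MF _ d0; have [_ [b ->] h2] := MG _ e2.
  exists (pi (k *: a + b) x); first by exists (k *: a + b).
  rewrite (hrep_lin hpi); have -> : k *: F + G - (k *: pi a x + pi b x) = k *: (F - pi a x) + (G - pi b x).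
    by rewrite scalerBr opprD addrACA.
  apply: le_trans (nrmD _ _) _; rewrite (splitr e); apply: lerD h2.
  rewrite nrmZ; apply: le_trans (ler_wpM2l (Defs.normc_ge0 k) h1) _.
  by rewrite mulrCA ler_piMr ?(ltW e2)// ler_pdivrMr// mul1r lerDl.
have Minv a F : M F -> M (pi a F).
  move=> MF e e0; have k1 : 0 < nrm a + 1 by rewrite ltr_wpDl// nrm_ge0.
  have d0 : 0 < e / (nrm a + 1) by rewrite divr_gt0.
  have [_ [b ->] h] := MF _ d0; exists (pi (cmul a b) x); first by exists (cmul a b).
  rewrite (hrep_mul hpi) -(hrep_subr hpi); apply: le_trans (hrep_contractive hpi _ _) _.
  apply: le_trans (ler_wpM2l (nrm_ge0 a) h) _.
  by rewrite mulrCA ler_piMr ?(ltW e0)// ler_pdivrMr// mul1r lerDl.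
have [|MT] := irr.2 M (@approx_closed R H D) M0 ML Minv.
  move=> MZ; have : M (pi a0 x) by apply: DM; exists a0.
  by rewrite MZ => /= z; rewrite z eqxx in a0x.
move=> F e e0; have : M F by rewrite MT.
by move=> /(_ e e0)[_ [a ->] h]; exists a.
Qed.

Lemma hrep_star_ker b x : pi (cmul (cstar b) b) x = 0 -> pi b x = 0.
Proof.
rewrite (hrep_mul hpi) => h.
apply: nrm_eq0; apply/eqP; rewrite -sqrf_eq0 -(inj_eq (@complexI R)) -hdot_nrm.
by rewrite (hrep_star hpi) h hdot0r.
Qed.

(** By density some pi(c) pi(b) y comes close to a vector that a does not kill. *)
Lemma irreducible_prime a b : (exists x, pi a x != 0) -> (exists x, pi b x != 0) ->
  exists c x, pi (cmul (cmul a c) b) x != 0.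
Proof.
move=> [x ax] [y bY]; have [c0 c0y] : exists c, pi c (pi b y) != 0.
  exists (cstar b); rewrite -(hrep_mul hpi); apply: contra bY => /eqP h.
  by apply/eqP; exact: hrep_star_ker.
apply: contrapT => no; move/eqP: ax; apply; apply: nrm_small => e e0.
have k1 : 0 < nrm a + 1 by rewrite ltr_wpDl// nrm_ge0.
have d0 : 0 < e / (nrm a + 1) by rewrite divr_gt0.
have [c h] := irreducible_dense (ex_intro _ c0 c0y) x d0.
have ac : pi a (pi c (pi b y)) = 0.
  apply/eqP; apply: contrapT => /negP h2; apply: no; exists c, y.
  by rewrite !(hrep_mul hpi).
rewrite -[pi a x]subr0 -ac -(hrep_subr hpi); apply: le_trans (hrep_contractive hpi _ _) _.
apply: le_trans (ler_wpM2l (nrm_ge0 a) h) _.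
by rewrite mulrCA ler_piMr ?(ltW e0)// ler_pdivrMr// mul1r lerDl.
Qed.

End Irreducible.

Section Cutoff.
Variables (R : realType) (A : cStarAlgType R).
Hypothesis hA : mx_normed A.
Local Notation C := R[i].

(* [e] is the positive part of [s^2 - d s], where [s] is the square of [c]. *)
Lemma cutoff_exists (c : A) (d : R) : cstar c = c -> 0 < d ->
  let s := cmul c c in exists e : A, nrm (cmul s s - e) <= d * nrm c ^+ 2 /\
  forall m (r : A -> 'M[C]_m), is_rep r -> opnorm (r c) ^+ 2 <= d -> r e = 0.
Proof.
move=> cs d0 s; have ss : cstar s = s by rewrite cstarM cs.
pose x := cmul s s - d%:C *: s.
have xs : cstar x = x by rewrite /x cstarB cstarM cstarZr ss.
have [e _ he] := pos_exists hA xs; exists e.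
have eig m (r : A -> 'M[C]_m) (w : 'cV[C]_m) (t : R) : is_rep r -> r c *m w = t%:C *: w ->
    r (cmul s s) *m w = (t ^+ 4)%:C *: w /\ r e *m w = (Num.max 0 (t ^+ 4 - d * t ^+ 2))%:C *: w.
  move=> hr h; have hs : r s *m w = (t ^+ 2)%:C *: w.
    rewrite (rep_mul hr c c) -mulmxA h -scalemxAr h scalerA.
    by congr (_ *: _); rewrite expr2 [RHS]rmorphM.
  have hss : r (cmul s s) *m w = (t ^+ 4)%:C *: w.
    rewrite (rep_mul hr s s) -mulmxA hs -scalemxAr hs scalerA.
    by congr (_ *: _); rewrite -rmorphM -exprD.
  split=> //; apply: (he _ _ _ _ hr); rewrite /x (repB _ _ hr) (repZ _ _ hr) mulmxBl hss.
  rewrite -scalemxAl hs scalerA -scalerBl; congr (_ *: _).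
  by rewrite -rmorphM -rmorphB.
split.
  apply: hA => [|m r hr]; first by rewrite mulr_ge0 ?(ltW d0)// sqr_ge0.
  have rcs : (r c) ^t* = r c by rewrite -(rep_star hr) cs.
  have [Q [t [Qu ht]]] := herm_spectral rcs.
  apply: (@opnorm_eigen R m Q _ (fun i => (t i ^+ 4 - Num.max 0 (t i ^+ 4 - d * t i ^+ 2))%:C)) => //.
  - by rewrite mulr_ge0 ?(ltW d0)// sqr_ge0.
  - move=> i; have [h1 h2] := eig _ _ _ _ hr (ht i).
    by rewrite (repB _ _ hr) mulmxBl h1 h2 -scalerBl rmorphB.
  move=> i; rewrite normc_real.
  have tc : `|t i| <= nrm c.
    rewrite -(normc_real (t i)); apply: le_trans (eigenvalue_opnorm Qu (ht i)) _.
    exact: rep_contractive.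
  have t2 : t i ^+ 2 <= nrm c ^+ 2.
    by rewrite -[t i ^+ 2]real_normK ?num_real// lerXn2r// nnegrE nrm_ge0.
  have t4 : t i ^+ 4 = (t i ^+ 2) ^+ 2 by rewrite -exprM.
  have := sqr_ge0 (t i); rewrite t4; move: (t i ^+ 2) t2 => q q1 q0.
  have dq : d * q <= d * nrm c ^+ 2 by exact: (ler_wpM2l (ltW d0)).
  have dq0 : 0 <= d * q by rewrite mulr_ge0// ltW.
  have q20 : 0 <= q ^+ 2 by exact: sqr_ge0.
  rewrite maxEle; case: ifP => h.
    by rewrite opprB addrC subrK ger0_norm.
  rewrite subr0 ger0_norm//; move/negbT: h; rewrite -ltNge subr_lt0 => /ltW h.
  exact: le_trans h dq.
move=> m r hr rd; have rcs : (r c) ^t* = r c by rewrite -(rep_star hr) cs.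
have [Q [t [Qu ht]]] := herm_spectral rcs.
apply: (mx_eq_cols Qu) => i; have [_ ->] := eig _ _ _ _ hr (ht i); rewrite mul0mx.
have tc : `|t i| <= opnorm (r c).
  by rewrite -(normc_real (t i)); exact: eigenvalue_opnorm Qu (ht i).
have t2 : t i ^+ 2 <= d.
  apply: le_trans rd; rewrite -[t i ^+ 2]real_normK ?num_real// lerXn2r// nnegrE.
  exact: opnorm_ge0.
have t4 : t i ^+ 4 = (t i ^+ 2) ^+ 2 by rewrite -exprM.
rewrite max_l ?scale0r// t4 expr2 -mulrBl; have := sqr_ge0 (t i).
by move: (t i ^+ 2) t2 => q q1 q0; apply: mulr_le0_ge0 => //; rewrite subr_le0.
Qed.

End Cutoff.

Lemma lin_sum (R : realType) (V W : lmodType R[i]) (f : V -> W) (I : Type) (r : seq I) (c : I -> R[i])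
    (v : I -> V) : (forall k a b, f (k *: a + b) = k *: f a + f b) ->
  f (\sum_(i <- r) c i *: v i) = \sum_(i <- r) c i *: f (v i).
Proof.
move=> fl; have f0 : f 0 = 0 by have := fl (-1) 0 0; rewrite scaler0 addr0 scaleN1r addNr.
by elim: r => [|i r ih]; rewrite ?big_nil// !big_cons fl ih.
Qed.

(** * Subhomogeneity of C*(S, kappa) *)

Section PtSubhomogeneous.
Variables (R : realType) (S : towerData R) (kappa : S).
Hypothesis hS : is_proper_pointed_mtower_fh kappa.
Local Notation C := R[i].
Local Notation B := (ptCstar kappa).
Let tS := mtower_tower (ppm_mtower hS).
Let wS := tower_wtower tS.
Let pS := ppm_proper hS.

Lemma pt_nrmE (b : B) : nrm b = supnorm b. Proof. by []. Qed.

Lemma pt_mx_normed : mx_normed B.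
Proof.
move=> b M M0 h; rewrite pt_nrmE; apply: supnorm_le => x.
by rewrite -(opnorm_pv b (erefl (tdeg x))); apply: (h _ (fun u => pv (tdeg x) u x)); exact: pv_is_rep.
Qed.

(* [K] plays the role of the kernel of an irreducible representation.  If no point
   [y] works, then finitely many [b] outside [K], vanishing on sets that cover all
   irreducible elements, have products outside [K] that vanish identically. *)
Lemma prime_point (K : B -> Prop) h : (forall x : S, ~ reducible x -> (tdeg x <= h)%N) ->
  K 0 -> (exists a, ~ K a) ->
  (forall a b, ~ K a -> ~ K b -> exists c, ~ K (cmul (cmul a c) b)) ->
  (forall b, (forall d : R, 0 < d -> exists2 e, K e & nrm (b - e) <= d) -> K b) ->
  (forall b, K (cmul (cstar b) b) -> K b) ->
  exists2 y : S, (tdeg y <= h)%N & forall b : B, b y = 0 -> K b.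
Proof.
move=> hP K0 Kne Kprime Klim Kstar.
have [y yh yK] : exists2 y : S, (tdeg y <= h)%N &
    forall b : B, (\forall p \near y, b p = 0) -> K b.
  apply: contrapT => no.
  have ex (y : S) : exists b : B, (tdeg y <= h)%N -> (\forall p \near y, b p = 0) /\ ~ K b.
    have [yh|yh] := boolP (tdeg y <= h)%N; last by exists 0.
    apply: contrapT => no2; apply: no; exists y => // b by0; apply: contrapT => nK.
    by apply: no2; exists b.
  pose bf y := sval (cid (ex y)).
  have bfP y : (tdeg y <= h)%N -> (\forall p \near y, bf y p = 0) /\ ~ K (bf y).
    by rewrite /bf; case: cid.
  have nb (y : S) : [set x : S | (tdeg x <= h)%N] y -> nbhs y [set p | bf y p = 0].
    by move=> yh; exact: ((bfP y yh).1).
  have [ys [ysh ysc]] := compact_list_cover (@tower_graded_compact R S tS pS h) nb.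
  have [b nKb bz] : exists2 b : B, ~ K b & forall y, y \in ys -> forall p, bf y p = 0 -> b p = 0.
    elim: ys ysh {ysc} => [|y r ih] ysh; first by have [a nKa] := Kne; exists a.
    have [|b nKb bz] := ih; first by move=> z zr; apply: ysh; rewrite inE zr orbT.
    have [_ nKy] := bfP y (ysh y (mem_head _ _)).
    have [c nKc] := Kprime _ _ nKy nKb; exists (cmul (cmul (bf y) c) b) => // z.
    rewrite inE => /orP[/eqP ->|zr] p zp.
      by rewrite -[LHS]/(bf y p *m c p *m b p) zp !mul0mx.
    by rewrite -[LHS]/(bf y p *m c p *m b p) (bz z zr p zp) mulmx0.
  apply: nKb; suff -> : b = 0 by [].
  have b0 x : opnorm (b x) <= 0.
    apply: (opnorm_core wS) => p pirr; have [y yys yp] := ysc p (hP p pirr).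
    by rewrite (bz y yys p yp) opnorm0.
  apply: ptCstar_eq => x; apply: opnorm_eq0; apply/eqP.
  by rewrite eq_le b0 opnorm_ge0.
exists y => // b by0; pose c := cmul (cstar b) b; pose s := cmul c c.
have cs : cstar c = c by rewrite cstarM cstarK.
have ss : cstar s = s by rewrite cstarM cs.
have cy : c y = 0 by rewrite -[LHS]/((b y) ^t* *m b y) by0 mulmx0.
(* It suffices that K contains s s, since s s = s* s, s = c* c and c = b* b. *)
apply: (Kstar b); apply: (Kstar c); rewrite cs; apply: (Kstar s); rewrite ss.
apply: Klim => d d0; have c1 : 0 < nrm c ^+ 2 + 1 by rewrite ltr_wpDl// sqr_ge0.
pose d' := d / (nrm c ^+ 2 + 1); have d'0 : 0 < d' by rewrite divr_gt0.
have [e [ne ze]] := cutoff_exists pt_mx_normed cs d'0.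
exists e; last first.
  apply: le_trans ne _; rewrite /d' mulrAC ler_pdivrMr//.
  by apply: (ler_wpM2l (ltW d0)); rewrite lerDl.
apply: yK; set n := tdeg y.
(* Near y the norm of c is at most m <= 1, so its square is at most m and hence at most d', as
   needed for e to vanish. *)
pose m := Num.min 1 d'; have m0 : 0 < m by rewrite lt_min ltr01.
have m1 : m <= 1 by rewrite ge_min lexx.
have md : m <= d' by rewrite ge_min lexx orbT.
have cc : pv n c p @[p --> y] --> pv n c y := @pv_cvg R S kappa (tdeg_near tS) n c y.
have nc : \forall p \near y, opnorm (pv n c p) <= m.
  have /(cvg_opnormP (nbhs_filter y)) h0 := cc.
  apply: filterS (h0 _ m0) => p; rewrite pv_id cy sub0r opnormN.
  by [].
apply: filterS2 nc (tdeg_near tS y) => p hp pn.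
have pe : pv n e p = 0.
  apply: (ze n (fun u => pv n u p) (@pv_is_rep R S kappa n p)).
  have := opnorm_ge0 (pv n c p); move: (opnorm _) hp => t t1 t0; apply: le_trans md.
  by rewrite expr2; apply: le_trans (_ : t * 1 <= _); [apply: ler_wpM2l => //; exact: le_trans t1 m1|rewrite mulr1].
by move: pe; rewrite /n -pn pv_id.
Qed.

Lemma hrep_kernel_point (H : hilbertType R) (pi : B -> H -> H) h :
  (forall x : S, ~ reducible x -> (tdeg x <= h)%N) -> is_hrep pi -> hirreducible pi ->
  exists2 y : S, (tdeg y <= h)%N & forall b : B, b y = 0 -> forall x, pi b x = 0.
Proof.
move=> hP hpi irr.
have nK a : ~ (forall x, pi a x = 0) -> exists x, pi a x != 0.
  by move=> no; apply: contrapT => h2; apply: no => x; apply/eqP; apply: contrapT => /negP h3; apply: h2; exists x.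
have nK' a : (exists x, pi a x != 0) -> ~ (forall x, pi a x = 0) by move=> [x /eqP ax] /(_ x).
apply: (@prime_point (fun b => forall x, pi b x = 0) h) => //.
- by move=> x; exact: hrep0.
- by have [a ax] := irr.1; exists a; exact: nK'.
- move=> a b /nK ax /nK bx; have [c cx] := irreducible_prime hpi irr ax bx.
  by exists c; exact: nK'.
- move=> b blim x; apply: nrm_small => d d0; have x1 : 0 < nrm x + 1 by rewrite ltr_wpDl// nrm_ge0.
  have [e ex h1] := blim _ (divr_gt0 d0 x1).
  rewrite -[pi b x]subr0 -(ex x) -(hrepB hpi); apply: le_trans (hrep_contractive hpi _ _) _.
  apply: le_trans (ler_wpM2r (nrm_ge0 x) h1) _.
  by rewrite mulrAC ler_pdivrMr//; apply: (ler_wpM2l (ltW d0)); rewrite lerDl.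
- by move=> b bx x; exact: hrep_star_ker.
Qed.

(** The kernel of pi contains the kernel of evaluation at some y of degree n <= h, so pi(B) x0 is a
    linear image of a subspace of the n x n matrices; it has dimension at most n^2 and is dense. *)
Lemma pt_subhomogeneous : subhomogeneous B.
Proof.
have [h hP] := height_bound hS; exists (h * h)%N => H pi hpi irr.
have [y yh yK] := hrep_kernel_point hP hpi irr.
have [a0 [x0 ax0]] := irr.1; set n := tdeg y in yh.
apply: (hdim_le_widen (m := (n * n)%N)); first exact: leq_mul.
pose P (v : 'rV[C]_(n * n)) := exists u : B, v = mxvec (pv n u y).
have P0 : P 0 by exists 0; rewrite (rep0 (@pv_is_rep R S kappa n y)) linear0.
have PL (k : C) v w : P v -> P w -> P (k *: v + w).
  by move=> [u ->] [u' ->]; exists (k *: u + u'); rewrite pv_lin linearP.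
have [G GE] := subspace_mx P0 PL.
have exu i : exists u : B, row i G = mxvec (pv n u y) by apply/GE; exact: row_sub.
pose us i := sval (cid (exu i)).
have usE i : row i G = mxvec (pv n (us i) y) by rewrite /us; case: cid.
apply: (@hdim_le_dense R H _ (fun i => pi (us i) x0)) => F e e0.
have [u Fu] := irreducible_dense hpi irr (ex_intro _ a0 ax0) F e0.
exists (pi u x0) => //.
have /submxP[c cG] : (mxvec (pv n u y) <= G)%MS by apply/GE; exists u.
exists (fun i => c 0 i).
have uy : (u - \sum_i c 0 i *: us i) y = 0.
  rewrite -[LHS]pv_id -/n pvB; apply/eqP; rewrite subr_eq0; apply/eqP.
  rewrite (lin_sum _ _ _ (f := fun u => pv n u y)); last by move=> k a b; exact: pv_lin.
  apply: (can_inj (@mxvecK _ n n)); rewrite cG mulmx_sum_row linear_sum; apply: eq_bigr => i _.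
  by rewrite linearZ usE.
have := yK _ uy x0; rewrite (hrepB hpi) => /eqP; rewrite subr_eq0 => /eqP ->.
by apply: (lin_sum _ _ _ (f := fun u => pi u x0)) => k a b; exact: hrep_lin.
Qed.

End PtSubhomogeneous.

Lemma mx_prime (F : fieldType) m n k l (M : 'M[F]_(m, n)) (N : 'M[F]_(k, l)) : M != 0 -> N != 0 ->
  exists X, M *m X *m N != 0.
Proof.
have nz a b (Y : 'M[F]_(a, b)) : Y != 0 -> exists i j, Y i j != 0.
  move=> Y0; apply: contrapT => h; move/eqP: Y0; apply; apply/matrixP => i j; rewrite mxE.
  by apply/eqP; apply: contrapT => /negP h2; apply: h; exists i, j.
move=> /nz[i [j Mij]] /nz[p [q Npq]]; exists (delta_mx j p).
apply/eqP => /matrixP/(_ i q); rewrite -(mul_delta_mx (0 : 'I_1)) mulmxA -mulmxA -colE -rowE.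
by rewrite mxE big_ord1 !mxE => /eqP; rewrite mulf_eq0 (negPf Mij) (negPf Npq).
Qed.

Lemma commute_scalar (F : fieldType) n (U : 'M[F]_n) (i0 : 'I_n) :
  (forall X, U *m X = X *m U) -> exists k, U = k%:M.
Proof.
move=> h; exists (U i0 i0); apply/matrixP => i j.
have := congr1 (fun M : 'M[F]_n => M i i0) (h (delta_mx j i0)); rewrite !mxE.
rewrite (bigD1 j)//= mxE !eqxx mulr1 big1 ?addr0; last first.
  by move=> k kj; rewrite mxE (negPf kj) mulr0.
move=> ->; rewrite (bigD1 i0)//= mxE eqxx andbT big1 ?addr0; last first.
  by move=> k ki; rewrite mxE (negPf ki) andbF mul0r.
by case: eqVneq => _; rewrite ?mul1r ?mul0r.
Qed.

(** * The points of S as the representations of C*(S, kappa) *)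

Section PointEvaluations.
Variables (R : realType) (S : towerData R) (kappa : S).
Hypothesis hS : is_proper_pointed_mtower_fh kappa.
Local Notation C := R[i].
Local Notation B := (ptCstar kappa).
Local Notation Z := (ztower B).
Local Notation ev := (@eval_at R S kappa).
Let mS := ppm_mtower hS.
Let tS := mtower_tower mS.
Let wS := tower_wtower tS.
Let pS := ppm_proper hS.
Let hZ := ztower_ppm (pt_subhomogeneous hS).
Let mZ := ppm_mtower hZ.
Let wZ := ztower_wtower B.

Lemma eval_deg s : tdeg (ev s) = tdeg s.
Proof. by rewrite -[LHS]/((tdeg s).-1.+1) prednK//; exact: (wdeg_gt0 wS). Qed.

Lemma zr_eval n s u : tdeg s = n -> zr n (ev s) u = pv n u s.
Proof.
move=> sn; have e : (tdeg s).-1.+1 = n by rewrite -sn prednK//; exact: (wdeg_gt0 wS).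
have cc k (X : 'M[C]_(tdeg s)) : k = n -> conform_mx (0 : 'M[C]_n) (conform_mx (0 : 'M[C]_k) X) = conform_mx 0 X.
  by move=> ->; rewrite conform_mx_id.
exact: cc.
Qed.

Lemma eval_act n (U : 'M[C]_n) s : tdeg s = n -> U \is unitarymx -> ev (U ∙ s) = U ∙ ev s.
Proof.
move=> sn Uu; have dU := wdeg_act wS sn Uu.
have ds : tdeg (ev s) = n by rewrite eval_deg.
have d1 : tdeg (ev (U ∙ s)) = n by rewrite eval_deg.
have d2 : tdeg (U ∙ ev s) = n := wdeg_act wZ ds Uu.
by apply: (zr_eq d1 d2) => u; rewrite (zr_eval u dU) (zr_act u ds Uu) (zr_eval u sn) pv_act.
Qed.

Lemma eval_plus s t : ev (s ⊕ t) = ev s ⊕ ev t.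
Proof.
have dst := wdegD wS s t.
have d1 : tdeg (ev (s ⊕ t)) = (tdeg s + tdeg t)%N by rewrite eval_deg.
have d2 : tdeg (ev s ⊕ ev t) = (tdeg s + tdeg t)%N by rewrite (wdegD wZ) !eval_deg.
apply: (zr_eq d1 d2) => u; rewrite (zr_eval u dst) (zr_plus u (eval_deg s) (eval_deg t)).
by rewrite !zr_eval// pv_plus.
Qed.

Lemma eval_kappa : ev kappa = zzero B.
Proof.
have k1 := ppm_point hS; have d1 : tdeg (ev kappa) = 1%N by rewrite eval_deg.
apply: (zr_eq d1 (erefl : tdeg (zzero B) = 1%N)) => u.
by rewrite (zr_eval u k1) zr_zzero /pv ptval0 conform0.
Qed.

Lemma pv_kappa m s (u : B) : s = kappa -> pv m u s = 0.
Proof. by move=> ->; rewrite /pv ptval0 conform0. Qed.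

Lemma tequiv_deg1 x y : tdeg y = 1%N -> tequiv x y -> x = y :> S.
Proof.
move=> y1 h; have [U Uu <-] := tequivE y1 (tequiv_sym wS h).
by rewrite [U]mx11_scalar; apply: (wscalar wS y1); rewrite -mx11_scalar.
Qed.

(** Interpolation asks for a second point of the same degree; the d-fold sum of [kappa] serves,
    being inequivalent to x. *)
Lemma eval_onto d (x : S) (X : 'M[C]_d) : tdeg x = d -> ~ reducible x -> x <> kappa ->
  exists u : B, pv d u x = X.
Proof.
move=> xd xirr xk; have d0 : (0 < d)%N by rewrite -xd; exact: (wdeg_gt0 wS).
have k1 := ppm_point hS; pose y := nfold d kappa.
have yd : tdeg y = d by rewrite (tdeg_nfold wS)// k1 muln1.
have xy : ~ tequiv x y.
  move=> e; have [d1|d1] := eqVneq d 1%N.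
    by apply: xk; rewrite /y d1 in e; exact: tequiv_deg1 k1 e.
  apply: xirr; have d2 : (0 < d.-1)%N by lia.
  have e2 : tequiv x (kappa ⊕ nfold d.-1 kappa) by rewrite -(nfoldS _ d2) prednK.
  exact: (reducible_plus e2).
by have [u [uX _]] := interpolation hS X xd yd xirr xy xk; exists u.
Qed.

(** A decomposition of ev x would make all values at x block diagonal in one basis, whereas all
    matrices occur as values. *)
Lemma eval_irreducible x : ~ reducible x -> ~ reducible (ev x).
Proof.
move=> xirr; have [->|xk] := pselect (x = kappa).
  by rewrite eval_kappa; exact: (deg1_irreducible wZ).
move=> [a [b [V [Vu e]]]]; have h : tequiv (ev x) (a ⊕ b) by exists V.
have ed : tdeg (ev x) = (tdeg a + tdeg b)%N by rewrite -(wdegD wZ) (tequiv_deg wZ h).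
have xd : tdeg x = (tdeg a + tdeg b)%N by rewrite -eval_deg.
have a0 := wdeg_gt0 wZ a; have b0 := wdeg_gt0 wZ b.
have [W Wu eW] := tequivE ed h.
pose D : 'M[C]_(tdeg a + tdeg b) := block_mx 0 (const_mx 1) 0 0.
have [u uD] := eval_onto (W ^t* *m D *m W) xd xirr xk.
have := congr1 (fun p => zr (tdeg a + tdeg b) p u) eW.
rewrite /= (zr_act u ed Wu) (zr_plus u (erefl _) (erefl _)) (zr_eval u xd) uD.
rewrite !mulmxA (unitarymxP Wu) mul1mx -mulmxA (unitarymxP Wu) mulmx1 /D /dsum.
move=> /eq_block_mx[_ /matrixP/(_ (Ordinal a0) (Ordinal b0)) h12 _ _]; move: h12; rewrite !mxE => /eqP.
by rewrite oner_eq0.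
Qed.

(** Points of different orbits are separated by interpolation. If t is the image of s under U,
    equality of all values makes U commute with every matrix, so U is scalar and acts trivially. *)
Lemma eval_inj_irreducible s t : ~ reducible s -> ~ reducible t -> ev s = ev t -> s = t.
Proof.
move=> sirr tirr e; have dst : tdeg t = tdeg s by rewrite -!eval_deg e.
have s0 := wdeg_gt0 wS s.
have one_neq0 : (1%:M : 'M[C]_(tdeg s)) <> 0.
  move=> /matrixP/(_ (Ordinal s0) (Ordinal s0)); rewrite !mxE eqxx => /eqP.
  by rewrite oner_eq0.
have eu (u : B) : pv (tdeg s) u s = pv (tdeg s) u t.
  by rewrite -(zr_eval u (erefl (tdeg s))) -(zr_eval u dst) e.
have [sk|sk] := pselect (s = kappa).
  have [tk|tk] := pselect (t = kappa); first by rewrite sk tk.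
  have [u ut] := eval_onto (1%:M : 'M[C]_(tdeg s)) dst tirr tk.
  by exfalso; apply: one_neq0; rewrite -ut -eu; exact: pv_kappa.
have [[U [Uu Ust]]|nst] := pselect (tequiv s t); last first.
  have [u [us ut]] := interpolation hS (1%:M : 'M[C]_(tdeg s)) (erefl _) dst sirr nst sk.
  by exfalso; apply: one_neq0; rewrite -us -ut eu.
have comm (X : 'M[C]_(tdeg s)) : U *m X = X *m U.
  have [u us] := eval_onto X (erefl _) sirr sk.
  have := eu u; rewrite -Ust pv_act// us => h; rewrite [in RHS]h.
  by rewrite -mulmxA unitarymxKl// mulmx1.
have [k Uk] : exists k, U = k%:M.
  exact: commute_scalar (Ordinal s0) comm.
by rewrite -Ust Uk; apply: esym; apply: (wscalar wS erefl); rewrite -Uk.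
Qed.

(** All matrices are values of p, so its kernel is prime and [prime_point] applies. *)
Lemma irreducible_kernel_point n (p : Z) : tdeg p = n -> ~ reducible p -> p <> zzero B ->
  exists y : S, forall b : B, b y = 0 -> zr n p b = 0.
Proof.
move=> pn pirr p0; have [h hP] := height_bound hS.
have nz : exists a, zr n p a != 0.
  apply: contrapT => no; apply: p0; apply: zero_irreducible => // a.
  by rewrite pn; apply/eqP; apply: contrapT => /negP h2; apply: no; exists a.
have onto X : exists b, zr n p b = X.
  have [b bX _] := rep_separate X pn (erefl : tdeg (zzero B) = 1%N) pirr nz (tdisj_zzero pirr p0).
  by exists b.
have hr := zr_rep n p.
have [|||||y _ yK] := @prime_point R S kappa hS (fun b => zr n p b = 0) h hP.
- exact: rep0 hr.
- by have [a /eqP] := nz; exists a.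
- move=> a b /eqP a0 /eqP b0; have [X /eqP aXb] := mx_prime a0 b0.
  by have [c cX] := onto X; exists c; rewrite !(rep_mul hr) cX.
- move=> b blim; apply: eq_opnorm => d d0; have [e e0 h1] := blim d d0.
  by rewrite -e0 -(repB _ _ hr); apply: le_trans h1; exact: rep_contractive.
- move=> b; rewrite (rep_mul hr) (rep_star hr) => e; apply: opnorm_eq0; apply/eqP.
  by rewrite -sqrf_eq0 -opnorm_star_sqr e opnorm0.
by exists y.
Qed.

Lemma not_disj_sub (p q : Z) : ~ reducible p -> ~ tdisj p q -> tsub p q.
Proof. by move=> pirr; apply: contra_notP; exact: (tdisj_irr wZ pirr). Qed.

(** By (mT1) for representations, p lies under one of the summands of a reducible y; descending ends
    at an irreducible point, whose evaluation is equivalent to p. *)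
Lemma eval_range_sub (p : Z) (y : S) : ~ reducible p -> tsub p (ev y) -> exists s, ev s = p.
Proof.
move=> pirr; have [n] := ubnP (tdeg y); elim: n y => // n ih y yn py.
have [yr|yirr] := pselect (reducible y); last first.
  have [U Uu e] := tequivE (eval_deg y) (tequiv_sym wZ (tsub_irr (eval_irreducible yirr) py)).
  by exists (U ∙ y); rewrite (eval_act (erefl _) Uu).
have [a [b [V [Vu e]]]] := yr.
have dab : (tdeg a + tdeg b)%N = tdeg y by rewrite -(wdegD wS) -e (wdeg_act wS).
have a0 := wdeg_gt0 wS a; have b0 := wdeg_gt0 wS b.
have pab : tsub p (ev a ⊕ ev b).
  rewrite -eval_plus -e (eval_act (erefl _) Vu).
  exact: (tsub_equivr wZ py (tequivI (eval_deg y) Vu)).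
have [da|/(not_disj_sub pirr) pa] := pselect (tdisj p (ev a)); last by apply: (ih a) => //; lia.
have [db|/(not_disj_sub pirr) pb] := pselect (tdisj p (ev b)); last by apply: (ih b) => //; lia.
exfalso; apply: (mtower_disj mZ da db); exists p; split => //; exact: (tsub_refl wZ).
Qed.

(** For an irreducible p other than the base point, take y whose evaluation has its kernel inside
    that of p. If p were disjoint from ev y, some a would be 1 at p and 0 at y. *)
Lemma eval_surj (p : Z) : exists s, ev s = p.
Proof.
have [n] := ubnP (tdeg p); elim: n p => // n ih p pn.
have [pr|pirr] := pselect (reducible p).
  have [a [b [V [Vu e]]]] := pr.
  have dab : (tdeg a + tdeg b)%N = tdeg p by rewrite -(wdegD wZ) -e (wdeg_act wZ).
  have a0 := wdeg_gt0 wZ a; have b0 := wdeg_gt0 wZ b.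
  have [|s sa] := ih a; first lia.
  have [|t tb] := ih b; first lia.
  have dst : tdeg (s ⊕ t) = tdeg p by rewrite (wdegD wS) -!eval_deg sa tb.
  exists (V ^t* ∙ (s ⊕ t)); rewrite (eval_act dst (unitarymx_star Vu)) eval_plus sa tb -e.
  by rewrite (wactK wZ erefl Vu).
have [->|p0] := pselect (p = zzero B); first by exists kappa; exact: eval_kappa.
have [y yK] := irreducible_kernel_point (erefl _) pirr p0.
apply: (eval_range_sub (y := y) pirr); apply: not_disj_sub => // dpy.
have nz : exists a, zr (tdeg p) p a != 0.
  apply: contrapT => no; apply: p0; apply: zero_irreducible => // a.
  by apply/eqP; apply: contrapT => /negP h2; apply: no; exists a.
have [a a1 ay] := rep_separate (1%:M : 'M[C]_(tdeg p)) (erefl _) (eval_deg y) pirr nz dpy.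
have := yK a; rewrite a1; rewrite (zr_eval a (erefl _)) pv_id in ay => /(_ ay).
move=> /matrixP/(_ (Ordinal (wdeg_gt0 wZ p)) (Ordinal (wdeg_gt0 wZ p))); rewrite !mxE eqxx => /eqP.
by rewrite oner_eq0.
Qed.

Lemma tower_plus_inj (x y x' y' : S) : tdeg x = tdeg x' -> x ⊕ y = x' ⊕ y' -> x = x'.
Proof.
move=> d e; have [_ inj _] := tplus_closed_embedding tS (tdeg x').
pose p : tfib S (tdeg x') * S := (exist _ x (mem_set d), y).
pose p' : tfib S (tdeg x') * S := (exist _ x' (mem_set erefl), y').
have ep : p = p' := inj p p' e.
by have := congr1 (fun q => set_val q.1) ep.
Qed.

Lemma eval_reducible s : reducible s -> reducible (ev s).
Proof.
move=> [a [b [V [Vu e]]]]; apply: (reducible_plus (a := ev a) (b := ev b)).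
by rewrite -eval_plus -e (eval_act (erefl _) Vu); exact: (tequivI (eval_deg s) Vu).
Qed.

Definition eval_inv (p : Z) : S := sval (cid (eval_surj p)).

Lemma eval_invK p : ev (eval_inv p) = p.
Proof. by rewrite /eval_inv; case: cid. Qed.

Lemma eval_inv_irreducible p : ~ reducible p -> ~ reducible (eval_inv p).
Proof. by move=> pirr /eval_reducible; rewrite eval_invK. Qed.

Lemma eval_inv_deg p : tdeg (eval_inv p) = tdeg p.
Proof. by rewrite -eval_deg eval_invK. Qed.

Lemma eval_inv_act p (U : 'M[C]_(tdeg p)) : ~ reducible p -> U \is unitarymx ->
  eval_inv (U ∙ p) = U ∙ eval_inv p.
Proof.
move=> pirr Uu; have d := eval_inv_deg p; apply: eval_inj_irreducible.
- apply: eval_inv_irreducible; exact: (irreducible_tequiv wZ (tequivI (erefl _) Uu) pirr).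
- exact: (irreducible_tequiv wS (tequivI d Uu) (eval_inv_irreducible pirr)).
- by rewrite eval_invK (eval_act d Uu) eval_invK.
Qed.

Lemma eval_inv_stab p n (U : 'M[C]_n) : ~ reducible p -> (0 < n)%N -> U \is unitarymx ->
  (U *t (1%:M : 'M[C]_(tdeg p))) ∙ nfold n (eval_inv p) = nfold n (eval_inv p).
Proof.
move=> pirr n0 Uu; rewrite -(eval_inv_deg p).
have : stab (n * tdeg (eval_inv p)) (nfold n (eval_inv p)) (U *t (1%:M : 'M[C]_(tdeg (eval_inv p)))).
  by rewrite (mtower_stab_nfold mS (eval_inv_irreducible pirr) n0); exists U.
by case.
Qed.

Lemma zzero_irreducible : [set p : Z | ~ reducible p] (zzero B).
Proof. exact: (deg1_irreducible wZ). Qed.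

Definition epair (s : S) : pair_tower wZ wS := pmk (eval_deg s).

(** Each pair of ev s and s is generated by pairs of irreducible elements, by induction on the
    degree of s. *)
Lemma epair_related s :
  related (P := [set p : Z | ~ reducible p]) zzero_irreducible (fun p _ => eval_inv_deg p) (epair s).
Proof.
have [n] := ubnP (tdeg s); elim: n s => // n ih s sn.
have [sr|sirr] := pselect (reducible s); last first.
  have sP : [set p : Z | ~ reducible p] (ev s) := eval_irreducible sirr.
  rewrite [epair s](_ : _ = px wZ wS zzero_irreducible (fun p _ => eval_inv_deg p) (ev s)).
    exact: related_px.
  apply: pair_tower_eq; first by rewrite px_fst.
  rewrite px_snd//; apply: eval_inj_irreducible => //; first exact: eval_inv_irreducible.
  by rewrite eval_invK.
have [a [b [V [Vu e]]]] := sr.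
have dab : (tdeg a + tdeg b)%N = tdeg s by rewrite -(wdegD wS) -e (wdeg_act wS).
have a0 := wdeg_gt0 wS a; have b0 := wdeg_gt0 wS b.
have [ra rb] : (tdeg a < n)%N /\ (tdeg b < n)%N by lia.
apply: (related_equiv (related_plus (ih a ra) (ih b rb))).
apply: (tequiv_sym (pair_wtower wZ wS)); have d : tdeg (epair s) = tdeg s := eval_deg s.
suff -> : epair a ⊕ epair b = V ∙ epair s by exact: (tequivI d Vu).
apply: pair_tower_eq.
  by rewrite (pfst_act d Vu) pfst_plus -[pfst (epair s)]/(ev s) -(eval_act (erefl _) Vu) e eval_plus.
by rewrite (psnd_act d Vu) psnd_plus -[psnd (epair s)]/s e.
Qed.

(** The transfer runs backwards here: T is the tower of representations, T' is S, and phi inverts ev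
    on irreducible points; so s is a function of ev s. *)
Theorem eval_inj : injective ev.
Proof.
move=> s t e; have d : tdeg (epair s) = tdeg s := eval_deg s.
have u1 := unitarymx1 R (tdeg s).
have := @related_functional R Z S wZ wS (mtower_disj mZ) (mtower_cancel mZ) (mtower_stab_plus mZ)
  (mtower_stab_nfold mZ) tower_plus_inj (zzero B) [set p : Z | ~ reducible p] eval_inv
  erefl zzero_irreducible (fun p h => h) (fun p _ => eval_inv_deg p) eval_inv_act eval_inv_stab
  (epair s) (epair t) _ 1%:M d (epair_related s) (epair_related t) u1.
rewrite -[pfst (epair s)]/(ev s) -[pfst (epair t)]/(ev t) -[psnd (epair s)]/s -[psnd (epair t)]/t.
by rewrite (wact1 wZ (eval_deg s)) (wact1 wS erefl); exact.
Qed.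

Lemma eval_continuous : continuous ev.
Proof.
move=> s; apply/z_cvgP => u; apply: (@cvg_mspace R _ _ _ _ (tdeg s)).
- exact: (eval_deg s).
- by apply: filterS (tdeg_near tS s) => t e; rewrite -e; exact: (eval_deg t).
rewrite [mat _ _](zr_eval u (erefl _)).
suff h : (fun t => mat (tdeg s) (zev u (ev t))) @ s --> pv (tdeg s) u s by exact: h.
apply: cvg_trans (@pv_cvg R S kappa (tdeg_near tS) (tdeg s) u s); apply: near_eq_cvg.
by apply: filterS (tdeg_near tS s) => t e; rewrite [RHS](zr_eval u e).
Qed.

(** The inverse is continuous because its values near p stay in a compact set, and its limit along
    an ultrafilter is identified by applying ev. *)
Lemma eval_homeomorphism : homeomorphism ev.
Proof.
exists eval_inv; split.
- by move=> s; apply: eval_inj; exact: eval_invK.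
- exact: eval_invK.
- exact: eval_continuous.
move=> p; apply: ultra_cvgP => G UG sG.
have FG : ProperFilter G by typeclasses eauto.
have [s Gs] : exists s : S, eval_inv @ G --> s.
  apply: (@ultra_tower_cvg R S tS pS _ G UG _ (tdeg p)).
  apply: sG; apply: filterS (@zdeg_near _ B p) => q e.
  by rewrite eval_inv_deg; move: e => /= ->.
suff -> : eval_inv p = s by [].
apply: eval_inj; rewrite eval_invK.
have tZ := ztower_is_tower B.
apply: (@tower_cvg_unique R Z tZ Z G FG id) => //.
apply: cvg_trans (cvg_trans (cvg_app ev Gs) (@eval_continuous s)); apply: near_eq_cvg.
by apply: (@filterE _ G) => q /=; rewrite eval_invK.
Qed.

Theorem eval_tower_iso : is_tower_iso kappa (zzero B) ev.
Proof.
split; [exact: eval_homeomorphism|exact: eval_deg| |exact: eval_plus|exact: eval_kappa].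
by move=> s U Uu; exact: eval_act.
Qed.

Theorem rep_is_eval n (pi : B -> 'M[C]_n) : (0 < n)%N -> is_rep pi ->
  exists! s : S, exists e : tdeg s = n, forall u, pi u = castmx (e, e) (u s).
Proof.
move=> n0 hpi; have [p [pn pE]] := zr_exists n0 hpi.
have cE s (e : tdeg s = n) (u : B) : castmx (e, e) (u s) = pv n u s.
  by case: n / e {n0 pi hpi p pn pE}; rewrite pv_id castmx_id.
have [s sp] := eval_surj p; have sn : tdeg s = n by rewrite -eval_deg sp.
exists s; split.
  by exists sn => u; rewrite cE -(zr_eval u sn) sp pE.
move=> t [tn ht]; apply: eval_inj; rewrite sp.
have tn' : tdeg (ev t) = n by rewrite eval_deg.
by apply: (zr_eq pn tn') => u; rewrite pE ht cE (zr_eval u tn).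
Qed.

End PointEvaluations.

Theorem theorem1p2 (R : realType) :
  (forall A : cStarAlgType R, subhomogeneous A ->
     is_proper_pointed_mtower_fh (zzero A) /\
     exists J : A -> ptCstar (zzero A),
       (forall a pi, J a pi = zrep pi a) /\ is_star_iso J)
  /\
  (forall (S : towerData R) (kappa : S), is_proper_pointed_mtower_fh kappa ->
     [/\ subhomogeneous (ptCstar kappa),
         forall n (pi : ptCstar kappa -> 'M[R[i]]_n), (0 < n)%N -> is_rep pi ->
           exists! s : S, exists e : tdeg s = n,
             forall u, pi u = castmx (e, e) (u s) &
         is_tower_iso kappa (zzero (ptCstar kappa)) eval_at]).
Proof.
split=> [A hA|S kappa hS].
  split; first exact: ztower_ppm hA.
  by exists (@gelfand R A); split => //; exact: gelfand_iso.
split; [exact: pt_subhomogeneous|exact: rep_is_eval|exact: eval_tower_iso].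
Qed.
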